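(* Let $T>0$, $k=T/N$ with $N\in\mathbb{N}$, and let $h_x>0$ and $h_y>0$ be mesh sizes. Assume that $0\le\rho_x,\rho_y<1$, $-1\le\rho_{xy}\le 1$ and $$2\rho_x^2(1+2|\rho_{xy}|)<1,\qquad 2\rho_y^2(1+2|\rho_{xy}|)<1,\qquad 2\rho_x\rho_y(3\rho_{xy}^2+2|\rho_{xy}|+1)<1 .$$ Then there exists $\theta\in(0,1)$, independent of $h_x,h_y$ and $k$, such that the implicit Milstein finite difference scheme (defined in the context) has the error expansion $$\begin{aligned}V_{i,j}^N-v(T,x_i,y_j)&=k\,E_1(T,x_i,y_j)+h_x^2\,E_2(T,x_i,y_j)+h_y^2\,E_3(T,x_i,y_j)+\theta^N h_x^{-2}E_4(T,x_i,y_j)\\&\quad+\theta^N h_y^{-2}E_5(T,x_i,y_j)+o\big(k,h_x^2,h_y^2,\theta^N h_x^{-2},\theta^N h_y^{-2}\big)\,R(T,x_i,y_j),\end{aligned}$$ where $x_i=ih_x$, $y_j=jh_y$, and $E_1,\ldots,E_5$ and $R$ are random variables with bounded first and second moments, all independent of $h_x$, $h_y$ and $k$.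
   Context: **SPDE.** Let $x_0,y_0,\mu_x,\mu_y\in\mathbb{R}$, and let $M^x,M^y$ be standard Brownian motions with correlation $\rho_{xy}$, i.e. $\mathrm{d}\langle M^x,M^y\rangle_t=\rho_{xy}\,\mathrm{d}t$. Consider on $(0,T]\times\mathbb{R}^2$ $$\mathrm{d}v=-\mu_x\tfrac{\partial v}{\partial x}\mathrm{d}t-\mu_y\tfrac{\partial v}{\partial y}\mathrm{d}t+\tfrac12\Big(\tfrac{\partial^2 v}{\partial x^2}+2\sqrt{\rho_x\rho_y}\rho_{xy}\tfrac{\partial^2 v}{\partial x\partial y}+\tfrac{\partial^2 v}{\partial y^2}\Big)\mathrm{d}t-\sqrt{\rho_x}\tfrac{\partial v}{\partial x}\mathrm{d}M^x_t-\sqrt{\rho_y}\tfrac{\partial v}{\partial y}\mathrm{d}M^y_t$$ with Dirac initial data $v(0,x,y)=\delta(x-x_0)\delta(y-y_0)$. Its solution at time $T$ is $$v(T,x,y)=\frac{\exp\Big(-\frac{(x-x_0-\mu_x T-\sqrt{\rho_x}M_T^x)^2}{2(1-\rho_x)T}-\frac{(y-y_0-\mu_y T-\sqrt{\rho_y}M_T^y)^2}{2(1-\rho_y)T}\Big)}{2\pi\sqrt{(1-\rho_x)(1-\rho_y)}\,T}.$$ **Grid.** The grid points are $(ih_x,jh_y)$, $i,j\in\mathbb{Z}$, with $h_x,h_y$ chosen such that $i_0=x_0/h_x$ and $j_0=y_0/h_y$ are integers. $V^n_{i,j}$ approximates $v(nk,ih_x,jh_y)$. Initial value: $V^0_{i,j}=h_x^{-1}h_y^{-1}$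 if $(i,j)=(i_0,j_0)$ and $V^0_{i,j}=0$ otherwise. **Difference operators.** $(D_xV)_{i,j}=V_{i+1,j}-V_{i-1,j}$, $(D_yV)_{i,j}=V_{i,j+1}-V_{i,j-1}$, $(D_{xx}V)_{i,j}=V_{i+1,j}-2V_{i,j}+V_{i-1,j}$, $(D_{yy}V)_{i,j}=V_{i,j+1}-2V_{i,j}+V_{i,j-1}$, $(D_{xy}V)_{i,j}=V_{i+1,j+1}-V_{i-1,j+1}-V_{i+1,j-1}+V_{i-1,j-1}$; $D_x^2=D_xD_x$, $D_y^2=D_yD_y$. **Noise.** $\sqrt{k}Z_{n,x}=M^x_{(n+1)k}-M^x_{nk}$, $\sqrt{k}\widetilde Z_{n,y}=M^y_{(n+1)k}-M^y_{nk}$ (so $Z_{n,x},\widetilde Z_{n,y}$ are standard normal with correlation $\rho_{xy}$, independent over $n$). **Implicit Milstein finite difference scheme.** For $n=0,\dots,N-1$, $$\begin{aligned}&\Big(I+\tfrac{\mu_xk}{2h_x}D_x+\tfrac{\mu_yk}{2h_y}D_y-\tfrac{k}{2h_x^2}D_{xx}-\tfrac{k}{2h_y^2}D_{yy}\Big)V^{n+1}\\&=\Big(I-\tfrac{\sqrt{\rho_xk}Z_{n,x}}{2h_x}D_x-\tfrac{\sqrt{\rho_yk}\widetilde Z_{n,y}}{2h_y}D_y+\tfrac{\rho_xk(Z_{n,x}^2-1)}{8h_x^2}D_x^2+\tfrac{\rho_yk(\widetilde Z_{n,y}^2-1)}{8h_y^2}D_y^2+\tfrac{\sqrt{\rho_x\rho_y}kZ_{n,x}\widetilde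 Z_{n,y}}{4h_xh_y}D_{xy}\Big)V^n,\end{aligned}$$ where $V^{n+1}$ is the solution in $\ell^2(\mathbb{Z}^2)$ (obtained by Fourier transform). **Asymptotic notation.** $o(a_1,\dots,a_m)$ denotes a term of smaller order than $a_1,\dots,a_m$, i.e. a quantity $q$ with $q/(a_1+\dots+a_m)\to0$.
   Formalization: E_1 may depend on k and R on h_x, h_y and k; only their moment bounds are independent of the mesh. A k-independent E_1 is impossible when noise is present: (V-v)/k contains N^{-1/2} times the sum of Z_n^3-3Z_n, which has no limit. θ and E_2,...,E_5 are independent of h_x, h_y and k. *)

(* Defs.v *)
From HB Require Import structures.
From mathcomp Require Import all_boot all_order all_algebra.
From mathcomp Require Import all_classical all_reals all_analysis.

Set Implicit Arguments.
Unset Strict Implicit.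
Unset Printing Implicit Defensive.

Import Order.TTheory GRing.Theory Num.Theory.
Import numFieldNormedType.Exports.

Local Open Scope classical_set_scope.
Local Open Scope ring_scope.

(** ** Correlated Brownian motions *)

(* [normal_prob m 0] is the uniform law on [0, 1]; the degenerate normal law
   N(m, 0) is the Dirac mass at m. *)
Definition gaussian_law (R : realType) (m s : R) (A : set R) : \bar R :=
  if s == 0 then \d_m A else normal_prob m s A.

Section Brownian.
Context d (Omega : measurableType d) (R : realType) (P : probability Omega R).

Definition increment (Mx My : R -> {RV P >-> R}) (s t : R) (w : Omega)
    : R * R :=
  (Mx t w - Mx s w, My t w - My s w).

(* [Mx] and [My] are standard Brownian motions with d<Mx, My>_t = rho dt, that
   is, (Mx, My) is a planar Brownian motion with covariance matrix
   ((1, rho), (rho, 1)) per unit of time.  A planar vector is centred Gaussian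
   with covariance matrix Q when each linear combination (a, b) of its
   coordinates has law N(0, (a, b) Q (a, b)^T); (a, b) = (1, 0) and (0, 1) give
   the two marginal Brownian motions. *)
Record correlated_brownian (rho : R) (Mx My : R -> {RV P >-> R}) : Prop := {
  brownian_start :
    {ae P, forall w, Mx 0 w = 0 /\ My 0 w = 0};
  brownian_continuous :
    {ae P, forall w,
      {within `[0, +oo[, continuous (fun t : R => (Mx t w : R))} /\
      {within `[0, +oo[, continuous (fun t : R => (My t w : R))}};
  brownian_increment :
    forall (s t a b : R), 0 <= s -> s <= t ->
    forall A : set R, measurable A ->
      P ((fun w => a * (Mx t w - Mx s w) + b * (My t w - My s w)) @^-1` A) =
      gaussian_law 0
        (Num.sqrt ((a ^+ 2 + 2 * rho * a * b + b ^+ 2) * (t - s))) A;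
  (* Taking some of the [A l] to be [setT] gives every subfamily. *)
  brownian_independent :
    forall (n : nat) (t : nat -> R), 0 <= t 0%N ->
    (forall l, t l <= t l.+1) ->
    forall A : nat -> set (R * R), (forall l, measurable (A l)) ->
      P [set w | forall l, (l < n)%N ->
                   A l (increment Mx My (t l) (t l.+1) w)] =
      (\prod_(l < n)
         P (increment Mx My (t l) (t l.+1) @^-1` A l))%E
}.

(* For a family of random variables, [C] is to be common to all its members.
   The random coefficient of the time step k = T / N in the error of a Milstein
   scheme has to be such a family, indexed by N: it involves
   N^(-1/2) * \sum_(n < N) (Z_n^3 - 3 Z_n), which is bounded in L^2 but converges
   only in law as N tends to infinity. *)
Definition moments_bounded_by (C : R) (X : {RV P >-> R}) : Prop :=
  ('E_P[fun w => `|X w|%R] <= C%:E)%E /\ ('E_P[fun w => (X w ^+ 2)%R] <= C%:E)%E.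

End Brownian.

(** ** The SPDE *)

Record spde_data (R : realType) := SpdeData {
  x0 : R; y0 : R;
  mu_x : R; mu_y : R;
  rho_x : R; rho_y : R;
  rho_xy : R
}.

(* The solution v(T, x, y) of the SPDE, on the event Mx_T = mx, My_T = my. *)
Definition spde_solution (R : realType) (c : spde_data R) (T mx my x y : R)
    : R :=
  expR (- (x - x0 c - mu_x c * T - Num.sqrt (rho_x c) * mx) ^+ 2
            / (2 * (1 - rho_x c) * T)
        - (y - y0 c - mu_y c * T - Num.sqrt (rho_y c) * my) ^+ 2
            / (2 * (1 - rho_y c) * T))
  / (2 * pi * Num.sqrt ((1 - rho_x c) * (1 - rho_y c)) * T).

(** ** The scheme *)

Section Scheme.
Context (R : realType).

Definition grid_fun := int -> int -> R.

Definition Dx (V : grid_fun) : grid_fun := fun i j => V (i + 1) j - V (i - 1) j.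
Definition Dy (V : grid_fun) : grid_fun := fun i j => V i (j + 1) - V i (j - 1).
Definition Dxx (V : grid_fun) : grid_fun :=
  fun i j => V (i + 1) j - 2 * V i j + V (i - 1) j.
Definition Dyy (V : grid_fun) : grid_fun :=
  fun i j => V i (j + 1) - 2 * V i j + V i (j - 1).
Definition Dxy (V : grid_fun) : grid_fun :=
  fun i j => V (i + 1) (j + 1) - V (i - 1) (j + 1)
             - V (i + 1) (j - 1) + V (i - 1) (j - 1).

Definition in_ell2 (V : grid_fun) : Prop :=
  summable [set: int * int] (fun p => (V p.1 p.2 ^+ 2)%:E).

Definition grid_dirac (hx hy : R) (i0 j0 : int) : grid_fun :=
  fun i j => if (i == i0) && (j == j0) then hx^-1 * hy^-1 else 0.

Definition implicit_lhs (c : spde_data R) (k hx hy : R) (V : grid_fun)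
    : grid_fun := fun i j =>
  V i j + mu_x c * k / (2 * hx) * Dx V i j
        + mu_y c * k / (2 * hy) * Dy V i j
        - k / (2 * hx ^+ 2) * Dxx V i j
        - k / (2 * hy ^+ 2) * Dyy V i j.

Definition milstein_rhs (c : spde_data R) (k hx hy zx zy : R) (V : grid_fun)
    : grid_fun := fun i j =>
  V i j - Num.sqrt (rho_x c * k) * zx / (2 * hx) * Dx V i j
        - Num.sqrt (rho_y c * k) * zy / (2 * hy) * Dy V i j
        + rho_x c * k * (zx ^+ 2 - 1) / (8 * hx ^+ 2) * Dx (Dx V) i j
        + rho_y c * k * (zy ^+ 2 - 1) / (8 * hy ^+ 2) * Dy (Dy V) i j
        + Num.sqrt (rho_x c * rho_y c) * k * zx * zy / (4 * hx * hy)
            * Dxy V i j.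

(* [V] is the output of the [N] steps of the scheme driven by one realisation
   [zx], [zy] of the normalised increments. *)
Definition milstein_scheme (c : spde_data R) (k hx hy : R) (N : nat)
    (i0 j0 : int) (zx zy : nat -> R) (V : nat -> grid_fun) : Prop :=
  [/\ V 0%N = grid_dirac hx hy i0 j0,
      forall n, (n <= N)%N -> in_ell2 (V n) &
      forall n, (n < N)%N -> forall i j,
        implicit_lhs c k hx hy (V n.+1) i j =
        milstein_rhs c k hx hy (zx n) (zy n) (V n) i j].

(* The sum of the arguments of the little-o term of the error expansion, for
   the time step k = T / N. *)
Definition error_scale (T theta : R) (N : nat) (hx hy : R) : R :=
  T / N%:R + hx ^+ 2 + hy ^+ 2
  + theta ^+ N * hx ^- 2 + theta ^+ N * hy ^- 2.

(* [q] is of smaller order than [error_scale] as k = T / N, hx, hy tend to 0. *)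
Definition error_little_o (T theta : R) (q : nat -> R -> R -> R) : Prop :=
  (fun m : nat * (R * R) =>
     q m.1 m.2.1 m.2.2 / error_scale T theta m.1 m.2.1 m.2.2)
  @ filter_prod \oo (filter_prod 0^'+ 0^'+) --> (0 : R).

End Scheme.

Section Noise.
Context d (Omega : measurableType d) (R : realType) (P : probability Omega R).

(* The Z_n such that sqrt(k) Z_n = M_((n+1)k) - M_(nk). *)
Definition noise (M : R -> {RV P >-> R}) (k : R) (w : Omega) (n : nat) : R :=
  (M (n.+1%:R * k) w - M (n%:R * k) w) / Num.sqrt k.

End Noise.

(* Main.v *)
(* The frequency zeta evolves independently of the others under the scheme: one
   time step multiplies the Fourier transform of V by a random factor num / den,
   and that of v by an explicit factor of modulus at most 1.  Averaging over the
   noise, E|num / den|^2 <= exp(-2s min(1, k|zeta|^2)) on the Brillouin zone; the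
   three stability assumptions are what makes E|num|^2, a quadratic form in
   k sin^2(h_x xi)/h_x^2 and k sin^2(h_y eta)/h_y^2, smaller than |den|^2.  The
   products of N factors are compared in mean square: a one-step error whose
   mean is O(k eps) and whose fluctuations are O(k^(1/2) eps) contributes O(eps)
   after N steps, times a power of the frequency and the decay of the product.
   This gives k E1 for the scheme with h_x = h_y = 0 on the zone k|zeta|^2 <= 1,
   and h_x^2 E2 + h_y^2 E3 for the part of the error that is linear in h_x^2 and
   h_y^2, itself driven by the increments of the whole interval [0, T].  Beyond
   that zone every product is at most e^(-sN) in mean square, and integrating over
   the Brillouin zone costs 1/(h_x h_y).  With theta = e^(-s/2) the bound
   e^(-sN) / (h_x h_y) = theta^(2N) / (h_x h_y) is already of smaller order than
   theta^N / h_x^2 + theta^N / h_y^2, so that E4 = E5 = 0 is a valid choice.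

   The inverse Fourier integral of the product of the factors of the scheme is
   square summable by Bessel's inequality, and is the only square summable
   solution by an energy estimate, so it is V. *)
Require Import Defs.
From HB Require Import structures.
From mathcomp Require Import all_boot all_order all_algebra.
From mathcomp Require Import ring lra.
From mathcomp Require Import all_classical all_reals all_analysis.
From mathcomp Require Import measurable_realfun.

Set Implicit Arguments.
Unset Strict Implicit.
Unset Printing Implicit Defensive.

Import Order.TTheory GRing.Theory Num.Theory.
Import numFieldNormedType.Exports.

Local Open Scope classical_set_scope.
Local Open Scope ring_scope.

(** * Integrals on the line, freezing of independent increments, Gaussian moments *)

(** For a given noise the factor of one step need not be at most 1, since the increments are
    unbounded; stability holds only in mean square, one frequency at a time, so expectations are
    taken before frequencies are integrated. A step can be averaged because the state after n steps
    is independent of the next increment ([freezing]). The h^2 correction must not depend on N: it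
    is measured relative to the exact factors, whose product over n steps is the exact factor of one
    step of length n k, so that it collapses to a single term driven by the increment over [0, T].
    What remains obeys a linear recursion with three forcing terms. A Gronwall estimate sums them
    while keeping the decay e^(-2s k |zeta|^2) per step, which pays for the powers of the frequency;
    the cut at k |zeta|^2 = 1 keeps the contraction factor, by which that estimate divides, away
    from 0. A weighted Cauchy-Schwarz inequality, with a deterministic envelope as weight, turns the
    mean-square bounds at each frequency into moments of the Fourier integrals. *)

Section real_integrable.
Context d (T : measurableType d) (R : realType) (mu : {measure set T -> \bar R}).
Implicit Types f g : T -> R.

Lemma integrable_EFinZ (r : R) f : mu.-integrable setT (EFin \o f) ->
  mu.-integrable setT (EFin \o (fun x => r * f x)).
Proof.
move=> h; rewrite (_ : EFin \o _ = (fun x => (r%:E * (EFin \o f) x)%E)) //.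
exact: integrableZl.
Qed.

Lemma integrable_EFinD f g : mu.-integrable setT (EFin \o f) ->
  mu.-integrable setT (EFin \o g) ->
  mu.-integrable setT (EFin \o (fun x => f x + g x)).
Proof.
move=> hf hg; rewrite (_ : EFin \o _ = ((EFin \o f) \+ (EFin \o g))%E) //.
exact: integrableD.
Qed.

Lemma integrable_EFinB f g : mu.-integrable setT (EFin \o f) ->
  mu.-integrable setT (EFin \o g) ->
  mu.-integrable setT (EFin \o (fun x => f x - g x)).
Proof.
move=> hf hg; rewrite (_ : EFin \o _ = ((EFin \o f) \- (EFin \o g))%E) //.
exact: integrableB.
Qed.

Lemma le_integrable_EFin f g : measurable_fun setT f ->
  (forall x, `|f x| <= g x) -> mu.-integrable setT (EFin \o g) ->
  mu.-integrable setT (EFin \o f).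
Proof.
move=> mf fg; apply: le_integrable => //; first exact/measurable_EFinP.
by move=> x _; rewrite /= lee_fin (le_trans (fg x)) ?ler_norm.
Qed.

End real_integrable.

(** * Gaussian integrals and the Fourier transform of a Gaussian *)

Section real_line_integrals.
Context {R : realType}.
Local Notation mu := (@lebesgue_measure R).

(** The fundamental theorem of calculus on [-n, n], and dominated convergence along n. It carries
    the two integrations by parts below. *)
Lemma Rintegral_derive_eq0 (F f : R -> R) :
  (forall x : R, is_derive x (1 : R) F (f x)) -> continuous f ->
  mu.-integrable setT (EFin \o f) ->
  F n%:R @[n --> \oo] --> (0 : R) -> F (- n%:R) @[n --> \oo] --> (0 : R) ->
  \int[mu]_x f x = 0.
Proof.
move=> dF cf intf Fy FNy.
pose D n : set R := `[- (n%:R : R), n%:R]%classic.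
pose f_ n (x : R) : \bar R := ((f \_ (D n)) x)%:E.
have mf : measurable_fun setT f by exact: continuous_measurable_fun.
have mD n : measurable (D n) by exact: measurable_itv.
have cvf : (\int[mu]_x f_ n x)%E @[n --> \oo] --> (\int[mu]_x (EFin \o f) x)%E.
  apply: (@dominated_cvg _ _ R mu setT measurableT f_ (EFin \o f) (abse \o (EFin \o f))).
  - by move=> n; apply/measurable_EFinP/(measurable_restrictT _ _).1; [exact: mD|apply: measurable_funS mf => //].
  - move=> x _; apply: cvg_near_cst.
    near=> n; rewrite /f_ patchE mem_set// /D/= in_itv/= -ler_norml.
    by near: n; exact: nbhs_infty_ger.
  - by [].
  - exact: integrable_abse.
  - move=> n x _ /=; rewrite /f_ patchE; case: ifP => // _.
    by rewrite normr0 lee_fin.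
have fE n : (0 < n)%N -> (\int[mu]_x f_ n x = (F n%:R - F (- n%:R))%:E)%E.
  move=> n0; have -> : (\int[mu]_x f_ n x = \int[mu]_(x in D n) (f x)%:E)%E.
    rewrite [RHS]integral_mkcond; apply: eq_integral => x _.
    by rewrite /f_ !patchE; case: ifP.
  rewrite /D (@continuous_FTC2 _ f F) ?EFinB//.
  - by have := ltr0n R n; rewrite n0 => /idP ?; lra.
  - exact: continuous_subspaceT.
  - have cF : continuous F.
      by move=> x; apply/differentiable_continuous/derivable1_diffP; have [] := dF x.
    split.
    + by move=> x _; have [] := dF x.
    + exact/cvg_at_right_filter/cF.
    + exact/cvg_at_left_filter/cF.
  - by move=> x _; rewrite derive1E; have [] := dF x.
have c0 : (\int[mu]_x f_ n x)%E @[n --> \oo] --> 0%:E.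
  apply: (@cvg_trans _ ((F n%:R - F (- n%:R))%:E @[n --> \oo])).
    by apply: near_eq_cvg; near=> n; rewrite fE//; near: n; exact: nbhs_infty_gt.
  apply: cvg_EFin; first exact: nearW.
  by rewrite -[X in _ --> X]subr0; exact: cvgB.
by rewrite /Rintegral (cvg_unique _ cvf c0).
Unshelve. all: by end_near. Qed.

(** One term of the exponential series: (ct)^n / n! <= e^(ct). *)
Lemma exprn_le_expR (n : nat) (c : R) : 0 < c ->
  exists2 C : R, 0 < C & forall t : R, 0 <= t -> t ^+ n <= C * expR (c * t).
Proof.
move=> c0; case: n => [|n].
  exists 1 => // t t0; rewrite expr0 mul1r -expR0 ler_expR.
  by rewrite mulr_ge0// ltW.
exists (n.+1`!%:R / c ^+ n.+1) => [|t t0].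
  by rewrite divr_gt0 ?exprn_gt0// ltr0n fact_gt0.
have ct0 : 0 <= c * t by rewrite mulr_ge0// ltW.
have := expR_ge1Dxn n ct0; rewrite exprMn => h.
have f0 : (0 : R) < n.+1`!%:R by rewrite ltr0n fact_gt0.
have cn0 : 0 < c ^+ n.+1 by rewrite exprn_gt0.
rewrite -(ler_pM2l cn0) mulrA (mulrCA _ _ (_^-1)) divff ?gt_eqF// mulr1.
by rewrite -ler_pdivrMl// mulrC; apply: le_trans h; rewrite lerDr.
Qed.

(** Half of the Gaussian absorbs the monomial. This serves both for integrability and for the
    boundary terms of the integrations by parts. *)
Lemma gauss_monomial_bound (n : nat) (a : R) : 0 < a ->
  exists2 C : R, 0 < C &
    forall x : R, `|x| ^+ n * expR (- (a * x ^+ 2)) <= C * expR (- (a / 2 * x ^+ 2)).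
Proof.
move=> a0; have a20 : 0 < a / 2 by rewrite divr_gt0.
have [C C0 hC] := exprn_le_expR n a20.
exists (1 + C) => [|x]; first by rewrite addr_gt0.
have -> : - (a * x ^+ 2) = - (a / 2 * x ^+ 2) + - (a / 2 * x ^+ 2) by field.
rewrite expRD mulrA ler_wpM2r ?expR_ge0// expRN.
rewrite ler_pdivrMr ?expR_gt0// mulrDl mul1r.
have e1 : 1 <= expR (a / 2 * x ^+ 2).
  by rewrite -[leLHS]expR0 ler_expR mulr_ge0 ?sqr_ge0// ltW.
(* The two summands of [1 + C]: for |x| <= 1 the monomial is at most 1, and beyond it is at most
   (x^2)^n, to which [exprn_le_expR] applies. *)
have [x1|/ltW x1] := leP `|x| 1.
  apply: (@le_trans _ _ 1); first by rewrite exprn_ile1.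
  by rewrite (le_trans e1)// lerDl mulr_ge0 ?expR_ge0 ?ltW.
apply: (@le_trans _ _ ((x ^+ 2) ^+ n)).
  by rewrite -(real_normK (num_real x)) -exprM ler_weXn2l// leq_pmull.
by apply: le_trans (hC _ (sqr_ge0 _)) _; rewrite lerDr (le_trans _ e1).
Qed.

Lemma cvg0_inv_sqr (F : R -> R) (C : R) :
  (forall x, `|F x| * (1 + x ^+ 2) <= C) ->
  F n%:R @[n --> \oo] --> (0 : R) /\ F (- n%:R) @[n --> \oo] --> (0 : R).
Proof.
move=> FC.
have h (s : R) : s ^+ 2 = 1 -> F (s * n%:R) @[n --> \oo] --> (0 : R).
  move=> s2; apply: norm_cvg0.
  apply: (@squeeze_cvgr _ _ _ _ (cst 0) (fun n => (2 * C) * harmonic n)).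
  - near=> n; rewrite normr_ge0/= /harmonic.
    have := FC (s * n%:R); rewrite exprMn s2 mul1r => h.
    have F0 := normr_ge0 (F (s * n%:R)).
    have n0 : (0 : R) <= n%:R by rewrite ler0n.
    rewrite ler_pdivlMr ?ltr0n// -natr1.
    apply: (@le_trans _ _ (`|F (s * n%:R)| * (2 * (1 + n%:R ^+ 2)))); last by lra.
    by rewrite ler_wpM2l//; have := sqr_ge0 ((n%:R : R) - 1); nra.
  - exact: cvg_cst.
  - by rewrite -[X in _ --> X](mulr0 (2 * C)); apply: cvgM;
      [exact: cvg_cst|exact: cvg_harmonic].
split; last by have := h (-1) _; under eq_fun do rewrite mulN1r; apply; rewrite sqrrN expr1n.
by have := h 1 (expr1n _ _); under eq_fun do rewrite mul1r.
Unshelve. all: by end_near. Qed.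

(** Read off from the total mass 1 of the normal density with variance s^2 = 1/(2a). *)
Lemma integral_gauss (a : R) : 0 < a ->
  (\int[mu]_x (expR (- (a * x ^+ 2)))%:E = (Num.sqrt (pi / a))%:E)%E.
Proof.
move=> a0; pose s : R := Num.sqrt (2 * a)^-1.
have s0 : s != 0 by rewrite gt_eqF// sqrtr_gt0 invr_gt0 mulr_gt0.
have s2 : s ^+ 2 *+ 2 = a^-1.
  by rewrite sqr_sqrtr ?invr_ge0 ?mulr_ge0 ?ltW// -mulr_natl invfM mulrA divff ?mul1r.
have := integral_normal_pdf (0 : R) s; rewrite (normal_pdfE _ s0).
have pk0 := normal_peak_gt0 s0.
under eq_integral => x _.
  rewrite /normal_fun subr0 s2 invrK mulNr (mulrC _ a) EFinM; over.
rewrite ge0_integralZl//; last 2 first.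
  apply/measurable_EFinP/measurableT_comp => //; apply: measurableT_comp => //.
  exact: measurable_funM.
  by rewrite lee_fin ltW.
move=> h.
have pkE : (normal_peak s)^-1 = Num.sqrt (pi / a).
  rewrite /normal_peak invrK; congr Num.sqrt.
  by rewrite -mulrnAr mulrC -(mulr_natl _ 2) -s2 -mulr_natl; ring.
by rewrite -pkE -[RHS]mule1 -h muleA -EFinM mulVf ?mul1e// gt_eqF.
Qed.

Lemma integrable_gauss (a : R) : 0 < a ->
  mu.-integrable setT (EFin \o (fun x : R => expR (- (a * x ^+ 2)))).
Proof.
move=> a0; apply/integrableP; split.
  apply/measurable_EFinP/measurableT_comp => //; apply: measurableT_comp => //.
  exact: measurable_funM.
under eq_integral do rewrite /= ger0_norm ?expR_ge0//.
by rewrite integral_gauss// ltry.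
Qed.

Lemma integrable_gauss_bound (a C : R) (f : R -> R) : 0 < a ->
  measurable_fun setT f ->
  (forall x, `|f x| <= C * expR (- (a * x ^+ 2))) ->
  mu.-integrable setT (EFin \o f).
Proof.
move=> a0 mf fC.
apply: (@le_integrable _ _ R mu setT measurableT _
  (fun x : R => (C%:E * (EFin \o (fun x : R => expR (- (a * x ^+ 2)))) x)%E)).
- exact/measurable_EFinP.
- by move=> x _; rewrite /= lee_fin (le_trans (fC x))// ler_norm.
- by apply: integrableZl => //; exact: integrable_gauss.
Qed.

Lemma integrable_gauss_monomial (n : nat) (a : R) : 0 < a ->
  mu.-integrable setT (EFin \o (fun x : R => x ^+ n * expR (- (a * x ^+ 2)))).
Proof.
move=> a0; have [C C0 hC] := gauss_monomial_bound n a0.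
apply: (@integrable_gauss_bound (a / 2) C); first by rewrite divr_gt0.
- apply: measurable_funM; first exact: exprn_measurable.
  by apply: measurableT_comp => //; apply: measurableT_comp => //; exact: measurable_funM.
- by move=> x; rewrite normrM normrX (ger0_norm (expR_ge0 _)).
Qed.

Lemma is_derive_gauss (a x : R) :
  is_derive x (1 : R) (fun x : R => expR (- (a * x ^+ 2)))
    (- (2 * a * x) * expR (- (a * x ^+ 2))).
Proof.
have h : is_derive x (1 : R) (fun x : R => - (a * x ^+ 2)) (- (2 * a * x)).
  apply: is_derive_eq; rewrite /GRing.scale/=; ring.
have := @is_derive1_comp R expR (fun x : R => - (a * x ^+ 2)) x _ _
  (is_derive_expR (- (a * x ^+ 2))) h.
by rewrite mulrC.
Qed.

Lemma continuous_gauss (a : R) : continuous (fun x : R => expR (- (a * x ^+ 2))).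
Proof.
move=> x; apply/differentiable_continuous/derivable1_diffP.
by have [] := is_derive_gauss a x.
Qed.

(** Integration by parts: with g the Gaussian, (n+1) x^n g - 2a x^(n+2) g is the derivative of
    x^(n+1) g. *)
Lemma gauss_moment (n : nat) (a : R) : 0 < a ->
  \int[mu]_x (x ^+ n.+2 * expR (- (a * x ^+ 2))) =
  n.+1%:R / (2 * a) * \int[mu]_x (x ^+ n * expR (- (a * x ^+ 2))).
Proof.
move=> a0; pose g (x : R) := expR (- (a * x ^+ 2)).
pose F (x : R) := x ^+ n.+1 * g x.
pose f (x : R) := n.+1%:R * (x ^+ n * g x) - (2 * a) * (x ^+ n.+2 * g x).
have In := integrable_gauss_monomial n a0.
have In2 := integrable_gauss_monomial n.+2 a0.
have i1 : mu.-integrable setT (EFin \o (fun x : R => n.+1%:R * (x ^+ n * g x))).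
  exact: integrable_EFinZ.
have i2 : mu.-integrable setT (EFin \o (fun x : R => (2 * a) * (x ^+ n.+2 * g x))).
  exact: integrable_EFinZ.
have intf : mu.-integrable setT (EFin \o f).
  exact: integrable_EFinB.
have [C1 C10 h1] := gauss_monomial_bound n.+1 a0.
have [C2 C20 h2] := gauss_monomial_bound n.+3 a0.
have [Fy FNy] : F n%:R @[n --> \oo] --> (0 : R) /\ F (- n%:R) @[n --> \oo] --> (0 : R).
  apply: (@cvg0_inv_sqr F (C1 + C2)) => x.
  rewrite /F normrM normrX (ger0_norm (expR_ge0 _)) mulrDr mulr1.
  have e1 : expR (- (a / 2 * x ^+ 2)) <= 1.
    by rewrite -[leRHS]expR0 ler_expR oppr_le0 mulr_ge0 ?sqr_ge0// divr_ge0// ltW.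
  apply: lerD.
    by apply: le_trans (h1 x) _; rewrite ler_piMr// ltW.
  have -> : `|x| ^+ n.+1 * g x * x ^+ 2 = `|x| ^+ n.+3 * g x.
    by rewrite -(real_normK (num_real x)) mulrAC -exprD addn2.
  by apply: le_trans (h2 x) _; rewrite ler_piMr// ltW.
have dF x : is_derive x (1 : R) F (f x).
  have dg := is_derive_gauss a x.
  have dx : is_derive (x : R) (1 : R) (fun x : R => x ^+ n.+1) (n.+1%:R * x ^+ n).
    have := @is_deriveX R R id n.+1 x (1 : R) _ (is_derive_id (x : R) (1 : R)).
    rewrite /GRing.scale/= mulr1 (_ : id ^+ n.+1 = (fun x : R => x ^+ n.+1))//.
    by apply/funext => y; rewrite exprfctE.
  have := @is_deriveM R R (fun x => x ^+ n.+1) g x (1 : R) _ _ dx dg.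
  move=> /is_derive_eq; apply; rewrite /f /g /GRing.scale/= !exprS; ring.
have cf : continuous f.
  move=> x; apply: cvgB; apply: cvgM; try exact: cvg_cst.
    by apply: cvgM; [exact: exprn_continuous|exact: continuous_gauss].
  by apply: cvgM; [exact: exprn_continuous|exact: continuous_gauss].
have := Rintegral_derive_eq0 dF cf intf Fy FNy.
rewrite /f RintegralB//= !RintegralZl//= => /eqP; rewrite subr_eq0 => /eqP h.
have a20 : 2 * a != 0 by rewrite mulf_neq0// gt_eqF.
apply: (mulfI a20); apply: (etrans (esym h)).
by rewrite mulrA (mulrC (2 * a)) divfK.
Qed.

Lemma Rintegral_gauss (a : R) : 0 < a ->
  \int[mu]_x expR (- (a * x ^+ 2)) = Num.sqrt (pi / a).
Proof. by move=> a0; rewrite /Rintegral integral_gauss. Qed.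

Lemma integrable_gauss_bounded (a : R) (g : R -> R) : 0 < a ->
  measurable_fun setT g -> (forall x, `|g x| <= 1) ->
  mu.-integrable setT (EFin \o (fun x : R => expR (- (a * x ^+ 2)) * g x)).
Proof.
move=> a0 mg g1; apply: (@integrable_gauss_bound a 1) => //.
  apply: measurable_funM => //.
  by apply: measurableT_comp => //; apply: measurableT_comp => //; exact: measurable_funM.
move=> x; rewrite normrM ger0_norm ?expR_ge0// mul1r ler_piMr// expR_ge0.
Qed.

Lemma norm_cos_le1 (x : R) : `|cos x| <= 1.
Proof. by rewrite ler_norml cos_geN1 cos_le1. Qed.

Lemma norm_sin_le1 (x : R) : `|sin x| <= 1.
Proof. by rewrite ler_norml sin_geN1 sin_le1. Qed.

Lemma measurable_cosM (t : R) : measurable_fun setT (fun x : R => cos (t * x)).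
Proof.
apply: (measurableT_comp (continuous_measurable_fun (@continuous_cos R))).
exact: measurable_funM.
Qed.

Lemma measurable_sinM (t : R) : measurable_fun setT (fun x : R => sin (t * x)).
Proof.
apply: (measurableT_comp (continuous_measurable_fun (@continuous_sin R))).
exact: measurable_funM.
Qed.

Lemma is_derive_sinM (t x : R) :
  is_derive x (1 : R) (fun x : R => sin (t * x)) (t * cos (t * x)).
Proof.
have h : is_derive x (1 : R) (fun x : R => t * x) t.
  by apply: is_derive_eq; rewrite /GRing.scale/=; ring.
have := @is_derive1_comp R sin (fun x : R => t * x) x _ _ (is_derive_sin (t * x)) h.
by rewrite mulrC.
Qed.

Lemma is_derive_cosM (t x : R) :
  is_derive x (1 : R) (fun x : R => cos (t * x)) (- t * sin (t * x)).
Proof.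
have h : is_derive x (1 : R) (fun x : R => t * x) t.
  by apply: is_derive_eq; rewrite /GRing.scale/=; ring.
have := @is_derive1_comp R cos (fun x : R => t * x) x _ _ (is_derive_cos (t * x)) h.
by rewrite mulrC mulrN mulNr.
Qed.

Lemma integrable_x_gauss_sin (a t : R) : 0 < a ->
  mu.-integrable setT (EFin \o (fun x : R => x * expR (- (a * x ^+ 2)) * sin (t * x))).
Proof.
move=> a0; have [C C0 hC] := gauss_monomial_bound 1 a0.
apply: (@integrable_gauss_bound (a / 2) C); first by rewrite divr_gt0.
  apply: measurable_funM; last exact: measurable_sinM.
  apply: measurable_funM => //.
  by apply: measurableT_comp => //; apply: measurableT_comp => //; exact: measurable_funM.
move=> x; rewrite normrM normrM (ger0_norm (expR_ge0 _)).
by apply: le_trans (hC x); rewrite expr1 ler_piMr ?norm_sin_le1// mulr_ge0// expR_ge0.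
Qed.

Lemma gauss_sin_parts (a t : R) : 0 < a ->
  \int[mu]_x (x * expR (- (a * x ^+ 2)) * sin (t * x)) =
  t / (2 * a) * \int[mu]_x (expR (- (a * x ^+ 2)) * cos (t * x)).
Proof.
move=> a0; pose g (x : R) := expR (- (a * x ^+ 2)).
pose F (x : R) := g x * sin (t * x).
pose f (x : R) := t * (g x * cos (t * x)) - (2 * a) * (x * g x * sin (t * x)).
have In := integrable_x_gauss_sin t a0.
have In2 := integrable_gauss_bounded a0 (measurable_cosM t) (fun x => norm_cos_le1 _).
have i1 : mu.-integrable setT (EFin \o (fun x : R => t * (g x * cos (t * x)))).
  exact: integrable_EFinZ.
have i2 : mu.-integrable setT (EFin \o (fun x : R => (2 * a) * (x * g x * sin (t * x)))).
  exact: integrable_EFinZ.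
have intf : mu.-integrable setT (EFin \o f).
  exact: integrable_EFinB.
have [C1 C10 h1] := gauss_monomial_bound 0 a0.
have [C2 C20 h2] := gauss_monomial_bound 2 a0.
have [Fy FNy] : F n%:R @[n --> \oo] --> (0 : R) /\ F (- n%:R) @[n --> \oo] --> (0 : R).
  apply: (@cvg0_inv_sqr F (C1 + C2)) => x.
  rewrite /F normrM (ger0_norm (expR_ge0 _)).
  have e1 : expR (- (a / 2 * x ^+ 2)) <= 1.
    by rewrite -[leRHS]expR0 ler_expR oppr_le0 mulr_ge0 ?sqr_ge0// divr_ge0// ltW.
  apply: (@le_trans _ _ (g x * (1 + x ^+ 2))).
    by rewrite ler_wpM2r ?addr_ge0 ?sqr_ge0// ler_piMr ?expR_ge0// norm_sin_le1.
  rewrite mulrDr mulr1; apply: lerD.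
    have := h1 x; rewrite expr0 mul1r => /le_trans; apply.
    by rewrite ler_piMr// ltW.
  have := h2 x; rewrite (real_normK (num_real x)) mulrC => /le_trans; apply.
  by rewrite ler_piMr// ltW.
have dF x : is_derive x (1 : R) F (f x).
  have := @is_deriveM R R g (fun x => sin (t * x)) x (1 : R) _ _
    (is_derive_gauss a x) (is_derive_sinM t x).
  move=> /is_derive_eq; apply; rewrite /f /g /GRing.scale/=; ring.
have csin : continuous (fun x : R => sin (t * x)).
  move=> x; apply/differentiable_continuous/derivable1_diffP.
  by have [] := is_derive_sinM t x.
have ccos : continuous (fun x : R => cos (t * x)).
  move=> x; apply/differentiable_continuous/derivable1_diffP.
  by have [] := is_derive_cosM t x.
have cf : continuous f.
  move=> x; apply: cvgB; apply: cvgM; try exact: cvg_cst.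
    by apply: cvgM; [exact: continuous_gauss|exact: ccos].
  apply: cvgM; last exact: csin.
  by apply: cvgM; [exact: cvg_id|exact: continuous_gauss].
have := Rintegral_derive_eq0 dF cf intf Fy FNy.
rewrite /f RintegralB//= !RintegralZl//= => /eqP; rewrite subr_eq0 => /eqP h.
have a20 : 2 * a != 0 by rewrite mulf_neq0// gt_eqF.
apply: (mulfI a20); apply: (etrans (esym h)).
by rewrite mulrA (mulrC (2 * a)) divfK.
Qed.

(** Differentiation under the integral, dominated by |x| e^(-a x^2), and then [gauss_sin_parts]: the
    transform I solves I' = -t/(2a) I. *)
Lemma is_derive_gauss_cos (a t : R) : 0 < a ->
  is_derive t (1 : R) (fun t => \int[mu]_x (expR (- (a * x ^+ 2)) * cos (t * x)))
    (- (t / (2 * a)) * \int[mu]_x (expR (- (a * x ^+ 2)) * cos (t * x))).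
Proof.
move=> a0; pose f (t x : R) := expR (- (a * x ^+ 2)) * cos (t * x).
pose G (x : R) : R := `|x| * expR (- (a * x ^+ 2)).
have df (s x : R) : is_derive s (1 : R) (f ^~ x) (- (x * expR (- (a * x ^+ 2)) * sin (s * x))).
  have -> : f ^~ x = (fun s => expR (- (a * x ^+ 2)) * cos (x * s)).
    by apply/funext => s'; rewrite /f (mulrC x).
  have := @is_deriveM R R (cst (expR (- (a * x ^+ 2)))) (fun s => cos (x * s)) s (1 : R) _ _
    (is_derive_cst _ _ _) (is_derive_cosM x s).
  by move=> /is_derive_eq; apply; rewrite /GRing.scale/= (mulrC s); ring.
have h1 (x : R) : (`]t - 1, t + 1[%classic : set R) x ->
    mu.-integrable setT (EFin \o f x).
  by move=> _; apply: integrable_gauss_bounded => //; [exact: measurable_cosM|move=> ?; exact: norm_cos_le1].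
have h2 (x y : R) : (`]t - 1, t + 1[%classic : set R) x -> (setT : set R) y ->
    derivable (f ^~ y) x 1.
  by move=> _ _; have [] := df x y.
have h3 (y : R) : 0 <= G y by rewrite mulr_ge0// expR_ge0.
have h4 : mu.-integrable setT (EFin \o G).
  have [C C0 hC] := gauss_monomial_bound 1 a0.
  apply: (@integrable_gauss_bound (a / 2) C); first by rewrite divr_gt0.
    apply: measurable_funM; first exact: normr_measurable.
    by apply: measurableT_comp => //; apply: measurableT_comp => //; exact: measurable_funM.
  by move=> x; rewrite (ger0_norm (h3 x)); have := hC x; rewrite expr1.
have d1E x y : partial1of2 f x y = - (y * expR (- (a * y ^+ 2)) * sin (x * y)).
  by rewrite partial1of2E; have [] := df x y.
have h5 (x y : R) : (`]t - 1, t + 1[%classic : set R) x -> (setT : set R) y ->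
    `|partial1of2 f x y| <= G y.
  move=> _ _; rewrite d1E normrN 2!normrM (ger0_norm (expR_ge0 _)).
  by rewrite ler_piMr ?norm_sin_le1// mulr_ge0// expR_ge0.
have tI : (`]t - 1, t + 1[%classic : set R) t by rewrite /= in_itv/=; apply/andP; split; lra.
have D1 := @derivable_under_integral R _ _ mu f setT measurableT _ _ _ tI h1 h2 G h3 h4 h5.
have D2 := @differentiation_under_integral R _ _ mu f setT measurableT _ _ _ tI h1 h2 G h3 h4 h5.
apply: DeriveDef => //.
rewrite -derive1E D2 mulNr -gauss_sin_parts//.
under eq_Rintegral do rewrite d1E -mulN1r.
by rewrite RintegralZl//= ?mulN1r//; exact: integrable_x_gauss_sin.
Qed.

Lemma gauss_cos (a t : R) : 0 < a ->
  \int[mu]_x (expR (- (a * x ^+ 2)) * cos (t * x)) =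
  Num.sqrt (pi / a) * expR (- (t ^+ 2 / (4 * a))).
Proof.
move=> a0; pose I t := \int[mu]_x (expR (- (a * x ^+ 2)) * cos (t * x)).
(* e^(t^2/(4a)) is the integrating factor of the equation for [I], so [H] is constant. *)
pose b := - (4 * a)^-1; pose H t := I t * expR (- (b * t ^+ 2)).
have dH s : is_derive s (1 : R) H 0.
  have := @is_deriveM R R I _ s (1 : R) _ _ (is_derive_gauss_cos s a0) (is_derive_gauss b s).
  move=> /is_derive_eq; apply; rewrite /GRing.scale/= -/(I s) /b.
  by field; rewrite gt_eqF.
have HE : H t = H 0 by apply: is_derive_0_is_cst => s; exact: dH.
have I0 : H 0 = Num.sqrt (pi / a).
  rewrite /H expr0n/= mulr0 oppr0 expR0 mulr1 /I -Rintegral_gauss//.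
  by apply: eq_Rintegral => x _; rewrite mul0r cos0 mulr1.
have -> : \int[mu]_x (expR (- (a * x ^+ 2)) * cos (t * x)) = I t by [].
rewrite -I0 -HE /H -mulrA -expRD (_ : _ + _ = 0) ?expR0 ?mulr1//.
by rewrite /b mulNr opprK mulrC subrr.
Qed.

End real_line_integrals.

Definition mfun_of d d' (T : measurableType d) (T' : measurableType d')
    (f : T -> T') (mf : measurable_fun setT f) : {mfun T >-> T'} :=
  HB.pack f (isMeasurableFun.Build _ _ _ _ _ mf).

(** Measurable rectangles form a generating pi-system that contains the whole space. *)
Lemma rectangle_measure_unique d1 d2 (T1 : measurableType d1)
    (T2 : measurableType d2) (R : realType)
    (m1 m2 : {measure set (T1 * T2) -> \bar R}) :
  (forall A B, measurable A -> measurable B -> m1 (A `*` B) = m2 (A `*` B)) ->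
  (m1 setT < +oo)%E -> forall X, measurable X -> m1 X = m2 X.
Proof.
move=> m12 m1oo X mX.
pose G : set (set (T1 * T2)) :=
  [set C | exists A, measurable A /\ exists B, measurable B /\ C = A `*` B].
apply: (measure_unique G (fun=> setT)) => //.
- rewrite measurable_prod_measurableType //; congr (<<s _ >>).
  rewrite predeqE; split => [[A mA [B mB <-]]|[A [mA [B [mB ->]]]]].
    by exists A; split => //; exists B.
  by exists A => //; exists B.
- move=> /= _ _ [X1 [mX1 [X2 [mX2 ->]]]] [Y1 [mY1 [Y2 [mY2 ->]]]].
  rewrite -setXI; exists (X1 `&` Y1); split; first exact: measurableI.
  by exists (X2 `&` Y2); split => //; exact: measurableI.
- move=> _; exists setT; split; first exact: measurableT.
  by exists setT; split; [exact: measurableT|rewrite setXTT].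
- by rewrite bigcup_const//; exists 0%N.
- by move=> _ [A [mA [B [mB ->]]]]; exact: m12.
Qed.

(** * Independence of the current state and the next increment *)

Section freezing.
Context d (Omega : measurableType d) (R : realType) (P : probability Omega R).
Context dS (S : measurableType dS) dU (U : measurableType dU).
Variables (N : nat) (X : nat -> Omega -> U).
Hypothesis mX : forall n, measurable_fun setT (X n).
Hypothesis indep : forall A : nat -> set U, (forall l, measurable (A l)) ->
  P [set w | forall l, (l < N)%N -> A l (X l w)] =
  (\prod_(l < N) P (X l @^-1` A l))%E.
Variables (phi : S -> U -> S) (s0 : S).
Hypothesis mphi : measurable_fun setT (fun p => phi p.1 p.2).

Fixpoint state (n : nat) (w : Omega) : S :=
  if n is n'.+1 then phi (state n' w) (X n' w) else s0.

Lemma measurable_state n : measurable_fun setT (state n).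
Proof.
elim: n => [|n IH]; first exact: measurable_cst.
have mp : measurable_fun setT (fun w => (state n w, X n w)) by exact: measurable_fun_pair.
exact: measurableT_comp mphi mp.
Qed.

(** Events about the increments still to come. The induction in [state_indep_future] needs
    independence from all of them, not only from the next one. *)
Let future n (B : nat -> set U) := [set w | forall l, (n <= l < N)%N -> B l (X l w)].

Let measurable_future n B : (forall l, measurable (B l)) -> measurable (future n B).
Proof.
move=> mB; rewrite (_ : future n B = \bigcap_(l in [set l | (n <= l < N)%N]) X l @^-1` B l)//.
by apply: bigcap_measurableType => l _; rewrite -[X in measurable X]setTI; exact: mX.
Qed.

Let futureS n B : (n < N)%N -> future n B = X n @^-1` B n `&` future n.+1 B.
Proof.
move=> nN; apply/seteqP; split => w /= h.
  split; first by apply: h; rewrite leqnn.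
  by move=> l /andP[nl lN]; apply: h; rewrite lN (ltnW nl).
move=> l /andP[]; rewrite leq_eqVlt => /orP[/eqP <- _|nl lN]; first exact: h.1.
by apply: h.2; rewrite nl.
Qed.

Let futureE n B : (forall l, measurable (B l)) ->
  P (future n B) = (\prod_(l < N | (n <= l)%N) P (X l @^-1` B l))%E.
Proof.
move=> mB; pose A l := if (n <= l)%N then B l else setT.
have mA l : measurable (A l) by rewrite /A; case: ifP.
have := indep mA; rewrite (_ : [set w | _] = future n B); last first.
  apply/seteqP; split => w /= h l; rewrite /A.
    by move=> /andP[nl lN]; have := h l lN; rewrite /A nl.
  by move=> lN; case: ifP => // nl; apply: h; rewrite nl.
move=> ->; rewrite [RHS]big_mkcond/=; apply: eq_bigr => l _; rewrite /A.
by case: ifP => // _; rewrite preimage_setT probability_setT.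
Qed.

Let future_indep n B : (n < N)%N -> (forall l, measurable (B l)) ->
  P (X n @^-1` B n `&` future n.+1 B) = (P (X n @^-1` B n) * P (future n.+1 B))%E.
Proof.
move=> nN mB; rewrite -futureS// !futureE// (bigD1 (Ordinal nN))//=; congr (_ * _)%E.
by apply: eq_bigl => l; rewrite ltn_neqAle eq_sym andbC.
Qed.

Lemma state_indep_future n (A : set S) (B : nat -> set U) : (n <= N)%N ->
  measurable A -> (forall l, measurable (B l)) ->
  P (state n @^-1` A `&` future n B) = (P (state n @^-1` A) * P (future n B))%E.
Proof.
elim: n A B => [|n IH] A B nN mA mB.
  rewrite /state preimage_cst; case: ifP => _; first by rewrite setTI probability_setT mul1e.
  by rewrite set0I measure0 mul0e.
pose F := future n.+1 B; have mF : measurable F by exact: measurable_future.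
have mSX : measurable_fun setT (fun w => (state n w, X n w)).
  by apply: measurable_fun_pair => //; exact: measurable_state.
have PF0 : (0 <= fine (P F)) by exact/fine_ge0/measure_ge0.
pose r := NngNum PF0.
(* [m1] is the law of (state, increment) on the event [F], and [m2] is P(F) times its law. They
   agree on rectangles by [key] and [key2], hence on the preimage of [A] under [phi]. *)
pose m1 := pushforward (mrestr P mF) (mfun_of mSX).
pose m2 := mscale r (distribution P (mfun_of mSX)).
have PFE : P F = (fine (P F))%:E by rewrite fineK// fin_num_measure.
have key C D : measurable C -> measurable D ->
    P (state n @^-1` C `&` (X n @^-1` D `&` F)) =
    (P (state n @^-1` C) * (P (X n @^-1` D) * P F))%E.
  (* Constraining the n-th increment to [D] merges this constraint and [F] into one event of
     [future n], to which the induction hypothesis applies. *)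
  move=> mC mD; pose B' l := if l == n then D else B l.
  have mB' l : measurable (B' l) by rewrite /B'; case: ifP.
  have B'n : B' n = D by rewrite /B' eqxx.
  have FB' : F = future n.+1 B'.
    apply/seteqP; split => w /= h l /andP[nl lN]; have := h l;
    by rewrite /B' nl lN gtn_eqF//; exact.
  by rewrite FB' -{1 2}B'n -futureS// IH// ?(ltnW nN)// futureS// future_indep.
have key2 C D : measurable C -> measurable D ->
    P (state n @^-1` C `&` X n @^-1` D) =
    (P (state n @^-1` C) * P (X n @^-1` D))%E.
  move=> mC mD; pose B' l := if l == n then D else setT.
  have mB' l : measurable (B' l) by rewrite /B'; case: ifP.
  have := IH C B' (ltnW nN) mC mB'; rewrite (_ : future n B' = X n @^-1` D)//.
  apply/seteqP; split => w /= h.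
    by have := h n; rewrite leqnn nN /B' eqxx; exact.
  by move=> l _; rewrite /B'; case: eqP => // ->.
have E : m1 ((fun p => phi p.1 p.2) @^-1` A) = m2 ((fun p => phi p.1 p.2) @^-1` A).
  apply: rectangle_measure_unique.
  - move=> C D mC mD.
    transitivity (P (state n @^-1` C `&` (X n @^-1` D `&` F))).
      apply: (congr1 P); apply/seteqP; split => w /=; first by move=> [[]].
      by move=> [? []].
    transitivity ((fine (P F))%:E * P (state n @^-1` C `&` X n @^-1` D))%E; last by [].
    by rewrite key// key2// [in LHS]PFE muleA muleC.
  - have mTF : measurable (setT `&` F) by exact: measurableI.
    exact: le_lt_trans (probability_le1 P mTF) (ltry 1).
  - by rewrite -[X in measurable X]setTI; exact: mphi.
transitivity (m1 ((fun p => phi p.1 p.2) @^-1` A)) => //.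
by rewrite E [in RHS]PFE muleC.
Qed.

(** The state after n steps and the n-th increment are independent, so their joint law is a product,
    and Tonelli's theorem integrates the increment first. *)
Lemma freezing n (f : S * U -> \bar R) : (n < N)%N ->
  measurable_fun setT f -> (forall p, 0 <= f p)%E ->
  (\int[P]_w f (state n w, X n w) = \int[P]_w \int[P]_w' f (state n w, X n w'))%E.
Proof.
move=> nN mf f0.
have mSX : measurable_fun setT (fun w => (state n w, X n w)).
  by apply: measurable_fun_pair => //; exact: measurable_state.
have mS := measurable_state n.
pose PS := distribution P (mfun_of mS); pose PX := distribution P (mfun_of (mX n)).
transitivity (\int[distribution P (mfun_of mSX)]_p f p)%E.
  by rewrite ge0_integral_distribution.
transitivity (\int[PS \x PX]_p f p)%E.
  apply: eq_measure_integral => /= A mA _.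
  apply/esym/product_measure_unique => // C D mC mD.
  pose B' l := if l == n then D else setT.
  have mB' l : measurable (B' l) by rewrite /B'; case: ifP.
  have := state_indep_future (ltnW nN) mC mB'.
  rewrite (_ : future n B' = X n @^-1` D)//.
  apply/seteqP; split => w /= h.
    by have := h n; rewrite leqnn nN /B' eqxx; exact.
  by move=> l _; rewrite /B'; case: eqP => // ->.
rewrite fubini_tonelli1// ge0_integral_distribution//=.
- apply: eq_integral => w _; rewrite /fubini_F ge0_integral_distribution//.
  exact: measurableT_comp.
- exact: measurable_fun_fubini_tonelli_F.
- by move=> s; apply: integral_ge0.
Qed.

End freezing.

(** * Moments of a centred normal law *)

Section normal_moments.
Context {R : realType}.
Local Notation mu := (@lebesgue_measure R).

(** The Radon-Nikodym derivative of the normal law equals [normal_pdf] almost everywhere, because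
    both integrate to that law on every measurable set. *)
Lemma ge0_integral_normal_prob (s : R) (f : R -> \bar R) :
  measurable_fun setT f -> (forall x, 0 <= f x)%E ->
  (\int[normal_prob 0 s]_x f x = \int[mu]_x (f x * (normal_pdf 0 s x)%:E))%E.
Proof.
move=> mf f0.
have dom : normal_prob 0 s `<< mu by exact: normal_prob_dominates.
rewrite -(Radon_Nikodym_SigmaFinite.change_of_variables dom)//.
have mpdf : measurable_fun setT (fun x : R => (normal_pdf 0 s x)%:E).
  by apply/measurable_EFinP; exact: measurable_normal_pdf.
apply: ae_eq_integral => //.
- apply: emeasurable_funM => //.
  exact: measurable_int (Radon_Nikodym_SigmaFinite.f_integrable dom).
- exact: emeasurable_funM.
- apply: ae_eqe_mul2l => /=; apply: integral_ae_eq => //=.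
  + exact: Radon_Nikodym_SigmaFinite.f_integrable.
  + by move=> E _ mE; rewrite -Radon_Nikodym_SigmaFinite.f_integral.
Qed.

Let normal_pdf_gauss (s : R) : s != 0 ->
  normal_pdf 0 s = (fun x => normal_peak s * expR (- ((2 * s ^+ 2)^-1 * x ^+ 2))).
Proof.
move=> s0; rewrite normal_pdfE//; apply/funext => x; rewrite /normal_fun subr0.
by rewrite mulNr (mulrC (x ^+ 2)) -(mulr_natl (s ^+ 2)).
Qed.

Let inv_gt0 (s : R) : s != 0 -> 0 < (2 * s ^+ 2)^-1.
Proof. by move=> s0; rewrite invr_gt0 mulr_gt0// exprn_even_gt0. Qed.

Lemma integrable_normal_monomial (n : nat) (s : R) : s != 0 ->
  mu.-integrable setT (EFin \o (fun x : R => x ^+ n * normal_pdf 0 s x)).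
Proof.
move=> s0; rewrite normal_pdf_gauss//.
under eq_fun do rewrite mulrCA.
by apply: integrable_EFinZ; apply: integrable_gauss_monomial; exact: inv_gt0.
Qed.

Let normal_moment_rec (n : nat) (s : R) : s != 0 ->
  \int[mu]_x (x ^+ n.+2 * normal_pdf 0 s x) =
  n.+1%:R * s ^+ 2 * \int[mu]_x (x ^+ n * normal_pdf 0 s x).
Proof.
move=> s0; rewrite normal_pdf_gauss//.
have a0 := inv_gt0 s0.
under eq_Rintegral do rewrite mulrCA.
under [in RHS]eq_Rintegral do rewrite mulrCA.
rewrite !RintegralZl//; try exact: integrable_gauss_monomial.
rewrite gauss_moment//; have -> : 2 * (2 * s ^+ 2)^-1 = (s ^+ 2)^-1.
  by rewrite invfM mulrA divff ?mul1r.
by rewrite invrK; ring.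
Qed.

Let normal_moment0 (s : R) : \int[mu]_x (x ^+ 0 * normal_pdf 0 s x) = 1.
Proof.
under eq_Rintegral do rewrite expr0 mul1r.
by rewrite /Rintegral integral_normal_pdf.
Qed.

Lemma normal_moment2 (s : R) : s != 0 ->
  \int[mu]_x (x ^+ 2 * normal_pdf 0 s x) = s ^+ 2.
Proof. by move=> s0; rewrite normal_moment_rec// normal_moment0 mul1r mulr1. Qed.

Lemma normal_moment4 (s : R) : s != 0 ->
  \int[mu]_x (x ^+ 4 * normal_pdf 0 s x) = 3 * s ^+ 4.
Proof. by move=> s0; rewrite normal_moment_rec// normal_moment2//; ring. Qed.

End normal_moments.

(** * Linear forms in a correlated Gaussian pair *)

Section gaussian_pair.
Context d (Omega : measurableType d) (R : realType) (P : probability Omega R).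
Variables (rho : R) (zx zy : Omega -> R).
Hypotheses (mzx : measurable_fun setT zx) (mzy : measurable_fun setT zy).
Hypothesis rho1 : -1 <= rho <= 1.
Hypothesis law : forall (a b : R) (A : set R), measurable A ->
  P ((fun w => a * zx w + b * zy w) @^-1` A) =
  gaussian_law 0 (Num.sqrt (a ^+ 2 + 2 * rho * a * b + b ^+ 2)) A.

Local Notation var a b := (a ^+ 2 + 2 * rho * a * b + b ^+ 2).

Lemma var_ge0 (a b : R) : 0 <= var a b.
Proof.
have -> : var a b = (a + rho * b) ^+ 2 + (1 - rho ^+ 2) * b ^+ 2 by ring.
by apply: addr_ge0; rewrite ?sqr_ge0// mulr_ge0 ?sqr_ge0//; move/andP: rho1 => [] *; nra.
Qed.

Let measurable_lin a b : measurable_fun setT (fun w => a * zx w + b * zy w).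
Proof. by apply: measurable_funD; exact: measurable_funM. Qed.

(** The case split is that of [gaussian_law]: a form of variance 0 has the Dirac mass at 0 as its
    law. *)
Lemma ge0_integral_gaussian (a b : R) (f : R -> R) :
  measurable_fun setT f -> (forall x, 0 <= f x) ->
  (\int[P]_w (f (a * zx w + b * zy w))%:E =
   if (var a b == 0)%R then (f 0%R)%:E
   else \int[lebesgue_measure]_x (f x * normal_pdf 0 (Num.sqrt (var a b)) x)%R%:E)%E.
Proof.
move=> mf f0; set s := Num.sqrt (var a b).
have mEf : measurable_fun setT (fun x : R => (f x)%:E) by exact/measurable_EFinP.
have [v0|v0] := eqVneq (var a b) 0.
  transitivity (\int[distribution P (mfun_of (measurable_lin a b))]_x (f x)%:E)%E.
    by rewrite ge0_integral_distribution// => x; rewrite lee_fin.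
  transitivity (\int[\d_(0%R : R)]_x (f x)%:E)%E; last first.
    by rewrite integral_dirac// diracE in_setT mul1e.
  apply: eq_measure_integral => A mA _; apply: (etrans (law a b mA)).
  by rewrite /gaussian_law v0 sqrtr0 eqxx.
have s0 : s != 0 by rewrite sqrtr_eq0 -ltNge lt0r v0 var_ge0.
have mlin : @measurable_fun _ _ Omega (measurableTypeR R) setT
    (fun w => a * zx w + b * zy w) := measurable_lin a b.
transitivity (\int[distribution P (mfun_of mlin)]_x (f x)%:E)%E.
  by rewrite ge0_integral_distribution// => x; rewrite lee_fin.
transitivity (\int[normal_prob 0 s]_x (f x)%:E)%E; last first.
  by rewrite ge0_integral_normal_prob// => x; rewrite lee_fin.
apply: eq_measure_integral => A mA _; apply: (etrans (law a b mA)).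
by rewrite /gaussian_law -/s (negbTE s0).
Qed.

Lemma gaussian_moment2 (a b : R) :
  (\int[P]_w ((a * zx w + b * zy w) ^+ 2)%:E = (var a b)%:E)%E.
Proof.
rewrite (@ge0_integral_gaussian a b (fun x => x ^+ 2))//; last by move=> x; exact: sqr_ge0.
case: eqP => [->|/eqP v0]; first by rewrite expr0n.
have s0 : Num.sqrt (var a b) != 0 by rewrite sqrtr_eq0 -ltNge lt0r v0 var_ge0.
rewrite -[LHS]fineK; last exact: integrable_fin_num (integrable_normal_monomial 2 s0).
by congr EFin; apply: (etrans (normal_moment2 s0)); rewrite sqr_sqrtr ?var_ge0.
Qed.

Lemma gaussian_moment4 (a b : R) :
  (\int[P]_w ((a * zx w + b * zy w) ^+ 4)%:E = (3 * var a b ^+ 2)%:E)%E.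
Proof.
rewrite (@ge0_integral_gaussian a b (fun x => x ^+ 4))//; last by move=> x; rewrite exprn_even_ge0.
case: eqP => [->|/eqP v0]; first by rewrite !expr0n mulr0.
have s0 : Num.sqrt (var a b) != 0 by rewrite sqrtr_eq0 -ltNge lt0r v0 var_ge0.
rewrite -[LHS]fineK; last exact: integrable_fin_num (integrable_normal_monomial 4 s0).
congr EFin; apply: (etrans (normal_moment4 s0)).
by rewrite (exprM _ 2 2) sqr_sqrtr ?var_ge0.
Qed.

Let integrable_even (n : nat) (a b : R) :
  P.-integrable setT (EFin \o (fun w => (a * zx w + b * zy w) ^+ n.*2)).
Proof.
have ge (x : R) : 0 <= x ^+ n.*2 by rewrite exprn_even_ge0// odd_double.
have mX : measurable_fun setT (fun x : R => x ^+ n.*2) by exact: exprn_measurable.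
apply/integrableP; split.
  exact/measurable_EFinP/(measurableT_comp mX)/measurable_lin.
under eq_integral do rewrite /= ger0_norm//.
rewrite (@ge0_integral_gaussian a b (fun x => x ^+ n.*2))//.
case: eqP => [_|/eqP v0]; first exact: ltry.
have s0 : Num.sqrt (var a b) != 0 by rewrite sqrtr_eq0 -ltNge lt0r v0 var_ge0.
rewrite -ge0_fin_numE; first exact: integrable_fin_num (integrable_normal_monomial _ s0).
by apply: integral_ge0 => x _; rewrite lee_fin mulr_ge0// normal_pdf_ge0.
Qed.

Definition poly_growth (g : R -> R -> R) := exists (K : R) (m : nat),
  forall x y, `|g x y| <= K * (1 + x ^+ 2 + y ^+ 2) ^+ m.

Lemma integrable_growth_base (m : nat) :
  P.-integrable setT (EFin \o (fun w => (1 + zx w ^+ 2 + zy w ^+ 2) ^+ m)).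
Proof.
apply: (@le_integrable_EFin _ _ _ _ _
  (fun w => 3 ^+ m * (1 + (1 * zx w + 0 * zy w) ^+ m.*2 + (0 * zx w + 1 * zy w) ^+ m.*2))).
- apply: measurable_funX; apply: measurable_funD; last exact: measurable_funX.
  by apply: measurable_funD => //; exact: measurable_funX.
- move=> w; rewrite !mul0r !mul1r addr0 add0r.
  set a := zx w ^+ 2; set b := zy w ^+ 2.
  have a0 : 0 <= a by exact: sqr_ge0.
  have b0 : 0 <= b by exact: sqr_ge0.
  rewrite ger0_norm; last by rewrite exprn_ge0// !addr_ge0.
  rewrite -mul2n !exprM -/a -/b.
  have am := exprn_ge0 m a0; have bm := exprn_ge0 m b0.
  (* A sum of three terms is at most three times the largest, whose m-th power is among the summands
     on the right. *)
  pose c := Num.max 1 (Num.max a b).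
  have c1 : 1 <= c by rewrite le_max lexx.
  have ca : a <= c by rewrite !le_max lexx orbT.
  have cb : b <= c by rewrite !le_max lexx !orbT.
  apply: (@le_trans _ _ ((3 * c) ^+ m)).
    by rewrite lerXn2r ?nnegrE ?addr_ge0//; lra.
  rewrite exprMn ler_wpM2l ?exprn_ge0// /c !maxEle.
  by case: (a <= b); [case: (1 <= b)|case: (1 <= a)]; rewrite ?expr1n; lra.
- apply: integrable_EFinZ; apply: integrable_EFinD; last exact: integrable_even.
  apply: integrable_EFinD; last exact: integrable_even.
  exact: finite_measure_integrable_cst.
Qed.

Lemma integrable_poly_growth (g : R -> R -> R) :
  measurable_fun setT (fun p : R * R => g p.1 p.2) -> poly_growth g ->
  P.-integrable setT (EFin \o (fun w => g (zx w) (zy w))).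
Proof.
move=> mg [K [m gK]]; apply: (@le_integrable_EFin _ _ _ _ _
  (fun w => K * (1 + zx w ^+ 2 + zy w ^+ 2) ^+ m)) => //.
- apply: (measurableT_comp mg (_ : measurable_fun _ (fun w => (zx w, zy w)))).
  exact: measurable_fun_pair.
- by apply: integrable_EFinZ; exact: integrable_growth_base.
Qed.

(** The linear form and its opposite have the same variance, hence the same law, so the mean equals
    its own opposite. *)
Lemma gaussian_odd (a b : R) (f : R -> R) : measurable_fun setT f ->
  (forall x, f (- x) = - f x) ->
  P.-integrable setT (EFin \o (fun w => f (a * zx w + b * zy w))) ->
  \int[P]_w f (a * zx w + b * zy w) = 0.
Proof.
move=> mf fodd intf.
have mEf : measurable_fun setT (fun x : R => (f x)%:E) by exact/measurable_EFinP.
have intf' : P.-integrable setT (EFin \o (fun w => f ((- a) * zx w + (- b) * zy w))).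
  rewrite (_ : (fun w => _) = (fun w => -1 * f (a * zx w + b * zy w))).
    exact: integrable_EFinZ.
  by apply/funext => w; rewrite mulN1r -fodd opprD !mulNr.
have h : \int[P]_w f (a * zx w + b * zy w) = \int[P]_w f ((- a) * zx w + (- b) * zy w).
  rewrite /Rintegral; congr fine.
  have e (a' b' : R) : P.-integrable setT (EFin \o (fun w => f (a' * zx w + b' * zy w))) ->
      (\int[P]_w (f (a' * zx w + b' * zy w))%:E =
       \int[distribution P (mfun_of (measurable_lin a' b'))]_x (f x)%:E)%E.
    by move=> i'; rewrite integral_distribution.
  rewrite e// e//.
  apply: eq_measure_integral => A mA _.
  apply: (etrans (law a b mA)); apply: (etrans _ (esym (law (- a) (- b) mA))).
  by congr (gaussian_law 0 (Num.sqrt _) A); ring.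
have h2 : \int[P]_w f ((- a) * zx w + (- b) * zy w) = - \int[P]_w f (a * zx w + b * zy w).
  rewrite -[RHS]mulN1r -RintegralZl//; apply: eq_Rintegral => w _.
  by rewrite mulN1r -fodd opprD !mulNr.
by have := etrans h h2; lra.
Qed.

End gaussian_pair.

(** * The symbols of the scheme and the one-step errors *)

Section trig_taylor.
Context {R : realType}.
Implicit Types x : R.

(** In the chain from [sin_le] to [cos_ge6] the derivative of each remainder is the preceding one,
    so this step yields all the Taylor inequalities in turn. *)
Lemma ge0_of_derive (f df : R -> R) :
  (forall x : R, is_derive x (1 : R) f (df x)) -> f 0 = 0 ->
  (forall x, 0 <= x -> 0 <= df x) -> forall x, 0 <= x -> 0 <= f x.
Proof.
move=> fd f0 df0 x; rewrite le_eqVlt => /predU1P[<-|x0]; first by rewrite f0.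
have cf : {within `[0, x], continuous f}.
  apply: derivable_within_continuous => y _; by have [] := fd y.
have [c cx] := @MVT R f df 0 x x0 (fun y _ => fd y) cf.
rewrite f0 !subr0 => ->; move: cx; rewrite in_itv/= => /andP[/ltW c0 _].
by rewrite mulr_ge0// ?df0// ltW.
Qed.

Let dmono (n : nat) (c x : R) :
  is_derive x (1 : R) (fun x : R => x ^+ n.+1 * c) (n.+1%:R * x ^+ n * c).
Proof.
have := @is_deriveX R R id n.+1 x (1 : R) _ (is_derive_id x (1 : R)).
rewrite /GRing.scale/= mulr1 (_ : id ^+ n.+1 = (fun x : R => x ^+ n.+1)); last first.
  by apply/funext => y; rewrite exprfctE.
move=> h; refine (is_derive_eq (is_deriveM h (is_derive_cst c x (1 : R))) _).
by rewrite /GRing.scale/= mulr0 add0r mulrC.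
Qed.

Lemma sin_le x : 0 <= x -> 0 <= x - sin x.
Proof.
move: x; have d (x : R) : is_derive x (1 : R) (fun x : R => x - sin x) (1 - cos x).
  refine (is_derive_eq ((is_deriveB (is_derive_id x (1 : R)) (is_derive_sin x))) _).
  by rewrite /=; field.
by apply: (ge0_of_derive d); [rewrite sin0; field|by move=> y _; rewrite subr_ge0 cos_le1].
Qed.

Lemma cos_ge2 x : 0 <= x -> 0 <= cos x - 1 + x ^+ 2 / 2.
Proof.
move: x; have d (x : R) : is_derive x (1 : R) (fun x : R => cos x - 1 + x ^+ 2 / 2) (x - sin x).
  refine (is_derive_eq ((is_deriveD (is_deriveB (is_derive_cos x) (is_derive_cst (1 : R) x (1 : R))) (dmono 1 2^-1 x))) _).
  by rewrite /=; field.
by apply: (ge0_of_derive d); [rewrite cos0; field|exact: sin_le].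
Qed.

Lemma sin_ge3 x : 0 <= x -> 0 <= sin x - x + x ^+ 3 / 6.
Proof.
move: x; have d (x : R) : is_derive x (1 : R) (fun x : R => sin x - x + x ^+ 3 / 6) (cos x - 1 + x ^+ 2 / 2).
  refine (is_derive_eq ((is_deriveD (is_deriveB (is_derive_sin x) (is_derive_id x (1 : R))) (dmono 2 6^-1 x))) _).
  by rewrite /=; field.
by apply: (ge0_of_derive d); [rewrite sin0; field|exact: cos_ge2].
Qed.

Lemma cos_le4 x : 0 <= x -> 0 <= 1 - x ^+ 2 / 2 + x ^+ 4 / 24 - cos x.
Proof.
move: x; have d (x : R) : is_derive x (1 : R) (fun x : R => 1 - x ^+ 2 / 2 + x ^+ 4 / 24 - cos x) (sin x - x + x ^+ 3 / 6).
  refine (is_derive_eq ((is_deriveB (is_deriveD (is_deriveB (is_derive_cst (1 : R) x (1 : R)) (dmono 1 2^-1 x)) (dmono 3 24^-1 x)) (is_derive_cos x))) _).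
  by rewrite /=; field.
by apply: (ge0_of_derive d); [rewrite cos0; field|exact: sin_ge3].
Qed.

Lemma sin_le5 x : 0 <= x -> 0 <= x - x ^+ 3 / 6 + x ^+ 5 / 120 - sin x.
Proof.
move: x; have d (x : R) : is_derive x (1 : R) (fun x : R => x - x ^+ 3 / 6 + x ^+ 5 / 120 - sin x) (1 - x ^+ 2 / 2 + x ^+ 4 / 24 - cos x).
  refine (is_derive_eq ((is_deriveB (is_deriveD (is_deriveB (is_derive_id x (1 : R)) (dmono 2 6^-1 x)) (dmono 4 120^-1 x)) (is_derive_sin x))) _).
  by rewrite /=; field.
by apply: (ge0_of_derive d); [rewrite sin0; field|exact: cos_le4].
Qed.

Lemma cos_ge6 x : 0 <= x -> 0 <= cos x - 1 + x ^+ 2 / 2 - x ^+ 4 / 24 + x ^+ 6 / 720.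
Proof.
move: x; have d (x : R) : is_derive x (1 : R) (fun x : R => cos x - 1 + x ^+ 2 / 2 - x ^+ 4 / 24 + x ^+ 6 / 720) (x - x ^+ 3 / 6 + x ^+ 5 / 120 - sin x).
  refine (is_derive_eq ((is_deriveD (is_deriveB (is_deriveD (is_deriveB (is_derive_cos x) (is_derive_cst (1 : R) x (1 : R))) (dmono 1 2^-1 x)) (dmono 3 24^-1 x)) (dmono 5 720^-1 x))) _).
  by rewrite /=; field.
by apply: (ge0_of_derive d); [rewrite cos0; field|exact: sin_le5].
Qed.

Let by_parity (P : R -> Prop) : (forall x, P x -> P (- x)) ->
  (forall x, 0 <= x -> P x) -> forall x, P x.
Proof.
move=> PN P0 x; have [|/ltW x0] := leP 0 x; first exact: P0.
by rewrite -[x]opprK; apply: PN; apply: P0; rewrite oppr_ge0.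
Qed.

Lemma norm_sin_le x : `|sin x| <= `|x|.
Proof.
move: x; apply: by_parity => x; first by rewrite sinN !normrN.
move=> x0; rewrite (ger0_norm x0) ler_norml.
have h1 := sin_le x0; have h3 := sin_ge3 x0.
have [x1|x1] := leP x 1; last by have := sin_geN1 x; lra.
have x3 : x ^+ 3 <= x by rewrite exprS ler_piMr// exprn_ile1.
by apply/andP; split; lra.
Qed.

Lemma norm_sinB_le x : `|sin x - x| <= `|x| ^+ 3 / 6.
Proof.
move: x; apply: by_parity => x; first by rewrite sinN -opprB !opprK normrN normrN addrC.
move=> x0; rewrite (ger0_norm x0) ler_norml.
have := sin_le x0; have := sin_ge3 x0; have := exprn_ge0 3 x0.
by move=> *; apply/andP; split; lra.
Qed.

Lemma norm_sin_taylor x : `|sin x - x + x ^+ 3 / 6| <= `|x| ^+ 5 / 120.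
Proof.
move: x; apply: by_parity => x.
  rewrite sinN normrN => h; rewrite (_ : _ + _ = - (sin x - x + x ^+ 3 / 6)) ?normrN//.
  by field.
move=> x0; rewrite (ger0_norm x0) ler_norml.
have := sin_le5 x0; have := sin_ge3 x0; have := exprn_ge0 5 x0.
by move=> *; apply/andP; split; lra.
Qed.

Lemma cosB1_bounds x : 0 <= 1 - cos x <= x ^+ 2 / 2.
Proof.
rewrite subr_ge0 cos_le1/=; move: x; apply: by_parity => x; first by rewrite cosN sqrrN.
by move=> x0; have := cos_ge2 x0; lra.
Qed.

Lemma norm_cos_taylor2 x : `|cos x - 1 + x ^+ 2 / 2| <= x ^+ 4 / 24.
Proof.
move: x; apply: by_parity => x; 
  have e4 : (- x) ^+ 4 = x ^+ 4 by ring.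
  by rewrite cosN sqrrN e4.
move=> x0; rewrite ler_norml.
have := cos_le4 x0; have := cos_ge2 x0; have := exprn_ge0 4 x0.
by move=> *; apply/andP; split; lra.
Qed.

Lemma norm_cos_taylor4 x : `|cos x - 1 + x ^+ 2 / 2 - x ^+ 4 / 24| <= x ^+ 6 / 720.
Proof.
move: x; apply: by_parity => x; 
  have e4 : (- x) ^+ 4 = x ^+ 4 by ring.
  have e6 : (- x) ^+ 6 = x ^+ 6 by ring.
  by rewrite cosN sqrrN e4 e6.
move=> x0; rewrite ler_norml.
have := cos_le4 x0; have := cos_ge6 x0; have := exprn_ge0 6 x0.
by move=> *; apply/andP; split; lra.
Qed.

(* The constant 1/9 replaces the optimal 4/pi^2; only positivity matters. *)
Lemma cosB1_ge x : `|x| <= pi -> x ^+ 2 / 18 <= 1 - cos x.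
Proof.
move: x; apply: by_parity => x; first by rewrite cosN sqrrN normrN.
move=> x0; rewrite (ger0_norm x0) => xpi.
pose y := x / 2; have y0 : 0 <= y by rewrite divr_ge0.
have xE : x = y *+ 2 by rewrite /y mulr2n; field.
have y2 : y < 2.
  have /andP[_ p2] := @pihalf_02 R; rewrite /y; apply: le_lt_trans p2.
  by rewrite ler_pdivrMr// divfK.
have h3 := sin_ge3 y0.
have y13 : y / 3 <= sin y.
  have : y * (y ^+ 2 / 6) <= y * (2 / 3).
    by rewrite ler_wpM2l//; nra.
  have e3 : y ^+ 3 / 6 = y * (y ^+ 2 / 6) by field.
  by move: h3; rewrite e3; lra.
have s0 : 0 <= y / 3 by rewrite divr_ge0.
have s2 : (y / 3) ^+ 2 <= sin y ^+ 2 by rewrite lerXn2r ?nnegrE// (le_trans s0).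
have cE : 1 - cos x = 2 * sin y ^+ 2.
  rewrite {1}xE cos_mulr2n; have := cos2Dsin2 y; lra.
rewrite cE (_ : x ^+ 2 / 18 = 2 * (y / 3) ^+ 2); first lra.
by rewrite xE mulr2n; field.
Qed.

Lemma expR_taylor x : 0 <= x -> `|expR (- x) - 1 + x| <= x ^+ 2.
Proof.
move=> x0; have h1 := expR_ge1Dx (- x); have h2 := expR_ge1Dx x.
have e0 := expR_gt0 (- x).
have ee : expR (- x) * expR x = 1 by rewrite -expRD addNr expR0.
have h3 : expR (- x) * (1 + x) <= 1 by rewrite -[leRHS]ee ler_wpM2l// ltW.
(* (1 - x + x^2)(1 + x) = 1 + x^3 is at least 1, while e^(-x) (1 + x) is at most 1. *)
have h4 : (expR (- x) - (1 - x + x ^+ 2)) * (1 + x) <= 0.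
  by have := exprn_ge0 3 x0; nra.
have h5 : expR (- x) <= 1 - x + x ^+ 2.
  by rewrite -subr_le0; move: h4; rewrite pmulr_lle0//; lra.
by rewrite ler_norml; apply/andP; split; [have := sqr_ge0 x; lra|lra].
Qed.

End trig_taylor.

(** * Complex arithmetic on pairs of reals *)

Section complex_pairs.
Context {R : realType}.
Implicit Types a b c : R * R.

(** Complex numbers are pairs of reals: the product sigma-algebra then gives measurability component
    by component. *)
Definition cadd a b : R * R := (a.1 + b.1, a.2 + b.2).
Definition csub a b : R * R := (a.1 - b.1, a.2 - b.2).
Definition cmul a b : R * R := (a.1 * b.1 - a.2 * b.2, a.1 * b.2 + a.2 * b.1).
Definition cconj a : R * R := (a.1, - a.2).
Definition cn2 a : R := a.1 ^+ 2 + a.2 ^+ 2.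
Definition cinv a : R * R := (a.1 / cn2 a, - a.2 / cn2 a).

Lemma cplxP a b : a.1 = b.1 -> a.2 = b.2 -> a = b.
Proof. by case: a b => [? ?] [? ?] /= -> ->. Qed.

Lemma cn2_ge0 a : 0 <= cn2 a.
Proof. by rewrite addr_ge0 ?sqr_ge0. Qed.

Lemma cn2M a b : cn2 (cmul a b) = cn2 a * cn2 b.
Proof. by rewrite /cn2 /cmul/=; ring. Qed.

Lemma cmulKV a b : cn2 a != 0 -> cmul a (cmul (cinv a) b) = b.
Proof. by move=> a0; apply: cplxP; rewrite /= /cn2 in a0 *; field. Qed.

Lemma cmulVK a b : cn2 a != 0 -> cmul (cinv a) (cmul a b) = b.
Proof. by move=> a0; apply: cplxP; rewrite /= /cn2 in a0 *; field. Qed.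

Lemma cn2V a : cn2 a != 0 -> cn2 (cinv a) = (cn2 a)^-1.
Proof. by move=> a0; rewrite {1}/cn2 /cinv/= -/(cn2 a); rewrite /cn2 in a0 *; field. Qed.

Lemma cn2_perturbation_le (a d u1 r1 u2 r2 u3 r3 : R * R) :
  cn2 (cadd (cmul a d) (cadd (cmul u1 r1) (cadd (cmul u2 r2) (cmul u3 r3)))) <=
  cn2 d * cn2 a +
  (2 * ((cmul d (cconj r1)).1 * (cmul a (cconj u1)).1 - (cmul d (cconj r1)).2 * (cmul a (cconj u1)).2)
      + 3 * cn2 r1 * cn2 u1 +
   (2 * ((cmul d (cconj r2)).1 * (cmul a (cconj u2)).1 - (cmul d (cconj r2)).2 * (cmul a (cconj u2)).2)
      + 3 * cn2 r2 * cn2 u2 +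
   (2 * ((cmul d (cconj r3)).1 * (cmul a (cconj u3)).1 - (cmul d (cconj r3)).2 * (cmul a (cconj u3)).2)
      + 3 * cn2 r3 * cn2 u3))).
Proof.
have cross u r : 2 * ((cmul d (cconj r)).1 * (cmul a (cconj u)).1 - (cmul d (cconj r)).2 * (cmul a (cconj u)).2)
  = 2 * ((cmul a d).1 * (cmul u r).1 + (cmul a d).2 * (cmul u r).2) by rewrite /=; ring.
have sq (e f : R * R) : 3 * cn2 e * cn2 f = 3 * cn2 (cmul f e) by rewrite cn2M; ring.
have sq0 : cn2 d * cn2 a = cn2 (cmul a d) by rewrite cn2M mulrC.
rewrite !cross !sq sq0 {cross sq sq0}.
move: (cmul a d) (cmul u1 r1) (cmul u2 r2) (cmul u3 r3) => [e f] [p1 q1] [p2 q2] [p3 q3].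
rewrite -subr_ge0 /cn2 /cadd /=.
(* Three times a sum of three squares, minus the square of the sum, is this sum of squared
   differences. *)
have q (x y t : R) : 0 <= (x - y) ^+ 2 + (y - t) ^+ 2 + (x - t) ^+ 2 by rewrite !addr_ge0 ?sqr_ge0.
have := addr_ge0 (q p1 p2 p3) (q q1 q2 q3); congr (0 <= _); ring.
Qed.

End complex_pairs.

(** * Orders of magnitude in k and h with polynomial constants *)

Section growth.
Context {R : realType}.
Variable T : R.

Local Notation hpar := (R * R * R)%type.
Local Notation fld := (hpar -> R * R -> R * R -> R).
Local Notation cfld := (hpar -> R * R -> R * R -> R * R).

(** A parameter [p] is (h_x, h_y, k^(1/2)). Taking the square root of k keeps the exponents of the
    noise integral: [mono a b] reads k^(a/2) (h_x^2 + h_y^2)^b. *)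
Definition step_h2 (p : hpar) : R := p.1.1 ^+ 2 + p.1.2 ^+ 2.
Definition adm (p : hpar) : Prop := 0 < p.2 /\ p.2 ^+ 2 <= T.
Definition weight (u : R * R) : R := 1 + u.1 ^+ 2 + u.2 ^+ 2.
Definition mono (a b : nat) (p : hpar) : R := p.2 ^+ a * step_h2 p ^+ b.

(* [poly_bounded g f] is f = O(g), with a constant that is polynomial in the
   frequency [zeta] and in the noise [z]. *)
Definition poly_bounded (g : hpar -> R) (f : fld) : Prop :=
  [/\ forall p, measurable_fun setT (fun u : (R * R) * (R * R) => f p u.1 u.2),
      forall p, adm p -> 0 <= g p &
      exists (K : R) (m : nat), 0 <= K /\ forall p zeta z, adm p ->
        `|f p zeta z| <= K * (weight zeta * weight z) ^+ m * g p].

Lemma weight_ge1 u : 1 <= weight u.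
Proof. by rewrite /weight -addrA lerDl addr_ge0 ?sqr_ge0. Qed.

Lemma weight_ge0 u : 0 <= weight u.
Proof. exact: le_trans ler01 (weight_ge1 u). Qed.

Lemma weight2_ge1 u v : 1 <= weight u * weight v.
Proof. by rewrite -[1]mulr1 ler_pM ?weight_ge1. Qed.

Lemma step_h2_ge0 p : 0 <= step_h2 p.
Proof. by rewrite addr_ge0 ?sqr_ge0. Qed.

Lemma mono_ge0 a b p : adm p -> 0 <= mono a b p.
Proof. by move=> [k0 _]; rewrite mulr_ge0 ?exprn_ge0 ?step_h2_ge0// ltW. Qed.

Lemma poly_bounded_ext g (f f' : fld) : (forall p zeta z, f p zeta z = f' p zeta z) ->
  poly_bounded g f -> poly_bounded g f'.
Proof.
move=> e; suff -> : f = f' by [].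
by do 3 (apply/funext => ?); exact: e.
Qed.

Lemma poly_boundedD g (f f' : fld) : poly_bounded g f -> poly_bounded g f' ->
  poly_bounded g (fun p zeta z => f p zeta z + f' p zeta z).
Proof.
move=> [mf g0 [K [m [K0 h]]]] [mf' _ [K' [m' [K'0 h']]]]; split => //.
  by move=> p; exact: measurable_funD.
exists (K + K'), (maxn m m'); split; first exact: addr_ge0.
move=> p zeta z ap; apply: le_trans (ler_normD _ _) _.
have := weight2_ge1 zeta z; have := h _ zeta z ap; have := h' _ zeta z ap.
move: (weight zeta * weight z) => W hW hW' W1.
rewrite !mulrDl; apply: lerD.
  apply: le_trans hW' _; rewrite ler_wpM2r ?g0// ler_wpM2l//.
  by rewrite ler_weXn2l// leq_maxl.
apply: le_trans hW _; rewrite ler_wpM2r ?g0// ler_wpM2l//.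
by rewrite ler_weXn2l// leq_maxr.
Qed.

Lemma poly_boundedM g g' (f f' : fld) : poly_bounded g f -> poly_bounded g' f' ->
  poly_bounded (fun p => g p * g' p) (fun p zeta z => f p zeta z * f' p zeta z).
Proof.
move=> [mf g0 [K [m [K0 h]]]] [mf' g0' [K' [m' [K'0 h']]]]; split.
- by move=> p; exact: measurable_funM.
- by move=> p ap; rewrite mulr_ge0 ?g0 ?g0'.
exists (K * K'), (m + m')%N; split; first exact: mulr_ge0.
move=> p zeta z ap; rewrite normrM exprD.
have -> : K * K' * ((weight zeta * weight z) ^+ m * (weight zeta * weight z) ^+ m') * (g p * g' p)
  = (K * (weight zeta * weight z) ^+ m * g p) * (K' * (weight zeta * weight z) ^+ m' * g' p).
  by ring.
by rewrite ler_pM ?h ?h'.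
Qed.

Lemma poly_boundedN g (f : fld) : poly_bounded g f ->
  poly_bounded g (fun p zeta z => - f p zeta z).
Proof.
move=> [mf g0 [K [m [K0 h]]]]; split => //.
  by move=> p; exact: measurableT_comp.
by exists K, m; split => // p zeta z ap; rewrite normrN h.
Qed.

Lemma poly_boundedB g (f f' : fld) : poly_bounded g f -> poly_bounded g f' ->
  poly_bounded g (fun p zeta z => f p zeta z - f' p zeta z).
Proof. by move=> h h'; apply: poly_boundedD => //; exact: poly_boundedN. Qed.

Lemma poly_bounded_le (g : hpar -> R) (f f' : fld) :
  (forall p, measurable_fun setT (fun u : (R * R) * (R * R) => f p u.1 u.2)) ->
  (forall p zeta z, adm p -> `|f p zeta z| <= `|f' p zeta z|) ->
  poly_bounded g f' -> poly_bounded g f.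
Proof.
move=> mf ff' [_ g0 [K [m [K0 h]]]]; split => //.
by exists K, m; split => // p zeta z ap; apply: le_trans (h _ _ _ ap); exact: ff'.
Qed.

Lemma poly_bounded_weaken (g g' : hpar -> R) (f : fld) (C : R) :
  (forall p, adm p -> 0 <= g' p) -> (forall p, adm p -> g p <= C * g' p) ->
  0 <= C -> poly_bounded g f -> poly_bounded g' f.
Proof.
move=> g'0 gg' C0 [mf g0 [K [m [K0 h]]]]; split => //.
exists (K * C), m; split; first exact: mulr_ge0.
move=> p zeta z ap; apply: le_trans (h _ _ _ ap) _.
rewrite (mulrAC K C) -[leRHS]mulrA ler_wpM2l ?gg'//.
by rewrite mulr_ge0// exprn_ge0// mulr_ge0 ?weight_ge0.
Qed.

Lemma poly_bounded_mul_mono a b a' b' (f f' : fld) :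
  poly_bounded (mono a b) f -> poly_bounded (mono a' b') f' ->
  poly_bounded (mono (a + a') (b + b')) (fun p zeta z => f p zeta z * f' p zeta z).
Proof.
move=> h h'; have := poly_boundedM h h'.
rewrite (_ : (fun p => _ * _) = mono (a + a') (b + b'))//.
by apply/funext => p; rewrite /mono !exprD; ring.
Qed.

Lemma poly_bounded_lower a a' b (f : fld) : 0 <= T -> (a' <= a)%N ->
  poly_bounded (mono a b) f -> poly_bounded (mono a' b) f.
Proof.
move=> T0 aa'; apply: (@poly_bounded_weaken _ _ _ ((1 + T) ^+ (a - a'))).
- by move=> p; exact: mono_ge0.
- move=> p [k0 kT]; rewrite /mono mulrA ler_wpM2r ?exprn_ge0 ?step_h2_ge0//.
  rewrite -{1}(subnK aa') exprD ler_wpM2r ?exprn_ge0 ?(ltW k0)//.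
  rewrite lerXn2r ?nnegrE ?addr_ge0 ?(ltW k0)//.
  (* k^(1/2) <= 1 + T, because 2 k^(1/2) <= 1 + k. *)
  by have := sqr_ge0 (p.2 - 1); nra.
- by rewrite exprn_ge0 ?addr_ge0.
Qed.

Let by_cst (f : fld) (C : R) : 0 <= C ->
  (forall p, measurable_fun setT (fun u : (R * R) * (R * R) => f p u.1 u.2)) ->
  (forall p zeta z, adm p -> `|f p zeta z| <= C * (weight zeta * weight z)) ->
  poly_bounded (mono 0 0) f.
Proof.
move=> C0 mf h; split => //; first by move=> p; exact: mono_ge0.
exists C, 1%N; split => // p zeta z ap.
by rewrite /mono !expr0 !mulr1 expr1 h.
Qed.

Lemma poly_bounded_cst (r : R) : poly_bounded (mono 0 0) (fun _ _ _ => r).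
Proof.
apply: (by_cst (normr_ge0 r)) => // p zeta z _.
by rewrite ler_peMr// weight2_ge1.
Qed.

Lemma poly_bounded0 (g : hpar -> R) : (forall p, adm p -> 0 <= g p) ->
  poly_bounded g (fun _ _ _ => 0).
Proof.
move=> g0; split => //; exists 0, 0%N; split => // p zeta z _.
by rewrite normr0 !mul0r.
Qed.

Lemma poly_bounded_bounded (f : fld) :
  (forall p, measurable_fun setT (fun u : (R * R) * (R * R) => f p u.1 u.2)) ->
  (forall p zeta z, adm p -> `|f p zeta z| <= 1) -> poly_bounded (mono 0 0) f.
Proof.
move=> mf h; apply: (by_cst ler01) => // p zeta z ap.
by rewrite mul1r (le_trans (h _ _ _ ap))// weight2_ge1.
Qed.

Let le_weight1 (u v : R * R) : `|u.1| <= 1 * (weight u * weight v).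
Proof.
rewrite mul1r; apply: (@le_trans _ _ (weight u)); last first.
  by rewrite ler_peMr ?weight_ge0 ?weight_ge1.
rewrite /weight; have := sqr_ge0 u.2; have := real_normK (num_real u.1).
by have := sqr_ge0 (`|u.1| - 1); nra.
Qed.

Let le_weight2 (u v : R * R) : `|u.2| <= 1 * (weight u * weight v).
Proof.
have := le_weight1 (u.2, u.1) v; rewrite /weight/=.
by rewrite (_ : 1 + u.2 ^+ 2 + u.1 ^+ 2 = 1 + u.1 ^+ 2 + u.2 ^+ 2)//; ring.
Qed.

Let m11 : measurable_fun setT (fun u : (R * R) * (R * R) => u.1.1).
Proof. exact: measurableT_comp measurable_fst measurable_fst. Qed.
Let m12 : measurable_fun setT (fun u : (R * R) * (R * R) => u.1.2).
Proof. exact: measurableT_comp measurable_snd measurable_fst. Qed.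
Let m21 : measurable_fun setT (fun u : (R * R) * (R * R) => u.2.1).
Proof. exact: measurableT_comp measurable_fst measurable_snd. Qed.
Let m22 : measurable_fun setT (fun u : (R * R) * (R * R) => u.2.2).
Proof. exact: measurableT_comp measurable_snd measurable_snd. Qed.

Lemma poly_bounded_zeta1 : poly_bounded (mono 0 0) (fun _ zeta _ => zeta.1).
Proof. by apply: (by_cst ler01) => // p zeta z _; exact: le_weight1. Qed.
Lemma poly_bounded_zeta2 : poly_bounded (mono 0 0) (fun _ zeta _ => zeta.2).
Proof. by apply: (by_cst ler01) => // p zeta z _; exact: le_weight2. Qed.
Lemma poly_bounded_z1 : poly_bounded (mono 0 0) (fun _ _ z => z.1).
Proof. by apply: (by_cst ler01) => // p zeta z _; rewrite (mulrC (weight zeta)); exact: le_weight1. Qed.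
Lemma poly_bounded_z2 : poly_bounded (mono 0 0) (fun _ _ z => z.2).
Proof. by apply: (by_cst ler01) => // p zeta z _; rewrite (mulrC (weight zeta)); exact: le_weight2. Qed.

Let by_le1 (a b : nat) (f : hpar -> R) : (forall p, adm p -> `|f p| <= mono a b p) ->
  poly_bounded (mono a b) (fun p _ _ => f p).
Proof.
move=> h; split => //; first by move=> p; exact: mono_ge0.
exists 1, 1%N; split => // p zeta z ap; rewrite expr1 mul1r.
by apply: le_trans (h p ap) _; rewrite ler_peMl ?mono_ge0 ?weight2_ge1.
Qed.

Lemma poly_bounded_kap : poly_bounded (mono 1 0) (fun p _ _ => p.2).
Proof. by apply: by_le1 => p [k0 _]; rewrite /mono expr1 expr0 mulr1 ger0_norm// ltW. Qed.
Lemma poly_bounded_hx2 : poly_bounded (mono 0 1) (fun p _ _ => p.1.1 ^+ 2).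
Proof.
apply: by_le1 => p _; rewrite /mono expr0 expr1 mul1r ger0_norm ?sqr_ge0//.
by rewrite lerDl sqr_ge0.
Qed.
Lemma poly_bounded_hy2 : poly_bounded (mono 0 1) (fun p _ _ => p.1.2 ^+ 2).
Proof.
apply: by_le1 => p _; rewrite /mono expr0 expr1 mul1r ger0_norm ?sqr_ge0//.
by rewrite lerDr sqr_ge0.
Qed.

Definition cpoly_bounded (g : hpar -> R) (f : cfld) : Prop :=
  poly_bounded g (fun p zeta z => (f p zeta z).1) /\
  poly_bounded g (fun p zeta z => (f p zeta z).2).

Lemma cpoly_bounded_ext g (f f' : cfld) : (forall p zeta z, f p zeta z = f' p zeta z) ->
  cpoly_bounded g f -> cpoly_bounded g f'.
Proof.
move=> e; suff -> : f = f' by [].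
by do 3 (apply/funext => ?); exact: e.
Qed.

Lemma cpoly_boundedD g (f f' : cfld) : cpoly_bounded g f -> cpoly_bounded g f' ->
  cpoly_bounded g (fun p zeta z => cadd (f p zeta z) (f' p zeta z)).
Proof. by move=> [? ?] [? ?]; split; exact: poly_boundedD. Qed.

Lemma cpoly_boundedB g (f f' : cfld) : cpoly_bounded g f -> cpoly_bounded g f' ->
  cpoly_bounded g (fun p zeta z => csub (f p zeta z) (f' p zeta z)).
Proof. by move=> [? ?] [? ?]; split; exact: poly_boundedB. Qed.

Lemma cpoly_bounded_mul_mono a b a' b' (f f' : cfld) :
  cpoly_bounded (mono a b) f -> cpoly_bounded (mono a' b') f' ->
  cpoly_bounded (mono (a + a') (b + b')) (fun p zeta z => cmul (f p zeta z) (f' p zeta z)).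
Proof.
move=> [? ?] [? ?]; split.
  by apply: poly_boundedB; exact: poly_bounded_mul_mono.
by apply: poly_boundedD; exact: poly_bounded_mul_mono.
Qed.

Lemma cpoly_boundedM g g' (f f' : cfld) :
  cpoly_bounded g f -> cpoly_bounded g' f' ->
  cpoly_bounded (fun p => g p * g' p) (fun p zeta z => cmul (f p zeta z) (f' p zeta z)).
Proof.
move=> [? ?] [? ?]; split.
  by apply: poly_boundedB; exact: poly_boundedM.
by apply: poly_boundedD; exact: poly_boundedM.
Qed.

Lemma cpoly_bounded_conj g (f : cfld) : cpoly_bounded g f ->
  cpoly_bounded g (fun p zeta z => cconj (f p zeta z)).
Proof. by move=> [? ?]; split => //; exact: poly_boundedN. Qed.

End growth.

(** * Expectations of fields of polynomial growth *)

Section mean_growth.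
Context d (Omega : measurableType d) (R : realType) (P : probability Omega R).
Variables (T rho : R).
Hypothesis rho1 : -1 <= rho <= 1.

Local Notation hpar := (R * R * R)%type.
Local Notation fld := (hpar -> R * R -> R * R -> R).
Local Notation cfld := (hpar -> R * R -> R * R -> R * R).

Definition gauss_pair (z : Omega -> R * R) : Prop :=
  measurable_fun setT z /\ forall (a b : R) (A : set R), measurable A ->
    P ((fun w => a * (z w).1 + b * (z w).2) @^-1` A) =
    gaussian_law 0 (Num.sqrt (a ^+ 2 + 2 * rho * a * b + b ^+ 2)) A.

Let m1 z : gauss_pair z -> measurable_fun setT (fun w => (z w).1).
Proof. by move=> [mz _]; exact: measurableT_comp measurable_fst mz. Qed.
Let m2 z : gauss_pair z -> measurable_fun setT (fun w => (z w).2).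
Proof. by move=> [mz _]; exact: measurableT_comp measurable_snd mz. Qed.

Let integrable_weight z m : gauss_pair z ->
  P.-integrable setT (EFin \o (fun w => weight (z w) ^+ m)).
Proof. by move=> gz; exact: integrable_growth_base (m1 gz) (m2 gz) rho1 gz.2 m. Qed.

Let weight_moment m : exists2 K : R, 0 <= K & forall z, gauss_pair z ->
  \int[P]_w (weight (z w) ^+ m) <= K.
Proof.
(* The constant must be common to all [z]. The moments depend on the law only, so one reference pair
   [z0] fixes them; if there is no such pair, nothing is claimed. *)
have [[z0 gz0]|no] := pselect (exists z, gauss_pair z); last first.
  by exists 0 => // z gz; exfalso; apply: no; exists z.
pose M1 (z : Omega -> R * R) := \int[P]_w ((1 * (z w).1 + 0 * (z w).2) ^+ m.*2).
pose M2 (z : Omega -> R * R) := \int[P]_w ((0 * (z w).1 + 1 * (z w).2) ^+ m.*2).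
have ge (x : R) : 0 <= x ^+ m.*2 by rewrite exprn_even_ge0// odd_double.
have Me (a b : R) z : gauss_pair z ->
    \int[P]_w ((a * (z w).1 + b * (z w).2) ^+ m.*2) =
    \int[P]_w ((a * (z0 w).1 + b * (z0 w).2) ^+ m.*2).
  move=> gz; rewrite /Rintegral; congr fine.
  rewrite (ge0_integral_gaussian (m1 gz) (m2 gz) rho1 gz.2 a b (exprn_measurable m.*2) ge).
  by rewrite (ge0_integral_gaussian (m1 gz0) (m2 gz0) rho1 gz0.2 a b (exprn_measurable m.*2) ge).
have ie (a b : R) z : gauss_pair z ->
    P.-integrable setT (EFin \o (fun w => (a * (z w).1 + b * (z w).2) ^+ m.*2)).
  move=> gz; have mm := exprn_measurable m.*2.
  apply: (integrable_poly_growth (m1 gz) (m2 gz) rho1 gz.2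
    (g := fun x y => (a * x + b * y) ^+ m.*2)).
    apply: measurable_funX; apply: measurable_funD; apply: measurable_funM => //.
  exists ((2 * (a ^+ 2 + b ^+ 2)) ^+ m), m => x y.
  rewrite ger0_norm// -mul2n exprM -exprMn lerXn2r ?nnegrE ?sqr_ge0//.
    by rewrite !mulr_ge0 ?addr_ge0 ?sqr_ge0.
  have := sqr_ge0 (a * x - b * y); have := sqr_ge0 (a * y); have := sqr_ge0 (b * x).
  by have := sqr_ge0 a; have := sqr_ge0 b; have := sqr_ge0 (b * y); have := sqr_ge0 (a * x); nra.
exists (3 ^+ m * (1 + M1 z0 + M2 z0)) => [|z gz].
  by rewrite mulr_ge0 ?exprn_ge0// !addr_ge0// Rintegral_ge0.
rewrite /M1 /M2 -(Me 1 0 _ gz) -(Me 0 1 _ gz).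
have e1 : \int[P]_w (1 : R) = 1 by rewrite /Rintegral integral_cst//= mul1e probability_setT.
have i1 : P.-integrable setT (EFin \o (fun=> 1 : R)) by exact: finite_measure_integrable_cst.
pose F1 w := (1 * (z w).1 + 0 * (z w).2) ^+ m.*2.
pose F2 w := (0 * (z w).1 + 1 * (z w).2) ^+ m.*2.
have i2 := integrable_EFinD i1 (ie 1 0 z gz).
have i3 := integrable_EFinD i2 (ie 0 1 z gz).
have -> : 3 ^+ m * (1 + \int[P]_w F1 w + \int[P]_w F2 w) =
    \int[P]_w (3 ^+ m * (1 + F1 w + F2 w)).
  rewrite RintegralZl// (RintegralD _ i2 (ie 0 1 z gz))//.
  by rewrite (RintegralD _ i1 (ie 1 0 z gz))// e1.
apply: le_Rintegral => //.
- exact: integrable_weight.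
- exact: integrable_EFinZ i3.
move=> w _; rewrite /F1 /F2 !mul0r !mul1r addr0 add0r -mul2n !exprM /weight.
set a := _.1 ^+ 2; set b := _.2 ^+ 2.
have a0 : 0 <= a by exact: sqr_ge0.
have b0 : 0 <= b by exact: sqr_ge0.
have am := exprn_ge0 m a0; have bm := exprn_ge0 m b0.
pose c := Num.max 1 (Num.max a b).
have c1 : 1 <= c by rewrite le_max lexx.
have ca : a <= c by rewrite !le_max lexx orbT.
have cb : b <= c by rewrite !le_max lexx !orbT.
apply: (@le_trans _ _ ((3 * c) ^+ m)).
  by rewrite lerXn2r ?nnegrE ?addr_ge0//; lra.
rewrite exprMn ler_wpM2l ?exprn_ge0// /c !maxEle.
by case: (a <= b); [case: (1 <= b)|case: (1 <= a)]; rewrite ?expr1n; lra.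
Qed.

Lemma integrable_poly_bounded g (f : fld) z p zeta : gauss_pair z -> adm T p ->
  poly_bounded T g f -> P.-integrable setT (EFin \o (fun w => f p zeta (z w))).
Proof.
move=> gz ap [mf g0 [K [m [K0 h]]]].
apply: (@le_integrable_EFin _ _ _ _ _
  (fun w => (K * weight zeta ^+ m * g p) * weight (z w) ^+ m)).
- have mp : measurable_fun setT (fun w => (zeta, z w)) by apply: measurable_fun_pair => //; exact: gz.1.
  exact: measurableT_comp (mf p) mp.
- by move=> w; apply: le_trans (h _ _ _ ap) _; rewrite exprMn; lra.
- by apply: integrable_EFinZ; exact: integrable_weight.
Qed.

Lemma poly_bounded_mean g (f : fld) : poly_bounded T g f ->
  exists (K : R) (m : nat), 0 <= K /\ forall z p zeta, gauss_pair z -> adm T p ->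
    `|\int[P]_w f p zeta (z w)| <= K * weight zeta ^+ m * g p.
Proof.
move=> bf; have := bf => -[mf g0 [K [m [K0 h]]]].
have [C C0 hC] := weight_moment m.
exists (K * C), m; split; first exact: mulr_ge0.
move=> z p zeta gz ap; have i := integrable_poly_bounded zeta gz ap bf.
apply: le_trans (le_normr_Rintegral _ i) _ => //.
apply: (@le_trans _ _ ((K * weight zeta ^+ m * g p) * \int[P]_w (weight (z w) ^+ m))).
  rewrite -RintegralZl//; last exact: integrable_weight.
  apply: le_Rintegral => //.
  - exact: integrable_norm.
  - by apply: integrable_EFinZ; exact: integrable_weight.
  - by move=> w _; apply: le_trans (h _ _ _ ap) _; rewrite exprMn; lra.
rewrite (_ : K * C * _ * _ = (K * weight zeta ^+ m * g p) * C); last by ring.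
by rewrite ler_wpM2l ?hC// !mulr_ge0 ?exprn_ge0 ?weight_ge0 ?g0.
Qed.

(** The growth bound makes the field integrable, so that vanishing means are stable under sums. *)
Definition zero_mean (f : fld) : Prop := (exists g, poly_bounded T g f) /\
  forall z p zeta, gauss_pair z -> adm T p -> \int[P]_w f p zeta (z w) = 0.

Lemma zero_mean_ext (f f' : fld) : (forall p zeta z, f p zeta z = f' p zeta z) ->
  zero_mean f -> zero_mean f'.
Proof.
move=> e; suff -> : f = f' by [].
by do 3 (apply/funext => ?); exact: e.
Qed.

Lemma zero_meanD (f f' : fld) : zero_mean f -> zero_mean f' ->
  zero_mean (fun p zeta z => f p zeta z + f' p zeta z).
Proof.
move=> [[g b] h] [[g' b'] h']; split.
  exists (fun p => g p + g' p); have [_ g0 _] := b; have [_ g'0 _] := b'.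
  apply: poly_boundedD; [move: b|move: b'];
    by apply: (poly_bounded_weaken (C := 1)) => // p ap; rewrite ?addr_ge0 ?g0 ?g'0// mul1r
      ?lerDl ?lerDr ?g0 ?g'0.
move=> z p zeta gz ap; rewrite RintegralD//.
- by rewrite h// h'// addr0.
- exact: integrable_poly_bounded gz ap b.
- exact: integrable_poly_bounded gz ap b'.
Qed.

Lemma zero_meanZ (a : hpar -> R * R -> R) (f : fld) :
  poly_bounded T (mono 0 0) (fun p zeta _ => a p zeta) -> zero_mean f ->
  zero_mean (fun p zeta z => a p zeta * f p zeta z).
Proof.
move=> ba [[g b] h]; split; first by exists (fun p => mono 0 0 p * g p); exact: poly_boundedM.
move=> z p zeta gz ap; rewrite RintegralZl//; first by rewrite h// mulr0.
exact: integrable_poly_bounded gz ap b.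
Qed.

Lemma zero_mean_odd (h : hpar -> R * R -> R -> R) (u v : hpar -> R * R -> R) g :
  (forall p zeta, measurable_fun setT (h p zeta)) ->
  (forall p zeta x, h p zeta (- x) = - h p zeta x) ->
  poly_bounded T g (fun p zeta z => h p zeta (u p zeta * z.1 + v p zeta * z.2)) ->
  zero_mean (fun p zeta z => h p zeta (u p zeta * z.1 + v p zeta * z.2)).
Proof.
move=> mh ho b; split; first by exists g.
move=> z p zeta gz ap.
by apply: (gaussian_odd (m1 gz) (m2 gz) gz.2 (mh p zeta) (ho p zeta));
  exact: integrable_poly_bounded gz ap b.
Qed.

(** A field whose mean is O(g) although it may itself be much larger: the excess averages out. *)
Definition mean_bounded (g : hpar -> R) (f : fld) : Prop := exists f1 f2,
  [/\ poly_bounded T g f1, zero_mean f2 &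
      forall p zeta z, f p zeta z = f1 p zeta z + f2 p zeta z].

Lemma mean_bounded_ext g (f f' : fld) : (forall p zeta z, f p zeta z = f' p zeta z) ->
  mean_bounded g f -> mean_bounded g f'.
Proof.
move=> e; suff -> : f = f' by [].
by do 3 (apply/funext => ?); exact: e.
Qed.

Lemma zero_mean0 : zero_mean (fun _ _ _ => 0).
Proof.
split; first by exists (mono 0 0); exact: poly_bounded_cst.
by move=> z p zeta _ _; rewrite /Rintegral integral0.
Qed.

Lemma poly_bounded_mean_bounded g f : poly_bounded T g f -> mean_bounded g f.
Proof.
move=> h; exists f, (fun _ _ _ => 0); split => //; first exact: zero_mean0.
by move=> *; rewrite addr0.
Qed.

Lemma zero_mean_mean_bounded g f : (forall p, adm T p -> 0 <= g p) ->
  zero_mean f -> mean_bounded g f.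
Proof.
move=> g0 h; exists (fun _ _ _ => 0), f; split => //; last by move=> *; rewrite add0r.
split=> //; exists 0, 0%N; split => // p zeta z ap.
by rewrite normr0 !mul0r.
Qed.

Lemma mean_boundedD g (f f' : fld) : mean_bounded g f -> mean_bounded g f' ->
  mean_bounded g (fun p zeta z => f p zeta z + f' p zeta z).
Proof.
move=> [f1 [f2 [b zm e]]] [f1' [f2' [b' zm' e']]].
exists (fun p zeta z => f1 p zeta z + f1' p zeta z), (fun p zeta z => f2 p zeta z + f2' p zeta z).
split; [exact: poly_boundedD|exact: zero_meanD|].
by move=> *; rewrite e e'; ring.
Qed.

Lemma mean_boundedZ (g : hpar -> R) (a : hpar -> R * R -> R) (f : fld) :
  poly_bounded T (mono 0 0) (fun p zeta _ => a p zeta) -> mean_bounded g f ->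
  mean_bounded g (fun p zeta z => a p zeta * f p zeta z).
Proof.
move=> ba [f1 [f2 [b zm e]]].
exists (fun p zeta z => a p zeta * f1 p zeta z), (fun p zeta z => a p zeta * f2 p zeta z).
split; last by move=> *; rewrite e mulrDr.
  have := poly_boundedM ba b; apply: (poly_bounded_weaken (C := 1)) => //.
  - by have [] := b.
  - by move=> p _; rewrite /mono !expr0 !mul1r.
exact: zero_meanZ.
Qed.

Lemma mean_boundedP g (f : fld) : mean_bounded g f ->
  exists (K : R) (m : nat), 0 <= K /\ forall z p zeta, gauss_pair z -> adm T p ->
    `|\int[P]_w f p zeta (z w)| <= K * weight zeta ^+ m * g p.
Proof.
move=> [f1 [f2 [b [[g2 b2] zm] e]]]; have [K [m [K0 h]]] := poly_bounded_mean b.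
exists K, m; split => // z p zeta gz ap.
under eq_Rintegral do rewrite e.
rewrite RintegralD//; first by rewrite zm// addr0 h.
- exact: integrable_poly_bounded gz ap b.
- exact: integrable_poly_bounded gz ap b2.
Qed.

End mean_growth.

(** * Taylor bounds for the difference symbols *)

Section difference_symbols.
Context {R : realType}.
Implicit Types h x : R.

(* The symbols of the difference quotients D_x/(2ih) and -D_xx/h^2; [h = 0]
   stands for the derivatives. *)
Definition sinq h x : R := if h == 0 then x else sin (h * x) / h.
Definition cosq h x : R := if h == 0 then x ^+ 2 else 2 * (1 - cos (h * x)) / h ^+ 2.

Lemma measurable_sinq h : measurable_fun setT (sinq h).
Proof.
rewrite /sinq; have [_|_] := eqVneq h 0; first exact: measurable_id.
by apply: measurable_funM => //; exact: measurable_sinM.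
Qed.

Lemma measurable_cosq h : measurable_fun setT (cosq h).
Proof.
rewrite /cosq; have [_|_] := eqVneq h 0; first exact: exprn_measurable.
apply: measurable_funM => //; apply: measurable_funM => //.
by apply: measurable_funB => //; exact: measurable_cosM.
Qed.

Lemma norm_sinq_le h x : `|sinq h x| <= `|x|.
Proof.
rewrite /sinq; have [_//|h0] := eqVneq h 0.
rewrite normrM normfV ler_pdivrMr ?normr_gt0//.
by rewrite -normrM mulrC norm_sin_le.
Qed.

(** The right-hand side keeps an absolute value because [poly_bounded_le] compares absolute values;
    the same holds for the Taylor bounds below. *)
Lemma norm_sinqB_le h x : `|sinq h x - x| <= `|h ^+ 2 * (x ^+ 3 / 6)|.
Proof.
rewrite /sinq; have [_|h0] := eqVneq h 0; first by rewrite subrr normr0.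
have -> : sin (h * x) / h - x = (sin (h * x) - h * x) / h by field.
rewrite normrM normfV ler_pdivrMr ?normr_gt0//.
apply: le_trans (norm_sinB_le _) _.
rewrite -normrM (_ : h ^+ 2 * (x ^+ 3 / 6) * h = (h * x) ^+ 3 / 6); last by field.
by rewrite (normrM (_ ^+ 3)) normrX (@ger0_norm _ (6^-1)).
Qed.

Lemma norm_sinq_taylor h x :
  `|sinq h x - x + h ^+ 2 * x ^+ 3 / 6| <= `|(h ^+ 2 * h ^+ 2) * (x ^+ 5 / 120)|.
Proof.
rewrite /sinq; have [->|h0] := eqVneq h 0.
  by rewrite subrr expr0n/= !mul0r addr0 normr0.
have -> : sin (h * x) / h - x + h ^+ 2 * x ^+ 3 / 6 =
  (sin (h * x) - h * x + (h * x) ^+ 3 / 6) / h by field.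
rewrite normrM normfV ler_pdivrMr ?normr_gt0//.
apply: le_trans (norm_sin_taylor _) _.
rewrite -normrM (_ : h ^+ 2 * h ^+ 2 * (x ^+ 5 / 120) * h = (h * x) ^+ 5 / 120); last by field.
by rewrite (normrM (_ ^+ 5)) normrX (@ger0_norm _ (120^-1)).
Qed.

Let sqr_gt0' h : h != 0 -> 0 < h ^+ 2.
Proof. by move=> h0; rewrite exprn_even_gt0. Qed.

Lemma cosq_ge0 h x : 0 <= cosq h x.
Proof.
rewrite /cosq; have [_|h0] := eqVneq h 0; first exact: sqr_ge0.
by rewrite divr_ge0 ?sqr_ge0// mulr_ge0//; have /andP[] := cosB1_bounds (h * x).
Qed.

Lemma cosq_le h x : cosq h x <= x ^+ 2.
Proof.
rewrite /cosq; have [_//|h0] := eqVneq h 0.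
rewrite ler_pdivrMr ?sqr_gt0'// -exprMn (mulrC x).
by have /andP[_] := cosB1_bounds (h * x); lra.
Qed.

Lemma cosq_taylor2 h x : `|cosq h x - x ^+ 2| <= `|h ^+ 2 * (x ^+ 4 / 12)|.
Proof.
rewrite /cosq; have [_|h0] := eqVneq h 0; first by rewrite subrr normr0.
have -> : 2 * (1 - cos (h * x)) / h ^+ 2 - x ^+ 2 =
  - (2 * (cos (h * x) - 1 + (h * x) ^+ 2 / 2)) / h ^+ 2 by field.
rewrite normrM normfV (ger0_norm (sqr_ge0 h)) ler_pdivrMr ?sqr_gt0'//.
rewrite normrN normrM ger0_norm//.
have := norm_cos_taylor2 (h * x); rewrite (ger0_norm (_ : 0 <= h ^+ 2 * (x ^+ 4 / 12))).
  have -> : (h * x) ^+ 4 / 24 = (h ^+ 2 * (x ^+ 4 / 12) * h ^+ 2) / 2 by field.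
  by lra.
by rewrite mulr_ge0 ?sqr_ge0// divr_ge0// exprn_even_ge0.
Qed.

Lemma cosq_taylor4 h x :
  `|cosq h x - x ^+ 2 + h ^+ 2 * x ^+ 4 / 12| <= `|(h ^+ 2 * h ^+ 2) * (x ^+ 6 / 360)|.
Proof.
rewrite /cosq; have [->|h0] := eqVneq h 0.
  by rewrite subrr expr0n/= !mul0r addr0 normr0.
have -> : 2 * (1 - cos (h * x)) / h ^+ 2 - x ^+ 2 + h ^+ 2 * x ^+ 4 / 12 =
  - (2 * (cos (h * x) - 1 + (h * x) ^+ 2 / 2 - (h * x) ^+ 4 / 24)) / h ^+ 2 by field.
rewrite normrM normfV (ger0_norm (sqr_ge0 h)) ler_pdivrMr ?sqr_gt0'//.
rewrite normrN normrM ger0_norm//.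
have := norm_cos_taylor4 (h * x); rewrite (ger0_norm (_ : 0 <= h ^+ 2 * h ^+ 2 * (x ^+ 6 / 360))).
  have -> : (h * x) ^+ 6 / 720 = (h ^+ 2 * h ^+ 2 * (x ^+ 6 / 360) * h ^+ 2) / 2 by field.
  by lra.
apply: mulr_ge0; first by apply: mulr_ge0; exact: sqr_ge0.
by apply: mulr_ge0; [exact: exprn_even_ge0|rewrite invr_ge0; exact: ler0n].
Qed.

(** sin^2 = (1 - cos)(1 + cos) <= 2 (1 - cos). Through this, the central differences of [num] are
    controlled by the second differences of [den]. *)
Lemma sinq2_le_cosq h x : sinq h x ^+ 2 <= cosq h x.
Proof.
rewrite /sinq /cosq; have [_//|h0] := eqVneq h 0.
rewrite expr_div_n ler_pM2r ?invr_gt0 ?sqr_gt0'//.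
have := cos2Dsin2 (h * x); have /andP[c1 _] := cosB1_bounds (h * x).
by have := cos_geN1 (h * x); nra.
Qed.

Lemma cosq_ge h x : `|h * x| <= pi -> x ^+ 2 / 9 <= cosq h x.
Proof.
rewrite /cosq; have [_ _|h0 hx] := eqVneq h 0; first by have := sqr_ge0 x; lra.
rewrite ler_pdivlMr ?sqr_gt0'//; have := cosB1_ge hx.
by rewrite exprMn; lra.
Qed.

End difference_symbols.

(** * One-step errors in time and in space *)

Section one_step.
Context {R : realType}.
Variables (c : spde_data R) (T : R).
Hypothesis T0 : 0 <= T.
Hypothesis rho_x_range : 0 <= rho_x c < 1.
Hypothesis rho_y_range : 0 <= rho_y c < 1.

Local Notation hpar := (R * R * R)%type.
Local Notation ax := (Num.sqrt (rho_x c)).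
Local Notation ay := (Num.sqrt (rho_y c)).
Local Notation pb a b := (poly_bounded T (mono a b)).
Local Notation cpb a b := (cpoly_bounded T (mono a b)).
Implicit Types (p : hpar) (zeta z : R * R).

(* [p] is (h_x, h_y, sqrt k), [zeta] the frequency and [z] the pair of
   normalised increments of one time step.  That step multiplies the Fourier
   transform of the scheme by [amp] and that of the solution by [exact]; [flat]
   sets h_x = h_y = 0. *)
Definition flat p : hpar := (0, 0, p.2).
Definition sX p zeta := sinq p.1.1 zeta.1.
Definition sY p zeta := sinq p.1.2 zeta.2.
Definition mX p zeta := cosq p.1.1 zeta.1.
Definition mY p zeta := cosq p.1.2 zeta.2.
Definition incr p zeta z := p.2 * (ax * sX p zeta * z.1 + ay * sY p zeta * z.2).
Definition quad p zeta := p.2 ^+ 2 * (rho_x c * sX p zeta ^+ 2 + rho_y c * sY p zeta ^+ 2).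
Definition num p zeta z : R * R :=
  (1 + quad p zeta / 2 - incr p zeta z ^+ 2 / 2, - incr p zeta z).
Definition den p zeta : R * R :=
  (1 + p.2 ^+ 2 * (mX p zeta + mY p zeta) / 2,
   p.2 ^+ 2 * (mu_x c * sX p zeta + mu_y c * sY p zeta)).
Definition amp p zeta z := cmul (cinv (den p zeta)) (num p zeta z).

Definition drift p zeta := p.2 ^+ 2 * (mu_x c * zeta.1 + mu_y c * zeta.2).
Definition decay p zeta :=
  p.2 ^+ 2 * ((1 - rho_x c) * zeta.1 ^+ 2 + (1 - rho_y c) * zeta.2 ^+ 2) / 2.
Definition exact_drift p zeta : R * R :=
  (expR (- decay p zeta) * cos (drift p zeta), - (expR (- decay p zeta) * sin (drift p zeta))).
Definition rot (t : R) : R * R := (cos t, - sin t).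
Definition exact p zeta z := cmul (exact_drift p zeta) (rot (incr (flat p) zeta z)).

(* Leading order in h^2 of the symbols, and of the relative one-step error. *)
Definition s1X p zeta := - (p.1.1 ^+ 2 * zeta.1 ^+ 3 / 6).
Definition s1Y p zeta := - (p.1.2 ^+ 2 * zeta.2 ^+ 3 / 6).
Definition m1X p zeta := - (p.1.1 ^+ 2 * zeta.1 ^+ 4 / 12).
Definition m1Y p zeta := - (p.1.2 ^+ 2 * zeta.2 ^+ 4 / 12).
Definition incr1 p zeta z := p.2 * (ax * s1X p zeta * z.1 + ay * s1Y p zeta * z.2).
Definition alpha p zeta : R * R :=
  (- (m1X p zeta + m1Y p zeta) / 2 + rho_x c * zeta.1 * s1X p zeta
     + rho_y c * zeta.2 * s1Y p zeta,
   - (mu_x c * s1X p zeta + mu_y c * s1Y p zeta)).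
Definition ystep p zeta z : R * R :=
  (p.2 ^+ 2 * (alpha p zeta).1, p.2 ^+ 2 * (alpha p zeta).2 - incr1 p zeta z).

Definition time_err p zeta z := csub (amp (flat p) zeta z) (exact p zeta z).
Definition space_err p zeta z := csub (amp p zeta z) (amp (flat p) zeta z).
Definition full_err p zeta z := csub (amp p zeta z) (exact p zeta z).
(** What is left of [space_err] after the h^2 correction [ystep], which is taken relative to [exact]
    because products of [exact] have a closed form. *)
Definition space_err2 p zeta z :=
  csub (space_err p zeta z) (cmul (ystep p zeta z) (exact p zeta z)).

Let ax2 : ax ^+ 2 = rho_x c.
Proof. by rewrite sqr_sqrtr//; case/andP: rho_x_range. Qed.
Let ay2 : ay ^+ 2 = rho_y c.
Proof. by rewrite sqr_sqrtr//; case/andP: rho_y_range. Qed.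

Let flat_sX p zeta : sX (flat p) zeta = zeta.1.
Proof. by rewrite /sX /sinq eqxx. Qed.
Let flat_sY p zeta : sY (flat p) zeta = zeta.2.
Proof. by rewrite /sY /sinq eqxx. Qed.
Let flat_mX p zeta : mX (flat p) zeta = zeta.1 ^+ 2.
Proof. by rewrite /mX /cosq eqxx. Qed.
Let flat_mY p zeta : mY (flat p) zeta = zeta.2 ^+ 2.
Proof. by rewrite /mY /cosq eqxx. Qed.

Let bC := @poly_bounded_cst R T.
Let bk := @poly_bounded_kap R T.
Let bx := @poly_bounded_zeta1 R T.
Let by_ := @poly_bounded_zeta2 R T.
Let bz1 := @poly_bounded_z1 R T.
Let bz2 := @poly_bounded_z2 R T.
Let bhx := @poly_bounded_hx2 R T.
Let bhy := @poly_bounded_hy2 R T.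
Let bxn n : pb 0 0 (fun _ zeta _ => zeta.1 ^+ n).
Proof.
elim: n => [|n IH]; first exact: poly_bounded_ext (bC 1).
by have := poly_bounded_mul_mono bx IH; apply: poly_bounded_ext => *; rewrite exprS.
Qed.
Let byn n : pb 0 0 (fun _ zeta _ => zeta.2 ^+ n).
Proof.
elim: n => [|n IH]; first exact: poly_bounded_ext (bC 1).
by have := poly_bounded_mul_mono by_ IH; apply: poly_bounded_ext => *; rewrite exprS.
Qed.
Let bk2 : pb 2 0 (fun p _ _ => p.2 ^+ 2).
Proof. by have := poly_bounded_mul_mono bk bk; apply: poly_bounded_ext => *; rewrite expr2. Qed.

Let mx1 : measurable_fun setT (fun u : (R * R) * (R * R) => u.1.1).
Proof. exact: measurableT_comp measurable_fst measurable_fst. Qed.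
Let mx2 : measurable_fun setT (fun u : (R * R) * (R * R) => u.1.2).
Proof. exact: measurableT_comp measurable_snd measurable_fst. Qed.
Let msX p : measurable_fun setT (fun u : (R * R) * (R * R) => sX p u.1).
Proof. exact: measurableT_comp (measurable_sinq _) mx1. Qed.
Let msY p : measurable_fun setT (fun u : (R * R) * (R * R) => sY p u.1).
Proof. exact: measurableT_comp (measurable_sinq _) mx2. Qed.
Let mmX p : measurable_fun setT (fun u : (R * R) * (R * R) => mX p u.1).
Proof. exact: measurableT_comp (measurable_cosq _) mx1. Qed.
Let mmY p : measurable_fun setT (fun u : (R * R) * (R * R) => mY p u.1).
Proof. exact: measurableT_comp (measurable_cosq _) mx2. Qed.

Let bsX : pb 0 0 (fun p zeta _ => sX p zeta).
Proof. by apply: poly_bounded_le bx => // p zeta z _; exact: norm_sinq_le. Qed.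
Let bsY : pb 0 0 (fun p zeta _ => sY p zeta).
Proof. by apply: poly_bounded_le by_ => // p zeta z _; exact: norm_sinq_le. Qed.
Let bmX : pb 0 0 (fun p zeta _ => mX p zeta).
Proof.
apply: poly_bounded_le (bxn 2) => // p zeta z _.
by rewrite ger0_norm ?cosq_ge0// ger0_norm ?sqr_ge0// cosq_le.
Qed.
Let bmY : pb 0 0 (fun p zeta _ => mY p zeta).
Proof.
apply: poly_bounded_le (byn 2) => // p zeta z _.
by rewrite ger0_norm ?cosq_ge0// ger0_norm ?sqr_ge0// cosq_le.
Qed.

Let mono_h2h2 (f : R * R -> R) (e : hpar -> R) :
  pb 0 1 (fun p _ _ => e p) -> pb 0 0 (fun _ zeta _ => f zeta) ->
  pb 0 2 (fun p zeta _ => (e p * e p) * f zeta).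
Proof. by move=> he hf; exact: poly_bounded_mul_mono (poly_bounded_mul_mono he he) hf. Qed.

Let bdsX : pb 0 1 (fun p zeta _ => sX p zeta - zeta.1).
Proof.
have := poly_bounded_mul_mono bhx (poly_bounded_mul_mono (bxn 3) (bC 6^-1)).
apply: poly_bounded_le => [p|p zeta z _]; last exact: norm_sinqB_le.
exact: measurable_funB.
Qed.
Let bdsY : pb 0 1 (fun p zeta _ => sY p zeta - zeta.2).
Proof.
have := poly_bounded_mul_mono bhy (poly_bounded_mul_mono (byn 3) (bC 6^-1)).
apply: poly_bounded_le => [p|p zeta z _]; last exact: norm_sinqB_le.
exact: measurable_funB.
Qed.
Let bdmX : pb 0 1 (fun p zeta _ => mX p zeta - zeta.1 ^+ 2).
Proof.
have := poly_bounded_mul_mono bhx (poly_bounded_mul_mono (bxn 4) (bC 12^-1)).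
apply: poly_bounded_le => [p|p zeta z _]; last exact: cosq_taylor2.
by apply: measurable_funB => //; exact: measurable_funX.
Qed.
Let bdmY : pb 0 1 (fun p zeta _ => mY p zeta - zeta.2 ^+ 2).
Proof.
have := poly_bounded_mul_mono bhy (poly_bounded_mul_mono (byn 4) (bC 12^-1)).
apply: poly_bounded_le => [p|p zeta z _]; last exact: cosq_taylor2.
by apply: measurable_funB => //; exact: measurable_funX.
Qed.

Let bs1X : pb 0 1 (fun p zeta _ => s1X p zeta).
Proof.
have := poly_boundedN (poly_bounded_mul_mono (poly_bounded_mul_mono bhx (bxn 3)) (bC 6^-1)).
exact: poly_bounded_ext.
Qed.
Let bs1Y : pb 0 1 (fun p zeta _ => s1Y p zeta).
Proof.
have := poly_boundedN (poly_bounded_mul_mono (poly_bounded_mul_mono bhy (byn 3)) (bC 6^-1)).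
exact: poly_bounded_ext.
Qed.
Let bm1X : pb 0 1 (fun p zeta _ => m1X p zeta).
Proof.
have := poly_boundedN (poly_bounded_mul_mono (poly_bounded_mul_mono bhx (bxn 4)) (bC 12^-1)).
exact: poly_bounded_ext.
Qed.
Let bm1Y : pb 0 1 (fun p zeta _ => m1Y p zeta).
Proof.
have := poly_boundedN (poly_bounded_mul_mono (poly_bounded_mul_mono bhy (byn 4)) (bC 12^-1)).
exact: poly_bounded_ext.
Qed.

Let b2sX : pb 0 2 (fun p zeta _ => sX p zeta - zeta.1 - s1X p zeta).
Proof.
have := mono_h2h2 bhx (poly_bounded_mul_mono (bxn 5) (bC 120^-1)).
apply: poly_bounded_le => [p|p zeta z _]; last first.
  by rewrite /s1X opprK; exact: norm_sinq_taylor.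
by apply: measurable_funB; [exact: measurable_funB|have [] := bs1X].
Qed.
Let b2sY : pb 0 2 (fun p zeta _ => sY p zeta - zeta.2 - s1Y p zeta).
Proof.
have := mono_h2h2 bhy (poly_bounded_mul_mono (byn 5) (bC 120^-1)).
apply: poly_bounded_le => [p|p zeta z _]; last first.
  by rewrite /s1Y opprK; exact: norm_sinq_taylor.
by apply: measurable_funB; [exact: measurable_funB|have [] := bs1Y].
Qed.
Let b2mX : pb 0 2 (fun p zeta _ => mX p zeta - zeta.1 ^+ 2 - m1X p zeta).
Proof.
have := mono_h2h2 bhx (poly_bounded_mul_mono (bxn 6) (bC 360^-1)).
apply: poly_bounded_le => [p|p zeta z _]; last first.
  by rewrite /m1X opprK; exact: cosq_taylor4.
by apply: measurable_funB; [have [] := bdmX|have [] := bm1X].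
Qed.
Let b2mY : pb 0 2 (fun p zeta _ => mY p zeta - zeta.2 ^+ 2 - m1Y p zeta).
Proof.
have := mono_h2h2 bhy (poly_bounded_mul_mono (byn 6) (bC 360^-1)).
apply: poly_bounded_le => [p|p zeta z _]; last first.
  by rewrite /m1Y opprK; exact: cosq_taylor4.
by apply: measurable_funB; [have [] := bdmY|have [] := bm1Y].
Qed.

Let b_lin b (f g : hpar -> R * R -> R) :
  pb 0 b (fun p zeta _ => f p zeta) -> pb 0 b (fun p zeta _ => g p zeta) ->
  pb 1 b (fun p zeta z => p.2 * (ax * f p zeta * z.1 + ay * g p zeta * z.2)).
Proof.
move=> hf hg; apply: (poly_bounded_mul_mono bk (a' := 0) (b' := b)).
have h1 := poly_bounded_mul_mono (poly_bounded_mul_mono (bC ax) hf) bz1.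
have h2 := poly_bounded_mul_mono (poly_bounded_mul_mono (bC ay) hg) bz2.
rewrite !addn0 in h1 h2; exact: poly_boundedD h1 h2.
Qed.

Let bW : pb 1 0 incr.
Proof. exact: b_lin bsX bsY. Qed.
Let bW0 : pb 1 0 (fun p => incr (flat p)).
Proof. by apply: poly_bounded_ext (b_lin bx by_) => p zeta z; rewrite /incr flat_sX flat_sY. Qed.
Let bW1 : pb 1 1 incr1.
Proof. exact: b_lin bs1X bs1Y. Qed.
Let bdW : pb 1 1 (fun p zeta z => incr p zeta z - incr (flat p) zeta z).
Proof.
apply: poly_bounded_ext (b_lin bdsX bdsY) => p zeta z.
by rewrite /incr flat_sX flat_sY; ring.
Qed.
Let bd2W : pb 1 2 (fun p zeta z => incr p zeta z - incr (flat p) zeta z - incr1 p zeta z).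
Proof.
apply: poly_bounded_ext (b_lin b2sX b2sY) => p zeta z.
by rewrite /incr /incr1 flat_sX flat_sY; ring.
Qed.

Let bA : pb 2 0 (fun p zeta _ => quad p zeta).
Proof.
apply: (poly_bounded_mul_mono bk2 (a' := 0) (b' := 0)); apply: poly_boundedD.
  apply: (poly_bounded_mul_mono (bC _) (a' := 0) (b' := 0)).
  by apply: poly_bounded_ext (poly_bounded_mul_mono bsX bsX) => *; rewrite expr2.
apply: (poly_bounded_mul_mono (bC _) (a' := 0) (b' := 0)).
by apply: poly_bounded_ext (poly_bounded_mul_mono bsY bsY) => *; rewrite expr2.
Qed.

Let bmu : pb 0 0 (fun p zeta _ => mu_x c * sX p zeta + mu_y c * sY p zeta).
Proof.
by apply: poly_boundedD; apply: (poly_bounded_mul_mono (bC _) (a' := 0) (b' := 0)).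
Qed.

Let bden1 : cpb 2 0 (fun p zeta z => csub (den p zeta) (1, 0)).
Proof.
split.
  have h := poly_bounded_mul_mono (poly_bounded_mul_mono bk2 (poly_boundedD bmX bmY)) (bC 2^-1).
  by apply: poly_bounded_ext h => p zeta z /=; ring.
have h := poly_bounded_mul_mono bk2 bmu.
by apply: poly_bounded_ext h => p zeta z /=; ring.
Qed.

Lemma den_ge1 p zeta : 1 <= (den p zeta).1.
Proof.
by rewrite /= lerDl divr_ge0// mulr_ge0 ?sqr_ge0// addr_ge0 ?cosq_ge0.
Qed.

Lemma cn2_den_neq0 p zeta : cn2 (den p zeta) != 0.
Proof.
have h := den_ge1 p zeta; have : 0 < cn2 (den p zeta); last by move/gt_eqF => ->.
by rewrite /cn2 ltr_pwDl ?sqr_ge0// exprn_gt0// (lt_le_trans _ h).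
Qed.

Let measurable_den p : measurable_fun setT (fun u : (R * R) * (R * R) => den p u.1).
Proof.
have [[m1 _ _] [m2 _ _]] := bden1; apply: measurable_fun_pair => /=.
  apply: measurable_funD => //; apply: measurable_funM => //; apply: measurable_funM => //.
  exact: measurable_funD.
by have [] := poly_bounded_mul_mono bk2 bmu.
Qed.

Let measurable_cn2_den_inv p :
  measurable_fun setT (fun u : (R * R) * (R * R) => (cn2 (den p u.1))^-1).
Proof.
(* On positive numbers the inverse is e^(-ln), a composition of measurable functions. *)
rewrite (_ : (fun _ => _) = (fun u => expR (- ln (cn2 (den p u.1))))); last first.
  apply/funext => u; rewrite expRN lnK// posrE.
  by rewrite lt0r cn2_den_neq0 cn2_ge0.
apply: measurableT_comp => //; apply: measurableT_comp => //.
apply: (measurableT_comp (@measurable_ln R)).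
have mf := measurableT_comp measurable_fst (measurable_den p).
have ms := measurableT_comp measurable_snd (measurable_den p).
by apply: measurable_funD; exact: measurable_funX.
Qed.

(** The real part of [den] is at least 1, so both components of its inverse are at most 1 in
    absolute value, uniformly in the frequency. *)
Let bcinv : cpb 0 0 (fun p zeta _ => cinv (den p zeta)).
Proof.
have mf p := measurableT_comp measurable_fst (measurable_den p).
have ms p := measurableT_comp measurable_snd (measurable_den p).
split; apply: poly_bounded_bounded => [p|p zeta z _].
- by apply: measurable_funM; [exact: mf|exact: measurable_cn2_den_inv].
- have h := den_ge1 p zeta.
  have c0 : 0 < cn2 (den p zeta) by rewrite lt0r cn2_den_neq0 cn2_ge0.
  rewrite normrM normfV (ger0_norm (cn2_ge0 _)) ler_pdivrMr// mul1r.
  rewrite ger0_norm ?(le_trans _ h)// /cn2.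
  by have := sqr_ge0 (den p zeta).2; nra.
- apply: measurable_funM; last exact: measurable_cn2_den_inv.
  by apply: measurableT_comp => //; exact: ms.
- have h := den_ge1 p zeta.
  have c0 : 0 < cn2 (den p zeta) by rewrite lt0r cn2_den_neq0 cn2_ge0.
  rewrite normrM normfV (ger0_norm (cn2_ge0 _)) ler_pdivrMr// mul1r normrN /cn2.
  have := sqr_ge0 (`|(den p zeta).2| - 1); rewrite sqrrB real_normK ?num_real//.
  by have := normr_ge0 (den p zeta).2; nra.
Qed.

Let bnum1 : cpb 1 0 (fun p zeta z => csub (num p zeta z) (1, 0)).
Proof.
split; last by apply: poly_bounded_ext (poly_boundedN bW) => p zeta z /=; ring.
have h1 := poly_bounded_lower T0 (isT : (1 <= 2)%N) (poly_bounded_mul_mono bA (bC 2^-1)).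
have h2 := poly_bounded_lower T0 (isT : (1 <= 2)%N)
  (poly_bounded_mul_mono (poly_bounded_mul_mono bW bW) (bC 2^-1)).
by apply: poly_bounded_ext (poly_boundedB h1 h2) => p zeta z /=; ring.
Qed.

Let clower a a' b f : (a' <= a)%N -> cpb a b f -> cpb a' b f.
Proof. by move=> aa [h1 h2]; split; exact: poly_bounded_lower aa _. Qed.

(** [amp] - 1 is ([num] - 1) - ([den] - 1) divided by [den]; its order k^(1/2) comes from the linear
    noise term. *)
Let bamp1 : cpb 1 0 (fun p zeta z => csub (amp p zeta z) (1, 0)).
Proof.
have h := cpoly_bounded_mul_mono bcinv
  (cpoly_boundedB bnum1 (clower (isT : (1 <= 2)%N) bden1)).
apply: cpoly_bounded_ext h => p zeta z.
have e : cmul (cinv (den p zeta)) (den p zeta) = (1, 0).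
  have := cmulVK (1, 0) (cn2_den_neq0 p zeta).
  by rewrite (_ : cmul (den p zeta) (1, 0) = den p zeta)//; apply: cplxP; rewrite /=; ring.
have alg (I D n u : R * R) : cmul I (csub (csub n u) (csub D u)) = csub (cmul I n) (cmul I D).
  by apply: cplxP; rewrite /=; ring.
by rewrite alg e.
Qed.

Let bone : cpb 0 0 (fun _ _ _ => (1, 0)).
Proof. by split; exact: bC. Qed.

Lemma amp_bounded : cpb 0 0 amp.
Proof.
have h := cpoly_boundedD bone (clower (isT : (0 <= 1)%N) bamp1).
by apply: cpoly_bounded_ext h => p zeta z; apply: cplxP; rewrite /=; ring.
Qed.

Let pflat a (f : hpar -> R * R -> R * R -> R) : pb a 0 f -> pb a 0 (fun p => f (flat p)).
Proof.
move=> [mf _ [K [m [K0 h]]]]; split.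
- by move=> p; exact: mf.
- by move=> p; exact: mono_ge0.
- exists K, m; split => // p zeta z ap.
  by apply: le_trans (h (flat p) zeta z _) _.
Qed.

Let cflat a (f : hpar -> R * R -> R * R -> R * R) : cpb a 0 f -> cpb a 0 (fun p => f (flat p)).
Proof. by move=> [h1 h2]; split; [exact: pflat h1|exact: pflat h2]. Qed.

Let brot : cpb 2 0 (fun p zeta z => csub (rot (incr (flat p) zeta z)) (1, - incr (flat p) zeta z)).
Proof.
have mW p : measurable_fun setT (fun u : (R * R) * (R * R) => incr (flat p) u.1 u.2).
  by have [] := bW0.
have w2 := poly_bounded_mul_mono bW0 bW0.
have w3 := poly_bounded_lower T0 (isT : (2 <= 3)%N) (poly_bounded_mul_mono bW0 w2).
split.
  apply: poly_bounded_le w2 => [p|p zeta z _] /=.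
    apply: measurable_funB => //.
    exact: measurableT_comp (continuous_measurable_fun (@continuous_cos R)) (mW p).
  move: (incr _ _ _) => t; have /andP[h1 h2] := cosB1_bounds t.
  rewrite distrC ger0_norm// -expr2 ger0_norm ?sqr_ge0//.
  by have := sqr_ge0 t; lra.
apply: poly_bounded_le w3 => [p|p zeta z _] /=.
  apply: measurable_funB; apply: measurableT_comp => //.
  exact: measurableT_comp (continuous_measurable_fun (@continuous_sin R)) (mW p).
move: (incr _ _ _) => t; rewrite -opprD normrN.
apply: le_trans (norm_sinB_le t) _; rewrite -expr2 -exprS normrX.
by rewrite ler_pdivrMr// ler_peMr ?exprn_ge0// ler1n.
Qed.

Let bdrift : pb 2 0 (fun p zeta _ => drift p zeta).
Proof.
apply: (poly_bounded_mul_mono bk2 (a' := 0) (b' := 0)).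
by apply: poly_boundedD; apply: (poly_bounded_mul_mono (bC _) (a' := 0) (b' := 0)).
Qed.

Let bdecay : pb 2 0 (fun p zeta _ => decay p zeta).
Proof.
apply: (poly_bounded_mul_mono _ (bC 2^-1) (a := 2) (b := 0)).
apply: (poly_bounded_mul_mono bk2 (a' := 0) (b' := 0)).
apply: poly_boundedD; apply: (poly_bounded_mul_mono (bC _) (a' := 0) (b' := 0)).
  exact: bxn.
exact: byn.
Qed.

Lemma decay_ge0 p zeta : 0 <= decay p zeta.
Proof.
rewrite divr_ge0// mulr_ge0 ?sqr_ge0// addr_ge0// mulr_ge0 ?sqr_ge0// subr_ge0 ltW//.
  by case/andP: rho_x_range.
by case/andP: rho_y_range.
Qed.

Let bexp : pb 4 0 (fun p zeta _ => expR (- decay p zeta) - 1 + decay p zeta).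
Proof.
have md p : measurable_fun setT (fun u : (R * R) * (R * R) => decay p u.1) by have [] := bdecay.
apply: poly_bounded_le (poly_bounded_mul_mono bdecay bdecay) => [p|p zeta z _].
  apply: measurable_funD => //; apply: measurable_funB => //.
  by apply: measurableT_comp => //; apply: measurableT_comp.
rewrite -expr2 (ger0_norm (sqr_ge0 _)).
exact: expR_taylor (decay_ge0 _ _).
Qed.

Let bcosd : pb 4 0 (fun p zeta _ => cos (drift p zeta) - 1).
Proof.
have md p : measurable_fun setT (fun u : (R * R) * (R * R) => drift p u.1) by have [] := bdrift.
apply: poly_bounded_le (poly_bounded_mul_mono bdrift bdrift) => [p|p zeta z _].
  apply: measurable_funB => //.
  exact: measurableT_comp (continuous_measurable_fun (@continuous_cos R)) (md p).
move: (drift _ _) => t; have /andP[h1 h2] := cosB1_bounds t.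
rewrite distrC ger0_norm// -expr2 ger0_norm ?sqr_ge0//.
by have := sqr_ge0 t; lra.
Qed.

Let bsind : pb 4 0 (fun p zeta _ => sin (drift p zeta) - drift p zeta).
Proof.
have md p : measurable_fun setT (fun u : (R * R) * (R * R) => drift p u.1) by have [] := bdrift.
have d2 := poly_bounded_mul_mono bdrift bdrift.
apply: poly_bounded_le (poly_bounded_lower T0 (isT : (4 <= 6)%N) (poly_bounded_mul_mono bdrift d2))
  => [p|p zeta z _].
  apply: measurable_funB => //.
  exact: measurableT_comp (continuous_measurable_fun (@continuous_sin R)) (md p).
move: (drift _ _) => t.
apply: le_trans (norm_sinB_le t) _; rewrite -expr2 -exprS normrX.
by rewrite ler_pdivrMr// ler_peMr ?exprn_ge0// ler1n.
Qed.

Let bedrift : cpb 4 0 (fun p zeta _ =>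
  csub (exact_drift p zeta) (1 - decay p zeta, - drift p zeta)).
Proof.
have bone' := bC 1.
have e1 : pb 2 0 (fun p zeta _ => expR (- decay p zeta) - 1).
  have h := poly_boundedB (poly_bounded_lower T0 (isT : (2 <= 4)%N) bexp) bdecay.
  by apply: poly_bounded_ext h => p zeta z; ring.
have c1 := poly_bounded_lower T0 (isT : (2 <= 4)%N) bcosd.
have s1 : pb 2 0 (fun p zeta _ => sin (drift p zeta)).
  have h := poly_boundedD (poly_bounded_lower T0 (isT : (2 <= 4)%N) bsind) bdrift.
  by apply: poly_bounded_ext h => p zeta z; ring.
split.
  have h := poly_boundedD (poly_boundedD bexp bcosd) (poly_bounded_mul_mono e1 c1).
  by apply: poly_bounded_ext h => p zeta z /=; ring.
have h := poly_boundedN (poly_boundedD bsind (poly_bounded_mul_mono e1 s1)).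
by apply: poly_bounded_ext h => p zeta z /=; ring.
Qed.

Let bexact1 : cpb 2 0 (fun p zeta z =>
  csub (exact p zeta z) (1, - incr (flat p) zeta z)).
Proof.
have bd : cpb 2 0 (fun p zeta _ => csub (exact_drift p zeta) (1, 0)).
  have h := clower (isT : (2 <= 4)%N) bedrift.
  have h' : cpb 2 0 (fun p zeta _ => (- decay p zeta, - drift p zeta)).
    by split; exact: poly_boundedN.
  have := cpoly_boundedD h h'; apply: cpoly_bounded_ext => p zeta z.
  by apply: cplxP; rewrite /=; ring.
have bI : cpb 0 0 (fun p zeta z => (1, - incr (flat p) zeta z)).
  by split; [exact: bC|apply: poly_boundedN; exact: poly_bounded_lower (isT : (0 <= 1)%N) bW0].
have br : cpb 0 0 (fun p zeta z => rot (incr (flat p) zeta z)).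
  have := cpoly_boundedD (clower (isT : (0 <= 2)%N) brot) bI.
  by apply: cpoly_bounded_ext => p zeta z; apply: cplxP; rewrite /=; ring.
have := cpoly_boundedD (cpoly_bounded_mul_mono bd br) brot.
by apply: cpoly_bounded_ext => p zeta z; apply: cplxP; rewrite /=; ring.
Qed.

Lemma exact_bounded : cpb 0 0 exact.
Proof.
have bI : cpb 0 0 (fun p zeta z => (1, - incr (flat p) zeta z)).
  by split; [exact: bC|apply: poly_boundedN; exact: poly_bounded_lower (isT : (0 <= 1)%N) bW0].
have := cpoly_boundedD (clower (isT : (0 <= 2)%N) bexact1) bI.
by apply: cpoly_bounded_ext => p zeta z; apply: cplxP; rewrite /=; ring.
Qed.

Context d (Omega : measurableType d) (P : probability Omega R).
Hypothesis rho_range : -1 <= rho_xy c <= 1.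

Local Notation mb := (mean_bounded P T (rho_xy c)).
Local Notation zm := (zero_mean P T (rho_xy c)).

(* A one-step error of size [eps]: its mean is O(k eps), its fluctuations are
   O(k^(1/2) eps). *)
Definition step_err (eps : hpar -> R) (f : hpar -> R * R -> R * R -> R * R) : Prop :=
  [/\ cpoly_bounded T (fun p => p.2 * eps p) f,
      mb (fun p => p.2 ^+ 2 * eps p) (fun p zeta z => (f p zeta z).1) &
      mb (fun p => p.2 ^+ 2 * eps p) (fun p zeta z => (f p zeta z).2)].

Let pb_eq (g g' : hpar -> R) f : (forall p, g p = g' p) ->
  poly_bounded T g f -> poly_bounded T g' f.
Proof. by move=> e; rewrite (_ : g = g')//; apply/funext. Qed.

Let pb_add1 (g g' : hpar -> R) f : (forall p, adm T p -> 0 <= g' p) ->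
  poly_bounded T g f -> poly_bounded T (fun p => g p + g' p) f.
Proof.
move=> g0' b; have [_ g0 _] := b.
apply: (poly_bounded_weaken (C := 1)) b => // p ap; first by rewrite addr_ge0 ?g0 ?g0'.
by rewrite mul1r lerDl g0'.
Qed.

Let zm_real_mul (a : hpar -> R * R -> R) g (f : hpar -> R * R -> R * R -> R) :
  (forall p, adm T p -> 0 <= g p) ->
  pb 0 0 (fun p zeta _ => a p zeta) -> zm f -> mb g (fun p zeta z => a p zeta * f p zeta z).
Proof. by move=> g0 ba zf; apply: zero_mean_mean_bounded => //; exact: (zero_meanZ rho_range ba zf). Qed.

(** The shape of the one-step errors below: a deterministic inverse of [den] times the sum of a term
    O(k eps) and i times a real fluctuation [o] of order k^(1/2) eps. As the first factor does not
    involve the noise, the mean of the fluctuation stays zero after the product. *)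
Let step_err_intro (eps : hpar -> R) (I : hpar -> R * R -> R * R)
    (U : hpar -> R * R -> R * R -> R * R) (o : hpar -> R * R -> R * R -> R) f :
  (forall p, adm T p -> 0 <= eps p) ->
  cpb 0 0 (fun p zeta _ => I p zeta) ->
  cpoly_bounded T (fun p => p.2 ^+ 2 * eps p) U ->
  poly_bounded T (fun p => p.2 * eps p) o -> zm o ->
  (forall p zeta z, f p zeta z = cmul (I p zeta) (cadd (U p zeta z) (0, o p zeta z))) ->
  step_err eps f.
Proof.
move=> e0 bI bU bo zo fE.
have g0 p : adm T p -> 0 <= p.2 * eps p.
  by move=> ap; rewrite mulr_ge0 ?e0//; case: ap => /ltW.
have g20 p : adm T p -> 0 <= p.2 ^+ 2 * eps p by move=> ap; rewrite mulr_ge0 ?sqr_ge0 ?e0.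
have one_g (g : hpar -> R) p : mono 0 0 p * g p = g p by rewrite /mono !expr0 !mul1r.
have low (u : hpar -> R * R -> R * R -> R) : poly_bounded T (fun p => p.2 ^+ 2 * eps p) u ->
    poly_bounded T (fun p => p.2 * eps p) u.
  apply: (poly_bounded_weaken (C := 1 + T)) => //; last by rewrite addr_ge0.
  move=> p ap; rewrite expr2 -mulrA ler_wpM2r ?g0//.
  by case: ap => k0 kT; have := sqr_ge0 (p.2 - 1); nra.
have bIU := cpoly_boundedM bI bU.
have bIU' : cpoly_bounded T (fun p => p.2 ^+ 2 * eps p) (fun p zeta z => cmul (I p zeta) (U p zeta z)).
  by case: bIU => h1 h2; split; [move: h1|move: h2];
    apply: pb_eq => p; exact: (one_g (fun p => p.2 ^+ 2 * eps p)).
case: bI => bI1 bI2; case: bIU' => b1 b2.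
have bo1 : poly_bounded T (fun p => p.2 * eps p) (fun p zeta z => (I p zeta).1 * o p zeta z).
  by have := poly_boundedM bI1 bo; apply: pb_eq => p; exact: (one_g (fun p => p.2 * eps p)).
have bo2 : poly_bounded T (fun p => p.2 * eps p) (fun p zeta z => (I p zeta).2 * o p zeta z).
  by have := poly_boundedM bI2 bo; apply: pb_eq => p; exact: (one_g (fun p => p.2 * eps p)).
split; first split.
- by apply: poly_bounded_ext (poly_boundedB (low _ b1) bo2) => p zeta z; rewrite fE /=; ring.
- by apply: poly_bounded_ext (poly_boundedD (low _ b2) bo1) => p zeta z; rewrite fE /=; ring.
- have z2 : mb (fun p => p.2 ^+ 2 * eps p) (fun p zeta z => - (I p zeta).2 * o p zeta z).
    by apply: (zm_real_mul (a := fun p zeta => - (I p zeta).2)) => //; exact: poly_boundedN.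
  apply: mean_bounded_ext (mean_boundedD rho_range (poly_bounded_mean_bounded P (rho_xy c) b1) z2) => p zeta z.
  by rewrite fE /=; ring.
- have z2 : mb (fun p => p.2 ^+ 2 * eps p) (fun p zeta z => (I p zeta).1 * o p zeta z).
    exact: zm_real_mul.
  apply: mean_bounded_ext (mean_boundedD rho_range (poly_bounded_mean_bounded P (rho_xy c) b2) z2) => p zeta z.
  by rewrite fE /=; ring.
Qed.

Lemma step_errD eps eps' f f' : step_err eps f -> step_err eps' f' ->
  step_err (fun p => eps p + eps' p) (fun p zeta z => cadd (f p zeta z) (f' p zeta z)).
Proof.
move=> [[b1 b2] m1 m2] [[b1' b2'] m1' m2'].
have sum (i : nat) (u u' : hpar -> R * R -> R * R -> R) :
    poly_bounded T (fun p => p.2 ^+ i * eps p) u -> poly_bounded T (fun p => p.2 ^+ i * eps' p) u' ->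
    poly_bounded T (fun p => p.2 ^+ i * (eps p + eps' p)) (fun p zeta z => u p zeta z + u' p zeta z).
  move=> b b'; have [_ g0 _] := b; have [_ g0' _] := b'.
  apply: poly_boundedD.
    have h := pb_add1 g0' b; move: h; apply: pb_eq => p; ring.
  have h := pb_add1 g0 b'; move: h; apply: pb_eq => p; ring.
have msum (u u' : hpar -> R * R -> R * R -> R) :
    mb (fun p => p.2 ^+ 2 * eps p) u -> mb (fun p => p.2 ^+ 2 * eps' p) u' ->
    mb (fun p => p.2 ^+ 2 * (eps p + eps' p)) (fun p zeta z => u p zeta z + u' p zeta z).
  move=> [f1 [f2 [b zf e]]] [f1' [f2' [b' zf' e']]].
  exists (fun p zeta z => f1 p zeta z + f1' p zeta z), (fun p zeta z => f2 p zeta z + f2' p zeta z).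
  split; [exact: sum|exact: (zero_meanD rho_range)|].
  by move=> p zeta z; rewrite e e'; ring.
by split; [split; apply: (sum 1)|exact: msum|exact: msum].
Qed.

Let zm_lin (f g : hpar -> R * R -> R) b :
  pb b.1 b.2 (fun p zeta z => p.2 * (ax * f p zeta * z.1 + ay * g p zeta * z.2)) ->
  zm (fun p zeta z => p.2 * (ax * f p zeta * z.1 + ay * g p zeta * z.2)).
Proof.
move=> h; pose u p zeta := p.2 * (ax * f p zeta); pose v p zeta := p.2 * (ay * g p zeta).
have e p zeta z : p.2 * (ax * f p zeta * z.1 + ay * g p zeta * z.2) =
  u p zeta * z.1 + v p zeta * z.2 by rewrite /u /v; ring.
apply: (@zero_mean_ext _ _ _ _ _ _ (fun p zeta z => u p zeta * z.1 + v p zeta * z.2)).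
  by move=> *; rewrite e.
apply: (@zero_mean_odd _ _ _ P T (rho_xy c) rho_range (fun _ _ x => x) u v (mono b.1 b.2)) => //.
by apply: poly_bounded_ext h.
Qed.

Let binv0 : cpb 0 0 (fun p zeta _ => cinv (den (flat p) zeta)).
Proof. exact: cflat bcinv. Qed.

Let flat_den p zeta : den (flat p) zeta =
  (1 + p.2 ^+ 2 * (zeta.1 ^+ 2 + zeta.2 ^+ 2) / 2, drift p zeta).
Proof. by rewrite /den flat_mX flat_mY flat_sX flat_sY. Qed.

Let flat_quad p zeta : quad (flat p) zeta =
  p.2 ^+ 2 * (rho_x c * zeta.1 ^+ 2 + rho_y c * zeta.2 ^+ 2).
Proof. by rewrite /quad flat_sX flat_sY. Qed.

Let bq : pb 2 0 (fun p zeta _ => p.2 ^+ 2 * (zeta.1 ^+ 2 + zeta.2 ^+ 2) / 2).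
Proof.
apply: (poly_bounded_mul_mono _ (bC 2^-1) (a := 2) (b := 0)).
by apply: (poly_bounded_mul_mono bk2 (a' := 0) (b' := 0)); exact: poly_boundedD.
Qed.

Let bA0 : pb 2 0 (fun p zeta _ => quad (flat p) zeta).
Proof. exact: pflat bA. Qed.

(** At order k the drifts cancel, and k |zeta|^2 / 2 from [den] minus [decay] leaves [quad] / 2,
    which is the deterministic correction inside [num]. *)
Let beta0 : cpb 4 0 (fun p zeta _ =>
  csub (cmul (den (flat p) zeta) (exact_drift p zeta)) (1 + quad (flat p) zeta / 2, 0)).
Proof.
pose a p zeta := p.2 ^+ 2 * (zeta.1 ^+ 2 + zeta.2 ^+ 2) / 2.
have bden0 : cpb 0 0 (fun p zeta _ => den (flat p) zeta).
  have := cpoly_boundedD bone (clower (isT : (0 <= 2)%N) (cflat bden1)).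
  by apply: cpoly_bounded_ext => p zeta z; apply: cplxP; rewrite /=; ring.
have r1 : pb 4 0 (fun p zeta _ => drift p zeta * drift p zeta - a p zeta * decay p zeta).
  exact: poly_boundedB (poly_bounded_mul_mono bdrift bdrift) (poly_bounded_mul_mono bq bdecay).
have r2 : pb 4 0 (fun p zeta _ => - (a p zeta * drift p zeta) - drift p zeta * decay p zeta).
  exact: poly_boundedB (poly_boundedN (poly_bounded_mul_mono bq bdrift)) (poly_bounded_mul_mono bdrift bdecay).
have r : cpb 4 0 (fun p zeta _ => (drift p zeta * drift p zeta - a p zeta * decay p zeta,
    - (a p zeta * drift p zeta) - drift p zeta * decay p zeta)) by split.
have := cpoly_boundedD (cpoly_bounded_mul_mono bden0 bedrift) r.
apply: cpoly_bounded_ext => p zeta z; rewrite flat_den flat_quad /a.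
by apply: cplxP; rewrite /= /decay; field.
Qed.

Let brot_le1 : cpb 0 0 (fun p zeta z => rot (incr (flat p) zeta z)).
Proof.
have bI : cpb 0 0 (fun p zeta z => (1, - incr (flat p) zeta z)).
  by split; [exact: bC|apply: poly_boundedN; exact: poly_bounded_lower (isT : (0 <= 1)%N) bW0].
have := cpoly_boundedD (clower (isT : (0 <= 2)%N) brot) bI.
by apply: cpoly_bounded_ext => p zeta z; apply: cplxP; rewrite /=; ring.
Qed.

Let mW0 p : measurable_fun setT (fun u : (R * R) * (R * R) => incr (flat p) u.1 u.2).
Proof. by have [] := bW0. Qed.

Let bcos4 : pb 4 0 (fun p zeta z =>
  1 - incr (flat p) zeta z ^+ 2 / 2 - cos (incr (flat p) zeta z)).
Proof.
have w2 := poly_bounded_mul_mono bW0 bW0.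
apply: poly_bounded_le (poly_bounded_mul_mono w2 w2) => [p|p zeta z _].
  apply: measurable_funB.
    by apply: measurable_funB => //; apply: measurable_funM => //; exact: measurable_funX.
  exact: measurableT_comp (continuous_measurable_fun (@continuous_cos R)) (mW0 p).
move: (incr _ _ _) => t.
have -> : 1 - t ^+ 2 / 2 - cos t = - (cos t - 1 + t ^+ 2 / 2) by ring.
rewrite normrN; apply: le_trans (norm_cos_taylor2 t) _.
have -> : t * t * (t * t) = t ^+ 4 by ring.
have t4 : 0 <= t ^+ 4 by rewrite exprn_even_ge0.
by rewrite ger0_norm//; lra.
Qed.

Let bsin3 : pb 3 0 (fun p zeta z => sin (incr (flat p) zeta z) - incr (flat p) zeta z).
Proof.
have w2 := poly_bounded_mul_mono bW0 bW0.
apply: poly_bounded_le (poly_bounded_mul_mono bW0 w2) => [p|p zeta z _].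
  apply: measurable_funB => //.
  exact: measurableT_comp (continuous_measurable_fun (@continuous_sin R)) (mW0 p).
move: (incr _ _ _) => t.
apply: le_trans (norm_sinB_le t) _; rewrite -expr2 -exprS normrX.
by rewrite ler_pdivrMr// ler_peMr ?exprn_ge0// ler1n.
Qed.

Let bcos2 : pb 2 0 (fun p zeta z => 1 - cos (incr (flat p) zeta z)).
Proof.
have [h _] := brot; apply: poly_bounded_ext (poly_boundedN h) => p zeta z /=; ring.
Qed.

Let bsin1 : pb 1 0 (fun p zeta z => sin (incr (flat p) zeta z)).
Proof.
have h := poly_boundedD (poly_bounded_lower T0 (isT : (1 <= 3)%N) bsin3) bW0.
by apply: poly_bounded_ext h => p zeta z; ring.
Qed.

Let mono_k a b i p : p.2 ^+ i * mono a b p = mono (i + a) b p.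
Proof. by rewrite /mono exprD; ring. Qed.

(** Let W be the linear noise term at h = 0. Up to O(k^2), [den] times the error has real part 1 -
    W^2/2 - cos W, which is O(k^2) thanks to the Milstein terms, and imaginary part sin W - W +
    ([quad]/2) sin W, which is of order k^(3/2) and odd in the noise. *)
Lemma time_err_step : step_err (mono 2 0) time_err.
Proof.
pose o p zeta z := sin (incr (flat p) zeta z) - incr (flat p) zeta z
  + quad (flat p) zeta / 2 * sin (incr (flat p) zeta z).
pose U p zeta z : R * R := csub
  (1 - incr (flat p) zeta z ^+ 2 / 2 - cos (incr (flat p) zeta z)
     + quad (flat p) zeta / 2 * (1 - cos (incr (flat p) zeta z)), 0)
  (cmul (csub (cmul (den (flat p) zeta) (exact_drift p zeta)) (1 + quad (flat p) zeta / 2, 0))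
     (rot (incr (flat p) zeta z))).
have bA2 : pb 2 0 (fun p zeta _ => quad (flat p) zeta / 2).
  exact: poly_bounded_mul_mono bA0 (bC 2^-1).
have bo : pb 3 0 o by exact: poly_boundedD bsin3 (poly_bounded_mul_mono bA2 bsin1).
have bU : cpb 4 0 U.
  apply: cpoly_boundedB; last exact: cpoly_bounded_mul_mono beta0 brot_le1.
  split; first exact: poly_boundedD bcos4 (poly_bounded_mul_mono bA2 bcos2).
  by apply: poly_bounded0 => p; exact: mono_ge0.
apply: (@step_err_intro _ (fun p zeta => cinv (den (flat p) zeta)) U o).
- by move=> p; exact: mono_ge0.
- exact: binv0.
- by case: bU => h1 h2; split; [move: h1|move: h2]; apply: pb_eq => p; rewrite mono_k.
- by move: bo; apply: pb_eq => p; rewrite /mono; ring.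
- pose u (p : hpar) zeta := p.2 * (ax * zeta.1); pose v (p : hpar) zeta := p.2 * (ay * zeta.2).
  pose h p zeta x : R := sin x - x + quad (flat p) zeta / 2 * sin x.
  have e p zeta z : incr (flat p) zeta z = u p zeta * z.1 + v p zeta * z.2.
    by rewrite /incr flat_sX flat_sY /u /v /=; ring.
  apply: (@zero_mean_ext _ _ _ _ _ _ (fun p zeta z => h p zeta (u p zeta * z.1 + v p zeta * z.2))).
    by move=> p zeta z; rewrite /o e.
  apply: (@zero_mean_odd _ _ _ P T (rho_xy c) rho_range h u v (mono 3 0)).
  + move=> p zeta; have ms := continuous_measurable_fun (@continuous_sin R).
    by apply: measurable_funD; [exact: measurable_funB|exact: measurable_funM].
  + by move=> p zeta x; rewrite /h sinN; ring.
  + by apply: poly_bounded_ext bo => p zeta z; rewrite /o e.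
- move=> p zeta z; rewrite /time_err -[X in csub _ X](cmulVK _ (cn2_den_neq0 (flat p) zeta)).
  have alg (I n w : R * R) : csub (cmul I n) (cmul I w) = cmul I (csub n w).
    by apply: cplxP; rewrite /=; ring.
  rewrite /amp alg; congr cmul.
  rewrite /exact /U /o; move: (den _ _) (exact_drift _ _) => D E.
  by apply: cplxP; rewrite /=; ring.
Qed.

Let bdden : cpb 2 1 (fun p zeta _ => csub (den p zeta) (den (flat p) zeta)).
Proof.
split.
  have h := poly_bounded_mul_mono (poly_bounded_mul_mono bk2 (poly_boundedD bdmX bdmY)) (bC 2^-1).
  by apply: poly_bounded_ext h => p zeta z; rewrite flat_den /=; field.
have h := poly_bounded_mul_mono bk2 (poly_boundedD (poly_bounded_mul_mono (bC (mu_x c)) bdsX)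
  (poly_bounded_mul_mono (bC (mu_y c)) bdsY)).
by apply: poly_bounded_ext h => p zeta z; rewrite flat_den /= /drift; ring.
Qed.

Let bdquad : pb 2 1 (fun p zeta _ => quad p zeta - quad (flat p) zeta).
Proof.
have h1 := poly_bounded_mul_mono (bC (rho_x c)) (poly_bounded_mul_mono bdsX (poly_boundedD bsX bx)).
have h2 := poly_bounded_mul_mono (bC (rho_y c)) (poly_bounded_mul_mono bdsY (poly_boundedD bsY by_)).
apply: poly_bounded_ext (poly_bounded_mul_mono bk2 (poly_boundedD h1 h2)) => p zeta z.
by rewrite flat_quad /quad; ring.
Qed.

Let amp_sub (p : hpar) zeta z w : csub (amp p zeta z) w =
  cmul (cinv (den p zeta)) (csub (num p zeta z) (cmul (den p zeta) w)).
Proof.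
rewrite /amp -[in LHS](cmulVK w (cn2_den_neq0 p zeta)).
have alg (I n u : R * R) : csub (cmul I n) (cmul I u) = cmul I (csub n u).
  by apply: cplxP; rewrite /=; ring.
exact: alg.
Qed.

Let den_amp_flat (p : hpar) zeta z :
  cmul (den (flat p) zeta) (amp (flat p) zeta z) = num (flat p) zeta z.
Proof. exact: cmulKV (cn2_den_neq0 _ _). Qed.

Let zm_dW : zm (fun p zeta z => - (incr p zeta z - incr (flat p) zeta z)).
Proof.
pose f p zeta := - (sX p zeta - zeta.1); pose g p zeta := - (sY p zeta - zeta.2).
have e p zeta z : p.2 * (ax * f p zeta * z.1 + ay * g p zeta * z.2) =
    - (incr p zeta z - incr (flat p) zeta z).
  by rewrite /f /g /incr flat_sX flat_sY /=; ring.
apply: (@zero_mean_ext _ _ _ _ _ _ (fun p zeta z => p.2 * (ax * f p zeta * z.1 + ay * g p zeta * z.2))) => //.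
apply: (@zm_lin f g (1, 1)%N).
exact: b_lin (poly_boundedN bdsX) (poly_boundedN bdsY).
Qed.

Let zm_d2W : zm (fun p zeta z => - (incr p zeta z - incr (flat p) zeta z - incr1 p zeta z)).
Proof.
pose f p zeta := - (sX p zeta - zeta.1 - s1X p zeta).
pose g p zeta := - (sY p zeta - zeta.2 - s1Y p zeta).
have e p zeta z : p.2 * (ax * f p zeta * z.1 + ay * g p zeta * z.2) =
    - (incr p zeta z - incr (flat p) zeta z - incr1 p zeta z).
  by rewrite /f /g /incr /incr1 flat_sX flat_sY /=; ring.
apply: (@zero_mean_ext _ _ _ _ _ _ (fun p zeta z => p.2 * (ax * f p zeta * z.1 + ay * g p zeta * z.2))) => //.
apply: (@zm_lin f g (1, 2)%N).
exact: b_lin (poly_boundedN b2sX) (poly_boundedN b2sY).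
Qed.

(** With an index 0 for h = 0, [den] times the error is num - num0 - (den - den0) amp0. All of it is
    O(k h^2), except -i times the difference of the linear noise terms, which has mean zero. *)
Lemma space_err_step : step_err (mono 0 1) space_err.
Proof.
pose o p zeta z := - (incr p zeta z - incr (flat p) zeta z).
pose U p zeta z : R * R := csub
  ((quad p zeta - quad (flat p) zeta) / 2
     - (incr p zeta z - incr (flat p) zeta z) * (incr p zeta z + incr (flat p) zeta z) / 2, 0)
  (cmul (csub (den p zeta) (den (flat p) zeta)) (amp (flat p) zeta z)).
have bU : cpb 2 1 U.
  apply: cpoly_boundedB; last exact: cpoly_bounded_mul_mono bdden (cflat amp_bounded).
  split; last by apply: poly_bounded0 => p; exact: mono_ge0.
  exact: poly_boundedB (poly_bounded_mul_mono bdquad (bC 2^-1))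
    (poly_bounded_mul_mono (poly_bounded_mul_mono bdW (poly_boundedD bW bW0)) (bC 2^-1)).
apply: (@step_err_intro _ (fun p zeta => cinv (den p zeta)) U o).
- by move=> p; exact: mono_ge0.
- exact: bcinv.
- by case: bU => h1 h2; split; [move: h1|move: h2]; apply: pb_eq => p; rewrite /mono; ring.
- by move: (poly_boundedN bdW); apply: pb_eq => p; rewrite /mono; ring.
- exact: zm_dW.
- move=> p zeta z; rewrite /space_err amp_sub; congr cmul.
  have alg (D D0 a n : R * R) :
      csub n (cmul D a) = csub (csub n (cmul D0 a)) (cmul (csub D D0) a).
    by apply: cplxP; rewrite /=; ring.
  rewrite (alg _ (den (flat p) zeta)) den_amp_flat /U /o /num.
  move: (cmul _ _) => u; by apply: cplxP; rewrite /=; field.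
Qed.

Lemma full_err_step : step_err (fun p => mono 0 1 p + mono 2 0 p) full_err.
Proof.
have := step_errD space_err_step time_err_step.
have e p zeta z : cadd (space_err p zeta z) (time_err p zeta z) = full_err p zeta z.
  by rewrite /space_err /time_err /full_err; apply: cplxP; rewrite /=; ring.
rewrite (_ : (fun p zeta z => cadd _ _) = full_err)//.
by do 3 (apply/funext => ?); exact: e.
Qed.

Let balpha1 : pb 0 1 (fun p zeta _ => (alpha p zeta).1).
Proof.
have h := poly_boundedD (poly_boundedD
  (poly_bounded_mul_mono (poly_boundedN (poly_boundedD bm1X bm1Y)) (bC 2^-1))
  (poly_bounded_mul_mono (poly_bounded_mul_mono (bC (rho_x c)) bx) bs1X))
  (poly_bounded_mul_mono (poly_bounded_mul_mono (bC (rho_y c)) by_) bs1Y).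
exact: poly_bounded_ext h.
Qed.

Let balpha2 : pb 0 1 (fun p zeta _ => (alpha p zeta).2).
Proof.
have h := poly_boundedN (poly_boundedD (poly_bounded_mul_mono (bC (mu_x c)) bs1X)
  (poly_bounded_mul_mono (bC (mu_y c)) bs1Y)).
exact: poly_bounded_ext h.
Qed.

Lemma ystep_bounded : cpb 1 1 ystep.
Proof.
split; first exact: poly_bounded_lower (isT : (1 <= 2)%N) (poly_bounded_mul_mono bk2 balpha1).
exact: poly_boundedB
  (poly_bounded_lower T0 (isT : (1 <= 2)%N) (poly_bounded_mul_mono bk2 balpha2)) bW1.
Qed.

(* Here den * space_err2 is O(k H^2 + k^(3/2) H), with H = h_x^2 + h_y^2, up to
   the increments of order H^2, which have mean zero. *)
Lemma space_err2_step : step_err (fun p => mono 0 2 p + mono 1 1 p) space_err2.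
Proof.
pose W0 p zeta z := incr (flat p) zeta z.
pose V p zeta z := incr p zeta z - W0 p zeta z.
pose o p zeta z := - (V p zeta z - incr1 p zeta z).
pose a1 p zeta := p.2 ^+ 2 * (alpha p zeta).1.
pose a2 p zeta := p.2 ^+ 2 * (alpha p zeta).2.
pose E1 p zeta z := csub (cmul (den p zeta) (exact p zeta z)) (1, - W0 p zeta z).
pose main p zeta z : R * R :=
  ((quad p zeta - quad (flat p) zeta) / 2
     - p.2 ^+ 2 * (rho_x c * zeta.1 * s1X p zeta + rho_y c * zeta.2 * s1Y p zeta)
     - (V p zeta z * V p zeta z / 2 + W0 p zeta z * (V p zeta z - incr1 p zeta z))
     - p.2 ^+ 2 * ((mX p zeta - zeta.1 ^+ 2 - m1X p zeta) + (mY p zeta - zeta.2 ^+ 2 - m1Y p zeta)) / 2,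
   - p.2 ^+ 2 * (mu_x c * (sX p zeta - zeta.1 - s1X p zeta) + mu_y c * (sY p zeta - zeta.2 - s1Y p zeta))).
pose rest p zeta z : R * R := csub (csub
  (- (a2 p zeta * W0 p zeta z), a1 p zeta * W0 p zeta z)
  (cmul (csub (den p zeta) (den (flat p) zeta)) (csub (amp (flat p) zeta z) (1, 0))))
  (cmul (ystep p zeta z) (E1 p zeta z)).
have ba1 : pb 2 1 (fun p zeta _ => a1 p zeta) by exact: poly_bounded_mul_mono bk2 balpha1.
have ba2 : pb 2 1 (fun p zeta _ => a2 p zeta) by exact: poly_bounded_mul_mono bk2 balpha2.
have by1 := ystep_bounded.
have bE1 : cpb 2 0 E1.
  have h := cpoly_boundedD bexact1 (cpoly_bounded_mul_mono bden1 exact_bounded).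
  apply: cpoly_bounded_ext h => p zeta z; rewrite /E1 /W0.
  by move: (den _ _) (exact _ _ _) => D X; apply: cplxP; rewrite /=; ring.
have brest : cpb 3 1 rest.
  apply: cpoly_boundedB; last exact: cpoly_bounded_mul_mono by1 bE1.
  apply: cpoly_boundedB; last exact: cpoly_bounded_mul_mono bdden (cflat bamp1).
  split; last exact: poly_bounded_mul_mono ba1 bW0.
  exact: poly_boundedN (poly_bounded_mul_mono ba2 bW0).
have bV : pb 1 1 V by exact: bdW.
have bq2 : pb 2 2 (fun p zeta _ => (quad p zeta - quad (flat p) zeta) / 2
    - p.2 ^+ 2 * (rho_x c * zeta.1 * s1X p zeta + rho_y c * zeta.2 * s1Y p zeta)).
  have hx := poly_bounded_mul_mono (bC (rho_x c)) (poly_boundedD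
    (poly_bounded_mul_mono (poly_bounded_mul_mono bdsX bdsX) (bC 2^-1)) (poly_bounded_mul_mono bx b2sX)).
  have hy := poly_bounded_mul_mono (bC (rho_y c)) (poly_boundedD
    (poly_bounded_mul_mono (poly_bounded_mul_mono bdsY bdsY) (bC 2^-1)) (poly_bounded_mul_mono by_ b2sY)).
  apply: poly_bounded_ext (poly_bounded_mul_mono bk2 (poly_boundedD hx hy)) => p zeta z.
  by rewrite flat_quad /quad; field.
have bmain : cpb 2 2 main.
  split; last first.
    have h := poly_bounded_mul_mono (poly_boundedN bk2) (poly_boundedD
      (poly_bounded_mul_mono (bC (mu_x c)) b2sX) (poly_bounded_mul_mono (bC (mu_y c)) b2sY)).
    exact: poly_bounded_ext h.
  have h1 := poly_boundedD (poly_bounded_mul_mono (poly_bounded_mul_mono bV bV) (bC 2^-1))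
    (poly_bounded_mul_mono bW0 bd2W).
  have h2 := poly_bounded_mul_mono (poly_bounded_mul_mono bk2 (poly_boundedD b2mX b2mY)) (bC 2^-1).
  exact: poly_bounded_ext (poly_boundedB (poly_boundedB bq2 h1) h2).
have m0 a b p : adm T p -> 0 <= mono a b p by exact: mono_ge0.
have bU : cpoly_bounded T (fun p => p.2 ^+ 2 * (mono 0 2 p + mono 1 1 p))
    (fun p zeta z => cadd (main p zeta z) (rest p zeta z)).
  have s (u u' : hpar -> R * R -> R * R -> R) : pb 2 2 u -> pb 3 1 u' ->
      poly_bounded T (fun p => p.2 ^+ 2 * (mono 0 2 p + mono 1 1 p))
        (fun p zeta z => u p zeta z + u' p zeta z).
    move=> b b'; have := poly_boundedD (pb_add1 (m0 3%N 1%N) b) _.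
    move=> /(_ u'); have h : poly_bounded T (fun p => mono 2 2 p + mono 3 1 p) u'.
      by move: (pb_add1 (m0 2%N 2%N) b'); apply: pb_eq => p; rewrite addrC.
    by move=> /(_ h); apply: pb_eq => p; rewrite /mono; ring.
  by case: bmain => ? ?; case: brest => ? ?; split; exact: s.
apply: (@step_err_intro _ (fun p zeta => cinv (den p zeta))
  (fun p zeta z => cadd (main p zeta z) (rest p zeta z)) o).
- by move=> p ap; rewrite addr_ge0// m0.
- exact: bcinv.
- exact: bU.
- have := pb_add1 (m0 2%N 1%N) (poly_boundedN bd2W).
  by apply: pb_eq => p; rewrite /mono; ring.
- exact: zm_d2W.
- move=> p zeta z; rewrite /space_err2 /space_err.
  have alg0 (a b e : R * R) : csub (csub a b) e = csub a (cadd b e).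
    by apply: cplxP; rewrite /=; ring.
  rewrite alg0 amp_sub; congr cmul.
  (* The products are expanded around 1 for [amp] at h = 0 and around [w] = 1 - i W for [den] times
     [exact], so that each remaining product gains a factor k^(1/2). *)
  have alg (D D0 A Y X n w : R * R) :
      csub n (cmul D (cadd A (cmul Y X))) =
      csub (csub (csub (csub (csub n (cmul D0 A)) (csub D D0)) (cmul (csub D D0) (csub A (1, 0))))
        (cmul Y w)) (cmul Y (csub (cmul D X) w)).
    by apply: cplxP; rewrite /=; ring.
  rewrite (alg _ (den (flat p) zeta) _ _ _ _ (1, - W0 p zeta z)) den_amp_flat.
  rewrite /rest /E1 -/(W0 p zeta z).
  move: (cmul (ystep p zeta z) (csub _ _)) => v.
  move: (cmul (csub _ _) (csub _ _)) => u.
  rewrite flat_den /main /o /V /ystep /a1 /a2 /den /num -/(W0 p zeta z) /alpha /drift.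
  move: (incr p zeta z) (W0 p zeta z) (incr1 p zeta z) (quad p zeta) (quad _ zeta) => w w0 w1 q0 q1.
  by apply: cplxP; rewrite /=; field.
Qed.

(** [amp] is 1 + O(k^(1/2)), so the product differs from conj f by O(k eps) pointwise, and conj f
    has mean O(k eps). *)
Lemma step_err_cross eps f : step_err eps f ->
  mb (fun p => p.2 ^+ 2 * eps p) (fun p zeta z => (cmul (amp p zeta z) (cconj (f p zeta z))).1) /\
  mb (fun p => p.2 ^+ 2 * eps p) (fun p zeta z => (cmul (amp p zeta z) (cconj (f p zeta z))).2).
Proof.
move=> [bf m1 m2].
have [b1 b2] : cpoly_bounded T (fun p => p.2 ^+ 2 * eps p)
    (fun p zeta z => cmul (csub (amp p zeta z) (1, 0)) (cconj (f p zeta z))).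
  have [h1 h2] := cpoly_boundedM bamp1 (cpoly_bounded_conj bf).
  by split; [move: h1|move: h2]; apply: pb_eq => p; rewrite /mono; ring.
have mN : mb (fun p => p.2 ^+ 2 * eps p) (fun p zeta z => -1 * (f p zeta z).2).
  by apply: (mean_boundedZ rho_range (a := fun _ _ => -1)) m2; exact: bC.
split.
  apply: mean_bounded_ext (mean_boundedD rho_range (poly_bounded_mean_bounded P _ b1) m1) => p zeta z.
  by rewrite /=; ring.
apply: mean_bounded_ext (mean_boundedD rho_range (poly_bounded_mean_bounded P _ b2) mN) => p zeta z.
by rewrite /=; ring.
Qed.

Local Notation gp := (gauss_pair P (rho_xy c)).

Let mean_le (g : hpar -> R) (u : hpar -> R * R -> R * R -> R) : mb g u -> exists2 B : R * nat, 1 <= B.1 & forall (z : Omega -> R * R) p zeta, gp z -> adm T p ->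
  0 <= g p -> `|\int[P]_w u p zeta (z w)| <= B.1 * weight zeta ^+ B.2 * g p.
Proof.
move=> h; have [K [m [K0 hK]]] := mean_boundedP rho_range h.
exists (1 + K, m) => /= [|z p zeta gz ap g0]; first by rewrite lerDl.
apply: le_trans (hK z p zeta gz ap) _.
by rewrite ler_wpM2r// ler_wpM2r ?exprn_ge0 ?weight_ge0// lerDr.
Qed.

Let sqr_le (eps : hpar -> R) (f : hpar -> R * R -> R * R -> R * R) : cpoly_bounded T (fun p => p.2 * eps p) f ->
  exists2 B : R * nat, 1 <= B.1 & forall (z : Omega -> R * R) p zeta, gp z -> adm T p ->
    \int[P]_w cn2 (f p zeta (z w)) <= B.1 * weight zeta ^+ B.2 * (p.2 ^+ 2 * eps p ^+ 2).
Proof.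
move=> [b1 b2]; have [_ g0 _] := b1.
have b : poly_bounded T (fun p => p.2 ^+ 2 * eps p ^+ 2) (fun p zeta z => cn2 (f p zeta z)).
  have h : poly_bounded T (fun p => p.2 ^+ 2 * eps p ^+ 2)
      (fun p zeta z => (f p zeta z).1 * (f p zeta z).1 + (f p zeta z).2 * (f p zeta z).2).
    by apply: poly_boundedD; [have := poly_boundedM b1 b1|have := poly_boundedM b2 b2];
      apply: pb_eq => p; ring.
  by apply: poly_bounded_ext h => p zeta z; rewrite /cn2 !expr2.
have [B B1 hB] := mean_le (poly_bounded_mean_bounded P (rho_xy c) b).
exists B => // z p zeta gz ap; apply: le_trans (ler_norm _) _; apply: hB => //.
by rewrite mulr_ge0 ?sqr_ge0.
Qed.

Let step_bound (eps : hpar -> R) (f : hpar -> R * R -> R * R -> R * R) : (forall p, adm T p -> 0 <= eps p) -> step_err eps f ->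
  exists2 B : R * nat, 1 <= B.1 & forall (z : Omega -> R * R) p zeta, gp z -> adm T p ->
  [/\ `|\int[P]_w (cmul (amp p zeta (z w)) (cconj (f p zeta (z w)))).1|
        <= B.1 * weight zeta ^+ B.2 * (p.2 ^+ 2 * eps p),
      `|\int[P]_w (cmul (amp p zeta (z w)) (cconj (f p zeta (z w)))).2|
        <= B.1 * weight zeta ^+ B.2 * (p.2 ^+ 2 * eps p) &
      \int[P]_w cn2 (f p zeta (z w)) <= B.1 * weight zeta ^+ B.2 * (p.2 ^+ 2 * eps p ^+ 2)].
Proof.
move=> e0 se; have [h1 h2] := step_err_cross se.
have [B1 B11 k1] := mean_le h1; have [B2 B21 k2] := mean_le h2.
have [B3 B31 k3] : exists2 B : R * nat, 1 <= B.1 & forall (z : Omega -> R * R) p zeta, gp z -> adm T p ->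
    \int[P]_w cn2 (f p zeta (z w)) <= B.1 * weight zeta ^+ B.2 * (p.2 ^+ 2 * eps p ^+ 2).
  by apply: sqr_le; have [] := se.
exists (B1.1 + B2.1 + B3.1, (B1.2 + B2.2 + B3.2)%N) => /= [|z p zeta gz ap]; first by lra.
have w1 := weight_ge1 zeta.
have lift (b g : R) (n m : nat) : 1 <= b -> b <= B1.1 + B2.1 + B3.1 -> (n <= m)%N -> 0 <= g ->
    b * weight zeta ^+ n * g <= (B1.1 + B2.1 + B3.1) * weight zeta ^+ m * g.
  move=> b1 bB nm g0; rewrite ler_wpM2r// ler_pM ?exprn_ge0 ?weight_ge0//; first by lra.
  by rewrite ler_weXn2l.
have g0 : 0 <= p.2 ^+ 2 * eps p by rewrite mulr_ge0 ?sqr_ge0 ?e0.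
split.
- apply: le_trans (k1 z p zeta gz ap g0) _; apply: lift => //; first by lra.
  by rewrite -addnA leq_addr.
- apply: le_trans (k2 z p zeta gz ap g0) _; apply: lift => //; first by lra.
  by rewrite addnAC leq_addl.
- apply: le_trans (k3 z p zeta gz ap) _; apply: lift => //; first by lra.
    by rewrite leq_addl.
  by rewrite mulr_ge0 ?sqr_ge0.
Qed.

(** The weight 1/3 on [dd] lets three perturbations together cost k |D|^2. The factor 6 is then
    dictated by the arithmetic-geometric mean inequality, since the square of the cross term is at
    most 8 t^2 k^2 [dd] [rr]. *)
Let young (t x1 x2 k dd rr s1 s2 : R) : 0 <= t -> 0 <= k -> `|x1| <= t * k -> `|x2| <= t * k ->
  0 <= dd -> 0 <= rr -> s1 ^+ 2 + s2 ^+ 2 = dd * rr ->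
  2 * (s1 * x1 - s2 * x2) <= k * (dd / 3 + 6 * t ^+ 2 * rr).
Proof.
move=> t0 k0 h1 h2 d0 r0 e.
pose y := `|s1| + `|s2|.
have y0 : 0 <= y by rewrite addr_ge0.
have y2 : y ^+ 2 <= 2 * (dd * rr).
  rewrite -e /y; have := real_normK (num_real s1); have := real_normK (num_real s2).
  by have := sqr_ge0 (`|s1| - `|s2|); lra.
have a1 : s1 * x1 <= `|s1| * (t * k).
  by apply: le_trans (ler_norm _) _; rewrite normrM ler_wpM2l.
have a2 : - (s2 * x2) <= `|s2| * (t * k).
  by apply: le_trans (ler_norm _) _; rewrite normrN normrM ler_wpM2l.
have b : 2 * (s1 * x1 - s2 * x2) <= k * (2 * t * y) by rewrite /y; lra.
apply: le_trans b _; rewrite ler_wpM2l//.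
have c0 : 0 <= dd / 3 + 6 * t ^+ 2 * rr.
  by rewrite addr_ge0 ?divr_ge0// !mulr_ge0 ?sqr_ge0.
have : (2 * t * y) ^+ 2 <= (dd / 3 + 6 * t ^+ 2 * rr) ^+ 2.
  have : (2 * t * y) ^+ 2 <= 8 * t ^+ 2 * (dd * rr).
    by rewrite !exprMn; have := sqr_ge0 t; nra.
  by have := sqr_ge0 (dd / 3 - 6 * t ^+ 2 * rr); lra.
by rewrite ler_pXn2r// nnegrE// !mulr_ge0.
Qed.

Lemma poly_bounded_cn2 (g : hpar -> R) (f : hpar -> R * R -> R * R -> R * R) : cpoly_bounded T g f ->
  poly_bounded T (fun p => g p * g p) (fun p zeta z => cn2 (f p zeta z)).
Proof.
move=> [h1 h2]; have := poly_boundedD (poly_boundedM h1 h1) (poly_boundedM h2 h2).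
by apply: poly_bounded_ext => p zeta z; rewrite /cn2 !expr2.
Qed.

Let ccst (D : R * R) : cpb 0 0 (fun _ _ _ => D).
Proof. by split; exact: bC. Qed.

Lemma amp_step (z : Omega -> R * R) p zeta (lam : R) (D : R * R) : gp z -> adm T p ->
  \int[P]_w cn2 (amp p zeta (z w)) <= lam ->
  (\int[P]_w (cn2 (cmul (amp p zeta (z w)) D))%:E <= (lam * cn2 D)%:E)%E.
Proof.
move=> gz ap hl.
have i := integrable_poly_bounded rho_range zeta gz ap (poly_bounded_cn2 amp_bounded).
under eq_integral do rewrite cn2M mulrC EFinM.
rewrite ge0_integralZl//.
- rewrite -[X in (_ * X <= _)%E]fineK; last exact: integrable_fin_num i.
  by rewrite -EFinM lee_fin mulrC ler_wpM2r ?cn2_ge0.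
- exact: measurable_int i.
- by move=> w _; rewrite lee_fin cn2_ge0.
- by rewrite lee_fin cn2_ge0.
Qed.

(** The step of the recursion for frozen D, R1, R2, R3. Fluctuations of order k^(1/2) eps enter only
    through means of cross terms, O(k eps), and through squares, O(k eps^2). Both the growth of D
    and the forcing therefore carry a factor k, and N steps cost a bounded factor. *)
Lemma mean_square_step (eps1 eps2 eps3 : hpar -> R)
    (f1 f2 f3 : hpar -> R * R -> R * R -> R * R) :
  (forall p, adm T p -> 0 <= eps1 p) -> (forall p, adm T p -> 0 <= eps2 p) ->
  (forall p, adm T p -> 0 <= eps3 p) ->
  step_err eps1 f1 -> step_err eps2 f2 -> step_err eps3 f3 ->
  exists (K : R) (m : nat), 0 <= K /\ forall (z : Omega -> R * R) p zeta (lam : R), gp z -> adm T p ->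
    \int[P]_w cn2 (amp p zeta (z w)) <= lam -> forall D R1 R2 R3 : R * R,
    (\int[P]_w (cn2 (cadd (cmul (amp p zeta (z w)) D) (cadd (cmul (f1 p zeta (z w)) R1)
        (cadd (cmul (f2 p zeta (z w)) R2) (cmul (f3 p zeta (z w)) R3)))))%:E <=
     ((lam + p.2 ^+ 2) * cn2 D + p.2 ^+ 2 * (K * weight zeta ^+ m) *
        (eps1 p ^+ 2 * cn2 R1 + eps2 p ^+ 2 * cn2 R2 + eps3 p ^+ 2 * cn2 R3))%:E)%E.
Proof.
move=> e1 e2 e3 s1 s2 s3.
have [B1 B11 k1] := step_bound e1 s1.
have [B2 B21 k2] := step_bound e2 s2.
have [B3 B31 k3] := step_bound e3 s3.
pose m0 := (B1.2 + B2.2 + B3.2)%N; pose K0 := B1.1 + B2.1 + B3.1.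
(* 9 = 6 + 3: 6 from [young] and 3 from the squares in [cn2_perturbation_le]. *)
exists (9 * K0 ^+ 2), (m0 * 2)%N; split; first by rewrite mulr_ge0 ?sqr_ge0.
move=> z p zeta lam gz ap hl D R1 R2 R3.
pose B := K0 * weight zeta ^+ m0.
have w1 := weight_ge1 zeta.
have BB : 9 * K0 ^+ 2 * weight zeta ^+ (m0 * 2) = 9 * B ^+ 2 by rewrite /B exprMn -exprM; ring.
have wm n : (n <= m0)%N -> 1 <= weight zeta ^+ n <= weight zeta ^+ m0.
  by move=> nm; rewrite exprn_ege1// ler_weXn2l.
have Ble (b : R * nat) : 1 <= b.1 -> b.1 <= K0 -> (b.2 <= m0)%N -> b.1 * weight zeta ^+ b.2 <= B.
  move=> b1 bK bm; rewrite /B ler_pM ?exprn_ge0 ?weight_ge0//; first by lra.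
  by have /andP[] := wm _ bm.
have B1B : B1.1 * weight zeta ^+ B1.2 <= B.
  by apply: Ble => //; [rewrite /K0; lra|rewrite /m0 -addnA leq_addr].
have B2B : B2.1 * weight zeta ^+ B2.2 <= B.
  by apply: Ble => //; [rewrite /K0; lra|rewrite /m0 (addnC B1.2) -addnA leq_addr].
have B3B : B3.1 * weight zeta ^+ B3.2 <= B.
  by apply: Ble => //; [rewrite /K0; lra|rewrite /m0 leq_addl].
have Bge1 : 1 <= B.
  have K01 : 1 <= K0 by rewrite /K0; lra.
  by have /andP[h _] := wm m0 (leqnn _); rewrite /B -[1]mulr1 ler_pM.
pose X (f : hpar -> R * R -> R * R -> R * R) p zeta z := cmul (amp p zeta z) (cconj (f p zeta z)).
pose Y (R' : R * R) := cmul D (cconj R').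
have one (eps : R) (f : hpar -> R * R -> R * R -> R * R) (b : R) (R' : R * R) : 0 <= eps -> b <= B -> 1 <= b ->
    `|\int[P]_w (X f p zeta (z w)).1| <= b * (p.2 ^+ 2 * eps) ->
    `|\int[P]_w (X f p zeta (z w)).2| <= b * (p.2 ^+ 2 * eps) ->
    \int[P]_w cn2 (f p zeta (z w)) <= b * (p.2 ^+ 2 * eps ^+ 2) ->
    2 * ((Y R').1 * \int[P]_w (X f p zeta (z w)).1 - (Y R').2 * \int[P]_w (X f p zeta (z w)).2)
      + 3 * cn2 R' * \int[P]_w cn2 (f p zeta (z w)) <=
    p.2 ^+ 2 * (cn2 D / 3 + 9 * B ^+ 2 * (eps ^+ 2 * cn2 R')).
  move=> eps0 bB b1 x1 x2 x3.
  have r0 := cn2_ge0 R'; have d0 := cn2_ge0 D; have k0 := sqr_ge0 p.2.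
  have yE : (Y R').1 ^+ 2 + (Y R').2 ^+ 2 = cn2 D * cn2 R' by rewrite /Y /cn2 /=; ring.
  have be : b * (p.2 ^+ 2 * eps) <= (B * eps) * p.2 ^+ 2.
    by rewrite (mulrC (p.2 ^+ 2)) mulrA !ler_wpM2r.
  have t0 : 0 <= B * eps by rewrite mulr_ge0//; lra.
  have yy := young t0 k0 (le_trans x1 be) (le_trans x2 be) d0 r0 yE.
  have x3' : 3 * cn2 R' * \int[P]_w cn2 (f p zeta (z w)) <=
      p.2 ^+ 2 * (3 * B ^+ 2 * (eps ^+ 2 * cn2 R')).
    have : 3 * cn2 R' * \int[P]_w cn2 (f p zeta (z w)) <=
        3 * cn2 R' * (B ^+ 2 * (p.2 ^+ 2 * eps ^+ 2)).
      rewrite ler_wpM2l ?mulr_ge0//; apply: le_trans x3 _.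
      apply: ler_wpM2r; first by rewrite mulr_ge0 ?sqr_ge0.
      by apply: le_trans bB _; rewrite expr2 ler_peMl// (le_trans ler01).
    by move=> h; apply: le_trans h _; rewrite le_eqVlt; apply/orP; left; apply/eqP; ring.
  have : p.2 ^+ 2 * (cn2 D / 3 + 6 * (B * eps) ^+ 2 * cn2 R') +
      p.2 ^+ 2 * (3 * B ^+ 2 * (eps ^+ 2 * cn2 R')) =
      p.2 ^+ 2 * (cn2 D / 3 + 9 * B ^+ 2 * (eps ^+ 2 * cn2 R')) by field.
  by move=> <-; apply: lerD.
have [x11 x12 x13] := k1 z p zeta gz ap.
have [x21 x22 x23] := k2 z p zeta gz ap.
have [x31 x32 x33] := k3 z p zeta gz ap.
have b1 (b : R * nat) : 1 <= b.1 -> 1 <= b.1 * weight zeta ^+ b.2.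
  by move=> h; rewrite -[1]mulr1 ler_pM// exprn_ege1.
have o1 := one _ f1 _ R1 (e1 p ap) B1B (b1 _ B11) x11 x12 x13.
have o2 := one _ f2 _ R2 (e2 p ap) B2B (b1 _ B21) x21 x22 x23.
have o3 := one _ f3 _ R3 (e3 p ap) B3B (b1 _ B31) x31 x32 x33.
have int (g : hpar -> R) (u : hpar -> R * R -> R * R -> R) : poly_bounded T g u -> P.-integrable setT (EFin \o (fun w => u p zeta (z w))).
  by move=> b; exact: (integrable_poly_bounded rho_range zeta gz ap b).
have [bf1 _ _] := s1; have [bf2 _ _] := s2; have [bf3 _ _] := s3.
have bX (g : hpar -> R) (f : hpar -> R * R -> R * R -> R * R) : cpoly_bounded T g f -> cpoly_bounded T (fun p => mono 0 0 p * g p) (X f).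
  by move=> b; exact: cpoly_boundedM amp_bounded (cpoly_bounded_conj b).
have iX1 (g : hpar -> R) (f : hpar -> R * R -> R * R -> R * R) : cpoly_bounded T g f -> P.-integrable setT (EFin \o (fun w => (X f p zeta (z w)).1)).
  by move=> b; case: (bX _ _ b) => b' _; exact: int b'.
have iX2 (g : hpar -> R) (f : hpar -> R * R -> R * R -> R * R) : cpoly_bounded T g f -> P.-integrable setT (EFin \o (fun w => (X f p zeta (z w)).2)).
  by move=> b; case: (bX _ _ b) => _ b'; exact: int b'.
have iN (g : hpar -> R) (f : hpar -> R * R -> R * R -> R * R) : cpoly_bounded T g f -> P.-integrable setT (EFin \o (fun w => cn2 (f p zeta (z w)))).
  by move=> b; exact: int (poly_bounded_cn2 b).
pose term (f : hpar -> R * R -> R * R -> R * R) (R' : R * R) w := 2 * ((Y R').1 * (X f p zeta (z w)).1 - (Y R').2 * (X f p zeta (z w)).2)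
  + 3 * cn2 R' * cn2 (f p zeta (z w)).
have iT (g : hpar -> R) (f : hpar -> R * R -> R * R -> R * R) (R' : R * R) : cpoly_bounded T g f -> P.-integrable setT (EFin \o term f R').
  move=> b; apply: integrable_EFinD; last by apply: integrable_EFinZ; exact: iN b.
  apply: integrable_EFinZ; apply: integrable_EFinB; apply: integrable_EFinZ.
    exact: iX1 b.
  exact: iX2 b.
have iTE (g : hpar -> R) (f : hpar -> R * R -> R * R -> R * R) (R' : R * R) : cpoly_bounded T g f -> \int[P]_w term f R' w =
    2 * ((Y R').1 * \int[P]_w (X f p zeta (z w)).1 - (Y R').2 * \int[P]_w (X f p zeta (z w)).2)
      + 3 * cn2 R' * \int[P]_w cn2 (f p zeta (z w)).
  move=> b; have j1 := iX1 _ _ b; have j2 := iX2 _ _ b; have j3 := iN _ _ b.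
  rewrite RintegralD//; last 2 first.
  - by apply: integrable_EFinZ; apply: integrable_EFinB; apply: integrable_EFinZ.
  - exact: integrable_EFinZ.
  rewrite RintegralZl//; last by apply: integrable_EFinB; apply: integrable_EFinZ.
  rewrite RintegralB//; [|exact: integrable_EFinZ|exact: integrable_EFinZ].
  by rewrite !RintegralZl.
have iA := iN _ _ amp_bounded.
pose S w := cn2 D * cn2 (amp p zeta (z w)) + (term f1 R1 w + (term f2 R2 w + term f3 R3 w)).
have i23 := integrable_EFinD (iT _ _ R2 bf2) (iT _ _ R3 bf3).
have i123 := integrable_EFinD (iT _ _ R1 bf1) i23.
have iAD : P.-integrable setT (EFin \o (fun w => cn2 D * cn2 (amp p zeta (z w)))) by exact: integrable_EFinZ.
have iS : P.-integrable setT (EFin \o S) by exact: integrable_EFinD iAD i123.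
pose V w := cn2 (cadd (cmul (amp p zeta (z w)) D) (cadd (cmul (f1 p zeta (z w)) R1)
        (cadd (cmul (f2 p zeta (z w)) R2) (cmul (f3 p zeta (z w)) R3)))).
have VS w : V w <= S w.
  rewrite /V /S /term /X /Y.
  move: (amp _ _ _) (f1 _ _ _) (f2 _ _ _) (f3 _ _ _) => a u1 u2 u3.
  exact: cn2_perturbation_le.
have mV : measurable_fun setT V.
  have mcc (f : hpar -> R * R -> R * R -> R * R) (g : hpar -> R) (R' : R * R) : cpoly_bounded T g f ->
      measurable_fun setT (fun w => (cmul (f p zeta (z w)) R').1) /\
      measurable_fun setT (fun w => (cmul (f p zeta (z w)) R').2).
    move=> b; have [h1 h2] := cpoly_boundedM b (ccst R'); split.
      by have /measurable_int/measurable_EFinP := int _ _ h1.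
    by have /measurable_int/measurable_EFinP := int _ _ h2.
  have [? ?] := mcc _ _ D amp_bounded; have [? ?] := mcc _ _ R1 bf1.
  have [? ?] := mcc _ _ R2 bf2; have [? ?] := mcc _ _ R3 bf3.
  by apply: measurable_funD; apply: measurable_funX; apply: measurable_funD => //;
    apply: measurable_funD => //; apply: measurable_funD.
have iV : P.-integrable setT (EFin \o V).
  by apply: (le_integrable_EFin mV) iS => w; rewrite ger0_norm ?cn2_ge0//; exact: VS.
have -> : (\int[P]_w (V w)%:E = (\int[P]_w V w)%:E)%E.
  by rewrite /Rintegral fineK//; apply: integrable_fin_num.
rewrite lee_fin; apply: (@le_trans _ _ (\int[P]_w S w)).
  by apply: le_Rintegral => // w _; exact: VS.
rewrite RintegralD// RintegralD//; last exact: iT bf1.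
rewrite (RintegralD _ (iT _ _ R2 bf2) (iT _ _ R3 bf3))//.
rewrite RintegralZl// (iTE _ _ _ bf1) (iTE _ _ _ bf2) (iTE _ _ _ bf3).
have hA : cn2 D * \int[P]_w cn2 (amp p zeta (z w)) <= cn2 D * lam.
  by rewrite ler_wpM2l ?cn2_ge0.
rewrite BB; move: (lerD hA (lerD o1 (lerD o2 o3))) => /le_trans; apply.
by rewrite le_eqVlt; apply/orP; left; apply/eqP; field.
Qed.

End one_step.

(** * Mean-square stability *)

Section stability.
Context d (Omega : measurableType d) (R : realType) (P : probability Omega R).
Variables (c : spde_data R) (T : R).
Hypothesis T0 : 0 <= T.
Hypothesis rho_x_range : 0 <= rho_x c < 1.
Hypothesis rho_y_range : 0 <= rho_y c < 1.
Hypothesis rho_range : -1 <= rho_xy c <= 1.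
Hypothesis stab_x : 2 * rho_x c ^+ 2 * (1 + 2 * `|rho_xy c|) < 1.
Hypothesis stab_y : 2 * rho_y c ^+ 2 * (1 + 2 * `|rho_xy c|) < 1.
Hypothesis stab_xy : 2 * rho_x c * rho_y c
  * (3 * rho_xy c ^+ 2 + 2 * `|rho_xy c| + 1) < 1.

Local Notation ax := (Num.sqrt (rho_x c)).
Local Notation ay := (Num.sqrt (rho_y c)).
Local Notation gp := (gauss_pair P (rho_xy c)).

Let ax2 : ax ^+ 2 = rho_x c.
Proof. by rewrite sqr_sqrtr//; case/andP: rho_x_range. Qed.
Let ay2 : ay ^+ 2 = rho_y c.
Proof. by rewrite sqr_sqrtr//; case/andP: rho_y_range. Qed.

(** The five strict inequalities leave a common gap 1 - b, from which the decay rate s is made. *)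
Let beta_ex : exists2 b : R, 0 <= b < 1 &
  [/\ rho_x c <= b, rho_y c <= b, 2 * rho_x c ^+ 2 * (1 + 2 * `|rho_xy c|) <= b,
      2 * rho_y c ^+ 2 * (1 + 2 * `|rho_xy c|) <= b &
      2 * rho_x c * rho_y c * (3 * rho_xy c ^+ 2 + 2 * `|rho_xy c| + 1) <= b].
Proof.
case/andP: rho_x_range => rx0 rx1; case/andP: rho_y_range => ry0 ry1.
move: stab_x stab_y stab_xy; set u1 := 2 * _ * _; set u2 := 2 * rho_y c ^+ 2 * _; set u3 := _ * _.
move=> h1 h2 h3.
exists (Num.max (rho_x c) (Num.max (rho_y c) (Num.max u1 (Num.max u2 u3)))).
  by rewrite le_max rx0 /= !gt_max rx1 ry1 h1 h2 h3.
by split; rewrite !le_max lexx ?orbT.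
Qed.

Section mean_square.
Variables (z : Omega -> R * R) (p : R * R * R) (zeta : R * R).
Hypothesis gz : gp z.

Let a := p.2 * (ax * sX p zeta).
Let b := p.2 * (ay * sY p zeta).
Let A := quad c p zeta.
Let r := rho_xy c * a * b.

Let AE : A = a ^+ 2 + b ^+ 2.
Proof. by rewrite /A /quad /a /b !exprMn ax2 ay2; ring. Qed.

Let mz1 : measurable_fun setT (fun w => (z w).1).
Proof. exact: measurableT_comp measurable_fst gz.1. Qed.
Let mz2 : measurable_fun setT (fun w => (z w).2).
Proof. exact: measurableT_comp measurable_snd gz.1. Qed.

(** The linear noise term W has variance [A] + 2 [r], and the squared modulus of [num] is (1 +
    A/2)^2 - (A/2) W^2 + W^4/4, so the second and fourth Gaussian moments suffice. *)
Let num_norm2 : P.-integrable setT (EFin \o (fun w => cn2 (num c p zeta (z w)))) /\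
  \int[P]_w cn2 (num c p zeta (z w)) = 1 + A + A ^+ 2 / 2 + 2 * A * r + 3 * r ^+ 2.
Proof.
have m2 := gaussian_moment2 mz1 mz2 rho_range gz.2 a b.
have m4 := gaussian_moment4 mz1 mz2 rho_range gz.2 a b.
have mW : measurable_fun setT (fun w => a * (z w).1 + b * (z w).2).
  by apply: measurable_funD; apply: measurable_funM.
have i n : (\int[P]_w ((a * (z w).1 + b * (z w).2) ^+ n.*2)%:E < +oo)%E ->
    P.-integrable setT (EFin \o (fun w => (a * (z w).1 + b * (z w).2) ^+ n.*2)).
  move=> h; apply/integrableP; split; first by apply/measurable_EFinP; exact: measurable_funX.
  under eq_integral => w _ do
    rewrite /= ger0_norm ?exprn_even_ge0 ?odd_double//.
  exact: h.
have i2 := i 1%N; have i4 := i 2%N; rewrite /= m2 m4 in i2 i4.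
have {}i2 : P.-integrable setT (EFin \o (fun w => (a * (z w).1 + b * (z w).2) ^+ 2)) := i2 (ltry _).
have {}i4 : P.-integrable setT (EFin \o (fun w => (a * (z w).1 + b * (z w).2) ^+ 4)) := i4 (ltry _).
have e2 : \int[P]_w ((a * (z w).1 + b * (z w).2) ^+ 2) = A + 2 * r.
  by rewrite /Rintegral m2/= AE /r; ring.
have e4 : \int[P]_w ((a * (z w).1 + b * (z w).2) ^+ 4) = 3 * (A + 2 * r) ^+ 2.
  by rewrite /Rintegral m4/= AE /r; ring.
have numE w : cn2 (num c p zeta (z w)) = (1 + A / 2) ^+ 2 +
    ((- (A / 2)) * (a * (z w).1 + b * (z w).2) ^+ 2 + 4^-1 * (a * (z w).1 + b * (z w).2) ^+ 4).
  rewrite /num /cn2 -/A /= (_ : incr c p zeta (z w) = a * (z w).1 + b * (z w).2); last first.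
    by rewrite /incr /a /b; ring.
  by move: (_ + b * _) => W; field.
have ic : P.-integrable setT (EFin \o (fun _ : Omega => (1 + A / 2) ^+ 2)).
  exact: finite_measure_integrable_cst.
have j2 := integrable_EFinZ (- (A / 2)) i2; have j4 := integrable_EFinZ 4^-1 i4.
split.
  rewrite (_ : EFin \o _ = EFin \o (fun w => (1 + A / 2) ^+ 2 +
    ((- (A / 2)) * (a * (z w).1 + b * (z w).2) ^+ 2 + 4^-1 * (a * (z w).1 + b * (z w).2) ^+ 4))).
    exact: integrable_EFinD ic (integrable_EFinD j2 j4).
  by apply/funext => w /=; rewrite numE.
under eq_Rintegral do rewrite numE.
rewrite (RintegralD _ ic (integrable_EFinD j2 j4))// (RintegralD _ j2 j4)//.
have -> : \int[P]_w (1 + A / 2) ^+ 2 = (1 + A / 2) ^+ 2.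
  by rewrite /Rintegral integral_cst//= probability_setT mule1.
by rewrite !RintegralZl// e2 e4; field.
Qed.

Lemma amp_norm2 : \int[P]_w cn2 (amp c p zeta (z w)) =
  (1 + A + A ^+ 2 / 2 + 2 * A * r + 3 * r ^+ 2) / cn2 (den c p zeta).
Proof.
have [inum <-] := num_norm2.
under eq_Rintegral do rewrite /amp cn2M cn2V ?cn2_den_neq0//.
by rewrite RintegralZl// mulrC.
Qed.

End mean_square.

(** Here [k] is the square root of the time step. Put e = k^2 x^2, f = k^2 y^2, u = rho_x e, v =
    rho_y f and m = |rho_xy|. The left side is at most 1 + u + v + (1 + 2m)(u^2 + v^2)/2 + (3m^2 +
    2m + 1) u v. In the comparison with (1 + (e + f)/2)^2, coefficient by coefficient, the terms in
    e^2, f^2 and e f are exactly the three stability assumptions. *)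
Let stab_algebra (be x y X Y k A r P' : R) :
  A = (k * (ax * x)) ^+ 2 + (k * (ay * y)) ^+ 2 ->
  r = rho_xy c * (k * (ax * x)) * (k * (ay * y)) -> P' = k ^+ 2 * (X + Y) -> 0 <= be -> be < 1 ->
  rho_x c <= be -> rho_y c <= be -> 2 * rho_x c ^+ 2 * (1 + 2 * `|rho_xy c|) <= be ->
  2 * rho_y c ^+ 2 * (1 + 2 * `|rho_xy c|) <= be ->
  2 * rho_x c * rho_y c * (3 * rho_xy c ^+ 2 + 2 * `|rho_xy c| + 1) <= be ->
  x ^+ 2 <= X -> y ^+ 2 <= Y ->
  1 + A + A ^+ 2 / 2 + 2 * A * r + 3 * r ^+ 2 <= (1 - be) + be * (1 + P' / 2) ^+ 2.
Proof.
move=> A_def r_def P'_def be0 be1 h1 h2 h3 h4 h5 hx hy.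
case/andP: rho_x_range => rx0 _; case/andP: rho_y_range => ry0 _.
have k0 := sqr_ge0 k.
pose u := rho_x c * (k ^+ 2 * x ^+ 2); pose v := rho_y c * (k ^+ 2 * y ^+ 2).
pose e := k ^+ 2 * x ^+ 2; pose f := k ^+ 2 * y ^+ 2.
have e0 : 0 <= e by rewrite mulr_ge0 ?sqr_ge0.
have f0 : 0 <= f by rewrite mulr_ge0 ?sqr_ge0.
have AE : A = u + v by rewrite A_def /u /v !exprMn ax2 ay2; ring.
have r2 : r ^+ 2 = rho_xy c ^+ 2 * (u * v).
  by rewrite r_def /u /v !exprMn ax2 ay2; ring.
have u0 : 0 <= u by rewrite mulr_ge0.
have v0 : 0 <= v by rewrite mulr_ge0.
pose m := `|rho_xy c|; have m0 : 0 <= m := normr_ge0 _.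
have mm : rho_xy c ^+ 2 = m ^+ 2 by rewrite /m real_normK ?num_real.
have rle : 2 * A * r <= m * (u ^+ 2 + v ^+ 2 + 2 * (u * v)).
  pose s := k * (ax * x); pose t := k * (ay * y).
  have su : s ^+ 2 = u by rewrite /s /u !exprMn ax2; ring.
  have tv : t ^+ 2 = v by rewrite /t /v !exprMn ay2; ring.
  have : r <= m * `|s * t|.
    by rewrite r_def -mulrA -normrM ler_norm.
  move=> hr; apply: (@le_trans _ _ (2 * A * (m * `|s * t|))).
    by rewrite ler_wpM2l// mulr_ge0// AE addr_ge0.
  have st : 2 * `|s * t| <= u + v.
    rewrite -su -tv -(real_normK (num_real s)) -(real_normK (num_real t)) normrM.
    by have := sqr_ge0 (`|s| - `|t|); lra.
  have : m * (2 * `|s * t|) * (u + v) <= m * (u + v) * (u + v).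
    by rewrite !ler_wpM2r ?ler_wpM2l ?addr_ge0.
  by rewrite AE; lra.
have e1 : u <= be * e by rewrite /u ler_wpM2r.
have f1 : v <= be * f by rewrite /v ler_wpM2r.
have u2 : (1 + 2 * m) * u ^+ 2 / 2 <= be * e ^+ 2 / 4.
  by have := ler_wpM2r (sqr_ge0 e) h3; rewrite -/m /u -/e; lra.
have v2 : (1 + 2 * m) * v ^+ 2 / 2 <= be * f ^+ 2 / 4.
  by have := ler_wpM2r (sqr_ge0 f) h4; rewrite -/m /v -/f; lra.
have uv : (3 * m ^+ 2 + 2 * m + 1) * (u * v) <= be * (e * f) / 2.
  by have := ler_wpM2r (mulr_ge0 e0 f0) h5; rewrite -/m mm /u /v -/e -/f; lra.
apply: (@le_trans _ _ ((1 - be) + be * (1 + (e + f) / 2) ^+ 2)).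
  by rewrite AE r2 mm; move: rle; rewrite AE; lra.
have ef : e + f <= P' by rewrite P'_def mulrDr lerD// ler_wpM2l.
rewrite lerD2l ler_wpM2l// lerXn2r ?nnegrE ?addr_ge0 ?divr_ge0 ?(le_trans _ ef) ?addr_ge0//.
by lra.
Qed.

Lemma stability : exists2 s : R, 0 < s &
  (forall z (p : R * R * R) zeta, gp z -> `|p.1.1 * zeta.1| <= pi -> `|p.1.2 * zeta.2| <= pi ->
     \int[P]_w cn2 (amp c p zeta (z w)) <=
     expR (- (2 * s * Num.min 1 (p.2 ^+ 2 * (zeta.1 ^+ 2 + zeta.2 ^+ 2))))) /\
  (forall (p : R * R * R) zeta z, cn2 (exact c p zeta z) <=
     expR (- (2 * s * (p.2 ^+ 2 * (zeta.1 ^+ 2 + zeta.2 ^+ 2))))).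
Proof.
have [be /andP[be0 be1] [h1 h2 h3 h4 h5]] := beta_ex.
(* 1/36 is the 1/9 of [cosq_ge], halved to pass from D >= 1 + l/9 to 1 - 1/D >= l/18, and halved
   again for the exponent 2s. *)
exists ((1 - be) / 36) => [|]; first by rewrite divr_gt0 ?subr_gt0.
split=> [z p zeta gz px py|p zeta z]; last first.
  have nrm (t : R) : cn2 (rot t) = 1 by rewrite /cn2 /rot/= sqrrN cos2Dsin2.
  rewrite /exact cn2M nrm mulr1 /cn2 /exact_drift /= sqrrN !exprMn -mulrDr cos2Dsin2 mulr1.
  rewrite -expRM_natl ler_expR.
  have := sqr_ge0 p.2; have := sqr_ge0 zeta.1; have := sqr_ge0 zeta.2.
  rewrite /decay; move: (zeta.1 ^+ 2) (zeta.2 ^+ 2) (p.2 ^+ 2) => u v k v0 u0 k0.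
  have ku := mulr_ge0 k0 u0; have kv := mulr_ge0 k0 v0.
  have := ler_wpM2l ku h1; have := ler_wpM2l kv h2.
  have := ler_wpM2l ku (ltW be1); have := ler_wpM2l kv (ltW be1).
  by move: ku kv; lra.
rewrite amp_norm2//.
set A := quad _ _ _; set r := rho_xy c * _ * _.
pose P' := p.2 ^+ 2 * (mX p zeta + mY p zeta).
have sx := sinq2_le_cosq p.1.1 zeta.1; have sy := sinq2_le_cosq p.1.2 zeta.2.
have AE : A = (p.2 * (ax * sX p zeta)) ^+ 2 + (p.2 * (ay * sY p zeta)) ^+ 2.
  by rewrite /A /quad !exprMn ax2 ay2; ring.
have nb := @stab_algebra be (sX p zeta) (sY p zeta) (mX p zeta) (mY p zeta) p.2 A r P'
  AE erefl erefl be0 be1 h1 h2 h3 h4 h5 sx sy.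
have P0 : 0 <= P' by rewrite mulr_ge0 ?sqr_ge0// addr_ge0// cosq_ge0.
have D1 : 1 <= (1 + P' / 2) ^+ 2 by rewrite exprn_ege1// lerDl divr_ge0.
have dD : (1 + P' / 2) ^+ 2 <= cn2 (den c p zeta).
  by rewrite /cn2 /den /= -/P' lerDl sqr_ge0.
set q := p.2 ^+ 2 * _.
have q0 : 0 <= q by rewrite mulr_ge0 ?sqr_ge0// addr_ge0 ?sqr_ge0.
have qP : q / 9 <= P'.
  rewrite /q /P' -mulrA ler_wpM2l ?sqr_ge0//.
  by have := cosq_ge px; have := cosq_ge py; rewrite /mX /mY; lra.
set l := Num.min 1 q.
have l1 : 0 <= l <= 1 by rewrite le_min ler01 q0 ge_min lexx.
have lq : l <= q by rewrite ge_min lexx orbT.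
apply: (@le_trans _ _ (1 - (1 - be) * l / 18)); last first.
  by have := @expR_ge1Dx R (- (2 * ((1 - be) / 36) * l)); lra.
rewrite ler_pdivrMr; last by apply: lt_le_trans dD; apply: lt_le_trans D1.
have F0 : 0 <= 1 - (1 - be) * l / 18 by nra.
apply: le_trans nb _; apply: le_trans (ler_wpM2l F0 dD).
have lP : l / 9 <= P' by lra.
move: D1 lP; set D := (1 + P' / 2) ^+ 2 => D1 lP.
have DE : 1 + P' <= D by rewrite /D; have := sqr_ge0 P'; lra.
suff : 0 <= (1 - be) * (D - 1 - l / 18 * D) by lra.
rewrite mulr_ge0 ?subr_ge0 ?(ltW be1)//.
have : (1 + l / 9) * (1 - l / 18) <= D * (1 - l / 18) by rewrite ler_wpM2r//; lra.
by nra.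
Qed.

End stability.

(** * Several time steps *)

Section measurable_pairs.
Context d (V : measurableType d) {R : realType}.
Implicit Types f g : V -> R * R.

Lemma measurable_fun1 f : measurable_fun setT f -> measurable_fun setT (fun x => (f x).1).
Proof. by move=> mf; exact: measurableT_comp measurable_fst mf. Qed.

Lemma measurable_fun2 f : measurable_fun setT f -> measurable_fun setT (fun x => (f x).2).
Proof. by move=> mf; exact: measurableT_comp measurable_snd mf. Qed.

Lemma measurable_cadd f g : measurable_fun setT f -> measurable_fun setT g ->
  measurable_fun setT (fun x => cadd (f x) (g x)).
Proof.
move=> mf mg; have [f1 f2] := (measurable_fun1 mf, measurable_fun2 mf).
have [g1 g2] := (measurable_fun1 mg, measurable_fun2 mg).
by apply: measurable_fun_pair; exact: measurable_funD.
Qed.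

Lemma measurable_csub f g : measurable_fun setT f -> measurable_fun setT g ->
  measurable_fun setT (fun x => csub (f x) (g x)).
Proof.
move=> mf mg; have [f1 f2] := (measurable_fun1 mf, measurable_fun2 mf).
have [g1 g2] := (measurable_fun1 mg, measurable_fun2 mg).
by apply: measurable_fun_pair; exact: measurable_funB.
Qed.

Lemma measurable_cmul f g : measurable_fun setT f -> measurable_fun setT g ->
  measurable_fun setT (fun x => cmul (f x) (g x)).
Proof.
move=> mf mg; have [f1 f2] := (measurable_fun1 mf, measurable_fun2 mf).
have [g1 g2] := (measurable_fun1 mg, measurable_fun2 mg).
apply: measurable_fun_pair; first by apply: measurable_funB; exact: measurable_funM.
by apply: measurable_funD; exact: measurable_funM.
Qed.

Lemma measurable_cn2 f : measurable_fun setT f -> measurable_fun setT (fun x => cn2 (f x)).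
Proof.
move=> mf; have [f1 f2] := (measurable_fun1 mf, measurable_fun2 mf).
by apply: measurable_funD; exact: measurable_funX.
Qed.

End measurable_pairs.

(** * The joint recursion and its averaged step *)

Section multi_step.
Context d (Omega : measurableType d) (R : realType) (P : probability Omega R).
Variables (c : spde_data R) (T : R).
Hypothesis T0 : 0 <= T.
Hypothesis rho_x_range : 0 <= rho_x c < 1.
Hypothesis rho_y_range : 0 <= rho_y c < 1.
Hypothesis rho_range : -1 <= rho_xy c <= 1.

Local Notation C := (R * R)%type.
Local Notation hpar := (R * R * R)%type.
Local Notation gp := (gauss_pair P (rho_xy c)).

(* The states of the full scheme, of the scheme with h = 0, of the solution, and
   of the term of the expansion that is linear in h^2. *)
Definition sweep (p : hpar) (zeta : C) (s : C * C * C * C) (z : C) : C * C * C * C :=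
  (cmul (amp c p zeta z) s.1.1.1, cmul (amp c (flat p) zeta z) s.1.1.2,
   cmul (exact c p zeta z) s.1.2,
   cmul (exact c p zeta z) (cadd s.2 (cmul (ystep c p zeta z) s.1.2))).
Definition sweep0 : C * C * C * C := ((1, 0), (1, 0), (1, 0), (0, 0)).

Lemma measurable_of_cpoly (g : hpar -> R) (f : hpar -> C -> C -> C) p : cpoly_bounded T g f ->
  measurable_fun setT (fun u : C * C => f p u.1 u.2).
Proof.
move=> [[m1 _ _] [m2 _ _]].
rewrite (_ : (fun u => _) = (fun u : C * C => ((f p u.1 u.2).1, (f p u.1 u.2).2))).
  exact: measurable_fun_pair.
by apply/funext => u; rewrite -surjective_pairing.
Qed.

Lemma measurable_amp p : measurable_fun setT (fun u : C * C => amp c p u.1 u.2).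
Proof. exact: measurable_of_cpoly (amp_bounded c T0). Qed.

Lemma measurable_exact p : measurable_fun setT (fun u : C * C => exact c p u.1 u.2).
Proof. exact: measurable_of_cpoly (exact_bounded T0 rho_x_range rho_y_range). Qed.

Lemma measurable_ystep p : measurable_fun setT (fun u : C * C => ystep c p u.1 u.2).
Proof. exact: measurable_of_cpoly (ystep_bounded c T0). Qed.

Section joint.
Context d' (V : measurableType d').
Variables (zeta : V -> C) (s : V -> C * C * C * C) (z : V -> C).
Hypothesis mzeta : measurable_fun setT zeta.
Hypothesis ms : measurable_fun setT s.
Hypothesis mz : measurable_fun setT z.

Lemma measurable_sweep p : measurable_fun setT (fun x => sweep p (zeta x) (s x) (z x)).
Proof.
have mu : measurable_fun setT (fun x => (zeta x, z x)) by exact: measurable_fun_pair.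
have ma := measurableT_comp (measurable_amp p) mu.
have ma0 := measurableT_comp (measurable_amp (flat p)) mu.
have me := measurableT_comp (measurable_exact p) mu.
have my := measurableT_comp (measurable_ystep p) mu.
have s4 := measurableT_comp measurable_snd ms.
have s1 := measurableT_comp measurable_fst ms.
have s3 := measurableT_comp measurable_snd s1.
have s2 := measurableT_comp measurable_fst s1.
have s22 := measurableT_comp measurable_snd s2.
have s21 := measurableT_comp measurable_fst s2.
apply: measurable_fun_pair; last first.
  by apply: measurable_cmul => //; apply: measurable_cadd => //; exact: measurable_cmul.
apply: measurable_fun_pair; last exact: measurable_cmul.
by apply: measurable_fun_pair; exact: measurable_cmul.
Qed.

End joint.

Variables (N : nat) (X : nat -> Omega -> C).
Hypothesis gX : forall n, gp (X n).
Hypothesis indep : forall A : nat -> set C, (forall l, measurable (A l)) ->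
  P [set w | forall l, (l < N)%N -> A l (X l w)] =
  (\prod_(l < N) P (X l @^-1` A l))%E.

Definition st p zeta n w := state X (sweep p zeta) sweep0 n w.

Let mX n : measurable_fun setT (X n). Proof. exact: (gX n).1. Qed.

Lemma measurable_st p n : measurable_fun setT (fun u : C * Omega => st p u.1 n u.2).
Proof.
elim: n => [|n IH]; first exact: measurable_cst.
apply: measurable_sweep => //.
exact: measurableT_comp (mX n) measurable_snd.
Qed.

Lemma measurable_st_w p zeta n : measurable_fun setT (st p zeta n).
Proof.
by apply: (measurableT_comp (measurable_st p n) (pair1_measurable zeta)).
Qed.

Local Notation E f := (\int[P]_w (f w)%:E)%E.

(** [freezing] turns a bound for every frozen state [s] into a bound for the random state after n
    steps. *)
Lemma st_step_le p zeta n (D R1 R2 R3 : C * C * C * C -> C) (L K e1 e2 e3 A B1 B2 B3 : R) :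
  (n < N)%N ->
  measurable_fun setT D -> measurable_fun setT R1 -> measurable_fun setT R2 ->
  measurable_fun setT R3 ->
  0 <= L -> 0 <= K -> 0 <= e1 -> 0 <= e2 -> 0 <= e3 ->
  (forall s, (E (fun w => cn2 (D (sweep p zeta s (X n w)))) <=
     (L * cn2 (D s) + K * (e1 * cn2 (R1 s) + e2 * cn2 (R2 s) + e3 * cn2 (R3 s)))%:E)%E) ->
  (E (fun w => cn2 (D (st p zeta n w))) <= A%:E)%E ->
  (E (fun w => cn2 (R1 (st p zeta n w))) <= B1%:E)%E ->
  (E (fun w => cn2 (R2 (st p zeta n w))) <= B2%:E)%E ->
  (E (fun w => cn2 (R3 (st p zeta n w))) <= B3%:E)%E ->
  (E (fun w => cn2 (D (st p zeta n.+1 w))) <= (L * A + K * (e1 * B1 + e2 * B2 + e3 * B3))%:E)%E.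
Proof.
move=> nN mD m1 m2 m3 L0 K0 e10 e20 e30 h hA h1 h2 h3.
have mphi : measurable_fun setT (fun q : (C * C * C * C) * C => sweep p zeta q.1 q.2).
  by apply: measurable_sweep.
have mf : measurable_fun setT (fun q : (C * C * C * C) * C =>
    (cn2 (D (sweep p zeta q.1 q.2)))%:E).
  by apply/measurable_EFinP; apply: measurable_cn2; exact: measurableT_comp mD mphi.
have := freezing mX indep sweep0 mphi nN mf; rewrite /= => ->; last first.
  by move=> q; rewrite lee_fin cn2_ge0.
have mst := measurable_st_w p zeta n.
have mcn (G : C * C * C * C -> C) : measurable_fun setT G ->
    measurable_fun setT (fun w => cn2 (G (st p zeta n w))).
  by move=> mG; apply: measurable_cn2; exact: measurableT_comp mG mst.
pose S s := L * cn2 (D s) + K * (e1 * cn2 (R1 s) + e2 * cn2 (R2 s) + e3 * cn2 (R3 s)).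
have cG (G : C * C * C * C -> C) w (a : R) : 0 <= a -> 0 <= a * cn2 (G (st p zeta n w)).
  by move=> a0; rewrite mulr_ge0 ?cn2_ge0.
apply: (@le_trans _ _ (E (fun w => S (st p zeta n w)))).
  apply: ge0_le_integral => //.
  - by move=> w _; apply: integral_ge0 => w' _; rewrite lee_fin cn2_ge0.
  (* The inner integral is rewritten against the law of the increment, where Tonelli's theorem gives
     its measurability in the state. *)
  - rewrite (_ : (fun w => _) = (fubini_F (distribution P (mfun_of (mX n)))
        (fun q : (C * C * C * C) * C => (cn2 (D (sweep p zeta q.1 q.2)))%:E)) \o st p zeta n).
      by apply: measurableT_comp mst; apply: measurable_fun_fubini_tonelli_F => // q; rewrite lee_fin cn2_ge0.
    apply/funext => w; rewrite /= /fubini_F ge0_integral_distribution//=.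
      exact: measurableT_comp mf (pair1_measurable _).
    by move=> q; rewrite lee_fin cn2_ge0.
  - apply/measurable_EFinP; apply: measurable_funD.
      by apply: measurable_funM => //; exact: mcn.
    apply: measurable_funM => //; apply: measurable_funD; first apply: measurable_funD;
      by apply: measurable_funM => //; exact: mcn.
rewrite {}/S.
have mcE (G : C * C * C * C -> C) (a : R) : measurable_fun setT G ->
    measurable_fun setT (fun w => (a * cn2 (G (st p zeta n w)))%:E).
  by move=> mG; apply/measurable_EFinP; apply: measurable_funM => //; exact: mcn.
have one (G : C * C * C * C -> C) (a B : R) : measurable_fun setT G -> 0 <= a ->
    (E (fun w => cn2 (G (st p zeta n w))) <= B%:E)%E ->
    (E (fun w => (a * cn2 (G (st p zeta n w)))%R) <= (a * B)%:E)%E.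
  move=> mG a0 hB; under eq_integral do rewrite EFinM.
  rewrite ge0_integralZl//.
  - by rewrite EFinM lee_wpmul2l.
  - by apply/measurable_EFinP; exact: mcn.
  - by move=> w _; rewrite lee_fin cn2_ge0.
have SE (a b1 b2 b3 : R) : (L * a + K * (e1 * b1 + e2 * b2 + e3 * b3))%:E =
    ((L * a)%:E + ((K * e1 * b1)%:E + (K * e2 * b2)%:E + (K * e3 * b3)%:E))%E.
  by rewrite -!EFinD; congr EFin; ring.
under eq_integral do rewrite SE.
rewrite SE.
have nn (G : C * C * C * C -> C) (a : R) : 0 <= a -> forall w, setT w -> (0%R <= (a * cn2 (G (st p zeta n w)))%:E)%E.
  by move=> a0 w _; rewrite lee_fin cG.
have K1 := mulr_ge0 K0 e10; have K2 := mulr_ge0 K0 e20; have K3 := mulr_ge0 K0 e30.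
have n1 := nn R1 _ K1; have n2 := nn R2 _ K2; have n3 := nn R3 _ K3; have nD := nn D _ L0.
have q1 := mcE R1 (K * e1) m1; have q2 := mcE R2 (K * e2) m2; have q3 := mcE R3 (K * e3) m3.
have qD := mcE D L mD.
rewrite ge0_integralD//; last 2 first.
- by move=> w iw; rewrite !adde_ge0 ?n1 ?n2 ?n3.
- by apply: emeasurable_funD => //; exact: emeasurable_funD.
rewrite ge0_integralD//; last 2 first.
- by move=> w iw; rewrite !adde_ge0 ?n1 ?n2 ?n3.
- exact: emeasurable_funD.
rewrite ge0_integralD//.
by apply: leeD; [exact: one|apply: leeD; [apply: leeD|]; exact: one].
Qed.

End multi_step.

(** * A discrete Gronwall inequality with geometric decay *)

Section gronwall.
Context {R : realType}.

(** The forcing decays at the rate of the homogeneous recursion, so n steps add up to about n k B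
    lam^n, with n k <= T. The lower bound [lam0] makes up for a missing power of lam and bounds (1 +
    k/lam)^n by e^(T/lam0). *)
Lemma gronwall_geometric (N : nat) (a : nat -> \bar R) (T lam lam0 k B : R) :
  0 < lam0 -> lam0 <= lam -> 0 <= k -> 0 <= B -> N%:R * k <= T -> (a 0%N <= 0)%E ->
  (forall n A, (n < N)%N -> (a n <= A%:E)%E ->
     (a n.+1 <= ((lam + k) * A + k * (B * lam ^+ n))%:E)%E) ->
  forall n, (n <= N)%N -> (a n <= (T * expR (T / lam0) / lam0 * B * lam ^+ n)%:E)%E.
Proof.
move=> l0 ll k0 B0 Nk a0 step.
have lam_gt0 : 0 < lam by exact: lt_le_trans ll.
have lk : 0 <= lam + k by rewrite addr_ge0// ltW.
have claim n : (n <= N)%N -> (a n <= (n%:R * k * B * (lam + k) ^+ n / lam0)%:E)%E.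
  elim: n => [_|n IH nN]; first by rewrite !mul0r.
  apply: le_trans (step n _ nN (IH (ltnW nN))) _; rewrite lee_fin.
  have h1 : lam ^+ n * lam0 <= (lam + k) ^+ n * (lam + k).
    apply: ler_pM => //; [exact/exprn_ge0/ltW|exact: ltW| |].
      by rewrite lerXn2r ?nnegrE ?(ltW lam_gt0)// lerDl.
    by rewrite (le_trans ll)// lerDl.
  have h2 : lam ^+ n <= (lam + k) ^+ n * (lam + k) / lam0 by rewrite ler_pdivlMr.
  have kB := mulr_ge0 k0 B0.
  have := ler_wpM2l kB h2.
  rewrite -natr1 exprS.
  have -> : (lam + k) * (n%:R * k * B * (lam + k) ^+ n / lam0) =
    n%:R * k * B * ((lam + k) * (lam + k) ^+ n) / lam0 by ring.
  have -> : k * (B * lam ^+ n) = k * B * lam ^+ n by ring.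
  have -> : (n%:R + 1) * k * B * ((lam + k) * (lam + k) ^+ n) / lam0 =
    n%:R * k * B * ((lam + k) * (lam + k) ^+ n) / lam0 + k * B * ((lam + k) ^+ n * (lam + k) / lam0).
    by ring.
  by move=> ?; rewrite lerD2l.
move=> n nN; apply: le_trans (claim n nN) _; rewrite lee_fin.
have {}Nk : n%:R * k <= T by apply: le_trans Nk; rewrite ler_wpM2r// ler_nat.
have Nk0 : 0 <= n%:R * k by rewrite mulr_ge0.
have e : (lam + k) ^+ n <= lam ^+ n * expR (T / lam0).
  have -> : lam + k = lam * (1 + k / lam) by field; exact: lt0r_neq0.
  rewrite exprMn ler_wpM2l ?exprn_ge0 ?(ltW lam_gt0)//.
  apply: (@le_trans _ _ (expR (k / lam) ^+ n)).
    rewrite lerXn2r ?nnegrE ?expR_ge0 ?addr_ge0 ?divr_ge0 ?(ltW lam_gt0)//.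
    exact: expR_ge1Dx.
  rewrite -expRM_natl ler_expR.
  have lV : lam^-1 <= lam0^-1 by rewrite lef_pV2 ?posrE.
  have : n%:R * k * lam^-1 <= T * lam0^-1 by rewrite ler_pM// invr_ge0 ltW.
  by rewrite mulrA.
have h : n%:R * k * (lam + k) ^+ n <= T * (lam ^+ n * expR (T / lam0)).
  by rewrite ler_pM ?exprn_ge0.
have Bl : 0 <= B / lam0 by rewrite divr_ge0 ?(ltW l0).
have := ler_wpM2r Bl h; congr (_ <= _); ring.
Qed.

End gronwall.

(** * Closed form of the exact state and of the h^2 correction *)

Section explicit_state.
Context d (Omega : measurableType d) (R : realType).
Variable c : spde_data R.
Local Notation C := (R * R)%type.
Variable X : nat -> Omega -> C.

(** n steps of length k amount to one step of length n k, whose normalised increment is n^(-1/2)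
    times the sum of theirs; [long_step] is the parameter of that step. *)
Definition scaled_sum (n : nat) (w : Omega) : C :=
  ((\sum_(l < n) (X l w).1) / Num.sqrt n%:R, (\sum_(l < n) (X l w).2) / Num.sqrt n%:R).
Definition long_step (p : R * R * R) (n : nat) : R * R * R := (p.1.1, p.1.2, Num.sqrt n%:R * p.2).

Lemma exactE (p : R * R * R) (zeta z : C) : exact c p zeta z =
  (expR (- decay c p zeta) * cos (drift c p zeta + incr c (flat p) zeta z),
   - (expR (- decay c p zeta) * sin (drift c p zeta + incr c (flat p) zeta z))).
Proof. by rewrite cosD sinD /exact /exact_drift /rot; apply: cplxP; rewrite /=; ring. Qed.

Let long_sqr (p : R * R * R) n : (Num.sqrt n%:R * p.2) ^+ 2 = n%:R * p.2 ^+ 2.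
Proof. by rewrite exprMn sqr_sqrtr. Qed.

Let long_lin (p : R * R * R) n (w : Omega) (u v : R) :
  Num.sqrt n%:R * p.2 * (u * (scaled_sum n w).1 + v * (scaled_sum n w).2) =
  p.2 * (u * \sum_(l < n) (X l w).1 + v * \sum_(l < n) (X l w).2).
Proof.
(* For n = 0 the division by [Num.sqrt 0] is harmless: both sides are 0. *)
case: n => [|n]; first by rewrite !big_ord0 sqrtr0 !mulr0 !mul0r addr0 mulr0.
by rewrite /scaled_sum /=; field; rewrite sqrtr_eq0 -ltNge ltr0Sn.
Qed.

(** [exact] is the exponential of an expression linear in k and the increments, and [ystep] is
    linear in them. Products and sums over n steps thus collapse to one long step. *)
Lemma exact_state p zeta n w :
  (state X (sweep c p zeta) (sweep0 R) n w).1.2 =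
    exact c (long_step p n) zeta (scaled_sum n w) /\
  (state X (sweep c p zeta) (sweep0 R) n w).2 =
    cmul (ystep c (long_step p n) zeta (scaled_sum n w))
      (exact c (long_step p n) zeta (scaled_sum n w)).
Proof.
have sq := long_sqr p.
have iE m u : incr c (flat (long_step p m)) zeta (scaled_sum m u) =
    p.2 * (Num.sqrt (rho_x c) * zeta.1 * \sum_(l < m) (X l u).1
      + Num.sqrt (rho_y c) * zeta.2 * \sum_(l < m) (X l u).2).
  by rewrite /incr /sX /sY /sinq /= eqxx long_lin.
have i1E m u : incr1 c (long_step p m) zeta (scaled_sum m u) =
    p.2 * (Num.sqrt (rho_x c) * s1X p zeta * \sum_(l < m) (X l u).1
      + Num.sqrt (rho_y c) * s1Y p zeta * \sum_(l < m) (X l u).2).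
  by rewrite /incr1 /s1X /s1Y /= long_lin.
have aE m : alpha c (long_step p m) zeta = alpha c p zeta by [].
have dE m : drift c (long_step p m) zeta = m%:R * drift c p zeta.
  by rewrite /drift /= sq; ring.
have eE m : decay c (long_step p m) zeta = m%:R * decay c p zeta.
  by rewrite /decay /= sq; ring.
have expE m : exact c (long_step p m.+1) zeta (scaled_sum m.+1 w) =
    cmul (exact c p zeta (X m w)) (exact c (long_step p m) zeta (scaled_sum m w)).
  rewrite !exactE !iE !eE !dE !big_ord_recr /=.
  set S1 := \sum_(l < m) _; set S2 := \sum_(l < m) _.
  set th := m%:R * _ + _.
  have -> : m.+1%:R * drift c p zeta + p.2 * (Num.sqrt (rho_x c) * zeta.1 * (S1 + (X m w).1)
      + Num.sqrt (rho_y c) * zeta.2 * (S2 + (X m w).2)) =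
      (drift c p zeta + incr c (flat p) zeta (X m w)) + th.
    by rewrite /th /incr /sX /sY /sinq /= eqxx -natr1; ring.
  have -> : - (m.+1%:R * decay c p zeta) = - decay c p zeta + - (m%:R * decay c p zeta).
    by rewrite -natr1; ring.
  move: (drift _ _ _ + _) (m%:R * decay _ _ _) th (- decay _ _ _) => A E B D.
  by rewrite expRD cosD sinD; apply: cplxP; rewrite /=; ring.
have yE m : ystep c (long_step p m.+1) zeta (scaled_sum m.+1 w) =
    cadd (ystep c (long_step p m) zeta (scaled_sum m w)) (ystep c p zeta (X m w)).
  rewrite /ystep !i1E !aE !big_ord_recr /= !sq /incr1 -natr1.
  move: (s1X _ _) (s1Y _ _) (m1X _ _) (m1Y _ _) => x y u v.
  by apply: cplxP; rewrite /=; ring.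
elim: n => [|n [IH1 IH2]].
  have z0 : 0%:R * drift c p zeta + p.2 * (Num.sqrt (rho_x c) * zeta.1 * 0
      + Num.sqrt (rho_y c) * zeta.2 * 0) = 0 by ring.
  rewrite exactE iE eE dE /ystep i1E aE !big_ord0 z0 mul0r oppr0 expR0 cos0 sin0 /= sqrtr0.
  by split; apply: cplxP; rewrite /=; ring.
rewrite expE yE /= IH1 IH2; split => //.
by apply: cplxP; rewrite /=; ring.
Qed.

End explicit_state.

(** The three forcing terms of [space_mean_square], with q = k^(1/2) and H = h_x^2 + h_y^2: squared
    step errors times the mean squares of the correction, of the time error and of the solution. The
    worst products are H^4, k H^2 and k^2 H^2, and the last is at most T k H^2. *)
Lemma space_forcing_le (R : realFieldType) (T q H K1 K2 W l : R) : 0 <= T -> 0 <= q ->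
  q ^+ 2 <= T -> 0 <= H -> 0 <= K1 -> 0 <= K2 -> 1 <= W -> 0 <= l ->
  (H + q ^+ 2) ^+ 2 * (K1 * W * H ^+ 2 * l) + H ^+ 2 * (K2 * W * q ^+ 4 * l)
    + (H ^+ 2 + q * H) ^+ 2 * l
  <= 2 * ((K1 + K2) * (1 + T) + 1) * W * (H ^+ 2 + q * H) ^+ 2 * l.
Proof.
move=> T0 q0 qT H0 K10 K20 W1 l0; set G := (H ^+ 2 + q * H) ^+ 2.
have G0 : 0 <= G by exact: sqr_ge0.
have W0 : 0 <= W by exact: le_trans ler01 W1.
have lW : 0 <= l * W by rewrite mulr_ge0.
have kH : q ^+ 2 * H ^+ 2 + H ^+ 4 <= G.
  have -> : G = q ^+ 2 * H ^+ 2 + H ^+ 4 + 2 * (q * H ^+ 3) by rewrite /G; ring.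
  by rewrite lerDl mulr_ge0// mulr_ge0// exprn_ge0.
have kkH : q ^+ 4 * H ^+ 2 <= T * (q ^+ 2 * H ^+ 2).
  by have := ler_wpM2r (mulr_ge0 (sqr_ge0 q) (sqr_ge0 H)) qT; congr (_ <= _); ring.
have kkH0 : 0 <= q ^+ 2 * H ^+ 2 by rewrite mulr_ge0 ?sqr_ge0.
have H40 : 0 <= H ^+ 4 by rewrite exprn_ge0.
have g1 : (H + q ^+ 2) ^+ 2 * H ^+ 2 <= 2 * (1 + T) * G.
  apply: (@le_trans _ _ (2 * (1 + T) * (q ^+ 2 * H ^+ 2 + H ^+ 4))); last first.
    by rewrite ler_wpM2l// mulr_ge0// addr_ge0.
  apply: (@le_trans _ _ (2 * (H ^+ 4 + q ^+ 4 * H ^+ 2))).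
    by have := sqr_ge0 ((H - q ^+ 2) * H); lra.
  by have := mulr_ge0 T0 H40; lra.
have g2 : H ^+ 2 * q ^+ 4 <= 2 * (1 + T) * G.
  apply: (@le_trans _ _ (T * G)); last by have := mulr_ge0 T0 G0; lra.
  by rewrite mulrC (le_trans kkH)// ler_wpM2l//; lra.
have a1 := ler_wpM2r (mulr_ge0 K10 lW) g1.
have a2 := ler_wpM2r (mulr_ge0 K20 lW) g2.
have a3 : G * l <= G * (l * W) by rewrite ler_wpM2l// ler_peMr.
have a4 := mulr_ge0 G0 lW.
move: a1 a2 a3 a4; clearbody G; clear -G; lra.
Qed.

(** * Mean-square errors at one frequency *)

Section mean_square_bounds.
Context d (Omega : measurableType d) (R : realType) (P : probability Omega R).
Variables (c : spde_data R) (T : R).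
Hypothesis T0 : 0 <= T.
Hypothesis rho_x_range : 0 <= rho_x c < 1.
Hypothesis rho_y_range : 0 <= rho_y c < 1.
Hypothesis rho_range : -1 <= rho_xy c <= 1.

Local Notation C := (R * R)%type.
Local Notation hpar := (R * R * R)%type.
Local Notation gp := (gauss_pair P (rho_xy c)).
Local Notation E f := (\int[P]_w (f w)%:E)%E.
Local Notation S4 := (C * C * C * C)%type.

(** The third clause concerns the partial sums. For Brownian motion they are increments over
    [0, n k], so their normality is read off directly in [noise_seq_brownian]. *)
Definition noise_seq (N : nat) (X : nat -> Omega -> C) : Prop :=
  [/\ forall n, gp (X n),
      forall A : nat -> set C, (forall l, measurable (A l)) ->
        P [set w | forall l, (l < N)%N -> A l (X l w)] = (\prod_(l < N) P (X l @^-1` A l))%E &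
      forall n, (0 < n)%N -> gp (scaled_sum X n)].

Definition freq2 (zeta : C) : R := zeta.1 ^+ 2 + zeta.2 ^+ 2.

Lemma freq2_ge0 zeta : 0 <= freq2 zeta.
Proof. by rewrite addr_ge0 ?sqr_ge0. Qed.

Variable s : R.
Hypothesis s_gt0 : 0 < s.
Hypothesis amp_decay : forall (z : Omega -> C) (p : hpar) zeta, gp z ->
  `|p.1.1 * zeta.1| <= pi -> `|p.1.2 * zeta.2| <= pi ->
  \int[P]_w cn2 (amp c p zeta (z w)) <= expR (- (2 * s * Num.min 1 (p.2 ^+ 2 * freq2 zeta))).
Hypothesis exact_decay : forall (p : hpar) zeta z,
  cn2 (exact c p zeta z) <= expR (- (2 * s * (p.2 ^+ 2 * freq2 zeta))).

Let bexp t n : expR (- t) ^+ n = expR (- (t * n%:R)) :> R.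
Proof. by rewrite -expRM_natl mulrN mulrC. Qed.

Let eq_ler (x y : R) : x = y -> x <= y.
Proof. by move=> ->. Qed.

(** Meant for long steps: the factor k in the mean square of [ystep] is bounded by T, so one
    constant serves after any number of steps. *)
Lemma ystep_mean_square : exists (K : R) (m : nat), 0 <= K /\
  forall (z : Omega -> C) (p : hpar) zeta, gp z -> adm T p ->
  (E (fun w => cn2 (cmul (ystep c p zeta (z w)) (exact c p zeta (z w)))) <=
   (K * weight zeta ^+ m * step_h2 p ^+ 2 * expR (- (2 * s * (p.2 ^+ 2 * freq2 zeta))))%:E)%E.
Proof.
have b := poly_bounded_cn2 (ystep_bounded c T0).
have [K [m [K0 h]]] := poly_bounded_mean P rho_range b.
exists (K * T), m; split; first exact: mulr_ge0.
move=> z p zeta gz ap; set l := expR _.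
have ib := integrable_poly_bounded rho_range zeta gz ap b.
apply: (@le_trans _ _ (E (fun w => l * cn2 (ystep c p zeta (z w))))).
  have mz : measurable_fun setT (fun w => (zeta, z w)) by apply: measurable_fun_pair => //; exact: gz.1.
  apply: ge0_le_integral => //.
  - by move=> w _; rewrite lee_fin cn2_ge0.
  - apply/measurable_EFinP; apply: measurable_cn2; apply: measurable_cmul.
      exact: measurableT_comp (measurable_ystep c T0 p) mz.
    exact: measurableT_comp (measurable_exact T0 rho_x_range rho_y_range p) mz.
  - apply/measurable_EFinP; apply: measurable_funM => //.
    by apply: measurable_cn2; exact: measurableT_comp (measurable_ystep c T0 p) mz.
  - by move=> w _; rewrite lee_fin cn2M mulrC ler_wpM2r ?cn2_ge0.
under eq_integral do rewrite EFinM.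
rewrite ge0_integralZl ?lee_fin ?expR_ge0//; last 2 first.
- exact: measurable_int ib.
- by move=> w _; rewrite lee_fin cn2_ge0.
rewrite -[X in (_ * X <= _)%E]fineK; last exact: integrable_fin_num ib.
rewrite -EFinM lee_fin mulrC ler_wpM2r ?expR_ge0//.
apply: le_trans (ler_norm _) _; apply: le_trans (h z p zeta gz ap) _.
have W0 : 0 <= K * weight zeta ^+ m by rewrite mulr_ge0// exprn_ge0// weight_ge0.
rewrite (_ : K * T * _ * _ = K * weight zeta ^+ m * (T * step_h2 p ^+ 2)); last by ring.
rewrite ler_wpM2l// (_ : mono 1 1 p * _ = p.2 ^+ 2 * step_h2 p ^+ 2); last by rewrite /mono; ring.
by rewrite ler_wpM2r ?sqr_ge0//; case: ap.
Qed.

Section one_frequency.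
Variables (N : nat) (X : nat -> Omega -> C) (p : hpar).
Hypothesis nX : noise_seq N X.
Hypothesis ap : adm T p.
Hypothesis NT : N%:R * p.2 ^+ 2 <= T.

Lemma exact_state_decay zeta n w :
  cn2 (st c X p zeta n w).1.2 <= expR (- (2 * s * (n%:R * p.2 ^+ 2 * freq2 zeta))).
Proof.
rewrite /st (exact_state c X p zeta n w).1; apply: le_trans (exact_decay _ _ _) _.
by rewrite /= exprMn sqr_sqrtr.
Qed.

Lemma exact_state_mean_square zeta n :
  (E (fun w => cn2 (st c X p zeta n w).1.2) <=
   (expR (- (2 * s * (n%:R * p.2 ^+ 2 * freq2 zeta))))%:E)%E.
Proof.
have [gX _ _] := nX.
have -> : (expR (- (2 * s * (n%:R * p.2 ^+ 2 * freq2 zeta))))%:E =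
  (\int[P]_w (cst (expR (- (2 * s * (n%:R * p.2 ^+ 2 * freq2 zeta))))%:E) w)%E.
  by rewrite integral_cst//= probability_setT mule1.
apply: ge0_le_integral => //.
- by move=> w _; rewrite lee_fin cn2_ge0.
- apply/measurable_EFinP; apply: measurable_cn2.
  have ms := measurable_st_w T0 rho_x_range rho_y_range gX p zeta n.
  exact: measurableT_comp measurable_snd (measurableT_comp measurable_fst ms).
- by move=> w _; rewrite lee_fin exact_state_decay.
Qed.

Lemma amp_state_decay zeta n : (n <= N)%N ->
  `|p.1.1 * zeta.1| <= pi -> `|p.1.2 * zeta.2| <= pi ->
  (E (fun w => cn2 (st c X p zeta n w).1.1.1) <=
   (expR (- (2 * s * Num.min 1 (p.2 ^+ 2 * freq2 zeta))) ^+ n)%:E)%E.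
Proof.
have [gX indep _] := nX => + px py.
have mD : measurable_fun setT (fun x : S4 => x.1.1.1).
  exact: measurableT_comp measurable_fst (measurableT_comp measurable_fst measurable_fst).
elim: n => [_|n IH nN].
  rewrite /st /= expr0; under eq_integral do rewrite /cn2 /= expr0n/= expr1n addr0.
  by rewrite integral_cst//= probability_setT mule1.
set l := expR _; have l0 : 0 <= l by exact: expR_ge0.
have := @st_step_le _ _ _ P _ _ T0 rho_x_range rho_y_range N X gX indep p zeta n
  (fun x => x.1.1.1) (fun x => x.1.1.1) (fun x => x.1.1.1) (fun x => x.1.1.1)
  l 0 0 0 0 (l ^+ n) (l ^+ n) (l ^+ n) (l ^+ n) nN mD mD mD mD l0 (lexx 0) (lexx 0) (lexx 0) (lexx 0).
rewrite mul0r addr0 -exprS; apply; [|exact/IH/ltnW..].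
move=> x; rewrite mul0r addr0; apply: (amp_step T0 rho_range) => //; exact: amp_decay.
Qed.

End one_frequency.

(** At h = 0 the difference D of scheme and solution obeys D' = amp D + time_err x, with x the exact
    state. [mean_square_step] applies with two perturbations set to 0, and x decays at the rate that
    [gronwall_geometric] requires of the forcing. *)
Lemma time_mean_square : exists (K : R) (m : nat), 0 <= K /\
  forall N X p zeta, noise_seq N X -> adm T p -> N%:R * p.2 ^+ 2 <= T ->
  p.2 ^+ 2 * freq2 zeta <= 1 -> forall n, (n <= N)%N ->
  (E (fun w => cn2 (csub (st c X p zeta n w).1.1.2 (st c X p zeta n w).1.2)) <=
   (K * weight zeta ^+ m * p.2 ^+ 4 * expR (- (2 * s * (p.2 ^+ 2 * freq2 zeta))) ^+ n)%:E)%E.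
Proof.
have te := time_err_step T0 rho_x_range rho_y_range P rho_range.
have e0 q : adm T q -> 0 <= mono 2 0 q by exact: mono_ge0.
have [K [m [K0 hK]]] := mean_square_step T0 rho_range e0 e0 e0 te te te.
(* A lower bound for the contraction factor on the zone k |zeta|^2 <= 1. *)
pose lam0 := expR (- (2 * s)) : R.
exists (T * expR (T / lam0) / lam0 * K), m; split.
  by rewrite !mulr_ge0 ?invr_ge0 ?expR_ge0.
move=> N X p zeta nX ap NT low.
have [gX indep _] := nX.
set lam := expR (- (2 * s * _)).
have lam1 : lam0 <= lam.
  by rewrite ler_expR lerN2 ler_piMr// mulr_ge0// ltW.
have W0 : 0 <= K * weight zeta ^+ m by rewrite mulr_ge0// exprn_ge0// weight_ge0.
have afl : adm T (flat p) by [].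
pose D (x : S4) := csub x.1.1.2 x.1.2.
pose a n := E (fun w => cn2 (D (st c X p zeta n w))).
have m3 : measurable_fun setT (fun x : S4 => x.1.2).
  exact: measurableT_comp measurable_snd measurable_fst.
have m2 : measurable_fun setT (fun x : S4 => x.1.1.2).
  exact: measurableT_comp measurable_snd (measurableT_comp measurable_fst measurable_fst).
have mD : measurable_fun setT D by exact: measurable_csub.
have ll := expR_ge0 (- (2 * s * (p.2 ^+ 2 * freq2 zeta))); rewrite -/lam in ll.
move=> n nN.
have := @gronwall_geometric R N a T lam lam0 (p.2 ^+ 2) (K * weight zeta ^+ m * p.2 ^+ 4)
  (expR_gt0 _) lam1 (sqr_ge0 _) _ NT _ _ n nN.
rewrite -/(a n) => h; apply: le_trans (h _ _ _) _.
- by rewrite mulr_ge0// exprn_even_ge0.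
- rewrite /a /st /= /D; under eq_integral do rewrite /cn2 /csub/= !subrr expr0n/= addr0.
  by rewrite integral0.
- move=> n' A nN' hA.
  pose z0 (x : S4) : C := (0, 0).
  have mz0 : measurable_fun setT z0 by exact: measurable_cst.
  have z0E : (E (fun w => cn2 (z0 (st c X p zeta n' w))) <= 0%:E)%E.
    by under eq_integral do rewrite /z0 /cn2/= expr0n/= addr0; rewrite integral0.
  have := @st_step_le _ _ _ P _ _ T0 rho_x_range rho_y_range N X gX indep p zeta n'
    D (fun x => x.1.2) z0 z0
    (lam + p.2 ^+ 2) (p.2 ^+ 2 * (K * weight zeta ^+ m)) (p.2 ^+ 4) 0 0
    A (lam ^+ n') 0 0 nN' mD m3 mz0 mz0.
  rewrite !mul0r !addr0 => h'; apply: le_trans (h' _ _ _ _ _ _ hA _ z0E z0E) _ => //.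
  + by rewrite addr_ge0// sqr_ge0.
  + by rewrite mulr_ge0// sqr_ge0.
  + by rewrite exprn_even_ge0.
  + move=> x.
    have hl : \int[P]_w cn2 (amp c (flat p) zeta (X n' w)) <= lam.
      have := amp_decay (p := flat p) (zeta := zeta) (gX n').
      rewrite /= !mul0r normr0 pi_ge0 (min_idPr low); exact.
    have := hK (X n') (flat p) zeta lam (gX n') afl hl (D x) x.1.2 (0, 0) (0, 0).
    congr (_ <= _)%E.
      apply: eq_integral => w _; congr (cn2 _)%:E; rewrite /D /sweep /time_err.
      have -> : exact c (flat p) zeta (X n' w) = exact c p zeta (X n' w) by [].
      have -> : amp c (flat (flat p)) zeta (X n' w) = amp c (flat p) zeta (X n' w) by [].
      by apply: cplxP; rewrite /=; ring.
    by rewrite /z0 /mono /cn2 /=; congr EFin; ring.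
  + apply: le_trans (exact_state_mean_square p nX zeta n') _.
    by rewrite lee_fin bexp; apply: eq_ler; congr (expR _); ring.
  + by rewrite lee_fin; apply: eq_ler; ring.
- by rewrite lee_fin; apply: eq_ler; ring.
Qed.

(** With a, a0, x, y the four components of the state, D = a - a0 - y obeys D' = amp D + full_err y
    + space_err (a0 - x) + space_err2 x. For H = h_x^2 + h_y^2 these terms have sizes (H + k) H, H k
    and H^2 + k^(1/2) H; the middle one is where [time_mean_square] enters. *)
Lemma space_mean_square : exists (K : R) (m : nat), 0 <= K /\
  forall N X (p : hpar) zeta, noise_seq N X -> adm T p -> N%:R * p.2 ^+ 2 <= T ->
  p.2 ^+ 2 * freq2 zeta <= 1 -> `|p.1.1 * zeta.1| <= pi -> `|p.1.2 * zeta.2| <= pi ->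
  forall n, (n <= N)%N ->
  (E (fun w => cn2 (csub (csub (st c X p zeta n w).1.1.1 (st c X p zeta n w).1.1.2)
       (st c X p zeta n w).2)) <=
   (K * weight zeta ^+ m * (step_h2 p ^+ 2 + p.2 * step_h2 p) ^+ 2
      * expR (- (2 * s * (p.2 ^+ 2 * freq2 zeta))) ^+ n)%:E)%E.
Proof.
have fe := full_err_step T0 rho_x_range rho_y_range P rho_range.
have se : step_err c T P (mono 0 1) (space_err c) by apply: space_err_step.
have se2 := space_err2_step T0 rho_x_range rho_y_range P rho_range.
have e0 a b q : adm T q -> 0 <= mono a b q :> R by exact: mono_ge0.
have e02 a b a' b' q : adm T q -> 0 <= mono a b q + mono a' b' q :> R.
  by move=> aq; rewrite addr_ge0 ?e0.
have [K [m [K0 hK]]] := mean_square_step T0 rho_range (e02 0 1 2 0)%N (e0 0 1)%N (e02 0 2 1 1)%N fe se se2.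
have [K1 [m1 [K10 hK1]]] := ystep_mean_square.
have [K2 [m2 [K20 hK2]]] := time_mean_square.
pose lam0 := expR (- (2 * s)) : R.
pose K3 := (K1 + K2) * (1 + T) + 1.
have K30 : 0 <= K3 by rewrite addr_ge0// mulr_ge0// addr_ge0.
exists (T * expR (T / lam0) / lam0 * (2 * K * K3)), (m + (m1 + m2))%N; split.
  by rewrite !mulr_ge0 ?invr_ge0 ?expR_ge0.
move=> N X p zeta nX ap NT low px py.
have [gX indep gS] := nX.
set lam := expR (- (2 * s * _)).
have lam1 : lam0 <= lam.
  by rewrite ler_expR lerN2 ler_piMr// mulr_ge0// ltW.
have W1 := weight_ge1 zeta.
have W0 : 0 <= K * weight zeta ^+ m by rewrite mulr_ge0// exprn_ge0// weight_ge0.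
pose D (x : S4) := csub (csub x.1.1.1 x.1.1.2) x.2.
pose a n := E (fun w => cn2 (D (st c X p zeta n w))).
have t1 : measurable_fun setT (fun x : S4 => x.1.1.1).
  exact: measurableT_comp measurable_fst (measurableT_comp measurable_fst measurable_fst).
have t2 : measurable_fun setT (fun x : S4 => x.1.1.2).
  exact: measurableT_comp measurable_snd (measurableT_comp measurable_fst measurable_fst).
have t3 : measurable_fun setT (fun x : S4 => x.1.2).
  exact: measurableT_comp measurable_snd measurable_fst.
have t4 : measurable_fun setT (fun x : S4 => x.2) by exact: measurable_snd.
pose D0 (x : S4) := csub x.1.1.2 x.1.2.
have mD : measurable_fun setT D by apply: measurable_csub => //; exact: measurable_csub.
have mD0 : measurable_fun setT D0 by exact: measurable_csub.
have ll := expR_ge0 (- (2 * s * (p.2 ^+ 2 * freq2 zeta))); rewrite -/lam in ll.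
have k0 : 0 <= p.2 by case: ap => /ltW.
have kT : p.2 ^+ 2 <= T by case: ap.
set H := step_h2 p; have H0 : 0 <= H by exact: step_h2_ge0.
pose G := (H ^+ 2 + p.2 * H) ^+ 2.
have G0 : 0 <= G by exact: sqr_ge0.
pose W := weight zeta ^+ (m1 + m2).
have W10 : weight zeta ^+ m1 <= W by rewrite ler_weXn2l// leq_addr.
have W20 : weight zeta ^+ m2 <= W by rewrite ler_weXn2l// leq_addl.
have Wge1 : 1 <= W by rewrite exprn_ege1.
(* After n > 0 steps the correction is that of one long step of length n k <= T; at n = 0 it
   vanishes. *)
have y_le n : (n <= N)%N -> (E (fun w => cn2 (st c X p zeta n w).2) <=
    (K1 * W * H ^+ 2 * lam ^+ n)%:E)%E.
  case: n => [_|n nN].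
    rewrite /st /=; under eq_integral do rewrite /cn2/= expr0n/= addr0.
    by rewrite integral0 lee_fin !mulr_ge0 ?exprn_ge0// (le_trans ler01).
  have al : adm T (long_step p n.+1).
    split=> /=; first by rewrite mulr_gt0 ?sqrtr_gt0 ?ltr0Sn//; case: ap.
    rewrite exprMn sqr_sqrtr//; apply: le_trans NT.
    by rewrite ler_wpM2r ?sqr_ge0// ler_nat.
  have h := hK1 (scaled_sum X n.+1) (long_step p n.+1) zeta (gS n.+1 isT) al.
  under eq_integral do rewrite /st (exact_state c X p zeta n.+1 _).2.
  apply: le_trans h _; rewrite lee_fin.
  have -> : step_h2 (long_step p n.+1) = H by [].
  rewrite bexp /= exprMn sqr_sqrtr//.
  have -> : 2 * s * (p.2 ^+ 2 * freq2 zeta) * n.+1%:R = 2 * s * (n.+1%:R * p.2 ^+ 2 * freq2 zeta).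
    by ring.
  rewrite ler_wpM2r ?expR_ge0// ler_wpM2r ?sqr_ge0//.
  by rewrite ler_wpM2l.
have d_le n : (n <= N)%N -> (E (fun w => cn2 (D0 (st c X p zeta n w))) <=
    (K2 * W * p.2 ^+ 4 * lam ^+ n)%:E)%E.
  move=> nN; apply: le_trans (hK2 N X p zeta nX ap NT low n nN) _; rewrite lee_fin -/lam.
  by rewrite ler_wpM2r ?exprn_ge0// ler_wpM2r ?exprn_even_ge0// ler_wpM2l.
move=> n nN.
have := @gronwall_geometric R N a T lam lam0 (p.2 ^+ 2) (K * weight zeta ^+ m * (2 * K3 * W * G))
  (expR_gt0 _) lam1 (sqr_ge0 _) _ NT _ _ n nN.
have WW : weight zeta ^+ (m + (m1 + m2)) = weight zeta ^+ m * W by rewrite exprD.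
rewrite -/(a n) => h; apply: le_trans (h _ _ _) _.
- have Wge0 := le_trans ler01 Wge1.
  by apply: mulr_ge0 => //; apply: mulr_ge0 => //; apply: mulr_ge0 => //; exact: mulr_ge0.
- rewrite /a /st /= /D; under eq_integral do rewrite /cn2 /csub/= !subrr expr0n/= addr0.
  by rewrite integral0.
- move=> n' A nN' hA.
  pose eps1 := mono 0 1 p + mono 2 0 p : R.
  pose eps2 := mono 0 1 p : R.
  pose eps3 := mono 0 2 p + mono 1 1 p : R.
  have := @st_step_le _ _ _ P _ _ T0 rho_x_range rho_y_range N X gX indep p zeta n'
    D (fun x => x.2) D0 (fun x => x.1.2)
    (lam + p.2 ^+ 2) (p.2 ^+ 2 * (K * weight zeta ^+ m)) (eps1 ^+ 2) (eps2 ^+ 2) (eps3 ^+ 2)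
    A (K1 * W * H ^+ 2 * lam ^+ n') (K2 * W * p.2 ^+ 4 * lam ^+ n') (lam ^+ n') nN' mD t4 mD0 t3.
  move=> h'; apply: le_trans (h' _ _ _ _ _ _ hA _ _ _) _ => //.
  + by rewrite addr_ge0// sqr_ge0.
  + by rewrite mulr_ge0// sqr_ge0.
  + exact: sqr_ge0.
  + exact: sqr_ge0.
  + exact: sqr_ge0.
  + move=> x.
    have hl : \int[P]_w cn2 (amp c p zeta (X n' w)) <= lam.
      by have := amp_decay (p := p) (zeta := zeta) (gX n') px py; rewrite (min_idPr low).
    have := hK (X n') p zeta lam (gX n') ap hl (D x) x.2 (D0 x) x.1.2.
    congr (_ <= _)%E.
    apply: eq_integral => w _; congr (cn2 _)%:E.
    rewrite /D /D0 /sweep /space_err2 /space_err /full_err.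
    rewrite /=; move: (amp c p zeta _) (amp c (flat p) zeta _) (exact c p zeta _) (ystep c p zeta _).
    move: x.1.1.1 x.1.1.2 x.1.2 x.2 => [? ?] [? ?] [? ?] [? ?] [? ?] [? ?] [? ?] [? ?].
    by apply: cplxP; rewrite /=; clear; ring.
  + exact/y_le/ltnW.
  + exact/d_le/ltnW.
  + apply: le_trans (exact_state_mean_square p nX zeta n') _.
    by rewrite lee_fin bexp; apply: eq_ler; congr (expR _); ring.
  + rewrite lee_fin lerD2l.
    have assoc (k w g l : R) : k * (w * g * l) = k * w * (g * l) by ring.
    rewrite [leRHS]assoc ler_wpM2l ?(mulr_ge0 (sqr_ge0 _) W0)//.
    rewrite /eps1 /eps2 /eps3 /mono -/H !expr0 !expr1 !mul1r !mulr1.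
    by apply: space_forcing_le; rewrite ?exprn_ge0.
- by rewrite lee_fin WW -/G; apply: eq_ler; ring.
Qed.

End mean_square_bounds.

(** * Integration over the frequencies *)

Section integral_mean_square.
Context d (Omega : measurableType d) (R : realType) (P : probability Omega R).
Context d' (V : measurableType d') (nu : {sigma_finite_measure set V -> \bar R}).
Variables (F : V -> Omega -> R) (g : V -> R).
Hypothesis mF : measurable_fun setT (fun u : V * Omega => F u.1 u.2).
Hypothesis mg : measurable_fun setT g.
Hypothesis g_gt0 : forall v, 0 < g v.
Hypothesis ig : nu.-integrable setT (EFin \o g).
Hypothesis Fg : forall v, (\int[P]_w (F v w ^+ 2)%:E <= (g v ^+ 2)%:E)%E.

Let G : R := \int[nu]_v g v.

Hypothesis G_gt0 : 0 < G.

Let mFv v : measurable_fun setT (F v).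
Proof. exact: (measurableT_comp mF (pair1_measurable v)). Qed.

Let mFw w : measurable_fun setT (fun v => F v w).
Proof. exact: (measurableT_comp mF (pair2_measurable w)). Qed.

Let I w : \bar R := (\int[nu]_v (`|F v w|)%:E)%E.
Let A w : \bar R := (\int[nu]_v (F v w ^+ 2 / g v)%:E)%E.

Let mgV : measurable_fun setT (fun v => (g v)^-1).
Proof.
rewrite (_ : (fun v => _) = (fun v => expR (- ln (g v)))).
  apply: measurableT_comp => //; apply: measurableT_comp => //.
  exact: (measurableT_comp (@measurable_ln R)).
by apply/funext => v; rewrite expRN lnK ?posrE.
Qed.

Let q0 v w : 0 <= F v w ^+ 2 / g v.
Proof. by rewrite divr_ge0 ?sqr_ge0// ltW. Qed.

Let mq : measurable_fun setT (fun u : Omega * V => (F u.2 u.1 ^+ 2 / g u.2)%:E).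
Proof.
apply/measurable_EFinP; apply: measurable_funM; last exact: measurableT_comp mgV measurable_snd.
apply: measurable_funX.
have ms : measurable_fun setT (fun u : Omega * V => (u.2, u.1)) by exact: measurable_fun_pair.
exact: measurableT_comp mF ms.
Qed.

Let mabs : measurable_fun setT (fun u : Omega * V => (`|F u.2 u.1|)%:E).
Proof.
apply/measurable_EFinP; apply: measurableT_comp => //.
have ms : measurable_fun setT (fun u : Omega * V => (u.2, u.1)) by exact: measurable_fun_pair.
exact: measurableT_comp mF ms.
Qed.

Let GE : (\int[nu]_v (g v)%:E)%E = G%:E.
Proof. by rewrite /G /Rintegral fineK//; exact: integrable_fin_num ig. Qed.

Let EA : (\int[P]_w A w <= G%:E)%E.
Proof.
have q0E (u : Omega * V) : (0 <= (F u.2 u.1 ^+ 2 / g u.2)%:E)%E by rewrite lee_fin.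
rewrite /A (fubini_tonelli (m1 := P) (m2 := nu) _ mq q0E)/=.
rewrite -GE; apply: ge0_le_integral => //.
- by move=> v _; apply: integral_ge0 => w _; rewrite lee_fin.
- exact: (measurable_fun_fubini_tonelli_G (m1 := P) _ mq q0E).
- exact/measurable_EFinP.
move=> v _; under eq_integral do rewrite mulrC EFinM.
rewrite ge0_integralZl//; last 3 first.
- by apply/measurable_EFinP; apply: measurable_funX.
- by move=> w _; rewrite lee_fin sqr_ge0.
- by rewrite lee_fin invr_ge0 ltW.
apply: le_trans (lee_wpmul2l _ (Fg v)) _; first by rewrite lee_fin invr_ge0 ltW.
by rewrite -EFinM lee_fin expr2 mulKf// gt_eqF.
Qed.

Let mA : measurable_fun setT A.
Proof. by apply: (measurable_fun_fubini_tonelli_F (m2 := nu) _ mq) => u; rewrite lee_fin. Qed.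

Let mI : measurable_fun setT I.
Proof. by apply: (measurable_fun_fubini_tonelli_F (m2 := nu) _ mabs) => u; rewrite lee_fin. Qed.

Let I0 w : (0 <= I w)%E.
Proof. by apply: integral_ge0 => v _; rewrite lee_fin. Qed.

Let A0 w : (0 <= A w)%E.
Proof. by apply: integral_ge0 => v _; rewrite lee_fin. Qed.

(* [2 t |F| <= t^2 F^2 / g + g] pointwise. *)
Let young (t : R) w : 0 <= t -> ((2 * t)%:E * I w <= (t ^+ 2)%:E * A w + G%:E)%E.
Proof.
move=> t0; rewrite -GE /I /A.
have ma : measurable_fun setT (fun v => (`|F v w|)%:E).
  by apply/measurable_EFinP; apply: measurableT_comp => //; exact: mFw.
have mb : measurable_fun setT (fun v => (F v w ^+ 2 / g v)%:E).
  by apply/measurable_EFinP; apply: measurable_funM => //; apply: measurable_funX; exact: mFw.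
rewrite -ge0_integralZl//; last by rewrite lee_fin mulr_ge0.
rewrite -ge0_integralZl//; last 2 first.
- by move=> v _; rewrite lee_fin.
- by rewrite lee_fin sqr_ge0.
have mgE : measurable_fun setT (fun v => (g v)%:E) by exact/measurable_EFinP.
rewrite -ge0_integralD//; last 3 first.
- by move=> v _; rewrite mule_ge0 ?lee_fin ?sqr_ge0.
- exact: emeasurable_funM.
- by move=> v _; rewrite lee_fin ltW.
apply: ge0_le_integral => //.
- by move=> v _; rewrite mule_ge0 ?lee_fin ?mulr_ge0.
- exact: emeasurable_funM.
- by apply: emeasurable_funD => //; exact: emeasurable_funM.
move=> v _; rewrite -!EFinM -EFinD lee_fin.
have g0 := g_gt0 v; rewrite -(ler_pM2r g0) [leRHS]mulrDl.
have -> : t ^+ 2 * (F v w ^+ 2 / g v) * g v = (t * `|F v w|) ^+ 2.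
  by rewrite exprMn real_normK ?num_real//; field; exact: lt0r_neq0.
by have := sqr_ge0 (t * `|F v w| - g v); lra.
Qed.

(** Weighted Cauchy-Schwarz, from [young] at the optimal t = G / I. The instance t = 1 excludes an
    infinite I with a finite A. *)
Let I2_le w : (I w * I w <= G%:E * A w)%E.
Proof.
move: (I0 w) (A0 w) (young (t := 1) w ler01) (fun t => young (t := t) w).
case: (A w) => [a| |] // I_0 A_0; last first.
  by move=> _ _; rewrite gt0_muley ?lte_fin// leey.
rewrite expr1n mul1e mulr1 -EFinD.
case: (I w) I_0 => [i| |] // i0; last by rewrite gt0_muley ?lte_fin// leye_eq.
move=> _ h; rewrite -!EFinM lee_fin; rewrite !lee_fin in i0 A_0.
have [->|i1] := eqVneq i 0; first by rewrite mulr0 (mulr_ge0 (ltW G_gt0) A_0).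
have {}i0 : 0 < i by rewrite lt0r i1.
have := h (G / i); rewrite -!EFinM -EFinD lee_fin => /(_ _).
have Gi : 0 <= G / i := ltW (divr_gt0 G_gt0 i0).
move=> /(_ Gi); have -> : 2 * (G / i) * i = 2 * G by field.
have -> : (G / i) ^+ 2 * a = G * (G * a / i ^+ 2) by field.
move=> h'; have h2 : G * 1 <= G * (G * a / i ^+ 2) by lra.
by move: h2; rewrite ler_pM2l// ler_pdivlMr ?exprn_gt0// mul1r expr2.
Qed.

Let X w := \int[nu]_v F v w.

(** Tonelli's theorem gives the measurability of the integrals of the positive and negative parts;
    [fine] takes care of the w where the integral is not finite. *)
Lemma measurable_param_Rintegral : measurable_fun setT X.
Proof.
have mFs : measurable_fun setT (fun u : Omega * V => (F u.2 u.1)%:E).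
  apply/measurable_EFinP.
  have ms : measurable_fun setT (fun u : Omega * V => (u.2, u.1)) by exact: measurable_fun_pair.
  exact: measurableT_comp mF ms.
rewrite (_ : X = fine \o (fun w => (\int[nu]_v ((fun u : Omega * V => (F u.2 u.1)%:E)^\+%E (w, v)) -
    \int[nu]_v ((fun u : Omega * V => (F u.2 u.1)%:E)^\-%E (w, v)))%E)); last first.
  by apply/funext => w; rewrite /X /Rintegral (integralE nu setT (fun v => (F v w)%:E));
    congr (fine (_ - _)%E); apply: eq_integral => v _; rewrite ?funeposE ?funenegE.
apply: measurableT_comp => //; apply: emeasurable_funB.
  apply: (measurable_fun_fubini_tonelli_F (m2 := nu) (fun u : Omega * V => (F u.2 u.1)%:E)^\+%E) => //.
  exact: measurable_funepos.
apply: (measurable_fun_fubini_tonelli_F (m2 := nu) (fun u : Omega * V => (F u.2 u.1)%:E)^\-%E) => //.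
exact: measurable_funeneg.
Qed.

Let XI w : ((`|X w|)%:E <= I w)%E.
Proof.
rewrite /X /Rintegral /I.
have mw : measurable_fun setT (fun v => (F v w)%:E) by apply/measurable_EFinP; exact: mFw.
apply: le_trans (le_abse_integral nu measurableT mw).
by case: (\int[nu]_v _)%E => [r| |] //=; rewrite ?normr0 ?leey.
Qed.

(** By [I2_le] the square is at most (int g)(int F^2 / g), and by Tonelli the last integral has mean
    at most int g, because F^2 has mean at most g^2. *)
Lemma Rintegral_mean_square : (\int[P]_w (X w ^+ 2)%:E <= (G ^+ 2)%:E)%E.
Proof.
have mX := measurable_param_Rintegral.
apply: (@le_trans _ _ (\int[P]_w (G%:E * A w))%E).
  apply: ge0_le_integral => //.
  - by move=> w _; rewrite lee_fin sqr_ge0.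
  - by apply/measurable_EFinP; apply: measurable_funX.
  - exact: emeasurable_funM.
  move=> w _; apply: le_trans (I2_le w).
  rewrite -(real_normK (num_real (X w))) expr2 EFinM.
  by apply: lee_pmul; rewrite ?lee_fin.
rewrite ge0_integralZl//; last by rewrite lee_fin ltW.
by rewrite expr2 EFinM lee_wpmul2l// lee_fin ltW.
Qed.

(** From |X| <= X^2/(2G) + G/2 and the mean square. *)
Lemma Rintegral_mean_abs : (\int[P]_w (`|X w|)%:E <= G%:E)%E.
Proof.
have mX := measurable_param_Rintegral.
apply: (@le_trans _ _ (\int[P]_w ((2 * G)^-1%:E * (X w ^+ 2)%:E + (G / 2)%:E))%E).
  apply: ge0_le_integral => //.
  - by apply/measurable_EFinP; exact: measurableT_comp.
  - by apply: emeasurable_funD => //; apply: emeasurable_funM => //;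
      apply/measurable_EFinP; apply: measurable_funX.
  move=> w _; rewrite -EFinM -EFinD lee_fin.
  have G2 : 0 < 2 * G by rewrite mulr_gt0.
  rewrite -(ler_pM2l G2) mulrDr mulVKf ?gt_eqF//.
  by have := sqr_ge0 (`|X w| - G); rewrite -(real_normK (num_real (X w))); lra.
have m2 : measurable_fun setT (fun w => (X w ^+ 2)%:E).
  by apply/measurable_EFinP; apply: measurable_funX.
have i0 : (0 <= (2 * G)^-1%:E :> \bar R)%E by rewrite lee_fin invr_ge0 mulr_ge0// ltW.
rewrite ge0_integralD//; last 3 first.
- by move=> w _; rewrite mule_ge0// lee_fin sqr_ge0.
- exact: emeasurable_funM.
- by move=> w _; rewrite lee_fin divr_ge0// ltW.
rewrite ge0_integralZl//; last by move=> w _; rewrite lee_fin sqr_ge0.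
rewrite integral_cst//= probability_setT mule1.
apply: le_trans (leeD2r _ (lee_wpmul2l i0 Rintegral_mean_square)) _.
rewrite -EFinM -EFinD lee_fin le_eqVlt; apply/orP; left; apply/eqP.
by field; exact: lt0r_neq0.
Qed.

(** [A] has finite mean, so it is almost surely finite, and [I2_le] passes this on to int |F|. *)
Lemma ae_integrable_param : {ae P, forall w, nu.-integrable setT (EFin \o F^~ w)}.
Proof.
have EI : (\int[P]_w A w < +oo)%E by exact: le_lt_trans EA (ltry _).
have iA : P.-integrable setT A.
  apply/integrableP; split => //.
  by under eq_integral do rewrite gee0_abs//.
have := integrable_ae measurableT iA; apply: filterS => w /(_ Logic.I) fA.
apply/integrableP; split; first by apply/measurable_EFinP; exact: mFw.
have := I2_le w; rewrite -/(I w); case: (I w) (I0 w) => [r _ _| |]//; first by rewrite ltry.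
move: fA; case: (A w) (A0 w) => // a _ _ _; rewrite -EFinM mulyy.
Qed.

End integral_mean_square.

(** * Lebesgue measure, Gaussians and the Brillouin zone in the frequency plane *)

Section plane.
Context {R : realType}.
Local Notation C := (R * R)%type.

(** The product measure is given a name so that the sigma-finiteness needed for Tonelli's theorem
    can be attached to it. *)
Definition lebesgue2 : set (measurableTypeR R * measurableTypeR R)%type -> \bar R :=
  (@lebesgue_measure R \x @lebesgue_measure R)%E.

HB.instance Definition _ := Measure.on lebesgue2.

Let sigma_finite_lebesgue2 : sigma_finite setT lebesgue2.
Proof.
have /sigma_finiteP[F [FT nF Foo]] := sigma_finiteT (@lebesgue_measure R).
exists (fun n => F n `*` F n) => [|n].
  apply/esym/seteqP; split => // -[x y] _.
  have [i _ xi] : (\bigcup_i F i) x by rewrite -FT.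
  have [j _ yj] : (\bigcup_i F i) y by rewrite -FT.
  exists (maxn i j) => //; split.
    by have /subsetPset := nF _ _ (leq_maxl i j); exact.
  by have /subsetPset := nF _ _ (leq_maxr i j); exact.
have [mFn Fnoo] := Foo n; split; first exact: measurableX.
by rewrite /lebesgue2 product_measure1E// lte_mul_pinfty// ge0_fin_numE.
Qed.

HB.instance Definition _ := Measure_isSigmaFinite.Build _ _ _ lebesgue2 sigma_finite_lebesgue2.

Definition gauss2 (b : R) (zeta : C) : R := expR (- (b * freq2 zeta)).

Lemma measurable_freq2 : measurable_fun setT (@freq2 R).
Proof. by apply: measurable_funD; apply: measurable_funX. Qed.

Lemma measurable_gauss2 b : measurable_fun setT (gauss2 b).
Proof.
apply: measurableT_comp => //; apply: measurableT_comp => //.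
by apply: measurable_funM => //; exact: measurable_freq2.
Qed.

Lemma integral_gauss2 (b : R) : 0 < b ->
  (\int[lebesgue2]_zeta (gauss2 b zeta)%:E = (pi / b)%:E)%E.
Proof.
move=> b0; have mG : measurable_fun setT (fun zeta => (gauss2 b zeta)%:E).
  by apply/measurable_EFinP; exact: measurable_gauss2.
rewrite /lebesgue2 fubini_tonelli1//; last by move=> z; rewrite lee_fin expR_ge0.
have m1 : measurable_fun setT (fun x : R => (expR (- (b * x ^+ 2)))%:E).
  have := measurable_int _ (integrable_gauss b0); exact.
rewrite /fubini_F.
transitivity (\int[@lebesgue_measure R]_x ((Num.sqrt (pi / b))%:E * (expR (- (b * x ^+ 2)))%:E))%E.
  apply: eq_integral => x _.
  under eq_integral => y _.
    rewrite /gauss2 /freq2 /= mulrDr opprD expRD EFinM; over.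
  by rewrite ge0_integralZl ?lee_fin ?expR_ge0// integral_gauss// muleC.
rewrite ge0_integralZl ?lee_fin ?sqrtr_ge0//.
by rewrite integral_gauss// -EFinM -expr2 sqr_sqrtr// divr_ge0 ?pi_ge0 ?ltW.
Qed.

Lemma integrable_gauss2 (b : R) : 0 < b -> lebesgue2.-integrable setT (EFin \o gauss2 b).
Proof.
move=> b0; apply/integrableP; split; first by apply/measurable_EFinP; exact: measurable_gauss2.
under eq_integral do rewrite /= ger0_norm ?expR_ge0//.
by rewrite integral_gauss2// ltry.
Qed.

Lemma weight_exp (m : nat) (b : R) : 0 < b -> exists2 K : R, 0 < K &
  forall zeta : C, weight zeta ^+ m <= K * expR (b * freq2 zeta).
Proof.
move=> b0; have [K K0 hK] := exprn_le_expR m b0.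
exists (K * expR b) => [|zeta]; first by rewrite mulr_gt0 ?expR_gt0.
have -> : weight zeta = 1 + freq2 zeta by rewrite /weight /freq2 addrA.
apply: le_trans (hK _ _) _; first by rewrite addr_ge0// freq2_ge0.
by rewrite mulrDr mulr1 expRD mulrA.
Qed.

(** The Brillouin zone of the grid with mesh sizes [hx] and [hy]. *)
Definition box (hx hy : R) (zeta : C) : bool := (`|hx * zeta.1| <= pi) && (`|hy * zeta.2| <= pi).

Lemma measurable_box hx hy : measurable_fun setT (box hx hy).
Proof.
have m1 : measurable_fun setT (fun zeta : C => `|hx * zeta.1|).
  by apply: measurableT_comp => //; exact: measurable_funM.
have m2 : measurable_fun setT (fun zeta : C => `|hy * zeta.2|).
  by apply: measurableT_comp => //; exact: measurable_funM.
by apply: measurable_and; exact: measurable_fun_ler.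
Qed.

Let side (h : R) : 0 < h ->
  (\int[@lebesgue_measure R]_x ((`|h * x| <= pi)%R%:R)%:E = (2 * pi / h)%:E)%E.
Proof.
move=> h0.
have e x : (`|h * x| <= pi) = (x \in `[- (pi / h), pi / h]).
  by rewrite in_itv /= -ler_norml normrM (gtr0_norm h0) mulrC ler_pdivlMr.
transitivity (\int[@lebesgue_measure R]_x (\1_(`[- (pi / h), pi / h]%classic) x)%:E)%E.
  by apply: eq_integral => x _; rewrite indicE e mem_setE.
rewrite integral_indic//= setIT lebesgue_measure_itv/= lte_fin.
have ph : 0 < pi / h by rewrite divr_gt0 ?pi_gt0.
rewrite ifT; last by lra.
by rewrite -EFinB; congr EFin; field; exact: lt0r_neq0.
Qed.

Lemma integral_box (hx hy : R) : 0 < hx -> 0 < hy ->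
  (\int[lebesgue2]_zeta ((box hx hy zeta)%:R)%:E = (4 * pi ^+ 2 / (hx * hy))%:E)%E.
Proof.
move=> hx0 hy0.
have mb : measurable_fun setT (fun zeta : C => ((box hx hy zeta)%:R)%:E : \bar R).
  apply/measurable_EFinP.
  rewrite (_ : (fun z => _) = (fun z => if box hx hy z then 1 else 0)); last first.
    by apply/funext => z; case: box.
  by apply: measurable_fun_ifT => //; exact: measurable_box.
rewrite /lebesgue2 fubini_tonelli1//.
rewrite /fubini_F.
have ms h : 0 < h -> measurable_fun setT (fun x : R => ((`|h * x| <= pi)%R%:R)%:E : \bar R).
  move=> h0; apply/measurable_EFinP.
  rewrite (_ : (fun z => _) = (fun z => if `|h * z| <= pi then 1 else 0)); last first.
    by apply/funext => z; case: (_ <= _).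
  apply: measurable_fun_ifT => //; apply: measurable_fun_ler => //.
  by apply: measurableT_comp => //; exact: measurable_funM.
transitivity (\int[@lebesgue_measure R]_x ((2 * pi / hy)%:E * ((`|hx * x| <= pi)%R%:R)%:E))%E.
  apply: eq_integral => x _.
  under eq_integral => y _.
    rewrite /box /= -mulnb natrM EFinM; over.
  rewrite ge0_integralZl //; last exact: ms.
  by rewrite (side hy0) muleC.
have c0 : 0 <= 2 * pi / hy by rewrite divr_ge0 ?(ltW hy0)// mulr_ge0// pi_ge0.
rewrite ge0_integralZl //; last exact: ms.
by rewrite (side hx0) -EFinM; congr EFin; field; rewrite (gt_eqF hx0) (gt_eqF hy0).
Qed.

End plane.

(** * Normalised Brownian increments *)

Section brownian_noise.
Context d (Omega : measurableType d) (R : realType) (P : probability Omega R).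
Variables (c : spde_data R) (Mx My : R -> {RV P >-> R}).
Hypothesis rho_range : -1 <= rho_xy c <= 1.
Hypothesis brownian : correlated_brownian (rho_xy c) Mx My.

Local Notation gp := (gauss_pair P (rho_xy c)).

Definition noise_pair (k : R) (n : nat) (w : Omega) : R * R := (noise Mx k w n, noise My k w n).

Definition increment_pair (s t : R) (w : Omega) : R * R :=
  ((Mx t w - Mx s w) / Num.sqrt (t - s), (My t w - My s w) / Num.sqrt (t - s)).

Lemma gauss_pair_increment s t : 0 <= s -> s < t -> gp (increment_pair s t).
Proof.
move=> s0 st; have ts : 0 < t - s by rewrite subr_gt0.
have q0 : Num.sqrt (t - s) != 0 by rewrite gt_eqF// sqrtr_gt0.
split.
  by apply: measurable_fun_pair; apply: measurable_funM => //; exact: measurable_funB.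
move=> a b A mA.
have := @brownian_increment _ _ _ _ _ _ _ brownian s t (a / Num.sqrt (t - s)) (b / Num.sqrt (t - s))
  s0 (ltW st) A mA.
have -> : (fun w => a / Num.sqrt (t - s) * (Mx t w - Mx s w) + b / Num.sqrt (t - s) * (My t w - My s w))
    = (fun w => a * (increment_pair s t w).1 + b * (increment_pair s t w).2).
  by apply/funext => w; rewrite /increment_pair/=; ring.
move=> ->; congr gaussian_law; congr Num.sqrt.
have e : Num.sqrt (t - s) ^+ 2 = t - s by rewrite sqr_sqrtr// ltW.
rewrite -[X in _ * X]e; move: (Num.sqrt _) q0 => q q0; by field.
Qed.

Lemma noise_pairE k n : noise_pair k n = increment_pair (n%:R * k) (n.+1%:R * k).
Proof.
apply/funext => w; rewrite /noise_pair /noise /increment_pair.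
by rewrite -mulrBl -natr1 (addrC n%:R) addrK mul1r.
Qed.

Lemma scaled_noiseE k n w : 0 < k ->
  scaled_sum (noise_pair k) n w = increment_pair 0 (n%:R * k) w.
Proof.
move=> k0; rewrite /scaled_sum /increment_pair subr0 sqrtrM ?ler0n//.
have tel (M : R -> {RV P >-> R}) : \sum_(l < n) noise M k w l =
    (M (n%:R * k) w - M 0 w) / Num.sqrt k.
  elim: n => [|n IH]; first by rewrite big_ord0 mul0r subrr mul0r.
  by rewrite big_ord_recr/= IH /noise -mulrDl; congr (_ / _); ring.
by congr pair; rewrite /= tel invfM (mulrC (_^-1)) mulrA.
Qed.

Lemma noise_seq_brownian k N : 0 < k -> noise_seq P c N (noise_pair k).
Proof.
move=> k0; split => [n|A mA|n n0].
- rewrite noise_pairE; apply: gauss_pair_increment; first by rewrite mulr_ge0// ltW.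
  by rewrite ltr_pM2r// ltr_nat.
- pose sc (x : R * R) := (x.1 / Num.sqrt k, x.2 / Num.sqrt k).
  have msc : measurable_fun setT sc.
    by apply: measurable_fun_pair; apply: measurable_funM.
  have mB l : measurable (sc @^-1` A l) by rewrite -[X in measurable X]setTI; exact: msc.
  have k0' : 0 <= (fun l : nat => l%:R * k) 0%N :> R by rewrite /= mul0r.
  have km l : (fun l : nat => l%:R * k) l <= (fun l : nat => l%:R * k) l.+1 :> R.
    by rewrite ler_wpM2r ?(ltW k0)// ler_nat.
  exact: (@brownian_independent _ _ _ _ _ _ _ brownian N (fun l => l%:R * k) k0' km
    (fun l => sc @^-1` A l) mB).
- have -> : scaled_sum (noise_pair k) n = increment_pair 0 (n%:R * k).
    by apply/funext => w; exact: scaled_noiseE.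
  by apply: gauss_pair_increment => //; rewrite mulr_gt0// ltr0n.
Qed.

End brownian_noise.

(** * Inverse Fourier integrals and their moments *)

Section inverse_fourier.
Context {R : realType}.
Local Notation C := (R * R)%type.

(* The real part of z e^(it). *)
Definition twist (z : C) (t : R) : R := z.1 * cos t - z.2 * sin t.

Lemma twist_sqr_le z t : twist z t ^+ 2 <= cn2 z.
Proof.
have -> : cn2 z = twist z t ^+ 2 + (z.1 * sin t + z.2 * cos t) ^+ 2.
  rewrite /twist /cn2 -[LHS]mulr1 -(cos2Dsin2 t); ring.
by rewrite lerDl sqr_ge0.
Qed.

Variable c : spde_data R.

(** The origin is moved to (x_0, y_0), so that the Dirac initial datum has transform 1. *)
Definition phase (x y : R) (zeta : C) : R := zeta.1 * (x - x0 c) + zeta.2 * (y - y0 c).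

Definition inv_fourier (x y : R) (f : C -> C) : R :=
  (4 * pi ^+ 2)^-1 * \int[lebesgue2]_zeta twist (f zeta) (phase x y zeta).

Lemma measurable_twist d (V : measurableType d) (f : V -> C) (zeta : V -> C) x y :
  measurable_fun setT f -> measurable_fun setT zeta ->
  measurable_fun setT (fun v => twist (f v) (phase x y (zeta v))).
Proof.
move=> mf mz; have [f1 f2] := (measurable_fun1 mf, measurable_fun2 mf).
have [z1 z2] := (measurable_fun1 mz, measurable_fun2 mz).
have mp : measurable_fun setT (fun v => phase x y (zeta v)).
  by apply: measurable_funD; exact: measurable_funM.
apply: measurable_funB; apply: measurable_funM => //.
  exact: measurableT_comp (continuous_measurable_fun (@continuous_cos R)) mp.
exact: measurableT_comp (continuous_measurable_fun (@continuous_sin R)) mp.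
Qed.

(** A bound for root mean squares at each frequency. The Gaussian part carries the size A of an
    error term; the part B on the Brillouin zone carries the high frequencies of the scheme, and its
    integral is of order B / (hx hy). *)
Definition envelope (A B b hx hy : R) (zeta : C) : R :=
  A * gauss2 b zeta + B * (box hx hy zeta)%:R.

Section envelope.
Variables (A B b hx hy : R).
Hypotheses (A0 : 0 < A) (B0 : 0 <= B) (b0 : 0 < b) (hx0 : 0 < hx) (hy0 : 0 < hy).

Let mbox : measurable_fun setT (fun zeta : C => (box hx hy zeta)%:R : R).
Proof.
rewrite (_ : (fun z => _) = (fun z => if box hx hy z then 1 else 0)); last first.
  by apply/funext => z; case: box.
by apply: measurable_fun_ifT => //; exact: measurable_box.
Qed.

Lemma measurable_envelope : measurable_fun setT (envelope A B b hx hy).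
Proof.
by apply: measurable_funD; apply: measurable_funM => //; exact: measurable_gauss2.
Qed.

Lemma envelope_gt0 zeta : 0 < envelope A B b hx hy zeta.
Proof. by rewrite ltr_wpDr ?mulr_ge0 ?ler0n// mulr_gt0// expR_gt0. Qed.

Let ibox : lebesgue2.-integrable setT (EFin \o (fun zeta : C => (box hx hy zeta)%:R : R)).
Proof.
apply/integrableP; split; first exact/measurable_EFinP.
under eq_integral do rewrite /= ger0_norm ?ler0n//.
by rewrite integral_box// ltry.
Qed.

Lemma integrable_envelope : lebesgue2.-integrable setT (EFin \o envelope A B b hx hy).
Proof.
apply: integrable_EFinD; apply: integrable_EFinZ => //.
exact: integrable_gauss2.
Qed.

Lemma integral_envelope :
  \int[lebesgue2]_zeta envelope A B b hx hy zeta = A * (pi / b) + B * (4 * pi ^+ 2 / (hx * hy)).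
Proof.
have ig := integrable_gauss2 b0.
rewrite (RintegralD _ (integrable_EFinZ A ig) (integrable_EFinZ B ibox))//.
rewrite !RintegralZl//.
by rewrite /Rintegral integral_gauss2// integral_box.
Qed.

Lemma integral_envelope_gt0 : 0 < \int[lebesgue2]_zeta envelope A B b hx hy zeta.
Proof.
rewrite integral_envelope ltr_wpDr//.
  by rewrite mulr_ge0// divr_ge0 ?(ltW (mulr_gt0 hx0 hy0))// mulr_ge0 ?sqr_ge0.
by rewrite mulr_gt0// divr_gt0// pi_gt0.
Qed.

Context d (Omega : measurableType d) (P : probability Omega R).
Variables (f : C -> Omega -> C) (x y : R).
Hypothesis mf : measurable_fun setT (fun u : C * Omega => f u.1 u.2).
Hypothesis f_le : forall zeta,
  (\int[P]_w (cn2 (f zeta w))%:E <= (envelope A B b hx hy zeta ^+ 2)%:E)%E.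

Let F zeta w := twist (f zeta w) (phase x y zeta).

Let mF : measurable_fun setT (fun u : C * Omega => F u.1 u.2).
Proof. exact: (measurable_twist x y mf measurable_fst). Qed.

Let F_le zeta : (\int[P]_w (F zeta w ^+ 2)%:E <= (envelope A B b hx hy zeta ^+ 2)%:E)%E.
Proof.
apply: le_trans (f_le zeta); apply: ge0_le_integral => //.
- by move=> w _; rewrite lee_fin sqr_ge0.
- apply/measurable_EFinP; apply: measurable_funX.
  exact: (measurableT_comp mF (pair1_measurable zeta)).
- apply/measurable_EFinP; apply: measurable_cn2.
  exact: (measurableT_comp mf (pair1_measurable zeta)).
- by move=> w _; rewrite lee_fin twist_sqr_le.
Qed.

Lemma ae_integrable_twist : {ae P, forall w,
  lebesgue2.-integrable setT (EFin \o (fun zeta => twist (f zeta w) (phase x y zeta)))}.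
Proof.
apply: (@ae_integrable_param _ _ _ P _ _ lebesgue2 F (envelope A B b hx hy)) => //.
- exact: measurable_envelope.
- exact: envelope_gt0.
- exact: integrable_envelope.
- exact: integral_envelope_gt0.
Qed.

(** The first moment is at most G and the second at most G^2, so G + G^2 serves for both. The
    prefactor 1/(4 pi^2) is below 1 and is dropped. *)
Lemma scaled_inv_fourier_moments (a G : R) : 0 <= a ->
  a * (A * (pi / b) + B * (4 * pi ^+ 2 / (hx * hy))) <= G ->
  exists Y : {RV P >-> R}, (forall w, Y w = a * inv_fourier x y (f^~ w)) /\
    moments_bounded_by (G + G ^+ 2) Y.
Proof.
move=> a0; rewrite -integral_envelope => aG.
have I0 := integral_envelope_gt0.
move: I0 aG; set I := \int[_]_zeta _ => I0 aG.
have mX := @measurable_param_Rintegral _ _ _ _ _ lebesgue2 F mF.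
have mean := @Rintegral_mean_abs _ _ _ P _ _ lebesgue2 F _ mF measurable_envelope
  envelope_gt0 integrable_envelope F_le I0.
have mean2 := @Rintegral_mean_square _ _ _ P _ _ lebesgue2 F _ mF measurable_envelope
  envelope_gt0 integrable_envelope F_le I0.
pose k : R := a * (4 * pi ^+ 2)^-1.
have pi1 : 1 <= 4 * pi ^+ 2 :> R by have := @pi_ge2 R; nra.
have k0 : 0 <= k by rewrite mulr_ge0// invr_ge0 (le_trans ler01).
have ka : k <= a by rewrite ler_piMr// invf_le1// (lt_le_trans ltr01).
have G0 : 0 <= G by apply: le_trans aG; rewrite mulr_ge0// ltW.
have kI : k * I <= G by apply: le_trans aG; rewrite ler_wpM2r// ltW.
have mY : measurable_fun setT (fun w => k * \int[lebesgue2]_zeta F zeta w).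
  exact: measurable_funM.
exists (mfun_of mY); split; first by move=> w; rewrite /= /k /inv_fourier -mulrA.
split; rewrite unlock /=.
  under eq_integral do rewrite normrM (ger0_norm k0) EFinM.
  rewrite ge0_integralZl//; last first.
    by apply/measurable_EFinP; exact: measurableT_comp.
  apply: le_trans (lee_wpmul2l _ mean) _ => //.
  by rewrite -EFinM lee_fin (le_trans kI)// lerDl sqr_ge0.
under eq_integral do rewrite exprMn EFinM.
rewrite ge0_integralZl//; last 3 first.
- by apply/measurable_EFinP; apply: measurable_funX.
- by move=> w _; rewrite lee_fin sqr_ge0.
- by rewrite lee_fin sqr_ge0.
apply: le_trans (lee_wpmul2l _ mean2) _; first by rewrite lee_fin sqr_ge0.
rewrite -EFinM -exprMn lee_fin.
apply: (@le_trans _ _ (G ^+ 2)); last by rewrite lerDr.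
by rewrite lerXn2r ?nnegrE// mulr_ge0// ltW.
Qed.

End envelope.
End inverse_fourier.

(** * Splitting of the error over the frequency zones *)

Section expansion.
Context d (Omega : measurableType d) (R : realType) (P : probability Omega R).
Variables (T : R) (c : spde_data R) (Mx My : R -> {RV P >-> R}).
Hypothesis T_gt0 : 0 < T.
Hypothesis rho_x_range : 0 <= rho_x c < 1.
Hypothesis rho_y_range : 0 <= rho_y c < 1.
Hypothesis rho_range : -1 <= rho_xy c <= 1.
Hypothesis brownian : correlated_brownian (rho_xy c) Mx My.

Local Notation C := (R * R)%type.
Local Notation hpar := (R * R * R)%type.
Local Notation gp := (gauss_pair P (rho_xy c)).
Local Notation E f := (\int[P]_w (f w)%:E)%E.
Local Notation S4 := (C * C * C * C)%type.

Variable s : R.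
Hypothesis s_gt0 : 0 < s.
Hypothesis amp_decay : forall (z : Omega -> C) (p : hpar) zeta, gp z ->
  `|p.1.1 * zeta.1| <= pi -> `|p.1.2 * zeta.2| <= pi ->
  \int[P]_w cn2 (amp c p zeta (z w)) <= expR (- (2 * s * Num.min 1 (p.2 ^+ 2 * freq2 zeta))).
Hypothesis exact_decay : forall (p : hpar) zeta z,
  cn2 (exact c p zeta z) <= expR (- (2 * s * (p.2 ^+ 2 * freq2 zeta))).

Let T0 : 0 <= T := ltW T_gt0.
(** One half of the decay e^(-2sT|zeta|^2) absorbs polynomial weights. The other half,
    e^(-sT|zeta|^2), is the square of the Gaussian of parameter sT/2, as needed for a root mean
    square. *)
Let b := s * T / 2.
Let b_gt0 : 0 < b. Proof. by rewrite divr_gt0// mulr_gt0. Qed.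

Let decayT zeta := expR (- (2 * s * (T * freq2 zeta))).

Let weight_gauss m : exists2 A : R, 0 < A &
  forall zeta, weight zeta ^+ m * decayT zeta <= A * gauss2 b zeta ^+ 2.
Proof.
have [A A0 hA] := weight_exp m (mulr_gt0 s_gt0 T_gt0).
exists A => // zeta.
have e : decayT zeta = expR (- (s * T * freq2 zeta)) * gauss2 b zeta ^+ 2.
  by rewrite /decayT /gauss2 -expRM_natl -expRD; congr expR; rewrite /b; field.
rewrite e mulrA ler_wpM2r ?sqr_ge0//.
by rewrite expRN ler_pdivrMr ?expR_gt0.
Qed.

(** [K + 1] stands in for the square root of K, as K <= (K + 1)^2; it is positive even for K = 0, as
    the envelope requires. *)
Let le_envelope (K V e B hx hy : R) zeta : 0 <= K -> 0 <= e -> 0 <= B ->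
  V <= K * e ^+ 2 * gauss2 b zeta ^+ 2 + (B * (box hx hy zeta)%:R) ^+ 2 ->
  V <= envelope ((K + 1) * e) B b hx hy zeta ^+ 2.
Proof.
move=> K0 e0 B0 /le_trans; apply; rewrite /envelope.
set g := gauss2 b zeta; set r := B * _.
have g0 : 0 <= g by exact: expR_ge0.
have r0 : 0 <= r by rewrite mulr_ge0 ?ler0n.
have eg : 0 <= e * g by rewrite mulr_ge0.
have h : K * e ^+ 2 * g ^+ 2 <= ((K + 1) * e * g) ^+ 2.
  have -> : ((K + 1) * e * g) ^+ 2 = (K + 1) ^+ 2 * (e * g) ^+ 2 by ring.
  rewrite -mulrA -exprMn ler_wpM2r ?sqr_ge0//.
  by have := sqr_ge0 K; lra.
have : 0 <= (K + 1) * e * g by rewrite -mulrA mulr_ge0// addr_ge0.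
move: h; move: ((K + 1) * e * g) (K * e ^+ 2 * g ^+ 2) => u l h u0; move: r r0 => r r0.
by have := mulr_ge0 u0 r0; rewrite sqrrD; lra.
Qed.

Definition sel (t : bool) (z : C) : C := if t then z else (0, 0).

Let measurable_sel d' (V : measurableType d') (t : V -> bool) (f : V -> C) :
  measurable_fun setT t -> measurable_fun setT f ->
  measurable_fun setT (fun v => sel (t v) (f v)).
Proof. by move=> mt mf; apply: measurable_fun_ifT. Qed.

Let E_csub (f g : Omega -> C) (u v : R) : measurable_fun setT f -> measurable_fun setT g ->
  (E (fun w => cn2 (f w)) <= u%:E)%E -> (E (fun w => cn2 (g w)) <= v%:E)%E ->
  (E (fun w => cn2 (csub (f w) (g w))) <= (2 * u + 2 * v)%:E)%E.
Proof.
move=> mf mg hu hv.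
have m1 : measurable_fun setT (fun w => (cn2 (f w))%:E) by apply/measurable_EFinP; exact: measurable_cn2.
have m2 : measurable_fun setT (fun w => (cn2 (g w))%:E) by apply/measurable_EFinP; exact: measurable_cn2.
apply: (@le_trans _ _ (\int[P]_w (2%:E * (cn2 (f w))%:E + 2%:E * (cn2 (g w))%:E))%E).
  apply: ge0_le_integral => //.
  - by move=> w _; rewrite lee_fin cn2_ge0.
  - by apply/measurable_EFinP; apply: measurable_cn2; exact: measurable_csub.
  - by apply: emeasurable_funD; exact: emeasurable_funM.
  move=> w _; rewrite -!EFinM -EFinD lee_fin /cn2 /csub /=.
  by have := sqr_ge0 ((f w).1 + (g w).1); have := sqr_ge0 ((f w).2 + (g w).2); lra.
have n0 (h : Omega -> C) w : (0 <= 2%:E * (cn2 (h w))%:E :> \bar R)%E.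
  by rewrite mule_ge0// lee_fin cn2_ge0.
rewrite ge0_integralD//; [|exact: emeasurable_funM|exact: emeasurable_funM].
rewrite !ge0_integralZl//; [|by move=> w _; rewrite lee_fin cn2_ge0|by move=> w _; rewrite lee_fin cn2_ge0].
have -> : (2 * u + 2 * v)%:E = (2%:E * u%:E + 2%:E * v%:E)%E by [].
by apply: leeD; apply: lee_wpmul2l.
Qed.

(** The correction as a single step of length T driven by the increment over [0, T], hence the same
    for every N. *)
Definition yterm (hx hy : R) (zeta : C) (w : Omega) : C :=
  cmul (ystep c (hx, hy, Num.sqrt T) zeta (increment_pair Mx My 0 T w))
    (exact c (hx, hy, Num.sqrt T) zeta (increment_pair Mx My 0 T w)).

Let gpT : gp (increment_pair Mx My 0 T).
Proof. exact: gauss_pair_increment. Qed.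

Let sqrtT2 : Num.sqrt T ^+ 2 = T.
Proof. by rewrite sqr_sqrtr. Qed.

Let admT hx hy : adm T (hx, hy, Num.sqrt T).
Proof. by split=> /=; [rewrite sqrtr_gt0|rewrite sqrtT2]. Qed.

Lemma measurable_yterm hx hy : measurable_fun setT (fun u : C * Omega => yterm hx hy u.1 u.2).
Proof.
have mu : measurable_fun setT (fun u : C * Omega => (u.1, increment_pair Mx My 0 T u.2)).
  by apply: measurable_fun_pair => //; exact: measurableT_comp gpT.1 measurable_snd.
apply: measurable_cmul.
  exact: measurableT_comp (measurable_ystep c T0 (hx, hy, Num.sqrt T)) mu.
exact: measurableT_comp (measurable_exact T0 rho_x_range rho_y_range (hx, hy, Num.sqrt T)) mu.
Qed.

Let yterm_weight : exists (K : R) (m : nat), 0 <= K /\ forall hx hy zeta,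
  (E (fun w => cn2 (yterm hx hy zeta w)) <=
   (K * (hx ^+ 2 + hy ^+ 2) ^+ 2 * (weight zeta ^+ m * decayT zeta))%:E)%E.
Proof.
have [K [m [K0 h]]] := ystep_mean_square P T0 rho_x_range rho_y_range rho_range exact_decay.
exists K, m; split => // hx hy zeta.
have := h _ (hx, hy, Num.sqrt T) zeta gpT (admT hx hy); rewrite sqrtT2 => /le_trans; apply.
rewrite lee_fin /step_h2 /= -/(decayT zeta) le_eqVlt; apply/orP; left; apply/eqP.
by ring.
Qed.

Let yterm_le : exists2 K : R, 0 <= K & forall hx hy zeta,
  (E (fun w => cn2 (yterm hx hy zeta w)) <=
   (K * (hx ^+ 2 + hy ^+ 2) ^+ 2 * gauss2 b zeta ^+ 2)%:E)%E.
Proof.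
have [K [m [K0 h]]] := yterm_weight; have [A A0 hA] := weight_gauss m.
exists (K * A) => [|hx hy zeta]; first by rewrite mulr_ge0// ltW.
apply: le_trans (h hx hy zeta) _; rewrite lee_fin.
have := ler_wpM2l (mulr_ge0 K0 (sqr_ge0 (hx ^+ 2 + hy ^+ 2))) (hA zeta).
by congr (_ <= _); ring.
Qed.

Lemma exists_yterm_RV hx hy : exists G : R, forall x y : R,
  exists2 Y : {RV P >-> R}, moments_bounded_by G Y &
    forall w, Y w = inv_fourier c x y (fun zeta => yterm hx hy zeta w).
Proof.
have [K K0 hK] := yterm_le.
pose H := hx ^+ 2 + hy ^+ 2; have H0 : 0 <= H by rewrite addr_ge0 ?sqr_ge0.
have A0 : 0 < (K * H ^+ 2 + 1) * 1 by rewrite mulr1 ltr_wpDl// mulr_ge0 ?sqr_ge0.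
exists ((K * H ^+ 2 + 1) * 1 * (pi / b) + ((K * H ^+ 2 + 1) * 1 * (pi / b)) ^+ 2) => x y.
have hf zeta : (E (fun w => cn2 (yterm hx hy zeta w)) <=
    (envelope ((K * H ^+ 2 + 1) * 1) 0 b 1 1 zeta ^+ 2)%:E)%E.
  apply: le_trans (hK hx hy zeta) _; rewrite lee_fin; apply: le_envelope => //.
    by rewrite mulr_ge0 ?sqr_ge0.
  by rewrite mul0r expr0n/= addr0 expr1n mulr1.
have aG : 1 * ((K * H ^+ 2 + 1) * 1 * (pi / b) + 0 * (4 * pi ^+ 2 / (1 * 1))) <=
    (K * H ^+ 2 + 1) * 1 * (pi / b) by rewrite mul0r addr0 mul1r.
have [Y [YE Ym]] := scaled_inv_fourier_moments c A0 (lexx 0) b_gt0 ltr01 ltr01 x y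
  (measurable_yterm hx hy) hf ler01 aG.
by exists Y => // w; rewrite YE mul1r.
Qed.

Section time_step.
Variable N : nat.
Hypothesis N_gt0 : (0 < N)%N.

Let k := T / N%:R.
Let kap := Num.sqrt k.
Let X := noise_pair Mx My k.
Let N0 : 0 < N%:R :> R. Proof. by rewrite ltr0n. Qed.
Let k_gt0 : 0 < k. Proof. exact: divr_gt0. Qed.
Let kap2 : kap ^+ 2 = k. Proof. by rewrite sqr_sqrtr// ltW. Qed.
Let Nk : N%:R * k = T. Proof. by rewrite /k mulrC divfK// gt_eqF. Qed.
Let kT : k <= T. Proof. by rewrite ler_pdivrMr// ler_peMr// ler1n. Qed.
Let adm_k hx hy : adm T (hx, hy, kap).
Proof. by split; rewrite /= ?kap2 ?sqrtr_gt0. Qed.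
Let nX : noise_seq P c N X. Proof. exact: noise_seq_brownian. Qed.
Let gX n : gp (X n). Proof. by case: nX. Qed.

Definition ampterm (hx hy : R) (zeta : C) (w : Omega) : C :=
  (st c (noise_pair Mx My (T / N%:R)) (hx, hy, Num.sqrt (T / N%:R)) zeta N w).1.1.1.
Definition low (zeta : C) : bool := T / N%:R * freq2 zeta <= 1.
Definition flatterm (zeta : C) (w : Omega) : C :=
  (st c (noise_pair Mx My (T / N%:R)) (0, 0, Num.sqrt (T / N%:R)) zeta N w).1.1.2.
Definition xterm (zeta : C) (w : Omega) : C :=
  exact c (0, 0, Num.sqrt T) zeta (increment_pair Mx My 0 T w).
(** Cut off at k |zeta|^2 <= 1, where [time_mean_square] holds; its inverse Fourier integral is k
    E1. *)
Definition timeterm (zeta : C) (w : Omega) : C :=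
  sel (low zeta) (csub (flatterm zeta w) (xterm zeta w)).
(** Defined by difference, so that the expansion is an identity and only the size of this term has
    to be estimated. *)
Definition restterm (hx hy : R) (zeta : C) (w : Omega) : C :=
  csub (csub (csub (sel (box hx hy zeta) (ampterm hx hy zeta w)) (xterm zeta w)) (timeterm zeta w))
    (yterm hx hy zeta w).

Lemma st_flatterm hx hy zeta n w :
  (st c X (hx, hy, kap) zeta n w).1.1.2 = (st c X (0, 0, kap) zeta n w).1.1.2.
Proof. by elim: n => // n; rewrite /st /= => ->. Qed.

Let long_stepE hx hy : long_step (hx, hy, kap) N = (hx, hy, Num.sqrt T).
Proof. by rewrite /long_step /= -sqrtrM ?ler0n// Nk. Qed.

Let scaledE w : scaled_sum X N w = increment_pair Mx My 0 T w.
Proof. by rewrite scaled_noiseE// Nk. Qed.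

Lemma st_xterm hx hy zeta w : (st c X (hx, hy, kap) zeta N w).1.2 = xterm zeta w.
Proof. by rewrite /st (exact_state c X _ zeta N w).1 long_stepE scaledE. Qed.

Lemma st_yterm hx hy zeta w : (st c X (hx, hy, kap) zeta N w).2 = yterm hx hy zeta w.
Proof. by rewrite /st (exact_state c X _ zeta N w).2 long_stepE scaledE. Qed.

Let mst hx hy := measurable_st T0 rho_x_range rho_y_range gX (hx, hy, kap) N.

Lemma measurable_ampterm hx hy : measurable_fun setT (fun u : C * Omega => ampterm hx hy u.1 u.2).
Proof.
exact: measurableT_comp measurable_fst (measurableT_comp measurable_fst
  (measurableT_comp measurable_fst (mst hx hy))).
Qed.

Lemma measurable_flatterm : measurable_fun setT (fun u : C * Omega => flatterm u.1 u.2).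
Proof.
exact: measurableT_comp measurable_snd (measurableT_comp measurable_fst
  (measurableT_comp measurable_fst (mst 0 0))).
Qed.

Lemma measurable_xterm : measurable_fun setT (fun u : C * Omega => xterm u.1 u.2).
Proof.
have mu : measurable_fun setT (fun u : C * Omega => (u.1, increment_pair Mx My 0 T u.2)).
  by apply: measurable_fun_pair => //; exact: measurableT_comp gpT.1 measurable_snd.
exact: measurableT_comp (measurable_exact T0 rho_x_range rho_y_range (0, 0, Num.sqrt T)) mu.
Qed.

Lemma measurable_timeterm : measurable_fun setT (fun u : C * Omega => timeterm u.1 u.2).
Proof.
apply: measurable_sel; last exact: measurable_csub measurable_flatterm measurable_xterm.
apply: measurable_fun_ler => //; apply: measurable_funM => //.
exact: measurableT_comp measurable_freq2 measurable_fst.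
Qed.

Lemma measurable_boxterm hx hy :
  measurable_fun setT (fun u : C * Omega => sel (box hx hy u.1) (ampterm hx hy u.1 u.2)).
Proof.
apply: measurable_sel; last exact: measurable_ampterm.
exact: measurableT_comp (measurable_box hx hy) measurable_fst.
Qed.

Lemma measurable_restterm hx hy : measurable_fun setT (fun u : C * Omega => restterm hx hy u.1 u.2).
Proof.
apply: measurable_csub; last exact: measurable_yterm.
apply: measurable_csub; last exact: measurable_timeterm.
exact: measurable_csub (measurable_boxterm hx hy) measurable_xterm.
Qed.

End time_step.

Local Notation step N := (T / N%:R).

Let step_gt0 (N : nat) : (0 < N)%N -> 0 < step N.
Proof. by move=> N0; rewrite divr_gt0// ltr0n. Qed.

Let step_le (N : nat) : (0 < N)%N -> step N <= T.
Proof. by move=> N0; rewrite ler_pdivrMr ?ltr0n// ler_peMr// ler1n. Qed.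

Let stepN (N : nat) : (0 < N)%N -> N%:R * step N = T.
Proof. by move=> N0; rewrite mulrC divfK// pnatr_eq0 -lt0n. Qed.

Let sqrt_step (N : nat) : (0 < N)%N -> Num.sqrt (step N) ^+ 2 = step N.
Proof. by move=> N0; rewrite sqr_sqrtr// ltW// step_gt0. Qed.

Let adm_step (N : nat) hx hy : (0 < N)%N -> adm T (hx, hy, Num.sqrt (step N)).
Proof. by move=> N0; split; rewrite /= ?sqrt_step// ?sqrtr_gt0 ?step_gt0 ?step_le. Qed.

Let decay_pow (N : nat) zeta : (0 < N)%N ->
  expR (- (2 * s * (step N * freq2 zeta))) ^+ N = decayT zeta.
Proof.
move=> N0; rewrite -expRM_natl /decayT; congr expR.
by have := stepN N0; move: (step N) => k <-; ring.
Qed.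

Let noise_step (N : nat) : (0 < N)%N -> noise_seq P c N (noise_pair Mx My (step N)).
Proof. by move=> N0; apply: noise_seq_brownian => //; exact: step_gt0. Qed.

Let xterm_le zeta : (E (fun w => cn2 (xterm zeta w)) <= (decayT zeta)%:E)%E.
Proof.
have -> : (decayT zeta)%:E = (\int[P]_w (cst (decayT zeta)%:E) w)%E.
  by rewrite integral_cst//= probability_setT mule1.
apply: ge0_le_integral => //.
- by move=> w _; rewrite lee_fin cn2_ge0.
- apply/measurable_EFinP; apply: measurable_cn2.
  exact: (measurableT_comp measurable_xterm (pair1_measurable zeta)).
- move=> w _; rewrite lee_fin; apply: le_trans (exact_decay _ _ _) _.
  by rewrite /= sqrtT2.
Qed.

Let timeterm_le : exists (K : R) (m : nat), 0 <= K /\ forall N zeta, (0 < N)%N -> low N zeta ->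
  (E (fun w => cn2 (csub (flatterm N zeta w) (xterm zeta w))) <=
   (K * step N ^+ 2 * (weight zeta ^+ m * decayT zeta))%:E)%E.
Proof.
have [K [m [K0 h]]] := time_mean_square T0 rho_x_range rho_y_range rho_range s_gt0 amp_decay exact_decay.
exists K, m; split => // N zeta N0 lo.
have := h N _ (0, 0, Num.sqrt (step N)) zeta (noise_step N0) (adm_step 0 0 N0).
rewrite /= sqrt_step// stepN// => /(_ (lexx _) lo N (leqnn N)).
under eq_integral do rewrite st_xterm//.
move/le_trans; apply; rewrite lee_fin decay_pow// -[4%N]/(2 * 2)%N exprM sqrt_step//.
by rewrite le_eqVlt; apply/orP; left; apply/eqP; ring.
Qed.

Let spaceterm_le : exists (K : R) (m : nat), 0 <= K /\ forall N hx hy zeta, (0 < N)%N ->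
  low N zeta -> box hx hy zeta ->
  (E (fun w => cn2 (csub (csub (ampterm N hx hy zeta w) (flatterm N zeta w)) (yterm hx hy zeta w))) <=
   (K * ((hx ^+ 2 + hy ^+ 2) ^+ 2 + Num.sqrt (step N) * (hx ^+ 2 + hy ^+ 2)) ^+ 2
      * (weight zeta ^+ m * decayT zeta))%:E)%E.
Proof.
have [K [m [K0 h]]] := space_mean_square T0 rho_x_range rho_y_range rho_range s_gt0 amp_decay exact_decay.
exists K, m; split => // N hx hy zeta N0 lo /andP[bx by_].
have := h N _ (hx, hy, Num.sqrt (step N)) zeta (noise_step N0) (adm_step hx hy N0).
rewrite /= sqrt_step// stepN// => /(_ (lexx _) lo bx by_ N (leqnn N)).
under eq_integral do rewrite st_yterm// st_flatterm.
move/le_trans; apply; rewrite lee_fin decay_pow//.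
by rewrite le_eqVlt; apply/orP; left; apply/eqP; rewrite /step_h2/=; ring.
Qed.

Let ampterm_le N hx hy zeta : (0 < N)%N -> box hx hy zeta ->
  (E (fun w => cn2 (ampterm N hx hy zeta w)) <=
   (expR (- (2 * s * Num.min 1 (step N * freq2 zeta))) ^+ N)%:E)%E.
Proof.
move=> N0 /andP[bx by_].
have := amp_state_decay T0 rho_x_range rho_y_range rho_range amp_decay (noise_step N0)
  (adm_step hx hy N0) (leqnn N) bx by_.
by rewrite /= sqrt_step.
Qed.

Let slice (f : C -> Omega -> C) zeta : measurable_fun setT (fun u : C * Omega => f u.1 u.2) ->
  measurable_fun setT (f zeta).
Proof. by move=> mf; exact: (measurableT_comp mf (pair1_measurable zeta)). Qed.

Let E_zero : (E (fun=> cn2 ((0, 0) : C)) <= 0%:E)%E.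
Proof. by under eq_integral do rewrite /cn2/= expr0n/= addr0; rewrite integral0. Qed.

Let timeterm_gauss : exists2 K : R, 0 <= K & forall N zeta, (0 < N)%N ->
  (E (fun w => cn2 (timeterm N zeta w)) <= (K * step N ^+ 2 * gauss2 b zeta ^+ 2)%:E)%E.
Proof.
have [K [m [K0 h]]] := timeterm_le; have [A A0 hA] := weight_gauss m.
exists (K * A) => [|N zeta N0]; first by rewrite mulr_ge0// ltW.
rewrite /timeterm; case: (boolP (low N zeta)) => lo /=; last first.
  by apply: le_trans E_zero _; rewrite lee_fin (mulr_ge0 (mulr_ge0 (mulr_ge0 K0 (ltW A0)) _)) ?sqr_ge0.
apply: le_trans (h N zeta N0 lo) _; rewrite lee_fin.
have := ler_wpM2l (mulr_ge0 K0 (sqr_ge0 (step N))) (hA zeta).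
by congr (_ <= _); ring.
Qed.

Lemma exists_timeterm_RV : exists G : R, forall N x y, (0 < N)%N ->
  exists2 Y : {RV P >-> R}, moments_bounded_by G Y &
    forall w, Y w = (T / N%:R)^-1 * inv_fourier c x y (fun zeta => timeterm N zeta w).
Proof.
have [K K0 hK] := timeterm_gauss.
pose G := (K + 1) * (pi / b); exists (G + G ^+ 2) => N x y N0.
have k0 := step_gt0 N0.
have A0 : 0 < (K + 1) * step N by rewrite mulr_gt0// ltr_wpDl.
have hf zeta : (E (fun w => cn2 (timeterm N zeta w)) <=
    (envelope ((K + 1) * step N) 0 b 1 1 zeta ^+ 2)%:E)%E.
  apply: le_trans (hK N zeta N0) _; rewrite lee_fin; apply: le_envelope => //.
    exact: ltW.
  by rewrite mul0r expr0n/= addr0.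
have aG : (step N)^-1 * ((K + 1) * step N * (pi / b) + 0 * (4 * pi ^+ 2 / (1 * 1))) <= G.
  rewrite mul0r addr0 /G le_eqVlt; apply/orP; left; apply/eqP.
  by rewrite (mulrC (K + 1)) -(mulrA (step N)) mulKf// gt_eqF.
have a0 : 0 <= (step N)^-1 by rewrite invr_ge0 ltW.
have [Y [YE Ym]] := scaled_inv_fourier_moments c A0 (lexx 0) b_gt0 ltr01 ltr01 x y
  (measurable_timeterm N0) hf a0 aG.
by exists Y.
Qed.

(** The first two summands are the space error at low frequency, and k^2 bounds the tail of the
    solution beyond k |zeta|^2 = 1. *)
Definition rest_scale (N : nat) (hx hy : R) : R :=
  (hx ^+ 2 + hy ^+ 2) ^+ 2 + Num.sqrt (T / N%:R) * (hx ^+ 2 + hy ^+ 2) + (T / N%:R) ^+ 2.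

Let weight_ge_freq2 (zeta : C) : freq2 zeta <= weight zeta.
Proof. by rewrite /freq2 /weight -addrA lerDr. Qed.

(** Outside the Brillouin zone some |h_x xi| or |h_y eta| exceeds pi >= 1, so powers of h_x^2 +
    h_y^2 can be gained there at the price of powers of the weight. *)
Let outside_box (hx hy : R) (zeta : C) : ~~ box hx hy zeta -> 1 <= (hx ^+ 2 + hy ^+ 2) * weight zeta.
Proof.
have pi1 : 1 <= pi :> R by have := @pi_ge2 R; lra.
have side (h u : R) : ~~ (`|h * u| <= pi) -> 1 <= h ^+ 2 * u ^+ 2.
  rewrite -ltNge => hu; rewrite -exprMn -(real_normK (num_real (h * u))).
  by rewrite exprn_ege1// ltW// (le_lt_trans pi1).
move=> nb; apply: (@le_trans _ _ ((hx ^+ 2 + hy ^+ 2) * freq2 zeta)); last first.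
  by rewrite ler_wpM2l ?addr_ge0 ?sqr_ge0.
have p (u v : R) : 0 <= u ^+ 2 * v ^+ 2 by rewrite mulr_ge0 ?sqr_ge0.
have := p hx zeta.1; have := p hx zeta.2; have := p hy zeta.1; have := p hy zeta.2.
rewrite /freq2 mulrDl !mulrDr; move: nb; rewrite /box negb_and => /orP[/side|/side]; lra.
Qed.

(** At low frequency inside the Brillouin zone this is [spaceterm_le]. Elsewhere no cancellation is
    used: with W the weight and H = h_x^2 + h_y^2, either H W >= 1 or k W >= 1, and powers of these
    factors turn the decay of the solution into [rest_scale]. The scheme itself contributes there
    only at high frequency inside the zone, through e^(-sN). *)
Let restterm_le : exists2 K : R, 0 <= K & forall N hx hy zeta, (0 < N)%N ->
  (E (fun w => cn2 (restterm N hx hy zeta w)) <=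
   (K * rest_scale N hx hy ^+ 2 * gauss2 b zeta ^+ 2
      + (3 * expR (- s) ^+ N * (box hx hy zeta)%:R) ^+ 2)%:E)%E.
Proof.
have [Kt [mt [Kt0 ht]]] := timeterm_le.
have [Ks [ms [Ks0 hs]]] := spaceterm_le.
have [Ky [my [Ky0 hy_]]] := yterm_weight.
(* The 4 extra powers pay for (H W)^4 >= 1 outside the Brillouin zone and for (k W)^4 >= 1 at high
   frequency. *)
have [A A0 hA] := weight_gauss (mt + ms + my + 4).
(* Nested uses of [E_csub] produce the coefficients 8, 4 and 2 of the solution, the time term and
   the correction. *)
pose K := 8 + 4 * Kt * T ^+ 2 + 2 * Ky + Ks.
have K0 : 0 <= K by rewrite !addr_ge0// ?mulr_ge0 ?sqr_ge0.
exists (K * A) => [|N hx hy zeta N0]; first by rewrite mulr_ge0// ltW.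
set k := step N; set H := hx ^+ 2 + hy ^+ 2; set kap := Num.sqrt k.
have k0 : 0 < k by exact: step_gt0.
have kT : k <= T by exact: step_le.
have kap2 : kap ^+ 2 = k by exact: sqrt_step.
have kap0 : 0 <= kap by exact: sqrtr_ge0.
have H0 : 0 <= H by rewrite addr_ge0 ?sqr_ge0.
set W := weight zeta; have W1 : 1 <= W by exact: weight_ge1.
set L := decayT zeta; have L0 : 0 <= L by exact: expR_ge0.
pose U := A * gauss2 b zeta ^+ 2.
have WL i : (i <= mt + ms + my + 4)%N -> W ^+ i * L <= U.
  by move=> iM; apply: le_trans (hA zeta); rewrite ler_wpM2r// ler_weXn2l.
have U0 : 0 <= U by rewrite mulr_ge0 ?sqr_ge0// ltW.
set e := rest_scale N hx hy.
have eE : e = H ^+ 2 + kap * H + k ^+ 2 by [].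
have e1 : 0 <= H ^+ 2 by exact: sqr_ge0.
have e2 : 0 <= kap * H by exact: mulr_ge0.
have e3 : 0 <= k ^+ 2 by exact: sqr_ge0.
have sq_le (u : R) : 0 <= u -> u <= e -> u ^+ 2 * U <= e ^+ 2 * U.
  move=> u0 ue; rewrite ler_wpM2r// lerXn2r ?nnegrE//; exact: le_trans ue.
have eU0 : 0 <= e ^+ 2 * U by rewrite mulr_ge0 ?sqr_ge0.
have KAE : K * A * e ^+ 2 * gauss2 b zeta ^+ 2 = K * (e ^+ 2 * U) by rewrite /U; ring.
have mx := slice zeta measurable_xterm; have my_ := slice zeta (measurable_yterm hx hy).
have mt_ : measurable_fun setT (fun w => csub (flatterm N zeta w) (xterm zeta w)).
  by apply: measurable_csub => //; exact: slice (measurable_flatterm N0).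
have ma := slice zeta (measurable_ampterm N0 hx hy).
have m0 : measurable_fun setT (fun _ : Omega => (0, 0) : C) by exact: measurable_cst.
rewrite KAE /restterm /timeterm.
case: (boolP (low N zeta)) => lo.
  case: (boolP (box hx hy zeta)) => bx /=.
  - apply: (@le_trans _ _ (Ks * (H ^+ 2 + kap * H) ^+ 2 * (W ^+ ms * L))%:E).
      apply: le_trans (hs N hx hy zeta N0 lo bx); rewrite le_eqVlt; apply/orP; left; apply/eqP.
      by apply: eq_integral => w _; congr (cn2 _)%:E; apply: cplxP; rewrite /=; ring.
    rewrite lee_fin; apply: (@le_trans _ _ (K * (e ^+ 2 * U))); last by rewrite lerDl sqr_ge0.
    apply: (@le_trans _ _ (Ks * (e ^+ 2 * U))).
      rewrite -mulrA ler_wpM2l//; apply: (@le_trans _ _ ((H ^+ 2 + kap * H) ^+ 2 * U)).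
        rewrite ler_wpM2l ?sqr_ge0// WL//.
        by rewrite -addnA -addnA (addnCA mt) leq_addr.
      by apply: sq_le; [exact: addr_ge0|rewrite eE lerDl].
    rewrite ler_wpM2r// /K lerDr !addr_ge0// ?mulr_ge0 ?sqr_ge0//.
  - have HW := outside_box bx; rewrite -/H -/W in HW.
    have h1 : L <= e ^+ 2 * U.
      apply: (@le_trans _ _ ((H * W) ^+ 4 * L)); first by rewrite ler_peMl// exprn_ege1.
      rewrite exprMn -mulrA; apply: (@le_trans _ _ ((H ^+ 2) ^+ 2 * U)).
        by rewrite -exprM ler_wpM2l ?exprn_ge0// WL// leq_addl.
      by apply: sq_le => //; rewrite eE -addrA lerDl addr_ge0.
    have h2 : k ^+ 2 * (W ^+ mt * L) <= T ^+ 2 * (e ^+ 2 * U).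
      apply: ler_pM => //; first by rewrite mulr_ge0// exprn_ge0// (le_trans ler01).
        by rewrite lerXn2r ?nnegrE// ltW.
      apply: (@le_trans _ _ ((H * W) ^+ 4 * (W ^+ mt * L))).
        by rewrite ler_peMl ?exprn_ege1// mulr_ge0// exprn_ge0// (le_trans ler01).
      rewrite exprMn (mulrA _ (W ^+ mt)) -(mulrA (H ^+ 4)) -exprD -mulrA.
      apply: (@le_trans _ _ ((H ^+ 2) ^+ 2 * U)).
        by rewrite -exprM ler_wpM2l ?exprn_ge0// WL// addnC leq_add2r -!addnA leq_addr.
      by apply: sq_le => //; rewrite eE -addrA lerDl addr_ge0.
    have h3 : H ^+ 2 * (W ^+ my * L) <= e ^+ 2 * U.
      apply: (@le_trans _ _ ((H * W) ^+ 2 * (H ^+ 2 * (W ^+ my * L)))).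
        rewrite ler_peMl ?exprn_ege1// mulr_ge0// mulr_ge0// exprn_ge0// (le_trans ler01)//.
      have -> : (H * W) ^+ 2 * (H ^+ 2 * (W ^+ my * L)) = (H ^+ 2) ^+ 2 * (W ^+ (2 + my) * L).
        by rewrite exprD; ring.
      apply: (@le_trans _ _ ((H ^+ 2) ^+ 2 * U)).
        rewrite ler_wpM2l ?sqr_ge0// WL//.
        by rewrite addnC leq_add// leq_addl.
      by apply: sq_le => //; rewrite eE -addrA lerDl addr_ge0.
    have g2 := ler_wpM2l Kt0 h2; have g3 := ler_wpM2l Ky0 h3; have g4 := mulr_ge0 Ks0 eU0.
    apply: le_trans (E_csub (measurable_csub (measurable_csub m0 mx) mt_) my_
      (E_csub (measurable_csub m0 mx) mt_ (E_csub m0 mx E_zero (xterm_le zeta)) (ht N zeta N0 lo))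
      (hy_ hx hy zeta)) _.
    rewrite lee_fin -/k -/H -/W -/L.
    move: g2 g3 g4 h1; rewrite /K; move: (e ^+ 2 * U) (W ^+ mt * L) (W ^+ my * L) => X Y Z.
    by rewrite !mulr0 expr0n /=; lra.
have kW : 1 <= k * W.
  apply: (@le_trans _ _ (k * freq2 zeta)); first by rewrite ltW// ltNge.
  by rewrite ler_wpM2l ?(ltW k0).
have h1 : L <= e ^+ 2 * U.
  apply: (@le_trans _ _ ((k * W) ^+ 4 * L)); first by rewrite ler_peMl// exprn_ege1.
  rewrite exprMn -mulrA; apply: (@le_trans _ _ ((k ^+ 2) ^+ 2 * U)).
    by rewrite -exprM ler_wpM2l ?exprn_ge0 ?(ltW k0)// WL// leq_addl.
  by apply: sq_le => //; rewrite eE lerDr addr_ge0.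
have h3 : H ^+ 2 * (W ^+ my * L) <= e ^+ 2 * U.
  apply: (@le_trans _ _ ((kap * H) ^+ 2 * (W ^+ (1 + my) * L))).
    rewrite exprMn kap2 exprD expr1.
    have := ler_wpM2r (mulr_ge0 (sqr_ge0 H) (mulr_ge0 (exprn_ge0 my (le_trans ler01 W1)) L0)) kW.
    rewrite mul1r => /le_trans; apply; rewrite le_eqVlt; apply/orP; left; apply/eqP; ring.
  apply: (@le_trans _ _ ((kap * H) ^+ 2 * U)).
    rewrite ler_wpM2l ?sqr_ge0// WL//.
    by rewrite addnC leq_add// leq_addl.
  by apply: sq_le => //; rewrite eE addrAC lerDr addr_ge0.
have g3 := ler_wpM2l Ky0 h3; have g4 := mulr_ge0 Ks0 eU0.
have g5 := mulr_ge0 (mulr_ge0 Kt0 (sqr_ge0 T)) eU0.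
have bound (z : Omega -> C) (v : R) : measurable_fun setT z ->
    (E (fun w => cn2 (z w)) <= v%:E)%E ->
    (E (fun w => cn2 (csub (csub (csub (z w) (xterm zeta w)) (0, 0)) (yterm hx hy zeta w))) <=
      (K * (e ^+ 2 * U) + 8 * v)%:E)%E.
  move=> mz hz.
  apply: le_trans (E_csub (measurable_csub (measurable_csub mz mx) m0) my_
    (E_csub (measurable_csub mz mx) m0 (E_csub mz mx hz (xterm_le zeta)) E_zero)
    (hy_ hx hy zeta)) _.
  rewrite lee_fin -/H -/W -/L.
  move: g3 g4 g5 h1; rewrite /K; move: (e ^+ 2 * U) (W ^+ my * L) => Y Z; lra.
case: (boolP (box hx hy zeta)) => bx /=; last first.
  apply: le_trans (bound _ _ m0 E_zero) _.
  by rewrite lee_fin mulr0 lerD2l sqr_ge0.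
apply: le_trans (bound _ _ ma (ampterm_le N0 bx)) _; rewrite lee_fin lerD2l.
(* At high frequency the scheme is at most e^(-2sN) in mean square, and the coefficient 8 from three
   uses of [E_csub] is below 3^2. *)
have -> : Num.min 1 (k * freq2 zeta) = 1 by apply/min_idPl; rewrite ltW// ltNge.
rewrite !mulr1 exprMn -(mulrN 2 s) -/k expRM_natl -exprM mulnC exprM.
by rewrite ler_wpM2r ?sqr_ge0// expr2; lra.
Qed.

(** The deterministic size [q] of the remainder; the last summand is e^(-sN) integrated over the
    Brillouin zone, up to a constant. *)
Definition rest_bound (N : nat) (hx hy : R) : R := rest_scale N hx hy + expR (- s) ^+ N / (hx * hy).

Let rest_scale_gt0 N hx hy : (0 < N)%N -> 0 < rest_scale N hx hy.
Proof.
move=> N0; rewrite /rest_scale ltr_wpDl ?exprn_gt0 ?step_gt0// addr_ge0 ?sqr_ge0//.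
by rewrite mulr_ge0 ?sqrtr_ge0// addr_ge0 ?sqr_ge0.
Qed.

Lemma exists_restterm_RV : exists G : R, forall N hx hy x y, (0 < N)%N -> 0 < hx -> 0 < hy ->
  exists2 Y : {RV P >-> R}, moments_bounded_by G Y &
    forall w, rest_bound N hx hy * Y w = inv_fourier c x y (fun zeta => restterm N hx hy zeta w).
Proof.
have [K K0 hK] := restterm_le.
pose G := (K + 1) * (pi / b) + 12 * pi ^+ 2; exists (G + G ^+ 2) => N hx hy x y N0 hx0 hy0.
have e0 := rest_scale_gt0 hx hy N0; set e := rest_scale N hx hy in e0.
have th0 : 0 <= expR (- s) ^+ N by rewrite exprn_ge0 ?expR_ge0.
have h0 : 0 < hx * hy by exact: mulr_gt0.
have A0 : 0 < (K + 1) * e by rewrite mulr_gt0// ltr_wpDl.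
have B0 : 0 <= 3 * expR (- s) ^+ N by rewrite mulr_ge0.
have hf zeta : (E (fun w => cn2 (restterm N hx hy zeta w)) <=
    (envelope ((K + 1) * e) (3 * expR (- s) ^+ N) b hx hy zeta ^+ 2)%:E)%E.
  apply: le_trans (hK N hx hy zeta N0) _; rewrite lee_fin; apply: le_envelope => //.
  exact: ltW.
have th1 : 0 <= expR (- s) ^+ N / (hx * hy) by rewrite divr_ge0// ltW.
have q0 : 0 < rest_bound N hx hy by rewrite /rest_bound ltr_wpDr.
have pb0 : 0 <= pi / b by rewrite divr_ge0 ?pi_ge0// ltW.
have aG : (rest_bound N hx hy)^-1 *
    ((K + 1) * e * (pi / b) + 3 * expR (- s) ^+ N * (4 * pi ^+ 2 / (hx * hy))) <= G.
  rewrite mulrC ler_pdivrMr// /rest_bound -/e.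
  have K1 : 0 <= (K + 1) * (pi / b) by rewrite mulr_ge0// addr_ge0.
  have := mulr_ge0 K1 th1; have := mulr_ge0 (ltW e0) (sqr_ge0 (pi : R)).
  move: (expR _ ^+ N) => t.
  have -> : 3 * t * (4 * pi ^+ 2 / (hx * hy)) = 12 * pi ^+ 2 * (t / (hx * hy)) by ring.
  by rewrite /G; move: (t / (hx * hy)) (pi / b) => u v; lra.
have a0 : 0 <= (rest_bound N hx hy)^-1 by rewrite invr_ge0 ltW.
have [Y [YE Ym]] := scaled_inv_fourier_moments c A0 B0 b_gt0 hx0 hy0 x y
  (measurable_restterm N0 hx hy) hf a0 aG.
by exists Y => // w; rewrite YE mulVKf// gt_eqF.
Qed.

Local Notation integrable_twist x y f :=
  (lebesgue2.-integrable setT (EFin \o (fun zeta => twist (f zeta) (phase c x y zeta)))).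

Lemma inv_fourier_comb x y (u v : R) (f g h : C -> C) :
  (forall zeta, f zeta = (u * (g zeta).1 + v * (h zeta).1, u * (g zeta).2 + v * (h zeta).2)) ->
  integrable_twist x y g -> integrable_twist x y h ->
  integrable_twist x y f /\
  inv_fourier c x y f = u * inv_fourier c x y g + v * inv_fourier c x y h.
Proof.
move=> fE ig ih.
have e : (fun zeta => twist (f zeta) (phase c x y zeta)) =
    (fun zeta => u * twist (g zeta) (phase c x y zeta) + v * twist (h zeta) (phase c x y zeta)).
  by apply/funext => zeta; rewrite fE /twist /=; ring.
have iu := integrable_EFinZ u ig; have iv := integrable_EFinZ v ih.
rewrite e; split; first exact: integrable_EFinD.
rewrite /inv_fourier e (RintegralD _ iu iv)// !RintegralZl//.
by ring.
Qed.

(** For almost every w all the integrands are integrable, by their envelopes; for such w the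
    identity is the linearity of the integral. *)
Lemma expansion_ae N hx hy x y : (0 < N)%N -> 0 < hx -> 0 < hy ->
  {ae P, forall w,
    inv_fourier c x y (fun zeta => sel (box hx hy zeta) (ampterm N hx hy zeta w))
      - inv_fourier c x y (fun zeta => xterm zeta w) =
    inv_fourier c x y (fun zeta => timeterm N zeta w)
      + hx ^+ 2 * inv_fourier c x y (fun zeta => yterm 1 0 zeta w)
      + hy ^+ 2 * inv_fourier c x y (fun zeta => yterm 0 1 zeta w)
      + inv_fourier c x y (fun zeta => restterm N hx hy zeta w)}.
Proof.
move=> N0 hx0 hy0.
have aamp : {ae P, forall w, integrable_twist x y (fun zeta => sel (box hx hy zeta) (ampterm N hx hy zeta w))}.
  have A0 : 0 < (0 + 1) * 1 :> R by rewrite add0r mulr1.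
  apply: (ae_integrable_twist c A0 ler01 b_gt0 hx0 hy0 x y (measurable_boxterm N0 hx hy)) => zeta.
  case: (boolP (box hx hy zeta)) => bx /=; last first.
    by apply: le_trans E_zero _; rewrite lee_fin sqr_ge0.
  apply: le_trans (ampterm_le N0 bx) _; rewrite lee_fin; apply: le_envelope => //.
  rewrite bx !mul0r add0r mulr1 expr1n exprn_ile1 ?expR_ge0// -[leRHS]expR0 ler_expR oppr_le0.
  rewrite !mulr_ge0 ?(ltW s_gt0)// le_min ler01 /= mulr_ge0 ?freq2_ge0// ltW//.
  exact: step_gt0.
have gauss_ae (f : C -> Omega -> C) (K : R) :
    measurable_fun setT (fun u : C * Omega => f u.1 u.2) -> 0 <= K ->
    (forall zeta, (E (fun w => cn2 (f zeta w)) <= (K * gauss2 b zeta ^+ 2)%:E)%E) ->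
    {ae P, forall w, integrable_twist x y (fun zeta => f zeta w)}.
  move=> mf K0 hK.
  have A0 : 0 < (K + 1) * 1 by rewrite mulr1 ltr_wpDl.
  apply: (ae_integrable_twist c A0 (lexx 0) b_gt0 hx0 hy0 x y mf) => zeta.
  apply: le_trans (hK zeta) _; rewrite lee_fin; apply: le_envelope => //.
  by rewrite mul0r expr0n/= addr0 expr1n mulr1.
have ax : {ae P, forall w, integrable_twist x y (fun zeta => xterm zeta w)}.
  have [A A0 hA] := weight_gauss 0; apply: gauss_ae measurable_xterm (ltW A0) _ => zeta.
  apply: le_trans (xterm_le zeta) _; rewrite lee_fin.
  by have := hA zeta; rewrite expr0 mul1r.
have at_ : {ae P, forall w, integrable_twist x y (fun zeta => timeterm N zeta w)}.
  have [K K0 hK] := timeterm_gauss.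
  apply: (gauss_ae _ (K * step N ^+ 2) (measurable_timeterm N0)) => [|zeta].
    by rewrite mulr_ge0 ?sqr_ge0.
  exact: hK.
have ay u v : {ae P, forall w, integrable_twist x y (fun zeta => yterm u v zeta w)}.
  have [K K0 hK] := yterm_le.
  apply: (gauss_ae _ (K * (u ^+ 2 + v ^+ 2) ^+ 2) (measurable_yterm u v)) => [|zeta].
    by rewrite mulr_ge0 ?sqr_ge0.
  exact: hK.
apply: filterS (filterI aamp (filterI ax (filterI at_ (filterI (ay 1 0) (ay 0 1))))) => w [h1 [h2 [h3 [h4 h5]]]].
have subE (z1 z2 : C) : csub z1 z2 = (1 * z1.1 + -1 * z2.1, 1 * z1.2 + -1 * z2.2).
  by apply: cplxP; rewrite /=; ring.
(* [ystep] is linear in (h_x^2, h_y^2) and [exact] does not involve h, so the correction is a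
   combination of its values at (1, 0) and (0, 1). These give E2 and E3, free of the mesh. *)
have yE zeta : yterm hx hy zeta w =
    (hx ^+ 2 * (yterm 1 0 zeta w).1 + hy ^+ 2 * (yterm 0 1 zeta w).1,
     hx ^+ 2 * (yterm 1 0 zeta w).2 + hy ^+ 2 * (yterm 0 1 zeta w).2).
  rewrite /yterm; move: (increment_pair _ _ _ _ _) => z.
  have -> : exact c (1, 0, Num.sqrt T) zeta z = exact c (hx, hy, Num.sqrt T) zeta z by [].
  have -> : exact c (0, 1, Num.sqrt T) zeta z = exact c (hx, hy, Num.sqrt T) zeta z by [].
  move: (exact _ _ _ _) => X.
  rewrite /ystep /alpha /incr1 /s1X /s1Y /m1X /m1Y /=.
  by apply: cplxP; rewrite /=; field.
have [i1 e1] := inv_fourier_comb (fun zeta => subE (sel (box hx hy zeta) (ampterm N hx hy zeta w))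
  (xterm zeta w)) h1 h2.
have [i2 e2] := inv_fourier_comb (fun zeta => subE _ (timeterm N zeta w)) i1 h3.
have [iy ey] := inv_fourier_comb yE h4 h5.
have [i3 e3] := inv_fourier_comb (fun zeta => subE _ (yterm hx hy zeta w)) i2 iy.
have -> : inv_fourier c x y (fun zeta => restterm N hx hy zeta w) = _ := e3.
rewrite e2 e1 ey; do 5 move: (inv_fourier _ _ _ _) => ?; clear; ring.
Qed.

End expansion.

(** * Fourier inversion of the solution of the SPDE *)

Section gaussian_transform.
Context {R : realType}.
Local Notation mu := (@lebesgue_measure R).
Local Notation C := (R * R)%type.

Lemma Rintegral_odd (f : R -> R) : mu.-integrable setT (EFin \o f) ->
  (forall x, f (- x) = - f x) -> \int[mu]_x f x = 0.
Proof.
move=> fi fN.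
have fNi : mu.-integrable setT (EFin \o f \o (-%R : measurableTypeR R -> measurableTypeR R)).
  rewrite (_ : _ \o _ = EFin \o (fun x => -1 * f x)); first exact: integrable_EFinZ.
  by apply/funext => x; rewrite /= fN mulN1r.
have h : \int[mu]_x f x = \int[mu]_x f (- x).
  rewrite /Rintegral; congr fine.
  transitivity (\int[pushforward mu (-%R : measurableTypeR R -> measurableTypeR R)]_x (f x)%:E)%E.
    by apply: eq_measure_integral => /= A mA _; rewrite lebesgue_measureN.
  have mN : measurable_fun setT (-%R : measurableTypeR R -> measurableTypeR R) by [].
  exact: (integral_pushforward mN (measurable_int _ fi) fNi measurableT).
have : \int[mu]_x f (- x) = - \int[mu]_x f x.
  rewrite -mulN1r -RintegralZl//; apply: eq_Rintegral => x _; by rewrite fN mulN1r.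
by rewrite -h; set I := \int[mu]_x f x; lra.
Qed.

Lemma gauss_sin (a t : R) : 0 < a ->
  \int[mu]_x (expR (- (a * x ^+ 2)) * sin (t * x)) = 0.
Proof.
move=> a0; apply: Rintegral_odd => [|x]; last by rewrite sqrrN mulrN sinN mulrN.
by apply: integrable_gauss_bounded => // [|x]; [exact: measurable_sinM|exact: norm_sin_le1].
Qed.

Lemma gauss_cos2 (a b u v : R) : 0 < a -> 0 < b ->
  \int[lebesgue2]_(zeta in setT)
    (expR (- (a * zeta.1 ^+ 2)) * expR (- (b * zeta.2 ^+ 2)) * cos (u * zeta.1 + v * zeta.2)) =
  Num.sqrt (pi / a) * expR (- (u ^+ 2 / (4 * a)))
    * (Num.sqrt (pi / b) * expR (- (v ^+ 2 / (4 * b)))).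
Proof.
move=> a0 b0; set F := fun zeta : C => _.
pose m := Num.min a b; have m0 : 0 < m by rewrite lt_min a0.
have mF : measurable_fun setT F.
  apply: measurable_funM; first apply: measurable_funM.
  - by apply: measurableT_comp => //; apply: measurableT_comp => //; apply: measurable_funM => //; apply: measurable_funX.
  - by apply: measurableT_comp => //; apply: measurableT_comp => //; apply: measurable_funM => //; apply: measurable_funX.
  apply: (measurableT_comp (continuous_measurable_fun (@continuous_cos R))).
  by apply: measurable_funD; exact: measurable_funM.
have iF : lebesgue2.-integrable setT (EFin \o F).
  apply: (@le_integrable_EFin _ _ _ lebesgue2 F (gauss2 m) mF _ (integrable_gauss2 m0)) => zeta.
  rewrite /F normrM ger0_norm ?mulr_ge0 ?expR_ge0// -expRD.
  apply: (@le_trans _ _ (expR (- (a * zeta.1 ^+ 2) - b * zeta.2 ^+ 2))).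
    by rewrite ler_piMr ?expR_ge0// norm_cos_le1.
  rewrite ler_expR /freq2 -opprD lerN2 mulrDr lerD// ler_wpM2r ?sqr_ge0//.
    by rewrite ge_min lexx.
  by rewrite ge_min lexx orbT.
have gc t := @gauss_cos R b t b0.
have gs t := @gauss_sin b t b0.
rewrite /Rintegral -(integral12_prod_meas1 iF) /fubini_F.
transitivity (fine (\int[mu]_x
    (expR (- (a * x ^+ 2)) * cos (u * x) * (Num.sqrt (pi / b) * expR (- (v ^+ 2 / (4 * b)))))%:E)%E).
  congr fine; apply: eq_integral => x _.
  have ic : mu.-integrable setT (EFin \o (fun y => expR (- (a * x ^+ 2)) * cos (u * x) * (expR (- (b * y ^+ 2)) * cos (v * y)))).
    apply: integrable_EFinZ; apply: integrable_gauss_bounded => // [|y].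
      exact: measurable_cosM.
    exact: norm_cos_le1.
  have is_ : mu.-integrable setT (EFin \o (fun y => - (expR (- (a * x ^+ 2)) * sin (u * x)) * (expR (- (b * y ^+ 2)) * sin (v * y)))).
    apply: integrable_EFinZ; apply: integrable_gauss_bounded => // [|y].
      exact: measurable_sinM.
    exact: norm_sin_le1.
  have e : (fun y => F (x, y)) = (fun y => expR (- (a * x ^+ 2)) * cos (u * x) * (expR (- (b * y ^+ 2)) * cos (v * y))
      + - (expR (- (a * x ^+ 2)) * sin (u * x)) * (expR (- (b * y ^+ 2)) * sin (v * y))).
    by apply/funext => y; rewrite /F /= cosD; ring.
  rewrite -[LHS]fineK; last first.
    have := integrable_fin_num _ (integrable_EFinD ic is_).
    by rewrite -e; apply.
  congr EFin; rewrite -[LHS]/(\int[mu]_y F (x, y)) e (RintegralD _ ic is_)//.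
  rewrite !RintegralZl//.
  - by rewrite gc gs mulr0 addr0.
  - by apply: integrable_gauss_bounded => // [|y]; [exact: measurable_sinM|exact: norm_sin_le1].
  - by apply: integrable_gauss_bounded => // [|y]; [exact: measurable_cosM|exact: norm_cos_le1].
rewrite -[LHS]/(\int[mu]_x (expR (- (a * x ^+ 2)) * cos (u * x) * _)).
under eq_Rintegral do rewrite mulrC.
rewrite RintegralZl//; first by rewrite gauss_cos// mulrC.
by apply: integrable_gauss_bounded => // [|y]; [exact: measurable_cosM|exact: norm_cos_le1].
Qed.

(** The transform is the Gaussian e^(-a xi^2 - b eta^2) times a phase that moves the centre to the
    one of the explicit solution, so [gauss_cos2] inverts it. *)
Lemma inv_fourier_exact (c : spde_data R) (T x y : R) (z : C) : 0 < T ->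
  0 <= rho_x c < 1 -> 0 <= rho_y c < 1 ->
  inv_fourier c x y (fun zeta => exact c (0, 0, Num.sqrt T) zeta z) =
  spde_solution c T (Num.sqrt T * z.1) (Num.sqrt T * z.2) x y.
Proof.
move=> T0 /andP[_ rx] /andP[_ ry].
pose a := (1 - rho_x c) * T / 2; pose b := (1 - rho_y c) * T / 2.
have a0 : 0 < a by rewrite divr_gt0// mulr_gt0// subr_gt0.
have b0 : 0 < b by rewrite divr_gt0// mulr_gt0// subr_gt0.
pose u := x - x0 c - mu_x c * T - Num.sqrt (rho_x c) * (Num.sqrt T * z.1).
pose v := y - y0 c - mu_y c * T - Num.sqrt (rho_y c) * (Num.sqrt T * z.2).
have T2 : Num.sqrt T ^+ 2 = T by rewrite sqr_sqrtr// ltW.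
rewrite /inv_fourier.
have -> : (fun zeta => twist (exact c (0, 0, Num.sqrt T) zeta z) (phase c x y zeta)) =
    (fun zeta : C => expR (- (a * zeta.1 ^+ 2)) * expR (- (b * zeta.2 ^+ 2))
       * cos (u * zeta.1 + v * zeta.2)).
  apply/funext => zeta; rewrite exactE /twist /=.
  set th := _ + incr _ _ _ _.
  have -> : u * zeta.1 + v * zeta.2 = phase c x y zeta - th.
    rewrite /th /u /v /phase /drift /incr /sX /sY /sinq /= eqxx T2; ring.
  rewrite cosB -expRD (_ : - decay c _ zeta = - (a * zeta.1 ^+ 2) - b * zeta.2 ^+ 2); last first.
    by rewrite /decay /= T2 /a /b; field.
  by ring.
rewrite gauss_cos2// /spde_solution -/u -/v.
set r := Num.sqrt ((1 - rho_x c) * (1 - rho_y c)).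
have sx : 0 < 1 - rho_x c by rewrite subr_gt0.
have sy : 0 < 1 - rho_y c by rewrite subr_gt0.
have r0 : 0 < r by rewrite sqrtr_gt0 mulr_gt0.
have r2 : r ^+ 2 = (1 - rho_x c) * (1 - rho_y c) by rewrite sqr_sqrtr// ltW// mulr_gt0.
have pi0 := @pi_gt0 R.
have ab : Num.sqrt (pi / a) * Num.sqrt (pi / b) = 2 * pi / (r * T).
  rewrite -sqrtrM; last exact: divr_ge0 (ltW pi0) (ltW a0).
  have -> : pi / a * (pi / b) = (2 * pi / (r * T)) ^+ 2.
    rewrite /a /b expr_div_n (exprMn _ r) r2; field.
    by rewrite (gt_eqF sx) (gt_eqF sy) (gt_eqF T0).
  by rewrite sqrtr_sqr ger0_norm// divr_ge0 ?mulr_ge0 ?(ltW pi0) ?(ltW r0) ?(ltW T0).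
have eE : expR (- u ^+ 2 / (2 * (1 - rho_x c) * T) - v ^+ 2 / (2 * (1 - rho_y c) * T)) =
    expR (- (u ^+ 2 / (4 * a))) * expR (- (v ^+ 2 / (4 * b))).
  rewrite -expRD; congr expR; rewrite /a /b; field.
  by rewrite (gt_eqF sx) (gt_eqF sy) (gt_eqF T0).
rewrite eE; move: (expR _) (expR _) => e1 e2.
transitivity ((4 * pi ^+ 2)^-1 * (Num.sqrt (pi / a) * Num.sqrt (pi / b)) * (e1 * e2)); first by ring.
rewrite ab; clear ab eE; move: (@pi R) pi0 => p p0; field.
by rewrite (gt_eqF p0) (gt_eqF r0) (gt_eqF T0).
Qed.

End gaussian_transform.

(** * The scheme as a Fourier integral *)

Section trigonometric_orthogonality.
Context {R : realType}.
Local Notation mu := (@lebesgue_measure R).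
Local Notation C := (R * R)%type.

Lemma sin_int_pi (m : int) : sin (m%:~R * pi) = 0 :> R.
Proof.
have h (n : nat) : sin (n%:R * pi) = 0 :> R.
  elim: n => [|n IH]; first by rewrite mul0r sin0.
  by rewrite -natr1 mulrDl mul1r sinDpi IH oppr0.
case: m => n; first exact: h.
by rewrite NegzE mulrNz mulNr sinN h oppr0.
Qed.

Let ind (h x : R) : R := (`|h * x| <= pi)%R%:R.

Let measurable_ind h : measurable_fun setT (ind h).
Proof.
rewrite (_ : ind h = (fun x => if `|h * x| <= pi then 1 else 0)); last first.
  by apply/funext => x; rewrite /ind; case: (_ <= _).
apply: measurable_fun_ifT => //; apply: measurable_fun_ler => //.
by apply: measurableT_comp => //; exact: measurable_funM.
Qed.

Let integrable_ind h : 0 < h -> mu.-integrable setT (EFin \o ind h).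
Proof.
move=> h0.
apply: (@le_integrable_EFin _ _ _ mu (ind h) (fun x => expR (pi ^+ 2) * expR (- (h ^+ 2 * x ^+ 2)))) => //.
- exact: measurable_ind.
- move=> x; rewrite -expRD /ind; case: (boolP (`|h * x| <= pi)) => hx /=; last by rewrite normr0 expR_ge0.
  rewrite normr1 -expR0 ler_expR -exprMn subr_ge0 -(real_normK (num_real (h * x))).
  by rewrite lerXn2r ?nnegrE// pi_ge0.
- by apply: integrable_EFinZ; apply: integrable_gauss; rewrite exprn_gt0.
Qed.

Let integrable_ind_mul h (g : R -> R) : 0 < h -> measurable_fun setT g -> (forall x, `|g x| <= 1) ->
  mu.-integrable setT (EFin \o (fun x => ind h x * g x)).
Proof.
move=> h0 mg g1.
apply: (@le_integrable_EFin _ _ _ mu _ (ind h)) (integrable_ind h0) => [|x].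
  by apply: measurable_funM => //; exact: measurable_ind.
by rewrite normrM (@ger0_norm _ (ind h x)) ?ler0n// ler_piMr ?ler0n.
Qed.

Let ind_itv h (g : R -> R) : 0 < h ->
  \int[mu]_x (ind h x * g x) = \int[mu]_(x in `[- (pi / h), pi / h]) g x.
Proof.
move=> h0; rewrite /Rintegral [in RHS]integral_mkcond; congr fine; apply: eq_integral => x _.
rewrite patchE /ind mem_setE in_itv /= -ler_norml.
have -> : `|h * x| = `|x| * h by rewrite normrM gtr0_norm// mulrC.
have -> : (`|x| <= pi / h) = (`|x| * h <= pi) by rewrite ler_pdivlMr.
by case: (_ <= _); rewrite ?mul1r ?mul0r.
Qed.

Lemma integral_ind_cos (h : R) (m : int) : 0 < h ->
  \int[mu]_x ((`|h * x| <= pi)%R%:R * cos (h * m%:~R * x)) = if m == 0 then 2 * pi / h else 0.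
Proof.
move=> h0; rewrite -/(ind h _) (ind_itv _ h0).
have ph : 0 < pi / h by rewrite divr_gt0// pi_gt0.
have pN : - (pi / h) < pi / h by rewrite gtrN.
case: eqP => [->|/eqP m0].
  under eq_Rintegral do rewrite mulr0z mulr0 mul0r cos0.
  rewrite /Rintegral integral_cst//= lebesgue_measure_itv/= lte_fin pN mul1e -EFinB/=.
  by field; exact: lt0r_neq0.
set t := h * m%:~R.
have t0 : t != 0 by rewrite mulf_neq0 ?(gt_eqF h0)// ?intr_eq0.
pose F (x : R) := t^-1 * sin (t * x).
have dF x : is_derive x (1 : R) F (cos (t * x)).
  have := is_deriveZ t^-1 (is_derive_sinM t x).
  by move=> /is_derive_eq; apply; rewrite /GRing.scale /= mulKf.
have cF x : {for x, continuous F}.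
  by apply: differentiable_continuous; apply/derivable1_diffP; exact: (@ex_derive _ _ _ _ _ _ _ (dF x)).
rewrite /Rintegral (@continuous_FTC2 _ (fun x => cos (t * x)) F)//.
- rewrite /= /F mulrN sinN mulrN opprK.
  have -> : t * (pi / h) = m%:~R * pi by rewrite /t; field; exact: lt0r_neq0.
  by rewrite sin_int_pi mulr0 addr0.
- apply: continuous_subspaceT => x.
  by apply: continuous_comp; [exact: mulrl_continuous|exact: continuous_cos].
- split=> [x _||].
  + exact: (@ex_derive _ _ _ _ _ _ _ (dF x)).
  + by apply: cvg_at_right_filter; exact: cF.
  + by apply: cvg_at_left_filter; exact: cF.
- by move=> x _; rewrite derive1E; exact: (@derive_val _ _ _ _ _ _ _ (dF x)).
Qed.

Lemma integral_ind_sin (h t : R) : 0 < h ->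
  \int[mu]_x ((`|h * x| <= pi)%R%:R * sin (t * x)) = 0.
Proof.
move=> h0; apply: Rintegral_odd => [|x].
  by apply: integrable_ind_mul => // [|x]; [exact: measurable_sinM|exact: norm_sin_le1].
by rewrite !mulrN sinN normrN mulrN.
Qed.

(** The product of sines in the addition formula is odd in each variable and integrates to 0, which
    leaves a product of two integrals on the line. *)
Lemma integral_box_cos (hx hy : R) (m n : int) : 0 < hx -> 0 < hy ->
  lebesgue2.-integrable setT (EFin \o (fun zeta : C => (box hx hy zeta)%:R
    * cos (hx * m%:~R * zeta.1 + hy * n%:~R * zeta.2))) /\
  \int[lebesgue2]_(zeta in setT) ((box hx hy zeta)%:R
    * cos (hx * m%:~R * zeta.1 + hy * n%:~R * zeta.2)) =
  if (m == 0) && (n == 0) then 4 * pi ^+ 2 / (hx * hy) else 0.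
Proof.
move=> hx0 hy0; set F := fun zeta : C => _ * _.
have mb : measurable_fun setT (fun zeta : C => (box hx hy zeta)%:R : R).
  rewrite (_ : (fun z => _) = (fun z => if box hx hy z then 1 else 0)); last first.
    by apply/funext => z; case: box.
  by apply: measurable_fun_ifT => //; exact: measurable_box.
have mF : measurable_fun setT F.
  apply: measurable_funM => //.
  apply: (measurableT_comp (continuous_measurable_fun (@continuous_cos R))).
  by apply: measurable_funD; exact: measurable_funM.
have iF : lebesgue2.-integrable setT (EFin \o F).
  apply: (@le_integrable_EFin _ _ _ lebesgue2 F (fun zeta => (box hx hy zeta)%:R) mF).
    by move=> z; rewrite normrM ger0_norm ?ler0n// ler_piMr ?ler0n// norm_cos_le1.
  apply/integrableP; split; first exact/measurable_EFinP.
  under eq_integral do rewrite /= ger0_norm ?ler0n//.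
  by rewrite integral_box// ltry.
split => //; rewrite /Rintegral -(integral12_prod_meas1 iF) /fubini_F.
pose In := \int[mu]_y (ind hy y * cos (hy * n%:~R * y)).
transitivity (fine (\int[mu]_x (In * (ind hx x * cos (hx * m%:~R * x)))%:E)%E).
  congr fine; apply: eq_integral => x _.
  have ic := integrable_EFinZ (ind hx x * cos (hx * m%:~R * x)) (integrable_ind_mul hy0
    (measurable_cosM (hy * n%:~R)) (fun y => norm_cos_le1 _)).
  have is_ := integrable_EFinZ (- (ind hx x * sin (hx * m%:~R * x))) (integrable_ind_mul hy0
    (measurable_sinM (hy * n%:~R)) (fun y => norm_sin_le1 _)).
  have e : (fun y => F (x, y)) = (fun y => ind hx x * cos (hx * m%:~R * x) * (ind hy y * cos (hy * n%:~R * y))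
      + - (ind hx x * sin (hx * m%:~R * x)) * (ind hy y * sin (hy * n%:~R * y))).
    by apply/funext => y; rewrite /F /box /= -mulnb natrM cosD /ind; ring.
  rewrite -[LHS]fineK; last first.
    have := integrable_fin_num _ (integrable_EFinD ic is_).
    by rewrite -e; apply.
  congr EFin; rewrite -[LHS]/(\int[mu]_y F (x, y)) e (RintegralD _ ic is_)//.
  rewrite !RintegralZl//.
  - by rewrite -/In integral_ind_sin// mulr0 addr0 mulrC.
  - by apply: integrable_ind_mul => // [|y]; [exact: measurable_sinM|exact: norm_sin_le1].
  - by apply: integrable_ind_mul => // [|y]; [exact: measurable_cosM|exact: norm_cos_le1].
rewrite -[LHS]/(\int[mu]_x (In * (ind hx x * cos (hx * m%:~R * x)))) RintegralZl//; last first.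
  by apply: integrable_ind_mul => // [|y]; [exact: measurable_cosM|exact: norm_cos_le1].
rewrite /In !integral_ind_cos//.
case: (m == 0); case: (n == 0); rewrite /= ?mulr0 ?mul0r//.
by field; rewrite (gt_eqF hx0) (gt_eqF hy0).
Qed.

End trigonometric_orthogonality.

(** * Sums of nonnegative families *)

Section sums.
Context {R : realType} {I : choiceType}.
Implicit Types f g : I -> R.

(** Only nonnegative families are summed, in the extended reals, so that sums may be rearranged
    freely; signed expressions are written as differences of two such families. *)
Definition has_sum f (v : R) : Prop :=
  (forall p, 0 <= f p) /\ (\esum_(p in [set: I]) (f p)%:E)%E = v%:E.

Lemma has_sumD f g (v w : R) : has_sum f v -> has_sum g w ->
  has_sum (fun p => f p + g p) (v + w).
Proof.
move=> [f0 fv] [g0 gw]; split=> [p|]; first exact: addr_ge0.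
rewrite EFinD -fv -gw -esumD//; try by move=> p _; rewrite lee_fin.
Qed.

Lemma has_sumZ (a : R) f (v : R) : 0 <= a -> has_sum f v ->
  has_sum (fun p => a * f p) (a * v).
Proof.
(* One inequality is enough: the reverse one is its instance at the inverse of [a]. *)
have le (b : R) (g : I -> R) : 0 <= b -> (forall p, 0 <= g p) ->
    ((\esum_(p in [set: I]) (b * g p)%:E) <= b%:E * \esum_(p in [set: I]) (g p)%:E)%E.
  move=> b0 g0; apply: ge_ereal_sup => _ [X [finX _] <-].
  under eq_fsbigr do rewrite EFinM.
  rewrite -ge0_mule_fsumr; last by move=> p; rewrite lee_fin.
  by rewrite lee_wpmul2l ?lee_fin//; apply: ereal_sup_ubound; exists X.
move=> a0 [f0 fv]; split=> [p|]; first exact: mulr_ge0.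
move: a0; rewrite le_eqVlt => /predU1P[<-|a0].
  by rewrite mul0r esum1// => p _; rewrite mul0r.
apply/eqP; rewrite eq_le; apply/andP; split.
  by rewrite (le_trans (le _ _ (ltW a0) f0))// fv.
have := le a^-1 (fun p => a * f p); rewrite invr_ge0 (ltW a0) => /(_ erefl (fun p => mulr_ge0 (ltW a0) (f0 p))).
under eq_esum do rewrite mulKf ?gt_eqF//.
by rewrite fv EFinM lee_pdivlMl.
Qed.

Lemma has_sum_le f g (v w : R) : (forall p, f p <= g p) -> has_sum f v -> has_sum g w ->
  v <= w.
Proof.
by move=> fg [f0 fv] [g0 gw]; rewrite -lee_fin -fv -gw; apply: le_esum => p _; rewrite lee_fin.
Qed.

Lemma has_sum_reindex (e e' : I -> I) f (v : R) : cancel e e' -> cancel e' e ->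
  has_sum f v -> has_sum (fun p => f (e p)) v.
Proof.
move=> ee' e'e [f0 fv]; split => [p|]; first exact: f0.
rewrite -fv [RHS](reindex_esum setT setT e)// setTT_bijective.
by exists e'.
Qed.

Lemma has_sum0 f : has_sum f 0 -> forall p, f p = 0.
Proof.
move=> [f0 fv] p; apply/eqP; rewrite eq_le f0 andbT -lee_fin -fv.
have -> : (f p)%:E = (\esum_(q in [set p]) (f q)%:E)%E by rewrite esum_set1 ?lee_fin.
by rewrite [X in (X <= _)%E]esum_mkcond; apply: le_esum => q _; case: ifP; rewrite lee_fin.
Qed.

Lemma has_sum_dominated f g (w : R) : (forall p, 0 <= f p) -> (forall p, f p <= g p) ->
  has_sum g w -> exists v, has_sum f v.
Proof.
move=> f0 fg [g0 gw].
have le : ((\esum_(p in [set: I]) (f p)%:E) <= w%:E)%E.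
  by rewrite -gw; apply: le_esum => p _; rewrite lee_fin.
have ge : (0 <= \esum_(p in [set: I]) (f p)%:E)%E.
  by apply: esum_ge0 => p _; rewrite lee_fin.
exists (fine (\esum_(p in [set: I]) (f p)%:E)%E); split=> //.
by rewrite fineK// ge0_fin_numE// (le_lt_trans le)// ltry.
Qed.

(* [V p * V (e p) = (S p - V p ^+ 2 - V (e p) ^+ 2) / 2] with
   [S p = (V p + V (e p)) ^+ 2] turns every flux into summable nonnegative
   terms. *)
Lemma energy_flux (V : I -> R) (e e' : I -> I) (a b v : R) :
  cancel e e' -> cancel e' e -> 0 <= b -> has_sum (fun p => V p ^+ 2) v ->
  exists L M s, [/\ has_sum L s, has_sum M s & forall p,
    L p - M p <= V p * (a * (V (e p) - V (e' p)) - b * (V (e p) - 2 * V p + V (e' p)))].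
Proof.
move=> ee' e'e b0 Vv.
pose S p := (V p + V (e p)) ^+ 2.
have Vev : has_sum (fun p => V (e p) ^+ 2) v by exact: has_sum_reindex Vv.
have Ve'v : has_sum (fun p => V (e' p) ^+ 2) v by exact: has_sum_reindex Vv.
have [sg Sv] : exists s, has_sum S s.
  apply: (@has_sum_dominated _ (fun p => 2 * (V p ^+ 2) + 2 * (V (e p) ^+ 2)) (2 * v + 2 * v)).
  - by move=> p; exact: sqr_ge0.
  - by move=> p; rewrite /S; have := sqr_ge0 (V p - V (e p)); rewrite !expr2; lra.
  - by apply: has_sumD; apply: has_sumZ.
have S'v : has_sum (fun p => S (e' p)) sg by exact: has_sum_reindex Sv.
(* The drift coefficient may have either sign and is split into a difference of nonnegative
   numbers. *)
have [c [d [c0 d0 cd]]] : exists c d : R, [/\ 0 <= c, 0 <= d & a = c - d].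
  exists (`|a| + a), `|a|; split => //; last by ring.
  by rewrite -lerBlDr sub0r ler_normr lexx orbT.
(* The terms of [L] and [M] correspond up to shifts, so the two sums agree. Pointwise, the pairing
   exceeds L - M by the dissipation b/2 ((V p - V (e p))^2 + (V p - V (e' p))^2). *)
pose L p := (c / 2 * S p + c / 2 * V (e' p) ^+ 2) + (d / 2 * V (e p) ^+ 2 + d / 2 * S (e' p))
  + b * V p ^+ 2.
pose M p := (c / 2 * S (e' p) + c / 2 * V (e p) ^+ 2) + (d / 2 * V (e' p) ^+ 2 + d / 2 * S p)
  + (b / 2 * V (e p) ^+ 2 + b / 2 * V (e' p) ^+ 2).
exists L, M, ((c / 2 * sg + c / 2 * v) + (d / 2 * v + d / 2 * sg) + b * v).
have c2 : 0 <= c / 2 by rewrite divr_ge0.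
have d2 : 0 <= d / 2 by rewrite divr_ge0.
have b2 : 0 <= b / 2 by rewrite divr_ge0.
split.
- by do ![apply: has_sumD|apply: has_sumZ].
- have -> : b * v = b / 2 * v + b / 2 * v by lra.
  by do ![apply: has_sumD|apply: has_sumZ].
- move=> p; rewrite /L /M /S e'e cd -subr_ge0.
  have -> : V p * ((c - d) * (V (e p) - V (e' p)) - b * (V (e p) - 2 * V p + V (e' p))) -
   (c / 2 * (V p + V (e p)) ^+ 2 + c / 2 * V (e' p) ^+ 2 +
    (d / 2 * V (e p) ^+ 2 + d / 2 * (V (e' p) + V p) ^+ 2) + b * V p ^+ 2 -
    (c / 2 * (V (e' p) + V p) ^+ 2 + c / 2 * V (e p) ^+ 2 +
     (d / 2 * V (e' p) ^+ 2 + d / 2 * (V p + V (e p)) ^+ 2) +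
     (b / 2 * V (e p) ^+ 2 + b / 2 * V (e' p) ^+ 2)))
    = b / 2 * ((V p - V (e p)) ^+ 2 + (V p - V (e' p)) ^+ 2) by field.
  by rewrite mulr_ge0// addr_ge0// sqr_ge0.
Qed.

End sums.

(** * Uniqueness of the square summable solution *)

Section scheme_uniqueness.
Context {R : realType}.
Implicit Types (c : spde_data R) (V W : grid_fun R).

Lemma in_ell2P V : in_ell2 V <-> exists v, has_sum (fun p : int * int => V p.1 p.2 ^+ 2) v.
Proof.
have e : (\esum_(p in [set: int * int]) `|(V p.1 p.2 ^+ 2)%:E|)%E
    = (\esum_(p in [set: int * int]) (V p.1 p.2 ^+ 2)%:E)%E.
  by apply: eq_esum => p _; rewrite gee0_abs// lee_fin sqr_ge0.
rewrite /in_ell2 /summable e; split=> [lty|[v [_ ->]]]; last exact: ltry.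
exists (fine (\esum_(p in [set: int * int]) (V p.1 p.2 ^+ 2)%:E)%E); split=> [p|].
  exact: sqr_ge0.
by rewrite fineK// ge0_fin_numE// esum_ge0// => p _; rewrite lee_fin sqr_ge0.
Qed.

Lemma in_ell2B V W : in_ell2 V -> in_ell2 W -> in_ell2 (fun i j => V i j - W i j).
Proof.
move=> /in_ell2P[v Vv] /in_ell2P[w Ww]; apply/in_ell2P.
apply: (@has_sum_dominated _ _ _ (fun p => 2 * V p.1 p.2 ^+ 2 + 2 * W p.1 p.2 ^+ 2) (2 * v + 2 * w)).
- by move=> p; exact: sqr_ge0.
- by move=> p; have := sqr_ge0 (V p.1 p.2 + W p.1 p.2); rewrite !expr2; lra.
- by apply: has_sumD; apply: has_sumZ.
Qed.

(** Pair the equation with W and sum over the grid: the drift contributes 0 and the diffusion is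
    nonnegative, so the sum of W^2 is at most 0. *)
Lemma implicit_lhs_injective0 c (k hx hy : R) W : 0 <= k -> in_ell2 W ->
  (forall i j, implicit_lhs c k hx hy W i j = 0) -> forall i j, W i j = 0.
Proof.
move=> k0 /in_ell2P[v Wv] W0.
have shift1 (a b : int) : cancel (fun p : int * int => (p.1 + a, p.2 + b)) (fun p => (p.1 - a, p.2 - b)).
  by move=> [p q] /=; rewrite !addrK.
have shift2 (a b : int) : cancel (fun p : int * int => (p.1 - a, p.2 - b)) (fun p => (p.1 + a, p.2 + b)).
  by move=> [p q] /=; rewrite !subrK.
have kh (h : R) : 0 <= k / (2 * h ^+ 2) by rewrite divr_ge0// mulr_ge0// sqr_ge0.
have [L1 [M1 [s1 [L1s M1s LM1]]]] := energy_flux (mu_x c * k / (2 * hx)) (shift1 1 0) (shift2 1 0) (kh hx) Wv.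
have [L2 [M2 [s2 [L2s M2s LM2]]]] := energy_flux (mu_y c * k / (2 * hy)) (shift1 0 1) (shift2 0 1) (kh hy) Wv.
have v0 : v + (s1 + s2) <= s1 + s2.
  apply: has_sum_le (has_sumD Wv (has_sumD L1s L2s)) (has_sumD M1s M2s) => -[i j] /=.
  have := LM1 (i, j); have := LM2 (i, j); rewrite /= ?subr0 ?addr0 => l2 l1.
  have := W0 i j; rewrite /implicit_lhs /Dx /Dy /Dxx /Dyy => /(congr1 (fun t => W i j * t)).
  rewrite mulr0; lra.
have ve : v = 0.
  apply/eqP; rewrite eq_le; apply/andP; split; first lra.
  have [W2 e] := Wv; rewrite -lee_fin -e; apply: esum_ge0 => p _; rewrite lee_fin; exact: W2.
move: Wv; rewrite ve => /has_sum0 h i j; apply/eqP; rewrite -sqrf_eq0; apply/eqP; exact: (h (i, j)).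
Qed.

Lemma milstein_scheme_unique c (k hx hy : R) (N : nat) (i0 j0 : int) (zx zy : nat -> R)
    (V W : nat -> grid_fun R) : 0 <= k ->
  milstein_scheme c k hx hy N i0 j0 zx zy V -> milstein_scheme c k hx hy N i0 j0 zx zy W ->
  forall n, (n <= N)%N -> forall i j, V n i j = W n i j.
Proof.
move=> k0 [V0 V2 Vs] [W0 W2 Ws]; elim=> [|n IH] nN i j; first by rewrite V0 W0.
have eVW : V n = W n by apply/funext => i'; apply/funext => j'; exact: IH (ltnW nN) _ _.
apply/eqP; rewrite -subr_eq0; apply/eqP.
apply: (@implicit_lhs_injective0 c k hx hy (fun i j => V n.+1 i j - W n.+1 i j)) => //.
  by apply: in_ell2B; [exact: V2|exact: W2].
move=> i' j'.
have := Vs n nN i' j'; have := Ws n nN i' j'; rewrite eVW => <- /eqP.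
rewrite -subr_eq0 => /eqP <-.
by rewrite /implicit_lhs /Dx /Dy /Dxx /Dyy; ring.
Qed.

End scheme_uniqueness.

(** * Difference operators under the integral sign *)

Section grid_functionals.
Context {R : realType}.
Local Notation C := (R * R)%type.
Local Notation int2 f := (\int[lebesgue2]_(zeta in setT) f zeta).
Local Notation integrable2 f := (lebesgue2.-integrable setT (EFin \o f)).

(** Integrability is part of the property so that it is closed under sums; [a] makes room for the
    prefactor 1/(4 pi^2). *)
Definition commutes_with_integral (Phi : grid_fun R -> R) : Prop :=
  forall (a : R) (G : int -> int -> C -> R), (forall i j, integrable2 (G i j)) ->
    integrable2 (fun zeta => Phi (fun i j => G i j zeta)) /\
    Phi (fun i j => a * int2 (G i j)) = a * int2 (fun zeta => Phi (fun i j => G i j zeta)).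

Lemma commutes_with_integral_eval i j : commutes_with_integral (fun V => V i j).
Proof. by move=> a G iG; split. Qed.

Lemma commutes_with_integralD Phi Psi : commutes_with_integral Phi ->
  commutes_with_integral Psi -> commutes_with_integral (fun V => Phi V + Psi V).
Proof.
move=> hP hQ a G iG; have [iP eP] := hP a G iG; have [iQ eQ] := hQ a G iG.
split; first exact: integrable_EFinD.
by rewrite eP eQ (RintegralD _ iP iQ)// mulrDr.
Qed.

Lemma commutes_with_integralZ b Phi : commutes_with_integral Phi ->
  commutes_with_integral (fun V => b * Phi V).
Proof.
move=> hP a G iG; have [iP eP] := hP a G iG; split; first exact: integrable_EFinZ.
by rewrite eP RintegralZl// mulrCA.
Qed.

Lemma commutes_with_integralN Phi : commutes_with_integral Phi ->
  commutes_with_integral (fun V => - Phi V).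
Proof.
move=> /(commutes_with_integralZ (-1)); have -> // : (fun V => -1 * Phi V) = (fun V => - Phi V).
by apply/funext => V; rewrite mulN1r.
Qed.

Lemma implicit_lhs_commutes c k hx hy i j :
  commutes_with_integral (fun V => implicit_lhs c k hx hy V i j).
Proof.
rewrite /implicit_lhs /Dx /Dy /Dxx /Dyy.
by do ?[exact: commutes_with_integral_eval | apply: commutes_with_integralD
  | apply: commutes_with_integralN | apply: commutes_with_integralZ].
Qed.

Lemma milstein_rhs_commutes c k hx hy zx zy i j :
  commutes_with_integral (fun V => milstein_rhs c k hx hy zx zy V i j).
Proof.
rewrite /milstein_rhs /Dx /Dy /Dxy.
by do ?[exact: commutes_with_integral_eval | apply: commutes_with_integralD
  | apply: commutes_with_integralN | apply: commutes_with_integralZ].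
Qed.

End grid_functionals.

(** * Difference operators on plane waves *)

Section symbols.
Context {R : realType}.
Variables (c : spde_data R) (k hx hy : R).
Hypotheses (k0 : 0 < k) (hx0 : 0 < hx) (hy0 : 0 < hy).
Hypotheses (rho_x0 : 0 <= rho_x c) (rho_y0 : 0 <= rho_y c).
Local Notation C := (R * R)%type.
Variable zeta : C.

(** The real part of z times the plane wave: a difference operator acts by multiplying z by its
    symbol, which keeps grid functions real. *)
Definition wave (z : C) : grid_fun R :=
  fun i j => twist z (phase c (i%:~R * hx) (j%:~R * hy) zeta).

Let a : R := hx * zeta.1.
Let b : R := hy * zeta.2.

Let phasexD i j : phase c ((i + 1)%:~R * hx) (j%:~R * hy) zeta =
  phase c (i%:~R * hx) (j%:~R * hy) zeta + a.
Proof. by rewrite /phase /a intrD; ring. Qed.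
Let phasexB i j : phase c ((i - 1)%:~R * hx) (j%:~R * hy) zeta =
  phase c (i%:~R * hx) (j%:~R * hy) zeta - a.
Proof. by rewrite /phase /a intrB; ring. Qed.
Let phaseyD i j : phase c (i%:~R * hx) ((j + 1)%:~R * hy) zeta =
  phase c (i%:~R * hx) (j%:~R * hy) zeta + b.
Proof. by rewrite /phase /b intrD; ring. Qed.
Let phaseyB i j : phase c (i%:~R * hx) ((j - 1)%:~R * hy) zeta =
  phase c (i%:~R * hx) (j%:~R * hy) zeta - b.
Proof. by rewrite /phase /b intrB; ring. Qed.

Lemma Dx_wave z : Dx (wave z) = wave (cmul (0, 2 * sin a) z).
Proof.
apply/funext => i; apply/funext => j; rewrite /Dx /wave phasexD phasexB /twist.
by rewrite cosD cosB sinD sinB /=; ring.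
Qed.

Lemma Dy_wave z : Dy (wave z) = wave (cmul (0, 2 * sin b) z).
Proof.
apply/funext => i; apply/funext => j; rewrite /Dy /wave phaseyD phaseyB /twist.
by rewrite cosD cosB sinD sinB /=; ring.
Qed.

Lemma Dxx_wave z : Dxx (wave z) = wave (cmul (2 * cos a - 2, 0) z).
Proof.
apply/funext => i; apply/funext => j; rewrite /Dxx /wave phasexD phasexB /twist.
by rewrite cosD cosB sinD sinB /=; ring.
Qed.

Lemma Dyy_wave z : Dyy (wave z) = wave (cmul (2 * cos b - 2, 0) z).
Proof.
apply/funext => i; apply/funext => j; rewrite /Dyy /wave phaseyD phaseyB /twist.
by rewrite cosD cosB sinD sinB /=; ring.
Qed.

Lemma Dxy_wave z : Dxy (wave z) = wave (cmul (0, 2 * sin b) (cmul (0, 2 * sin a) z)).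
Proof.
rewrite -Dy_wave -Dx_wave; apply/funext => i; apply/funext => j.
by rewrite /Dxy /Dy /Dx; ring.
Qed.

Let p : R * R * R := (hx, hy, Num.sqrt k).
Let k2 : Num.sqrt k ^+ 2 = k. Proof. by rewrite sqr_sqrtr// ltW. Qed.

Lemma implicit_lhs_wave z i j :
  implicit_lhs c k hx hy (wave z) i j = wave (cmul (den c p zeta) z) i j.
Proof.
rewrite /implicit_lhs Dx_wave Dy_wave Dxx_wave Dyy_wave /wave /twist.
rewrite /den /sX /sY /mX /mY /sinq /cosq /= !gt_eqF// k2 -/a -/b.
by field; rewrite !gt_eqF.
Qed.

(** As [Dxy] is the product of [Dx] and [Dy], the three second-order terms combine to (quad -
    W^2)/2, where W is the linear noise term [incr]. *)
Lemma milstein_rhs_wave zx zy z i j :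
  milstein_rhs c k hx hy zx zy (wave z) i j = wave (cmul (num c p zeta (zx, zy)) z) i j.
Proof.
rewrite /milstein_rhs !Dx_wave !Dy_wave Dxy_wave /wave /twist.
rewrite /num /quad /incr /sX /sY /sinq /= !gt_eqF// k2 -/a -/b.
rewrite !sqrtrM//.
have : Num.sqrt (rho_x c) ^+ 2 = rho_x c by rewrite sqr_sqrtr.
have : Num.sqrt (rho_y c) ^+ 2 = rho_y c by rewrite sqr_sqrtr.
move: (Num.sqrt (rho_x c)) (Num.sqrt (rho_y c)) (Num.sqrt k) k2 => u v w <- <- <-.
by field; rewrite !gt_eqF.
Qed.

End symbols.

(** * Fourier synthesis and Bessel's inequality *)

Section fourier_synthesis.
Context {R : realType}.
Variables (c : spde_data R) (hx hy : R).
Hypotheses (hx0 : 0 < hx) (hy0 : 0 < hy).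
Local Notation C := (R * R)%type.
Local Notation int2 f := (\int[lebesgue2]_(zeta in setT) f zeta).
Local Notation integrable2 f := (lebesgue2.-integrable setT (EFin \o f)).

Definition bounded_on_box (f : C -> C) : Prop :=
  measurable_fun setT f /\ exists K, forall zeta, box hx hy zeta -> cn2 (f zeta) <= K.

Definition dot (a b : C) : R := a.1 * b.1 + a.2 * b.2.

(** The real part of the inner product of complex functions on the Brillouin zone. *)
Definition box_inner (f g : C -> C) : R := int2 (fun zeta => (box hx hy zeta)%:R * dot (f zeta) (g zeta)).

Definition synthesis (f : C -> C) : grid_fun R := fun i j =>
  inv_fourier c (i%:~R * hx) (j%:~R * hy) (fun zeta => sel (box hx hy zeta) (f zeta)).

Let mbox : measurable_fun setT (fun zeta : C => (box hx hy zeta)%:R : R).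
Proof.
rewrite (_ : (fun z => _) = (fun z => if box hx hy z then 1 else 0)); last first.
  by apply/funext => z; case: box.
by apply: measurable_fun_ifT => //; exact: measurable_box.
Qed.

Let ibox : integrable2 (fun zeta : C => (box hx hy zeta)%:R : R).
Proof.
apply/integrableP; split; first exact/measurable_EFinP.
under eq_integral do rewrite /= ger0_norm ?ler0n//.
by rewrite integral_box// ltry.
Qed.

Lemma integrable_box_dot f g : bounded_on_box f -> bounded_on_box g ->
  integrable2 (fun zeta => (box hx hy zeta)%:R * dot (f zeta) (g zeta)).
Proof.
move=> [mf [K fK]] [mg [L gL]].
have [mf1 mf2] := (measurable_fun1 mf, measurable_fun2 mf).
have [mg1 mg2] := (measurable_fun1 mg, measurable_fun2 mg).
apply: (@le_integrable_EFin _ _ _ lebesgue2 _ (fun zeta => (K + L) * (box hx hy zeta)%:R)).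
- by apply: measurable_funM => //; apply: measurable_funD; exact: measurable_funM.
- move=> zeta; rewrite mulrC normrM (@ger0_norm _ _%:R) ?ler0n//.
  have := fK zeta; have := gL zeta; case: (box hx hy zeta); last by rewrite !mulr0.
  move=> /(_ isT) gl /(_ isT) fk; rewrite !mulr1 /dot.
  move: gl fk; rewrite /cn2; move: (f zeta) (g zeta) => [u1 u2] [v1 v2] /= gl fk.
  have h1 := sqr_ge0 (u1 - v1); have h2 := sqr_ge0 (u2 - v2).
  have h3 := sqr_ge0 (u1 + v1); have h4 := sqr_ge0 (u2 + v2).
  have h5 := sqr_ge0 u1; have h6 := sqr_ge0 u2.
  have h7 := sqr_ge0 v1; have h8 := sqr_ge0 v2.
  by rewrite ler_norml; apply/andP; split; nra.
- exact: integrable_EFinZ.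
Qed.

Lemma box_innerC f g : box_inner f g = box_inner g f.
Proof. by rewrite /box_inner; apply: eq_Rintegral => zeta _; rewrite /dot; ring. Qed.

Definition cdeflate (f g : C -> C) (t : R) (zeta : C) : C :=
  ((f zeta).1 - t * (g zeta).1, (f zeta).2 - t * (g zeta).2).

Lemma bounded_on_box_deflate f g t : bounded_on_box f -> bounded_on_box g ->
  bounded_on_box (cdeflate f g t).
Proof.
move=> [mf [K fK]] [mg [L gL]].
have [mf1 mf2] := (measurable_fun1 mf, measurable_fun2 mf).
have [mg1 mg2] := (measurable_fun1 mg, measurable_fun2 mg).
split; first by apply: measurable_fun_pair; apply: measurable_funB => //; exact: measurable_funM.
exists (2 * K + 2 * (t ^+ 2 * L)) => zeta b.
have h : cn2 (cdeflate f g t zeta) <= 2 * cn2 (f zeta) + 2 * (t ^+ 2 * cn2 (g zeta)).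
  rewrite /cn2 /cdeflate /=.
  have := sqr_ge0 ((f zeta).1 + t * (g zeta).1); have := sqr_ge0 ((f zeta).2 + t * (g zeta).2).
  by rewrite !expr2; lra.
apply: le_trans h _; apply: lerD; first by rewrite ler_wpM2l ?fK.
by rewrite ler_wpM2l// ler_wpM2l ?sqr_ge0 ?gL.
Qed.

Lemma box_inner_deflate f g e t : bounded_on_box f -> bounded_on_box g -> bounded_on_box e ->
  box_inner (cdeflate f g t) e = box_inner f e - t * box_inner g e.
Proof.
move=> bf bg be; have ife := integrable_box_dot bf be; have ige := integrable_box_dot bg be.
rewrite /box_inner -(RintegralZl t _ ige)//.
have itge := integrable_EFinZ t ige.
rewrite -(RintegralB _ ife itge)//; apply: eq_Rintegral => zeta _.
by rewrite /dot /cdeflate /=; ring.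
Qed.

Lemma box_inner_ge0 f : 0 <= box_inner f f.
Proof.
by apply: Rintegral_ge0 => zeta _; rewrite mulr_ge0 ?ler0n// /dot -!expr2 addr_ge0 ?sqr_ge0.
Qed.

(** By induction on the list: subtracting from f its projection on the first vector lowers the
    squared norm by that term and leaves the other coefficients unchanged. *)
Lemma bessel (I : eqType) (E : I -> C -> C) (M : R) (s : seq I) (f : C -> C) : 0 < M ->
  (forall p, bounded_on_box (E p)) ->
  (forall p q, box_inner (E p) (E q) = if p == q then M else 0) ->
  uniq s -> bounded_on_box f ->
  \sum_(p <- s) (box_inner f (E p) ^+ 2 / M) <= box_inner f f.
Proof.
move=> M0 bE oE; elim: s f => [|p s IH] f /=; first by rewrite big_nil box_inner_ge0.
move=> /andP[ps us] bf; rewrite big_cons.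
set t := box_inner f (E p) / M.
have bg := bounded_on_box_deflate t bf (bE p).
have := IH _ us bg.
have -> : \sum_(q <- s) (box_inner (cdeflate f (E p) t) (E q) ^+ 2 / M)
    = \sum_(q <- s) (box_inner f (E q) ^+ 2 / M).
  apply: eq_big_seq => q qs; rewrite box_inner_deflate// oE ifN ?mulr0 ?subr0//.
  by apply: contraNneq ps => ->.
have -> : box_inner (cdeflate f (E p) t) (cdeflate f (E p) t)
    = box_inner f f - box_inner f (E p) ^+ 2 / M.
  rewrite box_inner_deflate// ![box_inner _ (cdeflate _ _ _)]box_innerC !box_inner_deflate//.
  rewrite [box_inner (E p) f]box_innerC oE eqxx /t.
  by field; exact: lt0r_neq0.
lra.
Qed.

Let phi i j : C -> R := phase c (i%:~R * hx) (j%:~R * hy).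

(** The conjugate exponential, because [twist z t] is the real inner product of z with (cos t, - sin
    t). *)
Definition plane_wave (p : int * int) (zeta : C) : C := (cos (phi p.1 p.2 zeta), - sin (phi p.1 p.2 zeta)).

Let mphi i j : measurable_fun setT (phi i j).
Proof. by apply: measurable_funD; exact: measurable_funM. Qed.

Lemma plane_wave_bounded p : bounded_on_box (plane_wave p).
Proof.
have mc := measurableT_comp (continuous_measurable_fun (@continuous_cos R)) (mphi p.1 p.2).
have ms := measurableT_comp (continuous_measurable_fun (@continuous_sin R)) (mphi p.1 p.2).
split; first by apply: measurable_fun_pair => //; exact: measurableT_comp.
by exists 1 => zeta _; rewrite /cn2 /plane_wave /= sqrrN cos2Dsin2.
Qed.

Lemma twist_plane_wave f i j zeta :
  twist (sel (box hx hy zeta) (f zeta)) (phi i j zeta)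
    = (box hx hy zeta)%:R * dot (f zeta) (plane_wave (i, j) zeta).
Proof. by rewrite /twist /sel /dot /plane_wave; case: box => /=; ring. Qed.

Lemma synthesisE f i j : synthesis f i j = (4 * pi ^+ 2)^-1 * box_inner f (plane_wave (i, j)).
Proof.
congr (_ * _); apply: eq_Rintegral => zeta _; exact: twist_plane_wave.
Qed.

Lemma integrable_synthesis f i j : bounded_on_box f ->
  integrable2 (fun zeta => twist (sel (box hx hy zeta) (f zeta)) (phi i j zeta)).
Proof.
move=> bf; have := integrable_box_dot bf (plane_wave_bounded (i, j)).
by congr (_ .-integrable _ _); apply/funext => zeta; rewrite /= twist_plane_wave.
Qed.

Let M : R := 4 * pi ^+ 2 / (hx * hy).
Let M0 : 0 < M.
Proof. by have := @pi_gt0 R => p0; rewrite divr_gt0 ?mulr_gt0//. Qed.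

Lemma plane_wave_orthogonal p q : box_inner (plane_wave p) (plane_wave q) = if p == q then M else 0.
Proof.
have [_ e] := integral_box_cos (p.1 - q.1) (p.2 - q.2) hx0 hy0.
rewrite !subr_eq0 in e; rewrite -pair_eqE /pair_eq -/M in e *; rewrite -e.
apply: eq_Rintegral => zeta _; congr (_ * _).
rewrite /dot /plane_wave /= mulrNN -cosB; congr cos.
by rewrite /phi /phase !intrB; ring.
Qed.

(** Grid values are, up to a constant, Fourier coefficients of f on the Brillouin zone, and Bessel's
    inequality bounds every finite partial sum of their squares. *)
Lemma in_ell2_synthesis f : bounded_on_box f -> in_ell2 (synthesis f).
Proof.
move=> bf; rewrite /in_ell2 /summable.
pose B := (4 * pi ^+ 2)^-1 ^+ 2 * (M * box_inner f f).
apply: (@le_lt_trans _ _ B%:E); last exact: ltry.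
apply: ge_ereal_sup => _ [X [finX _] <-].
under eq_fsbigr do rewrite gee0_abs ?lee_fin ?sqr_ge0//.
rewrite fsbig_finite//= sumEFin lee_fin.
under eq_bigr => p _.
  rewrite synthesisE exprMn -surjective_pairing.
  rewrite (_ : box_inner f (plane_wave p) ^+ 2 = M * (box_inner f (plane_wave p) ^+ 2 / M)); last first.
    by field; exact: lt0r_neq0.
  over.
rewrite /= -mulr_sumr ler_wpM2l ?sqr_ge0// -mulr_sumr ler_wpM2l ?(ltW M0)//.
by apply: bessel => //; [exact: plane_wave_bounded|exact: plane_wave_orthogonal|exact: finmap.fset_uniq].
Qed.

(** The phase vanishes at (i0, j0), so the constant 1 is the plane wave of that point and
    orthogonality gives the Dirac datum. *)
Lemma synthesis1 i0 j0 : x0 c = i0%:~R * hx -> y0 c = j0%:~R * hy ->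
  synthesis (fun _ => (1, 0)) = grid_dirac hx hy i0 j0.
Proof.
move=> xi yj; apply/funext => i; apply/funext => j; rewrite synthesisE.
have -> : box_inner (fun _ => (1, 0)) (plane_wave (i, j)) =
    box_inner (plane_wave (i0, j0)) (plane_wave (i, j)).
  apply: eq_Rintegral => zeta _; congr (_ * dot _ _).
  by rewrite /plane_wave /phi /phase xi yj !subrr !mulr0 addr0 cos0 sin0 oppr0.
rewrite plane_wave_orthogonal /grid_dirac -pair_eqE /pair_eq /= [i0 == i]eq_sym [j0 == j]eq_sym.
case: (_ && _); last by rewrite mulr0.
rewrite /M; have := @pi_gt0 R; move: (@pi R) => w w0.
by field; rewrite !gt_eqF.
Qed.

End fourier_synthesis.

(** * The scheme solved by Fourier synthesis *)

Section fourier_scheme.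
Context {R : realType}.
Variables (c : spde_data R) (k hx hy : R).
Hypotheses (k0 : 0 < k) (hx0 : 0 < hx) (hy0 : 0 < hy).
Hypotheses (rho_x0 : 0 <= rho_x c) (rho_y0 : 0 <= rho_y c).
Local Notation C := (R * R)%type.

Let p : R * R * R := (hx, hy, Num.sqrt k).

(** The Brillouin zone is bounded for fixed mesh sizes, so polynomial growth in the frequency, for
    one value of the noise, is a bound. *)
Lemma bounded_on_box_amp z f : bounded_on_box hx hy f ->
  bounded_on_box hx hy (fun zeta => cmul (amp c p zeta z) (f zeta)).
Proof.
have k0' := ltW k0.
(* [amp_bounded] is applied with k in place of T, which makes [p] admissible. *)
have ap : adm k p by split; rewrite /= ?sqrtr_gt0// sqr_sqrtr.
move=> [mf [K fK]]; have [[_ _ [A [m [A0 hA]]]] [_ _ [B [n [B0 hB]]]]] := amp_bounded c k0'.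
split.
  apply: measurable_cmul => //.
  have mu : measurable_fun setT (fun zeta : C => (zeta, z)) by exact: measurable_fun_pair.
  exact (measurableT_comp (measurable_amp c k0' p) mu).
pose W := (1 + (pi / hx) ^+ 2 + (pi / hy) ^+ 2) * weight z.
exists (((A * W ^+ m) ^+ 2 + (B * W ^+ n) ^+ 2) * K) => zeta b.
rewrite cn2M; apply: ler_pM; rewrite ?cn2_ge0 ?fK//.
have sq (x h : R) : 0 < h -> `|h * x| <= pi -> x ^+ 2 <= (pi / h) ^+ 2.
  move=> h0 hxp; rewrite -(real_normK (num_real x)) lerXn2r ?nnegrE ?divr_ge0 ?pi_ge0 ?(ltW h0)//.
  by rewrite ler_pdivlMr// -{1}(gtr0_norm h0) -normrM mulrC.
have wW : weight zeta * weight z <= W.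
  rewrite ler_wpM2r ?weight_ge0// /weight; case/andP: b => bx b_y.
  by apply: lerD; [apply: lerD => //; exact: sq|exact: sq].
have W0 : 0 <= W by apply: le_trans wW; rewrite mulr_ge0// weight_ge0.
have le (u D : R) (l : nat) : 0 <= D -> `|u| <= D * (weight zeta * weight z) ^+ l * mono 0 0 p ->
    u ^+ 2 <= (D * W ^+ l) ^+ 2.
  move=> D0; rewrite /mono !expr0 !mulr1 => uD.
  rewrite -(real_normK (num_real u)) lerXn2r ?nnegrE ?mulr_ge0 ?exprn_ge0//.
  apply: le_trans uD _; rewrite ler_wpM2l// lerXn2r ?nnegrE//.
  by rewrite mulr_ge0// weight_ge0.
by apply: lerD; apply: le => //; [exact: hA|exact: hB].
Qed.

(** The first component of [st] for a single realisation of the noise, as uniqueness of the scheme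
    is a pathwise statement. *)
Fixpoint amp_chain (z : nat -> C) (n : nat) (zeta : C) : C :=
  if n is n'.+1 then cmul (amp c p zeta (z n')) (amp_chain z n' zeta) else (1, 0).

Lemma amp_chain_bounded z n : bounded_on_box hx hy (amp_chain z n).
Proof.
elim: n => [|n IH]; last exact: bounded_on_box_amp.
by split; [exact: measurable_cst|exists 1 => zeta _; rewrite /cn2/= expr1n expr0n addr0].
Qed.

Lemma st_amp_chain d (Omega : measurableType d) (X : nat -> Omega -> C) zeta n w :
  (st c X p zeta n w).1.1.1 = amp_chain (X^~ w) n zeta.
Proof. by elim: n => //= n <-. Qed.

(** Under the integral the operators act through their symbols, and [den] times [amp] is [num]. *)
Lemma synthesis_step f z i j : bounded_on_box hx hy f ->
  implicit_lhs c k hx hy (synthesis c hx hy (fun zeta => cmul (amp c p zeta z) (f zeta))) i j =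
  milstein_rhs c k hx hy z.1 z.2 (synthesis c hx hy f) i j.
Proof.
move=> bf; have bg := bounded_on_box_amp z bf.
have [_ ->] := implicit_lhs_commutes c k hx hy i j (4 * pi ^+ 2)^-1 (fun i j => integrable_synthesis c hx0 hy0 i j bg).
have [_ ->] := milstein_rhs_commutes c k hx hy z.1 z.2 i j (4 * pi ^+ 2)^-1 (fun i j => integrable_synthesis c hx0 hy0 i j bf).
congr (_ * _); apply: eq_Rintegral => zeta _.
have -> := implicit_lhs_wave c k0 hx0 hy0 zeta (sel (box hx hy zeta) (cmul (amp c p zeta z) (f zeta))) i j.
have -> := milstein_rhs_wave k0 hx0 hy0 rho_x0 rho_y0 zeta z.1 z.2 (sel (box hx hy zeta) (f zeta)) i j.
congr wave; rewrite -surjective_pairing; case: box => /=; last by rewrite /cmul /= !mulr0 subr0 addr0.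
rewrite -[in RHS](cmulKV (num c p zeta z) (cn2_den_neq0 c p zeta)).
by apply: cplxP; rewrite /amp /cmul /=; ring.
Qed.

Lemma fourier_scheme (N : nat) (i0 j0 : int) (zx zy : nat -> R) :
  x0 c = i0%:~R * hx -> y0 c = j0%:~R * hy ->
  milstein_scheme c k hx hy N i0 j0 zx zy
    (fun n => synthesis c hx hy (amp_chain (fun n => (zx n, zy n)) n)).
Proof.
move=> xi yj; split; first exact: synthesis1.
- by move=> n _; apply: in_ell2_synthesis => //; exact: amp_chain_bounded.
- by move=> n _ i j; exact: (synthesis_step (zx n, zy n) i j (amp_chain_bounded _ n)).
Qed.

End fourier_scheme.

(** * The remainder *)

Section little_o.
Context {R : realType}.
Variables (T s : R).
Hypotheses (T0 : 0 < T) (s0 : 0 < s).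

(** Each summand of [rest_bound] is a summand of [error_scale], or the sum of several, times one of
    the small quantities on the right. *)
Lemma rest_bound_ratio (N : nat) (hx hy : R) : 0 < hx -> 0 < hy ->
  0 <= rest_bound T s N hx hy / error_scale T (expR (- (s / 2))) N hx hy
    <= hx ^+ 2 + hy ^+ 2 + Num.sqrt (T / N%:R) + T / N%:R + expR (- (s / 2)) ^+ N.
Proof.
move=> x0 y0; rewrite /rest_bound /rest_scale /error_scale.
have -> : expR (- s) ^+ N = (expR (- (s / 2)) ^+ N) ^+ 2.
  by rewrite exprAC; congr (_ ^+ _); rewrite expr2 -expRD; congr expR; field.
have u0 : 0 <= expR (- (s / 2)) ^+ N by rewrite exprn_ge0// expR_ge0.
have k0 : 0 <= T / N%:R by rewrite divr_ge0// ltW.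
have r0 := sqrtr_ge0 (T / N%:R).
move: (expR _ ^+ N) (T / N%:R) (Num.sqrt _) u0 k0 r0 => u k r u0 k0 r0.
have H0 : 0 < hx ^+ 2 + hy ^+ 2 by rewrite addr_gt0// exprn_gt0.
have a0 : 0 <= u * hx ^- 2 by rewrite mulr_ge0// invr_ge0 sqr_ge0.
have b0 : 0 <= u * hy ^- 2 by rewrite mulr_ge0// invr_ge0 sqr_ge0.
(* With u = theta^N, e^(-sN) is u^2, so the choice theta = e^(-s/2) leaves a spare factor u after
   1/(h_x h_y) <= 1/h_x^2 + 1/h_y^2. *)
have ab : u ^+ 2 / (hx * hy) <= u * (u * hx ^- 2 + u * hy ^- 2).
  have -> : u * (u * hx ^- 2 + u * hy ^- 2) = u ^+ 2 / (hx * hy)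
      + u ^+ 2 * ((hx^-1 - hy^-1 / 2) ^+ 2 + 3 / 4 * hy^-1 ^+ 2).
    by field; rewrite !gt_eqF.
  by rewrite lerDl mulr_ge0 ?sqr_ge0// addr_ge0 ?sqr_ge0// mulr_ge0 ?sqr_ge0.
have c0 : 0 <= u ^+ 2 / (hx * hy) by rewrite mulr_ge0 ?sqr_ge0// invr_ge0 mulr_ge0 ?ltW.
move: (u * hx ^- 2) (u * hy ^- 2) (u ^+ 2 / _) a0 b0 ab c0 => a b e a0 b0 ab e0.
have -> : k + hx ^+ 2 + hy ^+ 2 + a + b = k + (hx ^+ 2 + hy ^+ 2) + a + b by ring.
move: (hx ^+ 2 + hy ^+ 2) H0 => H H0.
have S0 : 0 < k + H + a + b by lra.
rewrite divr_ge0 ?(ltW S0)//=; last first.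
  by rewrite !addr_ge0 ?sqr_ge0// mulr_ge0// ltW.
rewrite ler_pdivrMr//.
have h1 : 0 <= H * k by rewrite mulr_ge0// ltW.
have h2 : 0 <= H * a by rewrite mulr_ge0// ltW.
have h3 : 0 <= H * b by rewrite mulr_ge0// ltW.
have h4 : 0 <= r * k by rewrite mulr_ge0.
have h5 : 0 <= r * a by rewrite mulr_ge0.
have h6 : 0 <= r * b by rewrite mulr_ge0.
have h7 : 0 <= k * a by rewrite mulr_ge0.
have h8 : 0 <= k * b by rewrite mulr_ge0.
have h9 : 0 <= u * k by rewrite mulr_ge0.
have h10 : 0 <= u * H by rewrite mulr_ge0// ltW.
by rewrite !expr2; lra.
Qed.

Let cvg_invn : (fun N : nat => T / N%:R) @ \oo --> (0 : R).
Proof.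
have h : (fun n => T * harmonic n) @ \oo --> T * 0.
  by apply: cvgM; [exact: cvg_cst|exact: cvg_harmonic].
by rewrite -cvg_shiftS; rewrite mulr0 in h.
Qed.

Lemma rest_bound_little_o : error_little_o T (expR (- (s / 2))) (rest_bound T s).
Proof.
rewrite /error_little_o; set F := filter_prod _ _.
have FF : ProperFilter F by apply: filter_prod_proper.
have c1 : fst @ F --> \oo by exact: cvg_fst.
have cx : (fun m : nat * (R * R) => m.2.1) @ F --> 0^'+ by apply: cvg_comp cvg_snd cvg_fst.
have cy : (fun m : nat * (R * R) => m.2.2) @ F --> 0^'+ by apply: cvg_comp cvg_snd cvg_snd.
have cx0 : (fun m : nat * (R * R) => m.2.1) @ F --> (0 : R) by apply: cvg_trans cx _; exact: cvg_within.
have cy0 : (fun m : nat * (R * R) => m.2.2) @ F --> (0 : R) by apply: cvg_trans cy _; exact: cvg_within.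
have ck : (fun m : nat * (R * R) => T / m.1%:R) @ F --> (0 : R) by apply: cvg_comp c1 cvg_invn.
have cr : (fun m : nat * (R * R) => Num.sqrt (T / m.1%:R)) @ F --> (0 : R).
  have := @sqrt_continuous R 0; rewrite /continuous_at sqrtr0 => c0.
  exact: (cvg_comp _ _ ck c0).
have cu : (fun m : nat * (R * R) => expR (- (s / 2)) ^+ m.1) @ F --> (0 : R).
  apply: cvg_comp c1 _; apply: cvg_expr.
  by rewrite ger0_norm ?expR_ge0// expR_lt1 oppr_lt0 divr_gt0.
apply: (@squeeze_cvgr _ _ _ _ (fun=> 0) (fun m : nat * (R * R) => m.2.1 ^+ 2 + m.2.2 ^+ 2
  + Num.sqrt (T / m.1%:R) + T / m.1%:R + expR (- (s / 2)) ^+ m.1)).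
- have px : \forall m \near F, 0 < m.2.1 by exact: cx (nbhs_right_gt 0).
  have py : \forall m \near F, 0 < m.2.2 by exact: cy (nbhs_right_gt 0).
  by near=> m; apply: rest_bound_ratio; near: m.
- exact: cvg_cst.
- have := cvgD (cvgD (cvgD (cvgD (cvgM cx0 cx0) (cvgM cy0 cy0)) cr) ck) cu.
  by move=> /(_ _ _ _ _ _ _); rewrite mulr0 !addr0; apply.
Unshelve. all: by end_near. Qed.

End little_o.

(** * Assembly of the expansion *)

Section assembly.
Context d (Omega : measurableType d) (R : realType) (P : probability Omega R).

Lemma moments_bounded_le (G C : R) (X : {RV P >-> R}) : G <= C ->
  moments_bounded_by G X -> moments_bounded_by C X.
Proof. by move=> GC [h1 h2]; split; [apply: le_trans h1 _|apply: le_trans h2 _]; rewrite lee_fin. Qed.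

Lemma exists_zero_RV : exists Z : {RV P >-> R}, (forall w, Z w = 0) /\ moments_bounded_by 0 Z.
Proof.
have m0 : measurable_fun [set: Omega] (fun=> 0 : R) by exact: measurable_cst.
exists (mfun_of m0); split=> //; split; rewrite unlock /=.
  by under eq_integral do rewrite normr0; rewrite integral0.
by under eq_integral do rewrite expr0n; rewrite integral0.
Qed.

Lemma scheme_inv_fourier (T : R) (c : spde_data R) (Mx My : R -> {RV P >-> R})
    (N : nat) (hx hy : R) (i0 j0 : int) (w : Omega) (V : nat -> grid_fun R) :
  0 < T -> 0 <= rho_x c -> 0 <= rho_y c -> (0 < N)%N -> 0 < hx -> 0 < hy ->
  x0 c = i0%:~R * hx -> y0 c = j0%:~R * hy ->
  milstein_scheme c (T / N%:R) hx hy N i0 j0 (noise Mx (T / N%:R) w) (noise My (T / N%:R) w) V ->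
  forall i j, V N i j = inv_fourier c (i%:~R * hx) (j%:~R * hy)
    (fun zeta => sel (box hx hy zeta) (ampterm T c Mx My N hx hy zeta w)).
Proof.
move=> T0 rx ry N0 hx0 hy0 xi yj hV i j.
have k0 : 0 < T / N%:R by rewrite divr_gt0// ltr0n.
have hW := fourier_scheme k0 hx0 hy0 rx ry N (noise Mx (T / N%:R) w) (noise My (T / N%:R) w) xi yj.
rewrite (milstein_scheme_unique (ltW k0) hV hW (leqnn N)).
congr inv_fourier; apply/funext => zeta; congr sel.
by rewrite /ampterm st_amp_chain.
Qed.

Lemma xterm_inv_fourier (T : R) (c : spde_data R) (Mx My : R -> {RV P >-> R})
    (x y : R) (w : Omega) :
  0 < T -> 0 <= rho_x c < 1 -> 0 <= rho_y c < 1 -> Mx 0 w = 0 -> My 0 w = 0 ->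
  inv_fourier c x y ((xterm T c Mx My)^~ w) = spde_solution c T (Mx T w) (My T w) x y.
Proof.
move=> T0 rx ry Mx0 My0; rewrite (inv_fourier_exact _ _ _ T0 rx ry) /increment_pair /=.
by rewrite Mx0 My0 !subr0 !(mulrC (Num.sqrt T)) !divfK// gt_eqF// sqrtr_gt0.
Qed.

End assembly.

Theorem theorem2p1 (d : measure_display) (Omega : measurableType d)
    (R : realType) (P : probability Omega R)
    (T : R) (c : spde_data R) (Mx My : R -> {RV P >-> R})
    (T_gt0 : 0 < T)
    (rho_x_range : 0 <= rho_x c < 1)
    (rho_y_range : 0 <= rho_y c < 1)
    (rho_xy_range : -1 <= rho_xy c <= 1)
    (stab_x : 2 * rho_x c ^+ 2 * (1 + 2 * `|rho_xy c|) < 1)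
    (stab_y : 2 * rho_y c ^+ 2 * (1 + 2 * `|rho_xy c|) < 1)
    (stab_xy : 2 * rho_x c * rho_y c
                 * (3 * rho_xy c ^+ 2 + 2 * `|rho_xy c| + 1) < 1)
    (brownian : correlated_brownian (rho_xy c) Mx My) :
  exists theta : R, 0 < theta < 1 /\
  exists (E1 : nat -> R -> R -> {RV P >-> R})
         (E2 E3 E4 E5 : R -> R -> {RV P >-> R})
         (q : nat -> R -> R -> R)
         (Rem : nat -> R -> R -> R -> R -> {RV P >-> R})
         (C : R),
  [/\ (forall (N : nat) (x y : R), moments_bounded_by C (E1 N x y)),
      (forall x y : R,
         [/\ moments_bounded_by C (E2 x y), moments_bounded_by C (E3 x y),
             moments_bounded_by C (E4 x y) & moments_bounded_by C (E5 x y)]),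
      (forall (N : nat) (hx hy x y : R),
         moments_bounded_by C (Rem N hx hy x y)),
      error_little_o T theta q &
      forall (N : nat) (hx hy : R) (i0 j0 : int),
        (0 < N)%N -> 0 < hx -> 0 < hy ->
        x0 c = i0%:~R * hx -> y0 c = j0%:~R * hy ->
        let k := T / N%:R in
        forall V : Omega -> nat -> grid_fun R,
        (forall w, milstein_scheme c k hx hy N i0 j0
                     (noise Mx k w) (noise My k w) (V w)) ->
        forall (i j : int),
        let x := i%:~R * hx in
        let y := j%:~R * hy in
        {ae P, forall w,
          V w N i j - spde_solution c T (Mx T w) (My T w) x y =
            k * E1 N x y w + hx ^+ 2 * E2 x y w + hy ^+ 2 * E3 x y w
            + theta ^+ N * hx ^- 2 * E4 x y w
            + theta ^+ N * hy ^- 2 * E5 x y w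
            + q N hx hy * Rem N hx hy x y w}].
Proof.
have [s s0 [amp_decay exact_decay]] :=
  stability P rho_x_range rho_y_range rho_xy_range stab_x stab_y stab_xy.
have [G1 h1] := exists_timeterm_RV T_gt0 rho_x_range rho_y_range rho_xy_range brownian s0
  amp_decay exact_decay.
have [G2 h2] := exists_yterm_RV T_gt0 rho_x_range rho_y_range rho_xy_range brownian s0
  exact_decay 1 0.
have [G3 h3] := exists_yterm_RV T_gt0 rho_x_range rho_y_range rho_xy_range brownian s0
  exact_decay 0 1.
have [G4 h4] := exists_restterm_RV T_gt0 rho_x_range rho_y_range rho_xy_range brownian s0
  amp_decay exact_decay.
have [Z [Z0 mZ]] := exists_zero_RV P.
have e1 N x y : exists Y : {RV P >-> R}, moments_bounded_by G1 Y /\ ((0 < N)%N -> forall w,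
    Y w = (T / N%:R)^-1 * inv_fourier c x y ((timeterm T c Mx My N)^~ w)).
  (* The moment bound is claimed for every N; at N = 0 the variable of N = 1 is the default
     value. *)
  have [-> | N0] := posnP N; first by have [Y mY _] := h1 1%N x y isT; exists Y.
  by have [Y mY eY] := h1 N x y N0; exists Y.
have e4 N hx hy x y : exists Y : {RV P >-> R}, moments_bounded_by G4 Y /\
    ((0 < N)%N -> 0 < hx -> 0 < hy -> forall w, rest_bound T s N hx hy * Y w =
    inv_fourier c x y ((restterm T c Mx My N hx hy)^~ w)).
  case: (boolP [&& (0 < N)%N, 0 < hx & 0 < hy]) => [/and3P[N0 x0 y0]|n].
    by have [Y mY eY] := h4 N hx hy x y N0 x0 y0; exists Y.
  (* Default value outside the meaningful range of N, hx and hy: the remainder of N = hx = hy =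
     1. *)
  have [Y mY _] := h4 1%N 1 1 x y isT ltr01 ltr01; exists Y; split=> // N0 x0 y0.
  by rewrite N0 x0 y0 in n.
pose E1 N x y := sval (cid (e1 N x y)).
pose E2 x y := sval (cid2 (h2 x y)).
pose E3 x y := sval (cid2 (h3 x y)).
pose Rem N hx hy x y := sval (cid (e4 N hx hy x y)).
(* The signs of G1, ..., G4 are not recorded; absolute values give one nonnegative constant above
   all of them, valid also for the zero variable. *)
pose C : R := `|G1| + `|G2| + `|G3| + `|G4|.
have n1 := normr_ge0 G1; have n2 := normr_ge0 G2.
have n3 := normr_ge0 G3; have n4 := normr_ge0 G4.
have G1C : G1 <= C by have := ler_norm G1; rewrite /C; lra.
have G2C : G2 <= C by have := ler_norm G2; rewrite /C; lra.
have G3C : G3 <= C by have := ler_norm G3; rewrite /C; lra.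
have G4C : G4 <= C by have := ler_norm G4; rewrite /C; lra.
have C0 : 0 <= C by rewrite /C; lra.
exists (expR (- (s / 2))); split.
  by rewrite expR_gt0 expR_lt1 oppr_lt0 divr_gt0.
exists E1, E2, E3, (fun _ _ => Z), (fun _ _ => Z), (rest_bound T s), Rem, C; split.
- by move=> N x y; apply: moments_bounded_le G1C _; exact: (svalP (cid (e1 N x y))).1.
- move=> x y; split; try exact: moments_bounded_le C0 mZ.
    by apply: moments_bounded_le G2C _; exact: (s2valP (cid2 (h2 x y))).
  by apply: moments_bounded_le G3C _; exact: (s2valP (cid2 (h3 x y))).
- move=> N hx hy x y; apply: moments_bounded_le G4C _.
  exact: (svalP (cid (e4 N hx hy x y))).1.
- exact: rest_bound_little_o.
move=> N hx hy i0 j0 N0 hx0 hy0 xi yj k V hV i j x y.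
have exp := expansion_ae T_gt0 rho_x_range rho_y_range rho_xy_range brownian s0
  amp_decay exact_decay x y N0 hx0 hy0.
have start := brownian_start brownian.
(* The exceptional null set joins that of the Fourier expansion and that where a Brownian path does
   not start at 0; the latter identifies the increment over [0, T] with the value at T. *)
apply: filterS2 start exp => w [Mx0 My0].
have [rx ry] : 0 <= rho_x c /\ 0 <= rho_y c.
  by case/andP: rho_x_range; case/andP: rho_y_range.
rewrite -(scheme_inv_fourier T_gt0 rx ry N0 hx0 hy0 xi yj (hV w)).
rewrite (xterm_inv_fourier x y T_gt0 rho_x_range rho_y_range Mx0 My0) => ->.
have k0 : k != 0 by rewrite /k gt_eqF// divr_gt0// ltr0n.
rewrite Z0 !mulr0 !addr0.
rewrite /E1 (svalP (cid (e1 N x y))).2// mulVKf//.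
have -> : E2 x y w = _ := s2valP' (cid2 (h2 x y)) w.
have -> : E3 x y w = _ := s2valP' (cid2 (h3 x y)) w.
by rewrite /Rem (svalP (cid (e4 N hx hy x y))).2.
Qed.
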